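(* Let $\Omega$ be one of $\mathbb{T}^2$, $\mathbb{R}^2$, or $\mathbb{T}\times\mathbb{R}$. For $\beta>1$, the dissipative system $$\partial_t\theta+u\cdot\nabla\theta+\kappa\log^\beta(10+\Lambda)\theta=0,\qquad u=-\nabla^\perp\log(10+\Lambda)\theta \qquad (\ast)$$ is locally well-posed in $L^\infty_tH^s_x$ for any $s>4$. That is, given any $s>4$, any initial data $\theta_0\in H^s(\Omega)$, and any $\kappa>0$, there exist $T>0$ and a unique solution $\theta\in L^\infty([0,T];H^s(\Omega))$ to $(\ast)$ with initial data $\theta_0$.
   Context: Notation: $\theta(t,\cdot):\Omega\to\mathbb{R}$; $\nabla^\perp=(-\partial_{x_2},\partial_{x_1})^\top$; $\Lambda=(-\Delta)^{1/2}$ is the Fourier multiplier with symbol $|\xi|$; $\log(10+\Lambda)$ and $\log^\beta(10+\Lambda)$ are the Fourier multipliers with symbols $\log(10+|\xi|)$ and $(\log(10+|\xi|))^\beta$. $H^s$ is the usual $L^2$-based inhomogeneous Sobolev space. *)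

(* Defs.v *)
From HB Require Import structures.
From mathcomp Require Import all_boot all_order all_algebra.
From mathcomp Require Import all_classical all_reals all_analysis.
From mathcomp Require Import complex.

Set Implicit Arguments.
Unset Strict Implicit.
Unset Printing Implicit Defensive.

Import Order.TTheory GRing.Theory Num.Theory.
Import numFieldNormedType.Exports.

Local Open Scope classical_set_scope.
Local Open Scope ring_scope.

(* The domain Omega: T^2, R^2, or T x R, where T = R / (2 pi Z).  A function on
   Omega is a function on R * R that is 2 pi-periodic in each T-coordinate; the
   flag of a coordinate is true when that coordinate lives in T. *)
Inductive domain := T2 | R2 | TxR.

Definition per1 (Omega : domain) : bool :=
  match Omega with T2 => true | R2 => false | TxR => true end.

Definition per2 (Omega : domain) : bool :=
  match Omega with T2 => true | R2 => false | TxR => false end.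

Notation leb1 R := (@lebesgue_measure R).
Notation leb2 R := (@lebesgue_measure R \x @lebesgue_measure R)%E.

Section Space.
Context {R : realType}.
Implicit Types (Omega : domain) (f p : R * R -> R) (g : R * R -> R[i]).

Definition on_domain (Y : Type) Omega (f : R * R -> Y) : Prop :=
  (per1 Omega -> forall x, f (x.1 + 2 * pi, x.2) = f x) /\
  (per2 Omega -> forall x, f (x.1, x.2 + 2 * pi) = f x).

Definition period (per : bool) : set R :=
  if per then [set x | 0 <= x <= 2 * pi] else setT.

(* Integrals over Omega are integrals over this fundamental cell. *)
Definition cell Omega : set (R * R) :=
  period (per1 Omega) `*` period (per2 Omega).

Definition in_L2 Omega f : Prop :=
  [/\ on_domain Omega f, measurable_fun setT f &
      (\int[leb2 R]_(x in cell Omega) ((f x ^+ 2)%:E) < +oo)%E].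

(* Integral over the dual group: Z for a T-coordinate, R for an R-coordinate. *)
Definition dual_int1 (per : bool) (F : R -> \bar R) : \bar R :=
  if per then (\esum_(n in [set: int]) F n%:~R)%E
  else (\int[leb1 R]_k F k)%E.

Definition dual_int Omega (F : R * R -> \bar R) : \bar R :=
  dual_int1 (per1 Omega) (fun k1 =>
    dual_int1 (per2 Omega) (fun k2 => F (k1, k2))).

Definition norm2 (k : R * R) : R := Num.sqrt (k.1 ^+ 2 + k.2 ^+ 2).

Definition dot (v w : R * R) : R := v.1 * w.1 + v.2 * w.2.

Definition sqnormC (z : R[i]) : R := complex.Re z ^+ 2 + complex.Im z ^+ 2.

(* \int f(x) e^{-i x.k} dx over the part of the cell where |x_1|, |x_2| <= N. *)
Definition trunc_fourier Omega f (N : nat) (k : R * R) : R[i] :=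
  let D := cell Omega `&` [set x : R * R | `|x.1| <= N%:R /\ `|x.2| <= N%:R] in
  Complex (\int[leb2 R]_(x in D) (f x * cos (dot x k)))%R
          (- \int[leb2 R]_(x in D) (f x * sin (dot x k)))%R.

(* g is the (Plancherel) Fourier transform of the L^2 function f: the limit in
   L^2 of the dual group of the truncated Fourier integrals. *)
Definition is_fourier Omega f g : Prop :=
  [/\ in_L2 Omega f,
      measurable_fun setT (fun k => complex.Re (g k)),
      measurable_fun setT (fun k => complex.Im (g k)) &
      (fun N => dual_int Omega (fun k =>
         (sqnormC (g k - trunc_fourier Omega f N k))%:E))
        @ \oo --> 0%E].

Definition Hs_sqnorm_le Omega (s : R) f (M : R) : Prop :=
  exists2 g, is_fourier Omega f g &
    (dual_int Omega (fun k => (((1 + norm2 k ^+ 2) `^ s) * sqnormC (g k))%:E)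
     <= M%:E)%E.

Definition in_Hs Omega (s : R) f : Prop :=
  exists M : R, Hs_sqnorm_le Omega s f M.

(* h = m(Lambda) f, where Lambda has symbol |k|. *)
Definition is_multiplier Omega (m : R -> R) f h : Prop :=
  exists2 g, is_fourier Omega f g &
    is_fourier Omega h (fun k => Complex (m (norm2 k)) 0 * g k).

Definition log_symbol (r : R) : R := ln (10 + r).

(* C^infty: iterated directional derivatives of all orders exist and are
   continuous. *)
Definition smooth (V : normedModType R) (f : V -> R) : Prop :=
  forall l : seq V,
    let h := foldr (fun v (k : V -> R) x => 'D_v k x) f l in
    continuous h /\ forall x v, derivable h x v.

Definition bounded_coords Omega (A : R) (x : R * R) : Prop :=
  (~~ per1 Omega -> `|x.1| <= A) /\ (~~ per2 Omega -> `|x.2| <= A).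

Definition test_space Omega (psi : R * R -> R) : Prop :=
  [/\ smooth psi, on_domain Omega psi &
      exists A : R, forall x, psi x != 0 -> bounded_coords Omega A x].

Definition e1 : R * R := (1, 0).
Definition e2 : R * R := (0, 1).

Definition weak_partial Omega (e : R * R) f p : Prop :=
  forall psi, test_space Omega psi ->
    (\int[leb2 R]_(x in cell Omega) (f x * 'D_e psi x))%R =
    - (\int[leb2 R]_(x in cell Omega) (p x * psi x))%R.

Definition weak_grad Omega f (p : R * R -> R * R) : Prop :=
  [/\ in_L2 Omega (fst \o p), in_L2 Omega (snd \o p),
      weak_partial Omega e1 f (fst \o p) & weak_partial Omega e2 f (snd \o p)].

Definition perp (v : R * R) : R * R := (- v.2, v.1).

(* Test functions on [0, T) x Omega; they need not vanish at t = 0. *)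
Definition test_spacetime Omega (T : R) (phi : R * (R * R) -> R) : Prop :=
  [/\ smooth phi, (forall t, on_domain Omega (fun x => phi (t, x))) &
      exists A T' : R, T' < T /\
        forall t x, phi (t, x) != 0 -> t <= T' /\ bounded_coords Omega A x].

Definition slab Omega (T : R) : set (R * (R * R)) :=
  [set t | 0 <= t <= T] `*` cell Omega.

(* theta in L^infty([0,T]; H^s(Omega)), represented by a jointly measurable
   function of (t, x). *)
Definition Linfty_Hs Omega (T s : R) (theta : R -> R * R -> R) : Prop :=
  measurable_fun (slab Omega T) (fun z => theta z.1 z.2) /\
  exists M : R, {ae leb1 R, forall t, 0 <= t <= T ->
    Hs_sqnorm_le Omega s (theta t) M}.

(* theta solves, on [0, T] and with initial datum theta0,
     d_t theta + u . grad theta + kappa log^beta(10 + Lambda) theta = 0,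
     u = - perp grad (log(10 + Lambda) theta).
   Here gtheta = grad theta, w = log(10 + Lambda) theta, gw = grad w and
   d = log^beta(10 + Lambda) theta.  The evolution equation and the initial
   condition are taken together, in the sense of distributions on
   [0, T) x Omega. *)
Definition is_solution Omega (beta kappa s T : R) (theta0 : R * R -> R)
    (theta : R -> R * R -> R) : Prop :=
  Linfty_Hs Omega T s theta /\
  exists (gtheta : R -> R * R -> R * R) (w : R -> R * R -> R)
         (gw : R -> R * R -> R * R) (d : R -> R * R -> R),
  [/\ [/\ measurable_fun (slab Omega T) (fun z => gtheta z.1 z.2),
          measurable_fun (slab Omega T) (fun z => w z.1 z.2),
          measurable_fun (slab Omega T) (fun z => gw z.1 z.2) &
          measurable_fun (slab Omega T) (fun z => d z.1 z.2)],
      {ae leb1 R, forall t, 0 <= t <= T ->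
        [/\ weak_grad Omega (theta t) (gtheta t),
            is_multiplier Omega log_symbol (theta t) (w t),
            weak_grad Omega (w t) (gw t) &
            is_multiplier Omega (fun r => log_symbol r `^ beta) (theta t) (d t)]} &
      forall phi, test_spacetime Omega T phi ->
        let u t x := - perp (gw t x) in
        \int[leb1 R]_(t in [set t | 0 <= t <= T]) \int[leb2 R]_(x in cell Omega)
           (theta t x * 'D_(1, (0, 0)) phi (t, x)
            - (dot (u t x) (gtheta t x) + kappa * d t x) * phi (t, x))
        + \int[leb2 R]_(x in cell Omega) (theta0 x * phi (0, x)) = 0].

End Space.

(* Main.v *)
(** Everything is read on the Fourier side, through the real Hartley transform H of theta (cosine plus sine
coefficients), for which the equation becomes dH/dt = - N(H, H) - kappa m H with m = log^beta(10 + |k|).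

The quadratic form of N is an integral over frequency triples a + b + k = 0. Symmetrising it over the six
permutations leaves the differences of log(10 + |.|) and of the Sobolev weights; these commutators gain one
derivative up to one logarithm, which the damping absorbs because beta > 1. The same symmetrisation bounds the
difference of two solutions in L^2 with a constant that depends on only one of them.

Existence: explicit Euler steps for the equation truncated to |k| <= r stay bounded in the weighted space on a
short interval, and the stability estimate makes them a Cauchy sequence in L^2 of [0, T] times the dual.
Uniqueness: the transform of any solution is jointly measurable, and testing against bumps times characters shows
that it satisfies the integrated (mild) equation almost everywhere, to which the stability estimate applies. *)

Require Import Defs.
From HB Require Import structures.
From mathcomp Require Import all_boot all_order all_algebra.
From mathcomp Require Import all_classical all_reals all_analysis.
From mathcomp Require Import measurable_realfun complex ring lra zify.

Set Implicit Arguments.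
Unset Strict Implicit.
Unset Printing Implicit Defensive.

Import Order.TTheory GRing.Theory Num.Theory.
Import numFieldNormedType.Exports.
Local Open Scope classical_set_scope.
Local Open Scope ring_scope.

(** The kernel [cas] is real and its own inverse up to the factor [(2 * pi) ^+ 2]. One real
    Plancherel theorem, stated for an abstract pair of measures, therefore serves both directions of
    the transform and all three domains; the dual of a circle becomes a counting measure carried by
    the real line. The regularity [4 < s] is felt chiefly through [jap k ^+ 8 <= 16 * Wt s k]: eight
    powers in the square make two derivatives of the unknown summable over the two-dimensional dual
    group. No continuity in time and no Gronwall argument is needed. The energy identity is
    integrated once more in time; in that form it follows from Fubini for a right-hand side that is
    merely integrable, and [T] is so small that the quadratic term is absorbed. The nonlinearity
    loses derivatives, so it is Lipschitz in [L2] only after division by [jap k ^+ 2]; the Euler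
    residual and the limit equation are handled in that weaker norm. A difference of nonlinearities
    is [NN D F + NN G D] with [D = F - G]. The second term pairs to 0 with [D], and so the time of
    uniqueness does not depend on the competitor. *)

Section Derive1.
Context {R : realType}.

Implicit Types (f g : R -> R) (x a b c : R).

Notation is_d f x a := (is_derive x (1 : R) f a).

(** The value of the derivative is a parameter of these rules: a composite derivative is assembled
    by unification and compared with the wanted expression once, through [dEq]. *)
Lemma dEq f x a b : is_d f x a -> a = b -> is_d f x b.
Proof. by move=> h <-. Qed.
Lemma dD f g x a b : is_d f x a -> is_d g x b -> is_d (fun y => f y + g y) x (a + b).
Proof. exact: is_deriveD. Qed.
Lemma dB f g x a b : is_d f x a -> is_d g x b -> is_d (fun y => f y - g y) x (a - b).
Proof. exact: is_deriveB. Qed.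
Lemma dN f x a : is_d f x a -> is_d (fun y => - f y) x (- a).
Proof. exact: is_deriveN. Qed.
Lemma dC c x : is_d (fun _ : R => c) x 0.
Proof. exact: is_derive_cst. Qed.
Lemma dId x : is_d (fun y : R => y) x 1.
Proof. exact: is_derive_id. Qed.

Lemma dM f g x a b : is_d f x a -> is_d g x b -> is_d (fun y => f y * g y) x (a * g x + f x * b).
Proof.
move=> hf hg; suff -> : a * g x + f x * b = f x *: b + g x *: a by exact: is_deriveM.
by rewrite /GRing.scale /= addrC [a * _]mulrC.
Qed.

Lemma dZ c f x a : is_d f x a -> is_d (fun y => c * f y) x (c * a).
Proof. by move=> hf; apply: dEq (dM (dC c x) hf) _; rewrite mul0r add0r. Qed.
Lemma dZr c f x a : is_d f x a -> is_d (fun y => f y * c) x (a * c).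
Proof. by move=> hf; apply: dEq (dM hf (dC c x)) _; rewrite mulr0 addr0. Qed.
Lemma dComp g f x a b : is_d g (f x) b -> is_d f x a -> is_d (fun y => g (f y)) x (b * a).
Proof. by move=> hg hf; exact: (is_derive1_comp hg hf). Qed.
Lemma dExp f x a : is_d f x a -> is_d (fun y => expR (f y)) x (expR (f x) * a).
Proof. by move=> hf; apply: dComp hf. Qed.
Lemma dSin f x a : is_d f x a -> is_d (fun y => sin (f y)) x (cos (f x) * a).
Proof. by move=> hf; apply: dComp hf. Qed.
Lemma dCos f x a : is_d f x a -> is_d (fun y => cos (f y)) x (- sin (f x) * a).
Proof. by move=> hf; apply: dComp hf. Qed.
Lemma d_continuous f x a : is_d f x a -> {for x, continuous f}.
Proof. by move=> h; apply: differentiable_continuous; apply/derivable1_diffP; have [] := h. Qed.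

Lemma FTC (f F : R -> R) a b : a <= b -> (forall x, is_d F x (f x)) -> continuous f ->
 \int[@lebesgue_measure R]_(x in `[a, b]) f x = F b - F a.
Proof.
rewrite le_eqVlt => /predU1P[-> dF cf|ab dF cf].
 by rewrite set_itv1 Rintegral_set1 subrr.
have cF x : {for x, continuous F} := d_continuous (dF x).
rewrite /Rintegral (@continuous_FTC2 _ f F a b)//.
- by apply: continuous_subspaceT.
- split; first by move=> x _; have [] := dF x.
  by apply: cvg_at_right_filter; exact: cF.
 by apply: cvg_at_left_filter; exact: cF.
- by move=> x _; rewrite derive1E; have [_ ->] := dF x.
Qed.

End Derive1.

(** * Real-valued integration: convergence theorems, Fubini, completeness of L2 *)

Notation mfun f := (measurable_fun setT f).
Notation sfmeas T R := {sigma_finite_measure set T -> \bar R}.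
Notation mfunM := measurable_funM.
Notation mfunX := measurable_funX.
Notation mfunB := measurable_funB.
Notation mfunD := measurable_funD.
Notation mfun_pair := measurable_fun_pair.
Notation mfcomp := measurableT_comp.
Notation mfun_cst := measurable_cst.
Notation mfun_fst := measurable_fst.
Notation mfun_snd := measurable_snd.
Notation EFinP := measurable_EFinP.
Notation mf_indic := measurable_indic.
Notation cont_mfun := continuous_measurable_fun.

(** Measurability by descent on the syntax of the function. The generic composition rule comes last
    but one and has to close the outer function at once, so the search cannot wander. *)
Ltac mstep := match goal with
 | H : mfun ?f |- mfun ?f => exact: H
 | |- measurable_fun _ (fun _ => ?c) => apply: measurable_cst
 | |- measurable_fun _ (fun x => x) => apply: measurable_id
 | |- measurable_fun _ fst => apply: measurable_fst
 | |- measurable_fun _ snd => apply: measurable_snd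
 | |- measurable_fun _ (fun x => fst x) => apply: measurable_fst
 | |- measurable_fun _ (fun x => snd x) => apply: measurable_snd
 | |- measurable_fun _ (fun x => (@?f x, @?g x)) => apply: (@measurable_fun_pair _ _ _ _ _ _ f g)
 | |- measurable_fun _ (fun x => GRing.add (@?f x) (GRing.opp (@?g x))) => apply: (@measurable_funB _ _ _ _ f g)
 | |- measurable_fun _ (fun x => GRing.add (@?f x) (@?g x)) => apply: (@measurable_funD _ _ _ _ f g)
 | |- measurable_fun _ (fun x => GRing.mul (@?f x) (@?g x)) => apply: (@measurable_funM _ _ _ _ f g)
 | |- measurable_fun _ (fun x => GRing.exp (@?f x) ?n) => apply: (@measurable_funX _ _ _ _ f n)
 | |- measurable_fun _ (fun x => GRing.opp (@?f x)) => apply: (@measurableT_comp _ _ _ _ _ _ _ _ f (@oppr_measurable _ setT))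
 | |- measurable_fun _ (fun x => Num.norm (@?f x)) => apply: (@measurableT_comp _ _ _ _ _ _ _ _ f (@normr_measurable _ setT))
 | H : mfun ?F |- measurable_fun _ (fun x => ?F (@?f x)) => apply: (@measurableT_comp _ _ _ _ _ _ _ _ f H)
 | |- measurable_fun _ (fun x => fst (@?f x)) => apply: (@measurableT_comp _ _ _ _ _ _ _ _ f measurable_fst)
 | |- measurable_fun _ (fun x => snd (@?f x)) => apply: (@measurableT_comp _ _ _ _ _ _ _ _ f measurable_snd)
 | |- measurable_fun _ (fun x => ?F (@?f x)) => apply: (@measurableT_comp _ _ _ _ _ _ F _ f);
   [solve [done | match goal with H : _ |- _ => by apply: H end]|]
 | H : _ |- _ => solve [apply: H]
 end.

Ltac mtac := repeat mstep.

Notation intg mu f := (integrable mu setT (EFin \o f)).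

Lemma eq_ler (R : realType) (x y : R) : x = y -> x <= y.
Proof. by move->. Qed.

Lemma cvgEFin (R : realType) (u : nat -> R) (l : R) :
 u n @[n --> \oo] --> l -> (u n)%:E @[n --> \oo] --> l%:E.
Proof. by move=> h; apply/fine_cvgP; split => //; exact: nearW. Qed.

Lemma cvg_eq (R : realType) (u : nat -> R) (l l' : R) :
 u n @[n --> \oo] --> l -> l = l' -> u n @[n --> \oo] --> l'.
Proof. by move=> h <-. Qed.

Lemma cvg_sq (R : realType) (u : nat -> R) (l : R) :
 u n @[n --> \oo] --> l -> (u n) ^+ 2 @[n --> \oo] --> l ^+ 2.
Proof. by move=> h; rewrite expr2; under eq_fun do rewrite expr2; exact: cvgM. Qed.

Lemma ae2 d (T : measurableType d) (R : realType) (mu : {measure set T -> \bar R}) (P Q U : T -> Prop) :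
 {ae mu, forall x, P x} -> {ae mu, forall x, Q x} -> (forall x, P x -> Q x -> U x) -> {ae mu, forall x, U x}.
Proof. by move=> hP hQ h; have F := ae_filter_ringOfSetsType mu; exact: filterS2 hP hQ. Qed.

Lemma ae1 d (T : measurableType d) (R : realType) (mu : {measure set T -> \bar R}) (P Q : T -> Prop) :
 {ae mu, forall x, P x} -> (forall x, P x -> Q x) -> {ae mu, forall x, Q x}.
Proof. by move=> hP h; apply: (ae2 hP hP) => x Px _; exact: h. Qed.

Section RealIntegral.
Context d (T : measurableType d) (R : realType) (mu : {measure set T -> \bar R}).

Implicit Types f g : T -> R.

Lemma intg_mf f : intg mu f -> mfun f.
Proof. by move/measurable_int/EFinP. Qed.
Lemma intgD f g : intg mu f -> intg mu g -> intg mu (fun x => f x + g x).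
Proof. by move=> hf hg; exact: (integrableD measurableT hf hg). Qed.
Lemma intgB f g : intg mu f -> intg mu g -> intg mu (fun x => f x - g x).
Proof. by move=> hf hg; exact: (integrableB measurableT hf hg). Qed.
Lemma intgZ r f : intg mu f -> intg mu (fun x => r * f x).
Proof. by move=> hf; exact: (integrableZl measurableT r hf). Qed.
Lemma intgN f : intg mu f -> intg mu (fun x => - f x).
Proof. by move=> hf; exact: (integrableN hf). Qed.
Lemma intg0 : intg mu (fun _ : T => 0 : R).
Proof. exact: integrable0. Qed.

Lemma le_intg f g : mfun f -> (forall x, `|f x| <= g x) -> intg mu g -> intg mu f.
Proof.
move=> mf fg ig; apply: (le_integrable measurableT _ _ ig) => /=.
 exact/EFinP.
by move=> x _; rewrite lee_fin (le_trans (fg x))// ler_norm.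
Qed.

Lemma intg_norm f : intg mu f -> intg mu (fun x => `|f x|).
Proof. by move=> hf; exact: (integrable_norm hf). Qed.

Lemma ge0_intg f : mfun f -> (forall x, 0 <= f x) -> (\int[mu]_x (f x)%:E < +oo)%E -> intg mu f.
Proof.
move=> mf f0 foo; apply/integrableP; split; first exact/EFinP.
rewrite (eq_integral (EFin \o f))// => x _ /=.
by rewrite ger0_norm.
Qed.

Lemma RintE f : intg mu f -> (\int[mu]_x (f x)%:E)%E = (\int[mu]_x f x)%:E.
Proof. by move=> hf; rewrite /Rintegral fineK// (integrable_fin_num measurableT hf). Qed.
Lemma RintD f g : intg mu f -> intg mu g -> \int[mu]_x (f x + g x) = \int[mu]_x f x + \int[mu]_x g x.
Proof. exact: RintegralD. Qed.
Lemma RintB f g : intg mu f -> intg mu g -> \int[mu]_x (f x - g x) = \int[mu]_x f x - \int[mu]_x g x.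
Proof. exact: RintegralB. Qed.

Lemma RintB4 f g h k : intg mu f -> intg mu g -> intg mu h -> intg mu k ->
 \int[mu]_x (f x - g x - h x - k x) = \int[mu]_x f x - \int[mu]_x g x - \int[mu]_x h x - \int[mu]_x k x.
Proof. by move=> i1 i2 i3 i4; rewrite (RintB (intgB (intgB i1 i2) i3) i4) (RintB (intgB i1 i2) i3) (RintB i1 i2). Qed.

Lemma RintZ r f : intg mu f -> \int[mu]_x (r * f x) = r * \int[mu]_x f x.
Proof. exact: RintegralZl. Qed.

Lemma RintN f : intg mu f -> \int[mu]_x (- f x) = - \int[mu]_x f x.
Proof.
move=> hf; rewrite -mulN1r -RintZ//; congr Rintegral.
by apply/funext => x; rewrite mulN1r.
Qed.

Lemma Rint0 : \int[mu]_x (0 : R) = 0.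
Proof. by rewrite /Rintegral integral0. Qed.
Lemma Rint_ge0 f : (forall x, 0 <= f x) -> 0 <= \int[mu]_x f x.
Proof. by move=> h; apply: Rintegral_ge0. Qed.
Lemma le_Rint f g : intg mu f -> intg mu g -> (forall x, f x <= g x) -> \int[mu]_x f x <= \int[mu]_x g x.
Proof. by move=> hf hg h; apply: le_Rintegral. Qed.
Lemma norm_Rint f : intg mu f -> `|\int[mu]_x f x| <= \int[mu]_x `|f x|.
Proof. by move=> hf; apply: le_normr_Rintegral. Qed.
Lemma eq_Rint f g : f =1 g -> \int[mu]_x f x = \int[mu]_x g x.
Proof. by move/funext => ->. Qed.
Lemma eq_intg f g : f =1 g -> intg mu f -> intg mu g.
Proof. by move/funext => ->. Qed.

(** No integrability is asked: [Rintegral] is the [fine] part of the extended integral, so both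
    sides take the same default value when the integral is infinite. *)
Lemma ae_Rint f g : mfun f -> mfun g -> {ae mu, forall x, f x = g x} -> \int[mu]_x f x = \int[mu]_x g x.
Proof.
move=> mf mg h; rewrite /Rintegral; congr fine.
apply: ae_eq_integral => //; [exact/EFinP|exact/EFinP|].
by apply: filterS h => x /= -> _.
Qed.

Lemma ae_eq_int f g : mfun f -> mfun g -> {ae mu, forall x, f x = g x} ->
 (\int[mu]_x (f x)%:E = \int[mu]_x (g x)%:E)%E.
Proof.
move=> mf mg h; apply: ae_eq_integral => //; try exact/EFinP.
by apply: filterS h => x /= -> _.
Qed.

Lemma ae_intg f g : mfun g -> {ae mu, forall x, f x = g x} -> intg mu f -> intg mu g.
Proof.
move=> mg h hf; have mf := intg_mf hf.
apply/integrableP; split; first exact/EFinP.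
have /integrableP[_] := hf; rewrite (_ : integral _ _ _ = integral mu setT (fun x => `|(g x)%:E|%E))//.
apply: ae_eq_integral => //.
- by apply: mfcomp => //; exact/EFinP.
- by apply: mfcomp => //; exact/EFinP.
- by apply: filterS h => x /= -> _.
Qed.

Lemma Rint_dct (f_ : nat -> T -> R) f g :
 (forall n, mfun (f_ n)) -> mfun f -> intg mu g -> (forall n x, `|f_ n x| <= g x) ->
 {ae mu, forall x, f_ n x @[n --> \oo] --> f x} -> intg mu f /\ (\int[mu]_x f_ n x @[n --> \oo] --> \int[mu]_x f x).
Proof.
move=> mf_ mf ig hb hc.
have [i1 _ i3] := @dominated_convergence _ T R mu setT measurableT (fun n x => (f_ n x)%:E) (EFin \o f) (EFin \o g)
 (fun n => (EFinP _ _).2 (mf_ n)) ((EFinP _ _).2 mf) (filterS (fun x hx _ => cvgEFin hx) hc)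
 ig (aeW _ (fun x n _ => hb n x)).
split => //; rewrite /Rintegral; apply: fine_cvg.
by rewrite fineK ?(integrable_fin_num measurableT i1).
Qed.

(** Integrability of the limit is part of the conclusion. This is how uniform bounds survive a limit
    that exists only almost everywhere. *)
Lemma fatou_bound (f_ : nat -> T -> R) f C :
 (forall n, intg mu (f_ n)) -> mfun f -> (forall n x, 0 <= f_ n x) -> (forall x, 0 <= f x) ->
 {ae mu, forall x, f_ n x @[n --> \oo] --> f x} -> (forall n, \int[mu]_x f_ n x <= C) ->
 intg mu f /\ \int[mu]_x f x <= C.
Proof.
move=> if_ mf f_0 f0 hc hC.
have mE n : mfun (EFin \o f_ n) by exact: measurable_int (if_ n).
have h1 : (\int[mu]_x (f x)%:E <= C%:E)%E.
 apply: (@le_trans _ _ (\int[mu]_x limn_einf (fun n => (f_ n x)%:E))%E).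
  rewrite le_eqVlt; apply/orP; left; apply/eqP.
  apply: ae_eq_integral => //; first exact/EFinP.
   (* The lower limit is minus the upper limit of the negatives, and measurability is known for
      upper limits. *)
   rewrite (_ : (fun x => _) = (fun x => - limn_esup (fun n => - (f_ n x)%:E))%E).
    apply: mfcomp => //; apply: measurable_fun_limn_esup => n.
    by apply: mfcomp => //; exact: mE.
   by apply/funext => x; rewrite -limn_einfN; congr limn_einf; apply/funext => n /=; rewrite ?oppeK ?opprK.
  apply: filterS hc => x hx _ /=; symmetry.
  by have [-> _] := cvg_limn_einf_sup (cvgEFin hx).
 apply: (le_trans (@fatou _ _ _ mu _ measurableT _ mE (fun n x _ => _))) => //.
  by move=> n x; rewrite lee_fin.
 rewrite limn_einf_lim; apply: lime_le.
  exact: is_cvg_einfs.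
 apply: nearW => n; apply: (@le_trans _ _ (\int[mu]_x (f_ n x)%:E)%E).
  by apply: ereal_inf_lbound; exists n => /=.
 by rewrite RintE// lee_fin.
split; first by apply: ge0_intg => //; rewrite (le_lt_trans h1)// ltry.
have := h1; rewrite RintE ?lee_fin//.
by apply: ge0_intg => //; rewrite (le_lt_trans h1)// ltry.
Qed.

Lemma Rint_eq0 f : intg mu f -> (forall x, 0 <= f x) -> \int[mu]_x f x = 0 -> {ae mu, forall x, f x = 0}.
Proof.
move=> hf f0 h; have := RintE hf; rewrite h => /eqP.
rewrite (_ : integral _ _ _ = (\int[mu]_x `|(f x)%:E|)%E); last first.
 by apply: eq_integral => x _ /=; rewrite ger0_norm.
move/eqP/ae_eq_integral_abs => /(_ measurableT (measurable_int _ hf)).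
by apply: filterS => x /= /(_ I) -[].
Qed.

Lemma intg_sqM f g : mfun f -> mfun g -> intg mu (fun x => f x ^+ 2) -> intg mu (fun x => g x ^+ 2) ->
 intg mu (fun x => f x * g x).
Proof.
move=> mf mg hf hg; apply: le_intg (intgD hf hg).
 exact: mfunM.
move=> x; rewrite normrM.
rewrite -[f x ^+ 2]real_normK ?num_real// -[g x ^+ 2]real_normK ?num_real//.
have := sqr_ge0 (`|f x| - `|g x|); nra.
Qed.

Lemma cauchy_schwarz f g : mfun f -> mfun g -> intg mu (fun x => f x ^+ 2) -> intg mu (fun x => g x ^+ 2) ->
 (\int[mu]_x (f x * g x)) ^+ 2 <= \int[mu]_x (f x ^+ 2) * \int[mu]_x (g x ^+ 2).
Proof.
move=> mf mg hf hg; have hfg := intg_sqM mf mg hf hg.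
set A := Rintegral mu setT (fun x => f x ^+ 2).
set B := Rintegral mu setT (fun x => g x ^+ 2).
set C := Rintegral mu setT (fun x => f x * g x).
have q l : 0 <= A - 2 * l * C + l ^+ 2 * B.
 have -> : A - 2 * l * C + l ^+ 2 * B = \int[mu]_x ((f x - l * g x) ^+ 2).
  rewrite /A /B /C -!RintZ// -RintB//; last exact: intgZ.
  rewrite -RintD//; [|exact/intgB/intgZ|exact: intgZ].
  by apply: eq_Rint => x; ring.
 by apply: Rint_ge0 => x; exact: sqr_ge0.
have A0 : 0 <= A by apply: Rint_ge0 => x; exact: sqr_ge0.
have B0 : 0 <= B by apply: Rint_ge0 => x; exact: sqr_ge0.
have [B00|Bn0] := eqVneq B 0.
 have [->|C0] := eqVneq C 0; first by rewrite expr0n /= mulr_ge0.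
 (* With [B = 0] the expression is affine in [l]; this [l] would give it the value -1. *)
 have := q ((A + 1) / (2 * C)); rewrite B00 mulr0 addr0.
 rewrite (_ : _ - _ = -1); last by field.
 by rewrite lerNr oppr0 ler10.
(* The minimiser of the quadratic in [l]. *)
have := q (C / B); rewrite (_ : _ + _ = A - C ^+ 2 / B); last by field.
by rewrite subr_ge0 ler_pdivrMr// lt_neqAle eq_sym Bn0.
Qed.

End RealIntegral.

Lemma mf_Rint d1 d2 (T1 : measurableType d1) (T2 : measurableType d2)
  (R : realType) (m2 : sfmeas T2 R) (f : T1 * T2 -> R) :
 mfun f -> mfun (fun x => \int[m2]_y f (x, y)).
Proof.
move=> mf; rewrite /Rintegral.
have me : mfun (EFin \o f) by exact/EFinP.
apply: (mfcomp (@fine_measurable R setT measurableT)).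
rewrite (_ : (fun x => _) = (fun x => \int[m2]_y (EFin \o f)^\+ (x, y) - \int[m2]_y (EFin \o f)^\- (x, y))%E).
 apply: emeasurable_funB; apply: measurable_fun_fubini_tonelli_F => //.
  exact: measurable_funepos.
 exact: measurable_funeneg.
apply/funext => x; rewrite [LHS]integralE; congr (_ - _)%E;
 by apply: eq_integral => y _; rewrite ?funeposE ?funenegE.
Qed.

Lemma mf_Rint2 d1 d2 (T1 : measurableType d1) (T2 : measurableType d2)
  (R : realType) (m2 : sfmeas T2 R) (f : T1 -> T2 -> R) :
 mfun (fun z => f z.1 z.2) -> mfun (fun x => \int[m2]_y f x y).
Proof. by move=> mf; exact: (mf_Rint m2 mf). Qed.
Arguments mf_Rint2 {d1 d2 T1 T2 R} m2 f.

Section ProductMeasure.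
Context d1 d2 (T1 : measurableType d1) (T2 : measurableType d2) (R : realType).
Variables (m1 : sfmeas T1 R) (m2 : sfmeas T2 R).

(* The sigma-finite instance of [m1 \x m2] is not inferred, hence this copy. *)
Definition pm : set (T1 * T2) -> \bar R := (m1 \x m2)%E.

HB.instance Definition _ := Measure.on pm.

Let pm_sigma_finite : sigma_finite setT pm.
Proof.
have /sigma_finiteP[F [TF ndF Foo]] := sigma_finiteT m1.
have /sigma_finiteP[G [TG ndG Goo]] := sigma_finiteT m2.
exists (fun n => F n `*` G n).
 rewrite -setXTT TF TG predeqE => -[x y]; split.
  move=> [/= [n _ Fnx] [k _ Gky]]; exists (maxn n k) => //; split.
  - by move: x Fnx; exact/subsetPset/ndF/leq_maxl.
  - by move: y Gky; exact/subsetPset/ndG/leq_maxr.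
 by move=> [n _ [? ?]]; split; exists n.
move=> k; have [mF Fk] := Foo k; have [mG Gk] := Goo k; split; first exact: measurableX.
rewrite (_ : pm _ = m1 (F k) * m2 (G k))%E; last exact: product_measure1E.
by rewrite lte_mul_pinfty// ge0_fin_numE.
Qed.

HB.instance Definition _ := Measure_isSigmaFinite.Build _ _ _ pm pm_sigma_finite.

End ProductMeasure.

Section RealFubini.
Context d1 d2 (T1 : measurableType d1) (T2 : measurableType d2) (R : realType).
Variables (m1 : sfmeas T1 R) (m2 : sfmeas T2 R).
Variable f : T1 * T2 -> R.
Notation mm := (pm m1 m2).

Lemma intg_swap : intg mm f -> intg (pm m2 m1) (fun z => f (z.2, z.1)).
Proof.
move=> hf; have mf := intg_mf hf.
apply/(@integrable12ltyP _ _ T2 T1) => /=.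
 apply/EFinP; apply: (mfcomp mf).
 exact: measurable_swap.
exact: (@integrable21ltyP _ _ _ _ _ _ _ _ (measurable_int _ hf)).1.
Qed.

Lemma ae_intg1 : intg mm f -> {ae m1, forall x, intg m2 (fun y => f (x, y))}.
Proof. exact: ae_integrable1. Qed.

Lemma intg_Rint1 : intg mm f -> intg m1 (fun x => \int[m2]_y f (x, y)).
Proof.
move=> hf; have h := integrable_fubini_F hf.
have mf := intg_mf hf.
apply/integrableP; split; first exact/EFinP/mf_Rint.
have /integrableP[_] := h; apply: le_lt_trans.
apply: ae_ge0_le_integral => //.
- by apply: mfcomp => //; exact/EFinP/mf_Rint.
- by apply: mfcomp => //; exact: measurable_int h.
- apply: filterS (ae_intg1 hf) => x hx _ /=; rewrite /fubini_F /= (RintE hx) /= lexx //.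
Qed.

Lemma Rfubini1 : intg mm f -> \int[m1]_x \int[m2]_y f (x, y) = \int[mm]_z f z.
Proof.
move=> hf; have h := integrable_fubini_F hf; have mf := intg_mf hf.
rewrite /Rintegral -(integral12_prod_meas1 hf); congr fine.
apply: ae_eq_integral => //; first exact/EFinP/mf_Rint.
 exact: measurable_int h.
by apply: filterS (ae_intg1 hf) => x hx _ /=; rewrite /fubini_F /= (RintE hx).
Qed.

Lemma ge0_intg_prod : mfun f -> (forall z, 0 <= f z) -> (forall x, intg m2 (fun y => f (x, y))) ->
 intg m1 (fun x => \int[m2]_y f (x, y)) -> intg mm f.
Proof.
move=> mf f0 h1 h2; apply: ge0_intg => //.
rewrite fubini_tonelli1 //; first last.
 exact/EFinP.
rewrite /fubini_F (eq_integral (fun x => (\int[m2]_y f (x, y))%:E)).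
 by rewrite RintE// ltry.
by move=> x _; rewrite RintE.
Qed.

End RealFubini.

Section RealFubini2.
Context d1 d2 (T1 : measurableType d1) (T2 : measurableType d2) (R : realType).
Variables (m1 : sfmeas T1 R) (m2 : sfmeas T2 R).
Variable f : T1 * T2 -> R.
Notation mm := (pm m1 m2).

Lemma intg_Rint2 : intg mm f -> intg m2 (fun y => \int[m1]_x f (x, y)).
Proof. by move/intg_swap/intg_Rint1. Qed.

Lemma Rfubini2 : intg mm f -> \int[m2]_y \int[m1]_x f (x, y) = \int[mm]_z f z.
Proof.
move=> hf; rewrite (Rfubini1 (intg_swap hf)) /Rintegral; congr fine.
rewrite -(integral21_prod_meas1 hf) -(integral12_prod_meas1 (intg_swap hf)).
by [].
Qed.

Lemma Rfubini : intg mm f -> \int[m1]_x \int[m2]_y f (x, y) = \int[m2]_y \int[m1]_x f (x, y).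
Proof. by move=> hf; rewrite Rfubini1// Rfubini2. Qed.

Lemma intgM12 (g : T1 -> R) (h : T2 -> R) : intg m1 g -> intg m2 h -> intg mm (fun z => g z.1 * h z.2).
Proof.
move=> ig ih.
have m : mfun (fun z : T1 * T2 => g z.1 * h z.2).
 apply: mfunM; apply: mfcomp => //.
  exact: intg_mf ig.
 exact: intg_mf ih.
suff : intg mm (fun z => `|g z.1| * `|h z.2|).
 by apply: le_intg => // z; rewrite normrM.
apply: ge0_intg_prod => /=.
- have : mfun (fun z : T1 * T2 => `|g z.1 * h z.2|) by exact: mfcomp.
 by apply: eq_measurable_fun => z _; rewrite normrM.
- by move=> z; rewrite mulr_ge0.
- by move=> x; exact/intgZ/intg_norm.
- rewrite (_ : (fun x => _) = (fun x => (\int[m2]_y `|h y|) * `|g x|)).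
  exact/intgZ/intg_norm.
 apply/funext => x; rewrite [RHS]mulrC RintZ //; exact: intg_norm.
Qed.

End RealFubini2.

Section L2complete.
Context d (T : measurableType d) (R : realType) (mu : {measure set T -> \bar R}).
Variable f_ : nat -> T -> R.
Hypothesis mf_ : forall n, mfun (f_ n).
Hypothesis if_ : forall n m, intg mu (fun x => (f_ n x - f_ m x) ^+ 2).
Hypothesis cauchy_f : forall e, 0 < e -> exists N, forall n m, (N <= n)%N -> (N <= m)%N ->
 \int[mu]_x ((f_ n x - f_ m x) ^+ 2) <= e.

(** The rate [4^-1 ^+ k] leaves room for the weights [2 ^+ k] that turn summability in [L2] into
    summability at almost every point. *)
Lemma L2_subseq : exists phi : nat -> nat, (forall k, (k <= phi k)%N) /\
 (forall k, \int[mu]_x ((f_ (phi k.+1) x - f_ (phi k) x) ^+ 2) <= 4^-1 ^+ k).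
Proof.
have /choice[N hN] : forall k : nat, exists N, forall n m, (N <= n)%N -> (N <= m)%N ->
  \int[mu]_x ((f_ n x - f_ m x) ^+ 2) <= 4^-1 ^+ k.
 by move=> k; apply: cauchy_f; rewrite exprn_gt0// invr_gt0.
pose phi := fix phi k := if k is k'.+1 then maxn (phi k').+1 (N k) else N 0.
have hp k : (N k <= phi k)%N by case: k => //= k; rewrite leq_maxr.
have hs k : (phi k < phi k.+1)%N by rewrite /= leq_max leqnn.
exists phi; split.
 by elim=> // k ih; exact: leq_ltn_trans ih (hs k).
by move=> k; apply: hN; rewrite ?hp// (leq_trans (hp k))// ltnW.
Qed.

(** At each point [|g k x| <= 2^-1 ^+ k + 2 ^+ k * g k x ^+ 2], and the series of the last terms has
    integral at most the geometric sum 2, hence is finite almost everywhere. *)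
Lemma ae_cvg_of_summable (g : nat -> T -> R) :
 (forall k, mfun (g k)) -> (forall k, intg mu (fun x => g k x ^+ 2)) ->
 (forall k, \int[mu]_x (g k x ^+ 2) <= 4^-1 ^+ k) -> {ae mu, forall x, cvgn (series (g ^~ x))}.
Proof.
move=> mg ig hg.
pose u k x : \bar R := (2 ^+ k * g k x ^+ 2)%:E.
have mu_ k : mfun (u k).
 by apply/EFinP; apply: mfunM => //; exact: mfunX.
have u0 k x : (0 <= u k x)%E by rewrite lee_fin mulr_ge0 ?sqr_ge0 ?exprn_ge0.
have h : (\int[mu]_x \sum_(k <oo) u k x <= 2%:E)%E.
 rewrite integral_nneseries//; apply: lime_le.
  by apply: is_cvg_nneseries => k _ _; exact: integral_ge0.
 apply: nearW => n; apply: (@le_trans _ _ (\sum_(0 <= k < n) (2^-1 ^+ k)%:E)%E).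
  apply: lee_sum => k _; rewrite RintE; last exact: intgZ.
  rewrite RintZ// lee_fin (le_trans (ler_wpM2l _ (hg k)))//.
  by rewrite -exprMn (_ : 2 * 4^-1 = 2^-1 :> R)//; field.
 rewrite sumEFin lee_fin.
 have -> : \sum_(0 <= k < n) 2^-1 ^+ k = 2 * (1 - 2^-1 ^+ n) :> R.
  elim: n => [|n ih]; first by rewrite big_nil expr0 subrr mulr0.
  by rewrite big_nat_recr//= ih exprS; field.
 by rewrite ler_piMr// lerBlDr lerDl exprn_ge0.
have iu : mu.-integrable setT (fun x => \sum_(k <oo) u k x)%E.
 apply/integrableP; split; first by apply: ge0_emeasurable_sum.
 rewrite (eq_integral (fun x => \sum_(k <oo) u k x)%E).
  by rewrite (le_lt_trans h)// ltry.
 by move=> x _; rewrite gee0_abs// nneseries_ge0.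
apply: filterS (integrable_ae measurableT iu) => x /= /(_ I) fx.
pose C := fine (\sum_(k <oo) u k x).
apply: normed_cvg; apply: nondecreasing_is_cvgn.
  change {homo (fun n => \sum_(0 <= k < n) `|g k x|) : n m / (n <= m)%N >-> n <= m}.
 by apply/nondecreasing_seqP => n; rewrite big_nat_recr//= lerDl.
exists (2 + C) => _ [n _ <-].
have hC : \sum_(0 <= k < n) (2 ^+ k * g k x ^+ 2) <= C.
 rewrite -lee_fin /C fineK// -sumEFin; apply: nneseries_lim_ge => k _ _; exact: u0.
apply: (@le_trans _ _ (\sum_(0 <= k < n) (2^-1 ^+ k + 2 ^+ k * g k x ^+ 2))).
 apply: ler_sum => k _.
 have p0 : 0 < 2 ^+ k :> R by rewrite exprn_gt0.
 have e : 2 ^+ k * (2^-1 ^+ k + 2 ^+ k * g k x ^+ 2) = 1 + (2 ^+ k * `|g k x|) ^+ 2.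
  by rewrite exprMn real_normK ?num_real// exprVn; field; rewrite gt_eqF.
 rewrite -(ler_pM2l p0) e.
 have X0 : 0 <= 2 ^+ k * `|g k x| by rewrite mulr_ge0// ltW.
 move: X0; move: (2 ^+ k * `|g k x|) => X X0.
 by have := sqr_ge0 (X - 1); rewrite sqrrB expr1n mulr1; lra.
rewrite big_split /= lerD//.
have -> : \sum_(0 <= k < n) 2^-1 ^+ k = 2 * (1 - 2^-1 ^+ n) :> R.
 elim: n {hC} => [|n ih]; first by rewrite big_nil expr0 subrr mulr0.
 by rewrite big_nat_recr//= ih exprS; field.
by rewrite ler_piMr// lerBlDr lerDl exprn_ge0.
Qed.

Lemma L2_complete : exists f : T -> R, exists2 phi : nat -> nat, (forall k, (k <= phi k)%N) & [/\ mfun f,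
   {ae mu, forall x, f_ (phi k) x @[k --> \oo] --> f x}, forall n, intg mu (fun x => (f_ n x - f x) ^+ 2) &
   forall e, 0 < e -> exists N, forall n, (N <= n)%N -> \int[mu]_x ((f_ n x - f x) ^+ 2) <= e].
Proof.
have [phi [phik hphi]] := L2_subseq.
pose g k x := f_ (phi k.+1) x - f_ (phi k) x.
have mg k : mfun (g k) by exact: mfunB.
have ae1 := ae_cvg_of_summable mg (fun k => if_ _ _) hphi.
have [E [mE muE hE]] := ae1.
pose h k x := f_ (phi k) x * \1_(~` E) x.
have hx x : ~ E x -> f_ (phi k) x @[k --> \oo] --> f_ (phi 0) x + limn (series (g ^~ x)).
 move=> nEx.
 have cx : cvgn (series (g ^~ x)) by apply: contrapT => nc; apply: nEx; exact: hE.
 rewrite (_ : (fun k => _) = (fun k => f_ (phi 0%N) x + series (g ^~ x) k)).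
  by apply: cvgD => //; exact: cvg_cst.
 by apply/funext => k; rewrite /series/= telescope_sumr// addrC subrK.
(* Setting the limit to 0 on the exceptional set makes [h k] converge at every point, which yields
   measurability of [f]. *)
pose f x := (f_ (phi 0%N) x + limn (series (g ^~ x))) * \1_(~` E) x.
have hf x : h k x @[k --> \oo] --> f x.
 rewrite /h /f indicE; case: (boolP (x \in ~` E)) => Ex.
  rewrite mulr1; under eq_fun do rewrite mulr1.
  by apply: hx; move: Ex; rewrite inE.
 by rewrite mulr0; under eq_fun do rewrite mulr0; exact: cvg_cst.
have mf : mfun f.
 apply: (@measurable_fun_cvg _ _ _ _ h) => // k.
 by apply: mfunM => //; apply: mf_indic; exact: measurableC.
have aef : {ae mu, forall x, f_ (phi k) x @[k --> \oo] --> f x}.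
 exists E; split => // x /= nx; apply: contrapT => nEx; apply: nx.
 rewrite /f indicE mem_set// mulr1; exact: hx.
(* Fatou along the subsequence, shifted by [N] so that all its indices lie in the Cauchy range. *)
have key n N e : (forall k, (N <= k)%N -> \int[mu]_x ((f_ n x - f_ k x) ^+ 2) <= e) ->
  intg mu (fun x => (f_ n x - f x) ^+ 2) /\ \int[mu]_x ((f_ n x - f x) ^+ 2) <= e.
 move=> hk; apply: (@fatou_bound _ _ _ _ (fun k x => (f_ n x - f_ (phi (k + N)%N) x) ^+ 2)).
 - by move=> k; exact: if_.
 - by apply: mfunX; exact: mfunB.
 - by move=> k x; exact: sqr_ge0.
 - by move=> x; exact: sqr_ge0.
 - apply: filterS aef => x hx'.
  have h1 : f_ n x - f_ (phi (k + N)%N) x @[k --> \oo] --> f_ n x - f x.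
   by apply: cvgB; [exact: cvg_cst|move: hx'; rewrite -(cvg_shiftn N)].
  exact: cvg_sq.
 - by move=> k; apply: hk; rewrite (leq_trans _ (phik _))// leq_addl.
exists f, phi => //; split => //.
- move=> n; have [N hN] := cauchy_f ltr01.
 have i1 : intg mu (fun x => (f_ N x - f x) ^+ 2).
  by have [] := key N N 1 (fun k hk => hN _ _ (leqnn _) hk).
 have i2 : intg mu (fun x => 2 * (f_ n x - f_ N x) ^+ 2 + 2 * (f_ N x - f x) ^+ 2).
  by apply: intgD; apply: intgZ.
 apply: le_intg i2.
  by apply: mfunX; exact: mfunB.
 move=> x; rewrite ger0_norm ?sqr_ge0//.
 have := sqr_ge0 ((f_ n x - f_ N x) - (f_ N x - f x)); nra.
- move=> e e0; have [N hN] := cauchy_f e0; exists N => n Nn.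
 by have [] := key n N e (fun k hk => hN _ _ Nn hk).
Qed.

End L2complete.

(** * Smooth functions and a flat function at the origin *)

Section Smooth.
Context {R : realType}.

(** Smoothness of finite order, by recursion on the first derivative taken. The quantification over
    lists of directions in [smooth] does not lend itself to products and chain rules; here closure
    under them is an induction on [n]. *)
Fixpoint Sm (V : normedModType R) (n : nat) (f : V -> R) : Prop :=
 if n is n'.+1 then [/\ continuous f, forall x v, derivable f x v &
  forall v, Sm n' (fun x => 'D_v f x)] else continuous f.

Lemma Sm_continuous (V : normedModType R) n (f : V -> R) : Sm n f -> continuous f.
Proof. by case: n => [//|n []]. Qed.

Lemma SmS (V : normedModType R) n (f : V -> R) : Sm n.+1 f -> Sm n f.
Proof.
elim: n f => [|n ih] f; first by case.
by case=> cf df sf; split => // v; apply: ih.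
Qed.

Lemma smoothP (V : normedModType R) (f : V -> R) : smooth f <-> forall n, Sm n f.
Proof.
split=> [sf n|].
 elim: n f sf => [|n ih] f sf; first by have [] := sf [::].
 split; [by have [] := sf [::]|by have [] := sf [::]|move=> v; apply: ih => l /=].
 by have := sf (rcons l v); rewrite foldr_rcons.
move=> sf l; elim/last_ind: l f sf => [|l v ih] f sf /=.
 by have [cf df _] := sf 1%N.
rewrite foldr_rcons; apply: ih => n; have [_ _ h] := sf n.+1; exact: h.
Qed.

Lemma SmD (V : normedModType R) n (f g : V -> R) : Sm n f -> Sm n g -> Sm n (fun x => f x + g x).
Proof.
elim: n f g => [|n ih] f g.
 by move=> cf cg x; apply: cvgD; [exact: cf|exact: cg].
move=> [cf df sf] [cg dg sg]; split.
- by move=> x; apply: cvgD; [exact: cf|exact: cg].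
- by move=> x v; exact: derivableD.
- move=> v; have := ih _ _ (sf v) (sg v).
 by congr Sm; apply/funext => x; rewrite -deriveD.
Qed.

Lemma SmM (V : normedModType R) n (f g : V -> R) : Sm n f -> Sm n g -> Sm n (fun x => f x * g x).
Proof.
elim: n f g => [|n ih] f g.
 by move=> cf cg x; apply: cvgM; [exact: cf|exact: cg].
move=> sf sg; have [cf df df'] := sf; have [cg dg dg'] := sg; split.
- by move=> x; apply: cvgM; [exact: cf|exact: cg].
- by move=> x v; exact: derivableM.
- move=> v; have h1 := ih _ _ (SmS sf) (dg' v); have h2 := ih _ _ (SmS sg) (df' v).
 have := SmD h1 h2; congr Sm; apply/funext => x.
 by rewrite (deriveM (df x v) (dg x v)).
Qed.

Lemma Sm_cst (V : normedModType R) n (c : R) : Sm n (fun _ : V => c).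
Proof.
elim: n c => [|n ih] c; first by move=> x; exact: cvg_cst.
split; [by move=> x; exact: cvg_cst|by move=> x v; exact: derivable_cst|move=> v].
by have := ih 0; congr Sm; apply/funext => x; rewrite derive_cst.
Qed.

(** Restricting to the line through [x] reduces directional derivatives, and with them the chain
    rule, to one real variable. *)
Lemma is_derive_line (V : normedModType R) (f : V -> R) x v df :
 is_derive x v f df <-> is_derive (0 : R) 1 (fun h : R => f (h *: v + x)) df.
Proof.
have e : 'D_v f x = 'D_1 (fun h : R => f (h *: v + x)) 0.
 rewrite /derive; set F := fun h => _; set G := fun h => _.
 suff -> : F = G by [].
 by apply/funext => h; rewrite /F /G /= !addr0 scale0r add0r /GRing.scale /= mulr1.
split=> -[h1 h2]; split.
- by move/derivable1P : h1.
- by rewrite -e.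
- by apply/derivable1P.
- by rewrite e.
Qed.

Lemma is_derive_linear (V : normedModType R) (f : V -> R) x v :
 (forall a u w, f (a *: u + w) = a * f u + f w) -> is_derive x v f (f v).
Proof.
move=> lf; apply/is_derive_line.
rewrite (_ : (fun h => _) = (fun h => h * f v + f x)); last by apply/funext => h; rewrite lf.
by apply: is_derive_eq; rewrite !scaler0 add0r addr0 /GRing.scale /= mulr1.
Qed.

Lemma Sm_linear (V : normedModType R) n (f : V -> R) :
 (forall a u w, f (a *: u + w) = a * f u + f w) -> continuous f -> Sm n f.
Proof.
move=> lf cf; case: n => // n; split => //.
 by move=> x v; have [] := is_derive_linear x v lf.
move=> v; have := @Sm_cst V n (f v).
by congr Sm; apply/funext => x; have [_ ->] := is_derive_linear x v lf.
Qed.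

Lemma is_derive_compV (V : normedModType R) (b : V -> R) (g : R -> R) x v db dg :
 is_derive x v b db -> is_derive (b x) 1 g dg -> is_derive x v (fun y => g (b y)) (dg * db).
Proof.
move=> /is_derive_line hb hg; apply/is_derive_line.
apply: (is_derive1_comp (f := g)).
by rewrite scale0r add0r.
Qed.

(** An explicit tower of derivatives of [g 0]: the chain rule applied to [g k] stays inside the
    tower, so smoothness of a composition is an induction. *)
Definition chain (g : nat -> R -> R) := forall k y, is_derive y (1 : R) (g k) (g k.+1 y).
Lemma chain_continuous g k : chain g -> continuous (g k).
Proof. by move=> cg y; apply: differentiable_continuous; apply/derivable1_diffP; have [] := cg k y. Qed.

Lemma Sm_comp (V : normedModType R) n k g (b : V -> R) : chain g -> Sm n b -> Sm n (fun x => g k (b x)).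
Proof.
move=> cg; elim: n k => [|n ih] k sb.
 move=> x; apply: continuous_comp; [exact: sb|exact: chain_continuous].
have [cb db db'] := sb.
have D x v : is_derive x v (fun x => g k (b x)) (g k.+1 (b x) * 'D_v b x).
 by apply: is_derive_compV; [exact: DeriveDef|exact: cg].
split.
- by move=> x; apply: continuous_comp; [exact: cb|exact: chain_continuous].
- by move=> x v; have [] := D x v.
- move=> v; have := SmM (ih k.+1 (SmS sb)) (db' v).
 by congr Sm; apply/funext => x; have [_ ->] := D x v.
Qed.

(** The functions [p(1/y) exp(-1/y)] extended by 0. With the polynomial free the family is closed
    under differentiation; [p = 1] is the classical smooth function that is flat at 0. *)
Definition sigp (p : {poly R}) (y : R) := if 0 < y then p.[y^-1] * expR (- y^-1) else 0.

(** Coefficient by coefficient, from the power series bound [z ^+ i <= i! * expR z]. *)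
Lemma poly_exp_bound (p : {poly R}) : exists2 C, 0 <= C & forall z, 0 < z -> `|p.[z]| * expR (- z) <= C.
Proof.
exists (\sum_(i < size p) `|p`_i| * i`!%:R); first by apply: sumr_ge0 => i _; rewrite mulr_ge0.
move=> z z0; rewrite horner_coef.
apply: (@le_trans _ _ ((\sum_(i < size p) `|p`_i * z ^+ i|) * expR (- z))).
 by rewrite ler_wpM2r ?expR_ge0// ler_norm_sum.
rewrite mulr_suml; apply: ler_sum => i _.
rewrite normrM -mulrA ler_wpM2l// ger0_norm ?exprn_ge0 ?(ltW z0)// expRN ler_pdivrMr ?expR_gt0//.
rewrite mulrC -ler_pdivrMr ?ltr0n ?fact_gt0//.
case: (i : nat) => [|k]; first by rewrite expr0 fact0 divr1 -[leLHS]expR0 ler_expR ltW.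
apply: le_trans (expR_ge1Dxn k (ltW z0)).
by rewrite lerDr.
Qed.

(** The previous bound for ['X^2 * p] at [z = y^-1]. A quadratic bound at 0 is what makes the
    derivative there exist and vanish. *)
Lemma sigp_le (p : {poly R}) : exists2 C, 0 <= C & forall y, `|sigp p y| <= C * y ^+ 2.
Proof.
have [C C0 hC] := poly_exp_bound ('X^2 * p).
exists C => // y; rewrite /sigp; case: ifPn => y0; last by rewrite normr0 mulr_ge0// sqr_ge0.
have := hC y^-1; rewrite invr_gt0 => /(_ y0).
rewrite hornerM hornerXn [`|_ * p.[_]|]normrM (ger0_norm (sqr_ge0 _)) exprVn.
rewrite [`|_ * expR _|]normrM (gtr0_norm (expR_gt0 _)).
by rewrite -mulrA mulrC ler_pdivrMr ?exprn_gt0.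
Qed.

Lemma is_derive0_of_sq (f : R -> R) C : (forall y, `|f y| <= C * y ^+ 2) -> is_derive (0 : R) (1 : R) f 0.
Proof.
move=> hf; have f0 : f 0 = 0.
 by apply/eqP; rewrite -normr_le0; have := hf 0; rewrite expr0n /= mulr0.
have h : (fun h : R => h^-1 *: ((f \o shift 0) (h *: (1 : R)) - f 0)) @ 0^' --> (0 : R).
 apply: (@cvg_to_0_linear _ _ C 1) => // r /andP[r0 _].
 have rn0 : r != 0 by rewrite -normr_gt0.
 rewrite /= f0 subr0 addr0 /GRing.scale /= mulr1 normrM normfV mulrC.
 rewrite ler_pdivrMr// (le_trans (hf r))// -mulrA -expr2 real_normK ?num_real//.
by split; [apply/cvg_ex; exists 0|exact: cvg_lim].
Qed.

(** For [y > 0] the product rule sends [p] to ['X^2 * (p - p')]; for [y < 0] everything vanishes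
    nearby; at 0 the quadratic bound decides. *)
Lemma is_derive_sigp (p : {poly R}) (y : R)  : is_derive y (1 : R) (sigp p) (sigp ('X^2 * (p - p^`())) y).
Proof.
have [->|y0] := eqVneq y 0.
 have [C C0 hC] := sigp_le p.
 rewrite [X in is_derive _ _ _ X](_ : _ = 0); first exact: is_derive0_of_sq hC.
 by rewrite /sigp ltxx.
have [yn|yp] := ltP y 0.
 rewrite [X in is_derive _ _ _ X](_ : _ = 0); last by rewrite /sigp ltNge (ltW yn).
 have h0 : is_derive y (1 : R) (cst (0 : R)) 0 by exact: is_derive_cst.
 apply: near_eq_is_derive h0.
 near=> z; rewrite /sigp /= ltNge (_ : z <= 0)//.
 by apply/ltW; near: z; exact: lt_nbhsl.
have {y0}yp : 0 < y by rewrite lt_neqAle eq_sym y0.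
have yn0 : y != 0 by rewrite gt_eqF.
have h1 : is_derive y (1 : R) (fun y : R => y^-1) (- y ^- 2).
 have := is_deriveV (f := id) yn0 (is_derive_id y (1 : R)).
 by move/is_derive_eq; apply; rewrite /GRing.scale /= mulr1.
have h2 : is_derive y (1 : R) (fun y => p.[y^-1]) (p^`().[y^-1] * - y ^- 2).
 by apply: (@is_derive_compV _ (fun y : R => y^-1) (horner p)).
have h3 : is_derive y (1 : R) (fun y => expR (- y^-1)) (expR (- y^-1) * - - y ^- 2).
 by apply: (@is_derive_compV _ (fun y : R => - y^-1) expR); exact: is_deriveN.
have H : is_derive y (1 : R) (fun y => p.[y^-1] * expR (- y^-1)) (sigp ('X^2 * (p - p^`())) y).
 suff -> : sigp ('X^2 * (p - p^`())) y = p.[y^-1] *: (expR (- y^-1) * - - y ^- 2) +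
   expR (- y^-1) *: (p^`().[y^-1] * - y ^- 2) by exact: is_deriveM h2 h3.
 rewrite /sigp yp hornerM hornerXn hornerD hornerN /GRing.scale /= exprVn; ring.
apply: near_eq_is_derive H; near=> z.
by rewrite /sigp (_ : 0 < z)//; near: z; exact: lt_nbhsr.
Unshelve. all: by end_near. Qed.

Definition sigpoly k : {poly R} := iter k (fun p => 'X^2 * (p - p^`())) 1.
Definition sigma_ k := sigp (sigpoly k).
Lemma chain_sigma : chain sigma_.
Proof. by move=> k y; exact: is_derive_sigp. Qed.
Definition sigma := sigma_ 0.
Lemma sigmaE y : sigma y = if 0 < y then expR (- y^-1) else 0.
Proof. by rewrite /sigma /sigma_ /sigp /= hornerC mul1r. Qed.
Lemma sigma_ge0 y : 0 <= sigma y.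
Proof. by rewrite sigmaE; case: ifP => // _; exact: expR_ge0. Qed.

Lemma sigma_le1 y : sigma y <= 1.
Proof.
rewrite sigmaE; case: ifPn => // y0.
by rewrite -expR0 ler_expR oppr_le0 invr_ge0 ltW.
Qed.

Lemma sigma_eq0 y : y <= 0 -> sigma y = 0.
Proof. by move=> y0; rewrite sigmaE ltNge y0. Qed.
Lemma continuous_sigma : continuous sigma.
Proof. exact: chain_continuous chain_sigma. Qed.

(** Rescaling turns [sigma] into the indicator of the positive half-line. Smooth time cutoffs are
    thereby replaced by sharp ones when the integrated equation is recovered. *)
Lemma cvg_sigma (y : R) : sigma ((n%:R : R) * y) @[n --> \oo] --> ((0 < y)%R%:R : R).
Proof.
have [y0|y0] := leP y 0.
 by under eq_fun do rewrite sigma_eq0 ?mulr_ge0_le0//; exact: cvg_cst.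
rewrite -(cvg_shiftS (fun n => sigma (n%:R * y))) /=.
under eq_fun => n do rewrite sigmaE mulr_gt0// invfM -mulNr mulrC.
have h : y^-1 * - n.+1%:R^-1 @[n --> \oo] --> y^-1 * - 0.
 by apply: cvgM; [exact: cvg_cst|apply: cvgN; exact: cvg_harmonic].
have h2 : expR (y^-1 * - n.+1%:R^-1) @[n --> \oo] --> expR (y^-1 * - 0).
 by apply: continuous_cvg => //; exact: continuous_expR.
by move: h2; rewrite /= mulr1n oppr0 mulr0 expR0.
Qed.

Lemma intg_sigma u : integrable (leb1 R) [set` `]-oo, u]] (EFin \o sigma).
Proof.
have msig : mfun sigma by apply: cont_mfun; exact: continuous_sigma.
pose a := Num.max u 1.
have : integrable (leb1 R) [set` `]-oo, u]] (EFin \o (\1_[set` `[0, a]] : R -> R)).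
 by apply: integrableS (integrable_indic_itv 0 a true false).
apply: le_integrable => //; first exact/EFinP/measurable_funTS.
move=> x /= xu; rewrite lee_fin ger0_norm ?sigma_ge0// indicE ger0_norm//.
have [x0|x0] := leP x 0; first by rewrite sigma_eq0.
rewrite mem_set ?sigma_le1//= in_itv /= ltW//= /a le_max; move: xu; rewrite in_itv /= => ->.
by [].
Qed.

(** A smooth substitute for the positive part, vanishing on the negative half-line; its reflection
    serves as a cutoff in time. *)
Definition Sig (y : R) := \int[leb1 R]_(t in [set` `]-oo, y]]) sigma t.

Lemma is_derive_Sig y : is_derive y (1 : R) Sig (sigma y).
Proof.
have yu : y < y + 1 by rewrite ltrDl.
have [|h1 h2] := continuous_FTC1 yu (intg_sigma (y + 1)) _ (continuous_sigma (x := y)).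
 by rewrite ltNyr.
by split; [exact: h1|rewrite -h2 derive1E].
Qed.

Definition Sig_ k := if k is k'.+1 then sigma_ k' else Sig.
Lemma chain_Sig : chain Sig_.
Proof. by case=> [|k] y /=; [exact: is_derive_Sig|exact: chain_sigma]. Qed.

Lemma Sig_eq0 y : y <= 0 -> Sig y = 0.
Proof.
move=> y0; rewrite /Sig (@eq_Rintegral _ _ _ _ _ (fun _ => 0)).
 by rewrite /Rintegral integral0.
by move=> x; rewrite inE /= in_itv /= => xy; rewrite sigma_eq0// (le_trans xy).
Qed.

End Smooth.

(** * Restricted measures and the measures of the dual group *)

Lemma integral_mrestr d (T : measurableType d) (R : realType)
  (m : {measure set T -> \bar R}) (D : set T) (mD : measurable D) (f : T -> \bar R) :
 mfun f -> (\int[mrestr m mD]_x f x = \int[m]_(x in D) f x)%E.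
Proof.
move=> mf; rewrite [RHS](eq_measure_integral (mrestr m mD)); last first.
 by move=> A mA AD; rewrite /= /mrestr (setIidl AD).
rewrite [RHS]integral_mkcond; apply: ae_eq_integral => //.
 by apply/(measurable_restrict _ mD measurableT); exact: measurable_funTS.
exists (~` D); split; first exact: measurableC.
 by rewrite /= /mrestr setICl measure0.
move=> x /= nx Dx; apply: nx => _; rewrite patchE mem_set//.
Qed.

Section Restriction.
Context d (T : measurableType d) (R : realType) (m : sfmeas T R).
Variables (D : set T) (mD : measurable D).

(** Restricting the measure instead of the domain of integration lets every lemma be stated on
    [setT]. The copy carries the sigma-finite structure. *)
Definition rmeas := mrestr m mD.

HB.instance Definition _ := Measure.on rmeas.

Let rmeas_sf : sigma_finite setT rmeas.
Proof.
have /sigma_finiteP[F [FT ndF Foo]] := sigma_finiteT m.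
exists F => // i; have [mF Fi] := Foo i; split => //.
apply: le_lt_trans Fi; rewrite /rmeas /mrestr; apply: le_measure; rewrite ?inE//.
exact: measurableI.
Qed.

HB.instance Definition _ := Measure_isSigmaFinite.Build _ _ _ rmeas rmeas_sf.

End Restriction.

(** The restriction of the product measure to a rectangle agrees with the product of the
    restrictions on rectangles, which determines a product measure. *)
Lemma integral_rmeas_prod d1 d2 (T1 : measurableType d1) (T2 : measurableType d2) (R : realType)
  (m1 : sfmeas T1 R) (m2 : sfmeas T2 R)
  (A : set T1) (B : set T2) (mA : measurable A) (mB : measurable B) (f : T1 * T2 -> \bar R) :
 mfun f -> (\int[m1 \x m2]_(x in A `*` B) f x = \int[pm (rmeas m1 mA) (rmeas m2 mB)]_x f x)%E.
Proof.
move=> mf; rewrite -(integral_mrestr _ (measurableX mA mB))//.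
pose m' : {measure set (T1 * T2)%type -> \bar R} := mrestr (m1 \x m2)%E (measurableX mA mB).
apply: eq_measure_integral => C mC _; apply/esym.
apply: (@product_measure_unique _ _ _ _ R (rmeas m1 mA) (rmeas m2 mB) m') => // E F mE mF.
by rewrite /= /rmeas /mrestr -setXI product_measure1E//; exact: measurableI.
Qed.

Section Measures.
Context {R : realType}.
Notation RM := (measurableTypeR R).

Lemma meas_period (per : bool) : measurable (period per : set RM).
Proof.
have h : measurable ([set x : R | 0 <= x <= 2 * pi] : set RM).
 have -> : [set x : R | 0 <= x <= 2 * pi] = `[0, 2 * pi]%classic by apply/seteqP; split => x /=; rewrite in_itv.
 exact: measurable_itv.
exact: (if per as b return measurable (period b : set RM) then h else @measurableT _ RM).
Qed.

(** The order is 0, -1, 1, -2, 2, ...: the first [N.*2.+1] values are the integers of modulus at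
    most [N], so symmetric partial sums are partial sums of the series. *)
Definition zenum (k : nat) : int := if odd k then Negz k./2 else Posz k./2.

Lemma zenum_inj : injective zenum.
Proof.
move=> i j; rewrite /zenum; have := odd_double_half i; have := odd_double_half j.
by case: (odd i); case: (odd j) => // hj hi [e]; rewrite -hi -hj e.
Qed.

Lemma zenum_bij : set_bij [set: nat] [set: int] zenum.
Proof.
split=> //.
 by move=> i j _ _; exact: zenum_inj.
move=> [n|n] _ /=.
 by exists n.*2 => //; rewrite /zenum odd_double doubleK.
by exists n.*2.+1 => //; rewrite /zenum /= odd_double /= uphalf_double.
Qed.

(** Counting measure of the integers, placed on the real line so that both kinds of dual factor live
    on one measurable type. *)
Definition zmeas : set RM -> \bar R := mseries (fun k => \d_((zenum k)%:~R : RM)) 0.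

HB.instance Definition _ := Measure.on zmeas.

Lemma integral_zmeas_series (f : RM -> \bar R) : mfun f -> (forall x, 0 <= f x)%E ->
 (\int[zmeas]_x f x = \sum_(k <oo) f (zenum k)%:~R)%E.
Proof.
move=> mf f0; rewrite ge0_integral_measure_series//.
by apply: eq_eseriesr => k _; rewrite integral_dirac// diracT mul1e.
Qed.

Lemma integral_zmeas (f : RM -> \bar R) : mfun f -> (forall x, 0 <= f x)%E ->
 (\int[zmeas]_x f x = \esum_(n in [set: int]) f n%:~R)%E.
Proof.
move=> mf f0; rewrite integral_zmeas_series//.
rewrite (reindex_esum [set: nat] [set: int] zenum)//; last exact: zenum_bij.
by rewrite -nneseries_esumT.
Qed.

Let zmeas_sf : sigma_finite setT zmeas.
Proof.
(* [F n] drops the integers enumerated after index [n], so it carries at most [n.+1] atoms. *)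
pose F n : set RM := ~` \bigcup_(k in [set k | (n < k)%N]) [set (zenum k)%:~R : RM].
exists F.
 apply/seteqP; split => // x _.
 have [[k xk]|nx] := pselect (exists k, x = (zenum k)%:~R).
  exists k => // -[j /= kj]; rewrite xk => /intr_inj/zenum_inj kj'.
  by move: kj; rewrite kj' ltnn.
 exists 0%N => // -[j _ /= xj]; apply: nx; by exists j.
move=> n; split.
 by apply: measurableC; apply: bigcup_measurable => k _; exact: measurable_set1.
rewrite /zmeas /mseries /=; apply: (@le_lt_trans _ _ (n.+1%:R)%:E); last exact: ltry.
apply: lime_le; first by apply: is_cvg_nneseries => k _ _; exact: measure_ge0.
apply: nearW => N; apply: (@le_trans _ _ (\sum_(0 <= k < N) (k <= n)%:R%:E)%E).
 apply: lee_sum => k _; rewrite diracE lee_fin ler_nat.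
 case: (leqP k n) => [_|nk]; first exact: leq_b1.
 by rewrite memNset//= => h; apply: h; exists k.
rewrite sumEFin lee_fin -natr_sum ler_nat.
suff -> : (\sum_(0 <= i < N) (i <= n) = minn N n.+1)%N by exact: geq_minr.
elim: N => [|N ih]; first by rewrite big_nil min0n.
by rewrite big_nat_recr//= ih; case: (leqP N n) => h; rewrite /minn; case: ifP; case: ifP; lia.
Qed.

HB.instance Definition _ := Measure_isSigmaFinite.Build _ _ _ zmeas zmeas_sf.

Definition mu1 (per : bool) : sfmeas RM R :=
 if per then [the (sfmeas RM R) of zmeas] else [the (sfmeas RM R) of @lebesgue_measure R].

Lemma dual_int1E per (f : RM -> \bar R) : mfun f -> (forall x, 0 <= f x)%E ->
 dual_int1 per f = (\int[mu1 per]_x f x)%E.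
Proof. by move=> mf f0; case: per => //=; rewrite integral_zmeas. Qed.

Notation nu1 per := (rmeas (@lebesgue_measure R) (meas_period per)).
Notation mu2 Omega := (pm (mu1 (per1 Omega)) (mu1 (per2 Omega))).
Notation nu2 Omega := (pm (nu1 (per1 Omega)) (nu1 (per2 Omega))).

Lemma dual_intE Omega (f : R * R -> \bar R) : mfun (f : RM * RM -> _) ->
 (forall x, 0 <= f x)%E -> dual_int Omega f = (\int[mu2 Omega]_x f x)%E.
Proof.
move=> mf f0; rewrite fubini_tonelli1// /dual_int.
have e k1 : dual_int1 (per2 Omega) (fun k2 => f (k1, k2)) = (\int[mu1 (per2 Omega)]_y f (k1, y))%E.
 by rewrite dual_int1E//; apply: mfcomp mf _; exact: measurable_pair1.
rewrite (_ : (fun k1 => _) = (fun k1 => \int[mu1 (per2 Omega)]_y f (k1, y))%E); last exact/funext.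
rewrite dual_int1E//; first exact: measurable_fun_fubini_tonelli_F.
by move=> x; exact: integral_ge0.
Qed.

Lemma meas_cell Omega : measurable (cell Omega : set (RM * RM)).
Proof. by apply: measurableX; exact: meas_period. Qed.

Lemma cell_int Omega (f : R * R -> \bar R) : mfun (f : RM * RM -> _) ->
 (\int[leb2 R]_(x in cell Omega) f x = \int[nu2 Omega]_x f x)%E.
Proof. move=> mf.
have H := @integral_rmeas_prod _ _ RM RM R (@lebesgue_measure R) (@lebesgue_measure R) _ _
 (meas_period (per1 Omega)) (meas_period (per2 Omega)) f mf.
exact: H. Qed.

Lemma cell_Rint Omega (f : R * R -> R) : mfun (f : RM * RM -> _) ->
 \int[leb2 R]_(x in cell Omega) f x = \int[nu2 Omega]_x f x.
Proof. by move=> mf; rewrite /Rintegral cell_int//; exact/EFinP. Qed.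

(** Membership in the dual group. For a circle it holds only almost everywhere for [mu1], which is
    why group invariance is later an almost-everywhere statement. *)
Definition dualpt (per : bool) (a : R) := per -> exists n : int, a = n%:~R.

Lemma ae_dualpt per : {ae mu1 per, forall a, dualpt per a}.
Proof.
case: per; last by apply: aeW => x.
exists (~` \bigcup_k [set (zenum k)%:~R : RM]); split.
- by apply: measurableC; apply: bigcup_measurable => k _; exact: measurable_set1.
- rewrite /= /zmeas /mseries; apply: eseries0 => k _ _; rewrite /= diracE memNset//= => h; apply: h; by exists k.
- move=> x /= h [k _ xk]; apply: h => _; by exists (zenum k).
Qed.

(** Reflection and translation in a single map. Together with the exchange of two variables it is
    the source of every change of frequency variables below. *)
Lemma int_reflect (per : bool) a (f : R -> \bar R) : dualpt per a -> mfun (f : RM -> _) -> (forall x, 0 <= f x)%E ->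
 (\int[mu1 per]_x f (- a - x)%R = \int[mu1 per]_x f x)%E.
Proof.
move=> da mf f0.
have mr : mfun (fun x : RM => - a - x : RM).
 by apply: mfunB => //; exact: mfun_cst.
case: per da => /=.
 move=> /(_ isT)[n an]; subst a; rewrite !integral_zmeas//; last exact: mfcomp mf mr.
 rewrite (reindex_esum [set: int] [set: int] (fun m => - n - m)).
  by apply: eq_esum => m _; rewrite -mulrNz -intrB opprB addrC subrK.
 split=> //; first by move=> i j _ _ /addrI/oppr_inj.
 by move=> m _; exists (- n - m) => //; rewrite opprB addrC subrK.
move=> _.
(* Lebesgue measure is characterised by its values on half-open intervals; the map reverses which
   end is open, and this does not change the length. *)
have e A : measurable A -> (@lebesgue_measure R) A = pushforward (@lebesgue_measure R) (fun x : RM => - a - x : RM) A.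
 apply: lebesgue_measure_unique => _ [[u v] _ <-]; rewrite /= /pushforward.
 rewrite (_ : _ @^-1` _ = `[- a - v, - a - u[%classic); last first.
  by apply/seteqP; split => x /=; rewrite !in_itv /= => /andP[? ?]; apply/andP; split; lra.
 rewrite !lebesgue_measure_itv /= !lte_fin.
 have -> : (- a - v < - a - u) = (u < v) by apply/idP/idP; lra.
 case: ifP => // _; rewrite -!EFinB; congr (_%:E); ring.
rewrite [RHS](eq_measure_integral (pushforward (@lebesgue_measure R) (fun x : RM => - a - x : RM))); last first.
 by move=> A mA _; exact: e.
by rewrite ge0_integral_pushforward.
Qed.

End Measures.

Notation nu1 per := (rmeas (@lebesgue_measure _) (meas_period per)).
Notation mu2 Omega := (pm (mu1 (per1 Omega)) (mu1 (per2 Omega))).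

(** * Symmetric approximate identities and their quadratic forms on L2 *)

Section ApproxId.
Context d (T : measurableType d) (R : realType).
Variable mu : sfmeas T R.
Variables (p : nat -> T * T -> R) (c : R).
Hypothesis mp : forall j, mfun (p j).
Hypothesis p0 : forall j z, 0 <= p j z.
Hypothesis psym : forall j x y, p j (x, y) = p j (y, x).
Hypothesis pint : forall j x, intg mu (fun y => p j (x, y)).
Hypothesis pc : forall j x, \int[mu]_y p j (x, y) <= c.
Hypothesis p1 : forall j, {ae mu, forall x, \int[mu]_y p j (x, y) = c}.
Notation mm := (pm mu mu).

Definition L2 (F : T -> R) := mfun F /\ intg mu (fun x => F x ^+ 2).

Lemma L2D F G : L2 F -> L2 G -> L2 (fun x => F x + G x).
Proof.
move=> [mF iF] [mG iG]; have mD : mfun (fun x => F x + G x) by exact: mfunD.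
split=> //; apply: (le_intg _ _ (intgD (intgZ 2 iF) (intgZ 2 iG))); first exact: mfunX.
by move=> x; rewrite ger0_norm ?sqr_ge0//; have := sqr_ge0 (F x - G x); nra.
Qed.

Lemma L2Z a F : L2 F -> L2 (fun x => a * F x).
Proof.
move=> [mF iF]; split; first by apply: mfunM.
by apply: eq_intg (intgZ (a ^+ 2) iF) => x; rewrite exprMn.
Qed.

Lemma L2B F G : L2 F -> L2 G -> L2 (fun x => F x - G x).
Proof.
move=> hF hG; have := L2D hF (L2Z (-1) hG).
by rewrite (_ : (fun x => _) = (fun x => F x - G x))//; apply/funext => x; rewrite mulN1r.
Qed.

Lemma intg_sq1p j F : L2 F -> intg mm (fun z => F z.1 ^+ 2 * p j z).
Proof.
move=> [mF iF].
have m : mfun (fun z : T * T => F z.1 ^+ 2 * p j z).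
 apply: mfunM => //; apply: mfunX.
 exact: mfcomp.
apply: ge0_intg_prod => //=.
- by move=> z; rewrite mulr_ge0// sqr_ge0.
- by move=> x; apply: intgZ.
- apply: (le_intg _ _ (intgZ c iF)); first by apply: mf_Rint2; mtac.
 move=> x; rewrite RintZ// normrM (ger0_norm (sqr_ge0 _)) mulrC ler_wpM2r ?sqr_ge0//.
 by rewrite ger0_norm ?Rint_ge0.
Qed.

Lemma intg_sq2p j F : L2 F -> intg mm (fun z => F z.2 ^+ 2 * p j z).
Proof.
move=> hF; apply: eq_intg (intg_swap (intg_sq1p j hF)) => -[x y] /=.
by rewrite psym.
Qed.

Lemma Rint_sq1p j F : L2 F -> \int[mm]_z (F z.1 ^+ 2 * p j z) = c * \int[mu]_x (F x ^+ 2).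
Proof.
move=> hF; have [mF iF] := hF; rewrite -(Rfubini1 (intg_sq1p j hF)) -RintZ//.
apply: ae_Rint.
- by apply: mf_Rint2 => /=; mtac.
- by apply: mfunM => //; exact: mfunX.
- by apply: filterS (p1 j) => x /= e; rewrite RintZ// e mulrC.
Qed.

Lemma Rint_sq2p j F : L2 F -> \int[mm]_z (F z.2 ^+ 2 * p j z) = c * \int[mu]_x (F x ^+ 2).
Proof.
move=> hF; rewrite -(Rint_sq1p j hF) -(Rfubini2 (intg_sq2p j hF)) -(Rfubini1 (intg_sq1p j hF)).
by apply: eq_Rint => y; apply: eq_Rint => x /=; rewrite psym.
Qed.

(** [Ep] is the quadratic form of the kernel, [Dp] the mean square increment. By [DpE], [Ep j F]
    tends to [c] times the squared norm exactly when [Dp j F] tends to 0, and the second form of the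
    property passes to sums and limits. *)
Definition Ep j (F : T -> R) := \int[mm]_z (F z.1 * F z.2 * p j z).
Definition Dp j (F : T -> R) := \int[mm]_z ((F z.1 - F z.2) ^+ 2 * p j z).

Lemma intg_Ep j F : L2 F -> intg mm (fun z => F z.1 * F z.2 * p j z).
Proof.
move=> hF; have [mF _] := hF.
have := intgD (intg_sq1p j hF) (intg_sq2p j hF); apply: le_intg.
 by apply: mfunM => //; apply: mfunM; exact: mfcomp.
move=> z; rewrite normrM (ger0_norm (p0 _ _)) -mulrDl ler_wpM2r//.
rewrite ler_norml; have := sqr_ge0 (F z.1 - F z.2); have := sqr_ge0 (F z.1 + F z.2); nra.
Qed.

Lemma intg_Dp j F : L2 F -> intg mm (fun z => (F z.1 - F z.2) ^+ 2 * p j z).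
Proof.
move=> hF; have := intgB (intgD (intg_sq1p j hF) (intg_sq2p j hF)) (intgZ 2 (intg_Ep j hF)).
by apply: eq_intg => z; ring.
Qed.

Lemma Dp_ge0 j F : 0 <= Dp j F.
Proof. by apply: Rint_ge0 => z; rewrite mulr_ge0// sqr_ge0. Qed.

Lemma DpE j F : L2 F -> Dp j F = 2 * (c * \int[mu]_x (F x ^+ 2) - Ep j F).
Proof.
move=> hF.
transitivity (\int[mm]_z (F z.1 ^+ 2 * p j z + F z.2 ^+ 2 * p j z - 2 * (F z.1 * F z.2 * p j z))).
 by apply: eq_Rint => z; ring.
rewrite RintB; [|exact: intgD (intg_sq1p _ hF) (intg_sq2p _ hF)|exact: intgZ (intg_Ep j hF)].
rewrite RintD; [|exact: intg_sq1p|exact: intg_sq2p].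
rewrite RintZ ?Rint_sq1p ?Rint_sq2p//; last exact: intg_Ep.
by rewrite /Ep; ring.
Qed.

Lemma Ep_le j F : L2 F -> Ep j F <= c * \int[mu]_x (F x ^+ 2).
Proof. by move=> hF; have := Dp_ge0 j F; rewrite DpE//; lra. Qed.

Lemma Dp_le4 j F : L2 F -> Dp j F <= 4 * (c * \int[mu]_x (F x ^+ 2)).
Proof.
move=> hF; have i1 := intg_sq1p j hF; have i2 := intg_sq2p j hF.
apply: (@le_trans _ _ (\int[mm]_z (2 * (F z.1 ^+ 2 * p j z) + 2 * (F z.2 ^+ 2 * p j z)))).
 apply: le_Rint; [exact: intg_Dp|by apply: intgD; exact: intgZ|].
 move=> z; rewrite !mulrA -mulrDl ler_wpM2r//.
 by have := sqr_ge0 (F z.1 + F z.2); nra.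
rewrite RintD; [|exact: intgZ|exact: intgZ]; rewrite !RintZ// Rint_sq1p// Rint_sq2p//; lra.
Qed.

Lemma DpD j F G : L2 F -> L2 G -> Dp j (fun x => F x + G x) <= 2 * Dp j F + 2 * Dp j G.
Proof.
move=> hF hG; rewrite /Dp -!RintZ; [|exact: intg_Dp|exact: intg_Dp].
rewrite -RintD; [|exact/intgZ/intg_Dp|exact/intgZ/intg_Dp].
apply: le_Rint; [exact: intg_Dp (L2D hF hG)|by apply: intgD; exact/intgZ/intg_Dp|].
move=> z; rewrite !mulrA -mulrDl ler_wpM2r//.
have := sqr_ge0 ((F z.1 - F z.2) - (G z.1 - G z.2)); nra.
Qed.

Definition good F := L2 F /\ Dp j F @[j --> \oo] --> 0.

Lemma goodP F : L2 F -> Ep j F @[j --> \oo] --> c * \int[mu]_x (F x ^+ 2) -> good F.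
Proof.
move=> hF h; split=> //; rewrite (_ : Dp ^~ F = fun j => 2 * (c * \int[mu]_x (F x ^+ 2) - Ep j F)).
 rewrite -[X in _ --> X](mulr0 2); apply: cvgM; first exact: cvg_cst.
 by rewrite -[X in _ --> X](subrr (c * \int[mu]_x (F x ^+ 2))); apply: cvgB => //; exact: cvg_cst.
by apply/funext => j; rewrite DpE.
Qed.

Lemma good_Ep F : good F -> Ep j F @[j --> \oo] --> c * \int[mu]_x (F x ^+ 2).
Proof.
move=> [hF h]; rewrite (_ : Ep ^~ F = fun j => c * \int[mu]_x (F x ^+ 2) - 2^-1 * Dp j F).
 rewrite -[X in _ --> X]subr0; apply: cvgB; first exact: cvg_cst.
 by rewrite -[X in _ --> X](mulr0 2^-1); apply: cvgM => //; exact: cvg_cst.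
by apply/funext => j; rewrite DpE//; field.
Qed.

Lemma goodD F G : good F -> good G -> good (fun x => F x + G x).
Proof.
move=> [hF dF] [hG dG]; split; first exact: L2D.
apply: (@squeeze_cvgr _ _ _ _ (cst 0) (fun j => 2 * Dp j F + 2 * Dp j G)).
- by apply: nearW => j; rewrite Dp_ge0 DpD.
- exact: cvg_cst.
- rewrite -[X in _ --> X](addr0 0) -[X in _ --> X + X](mulr0 2).
 by apply: cvgD; apply: cvgM => //; exact: cvg_cst.
Qed.

Lemma goodZ a F : good F -> good (fun x => a * F x).
Proof.
move=> [hF dF]; split; first exact: L2Z.
rewrite (_ : (fun j => _) = (fun j => a ^+ 2 * Dp j F)).
 by rewrite -[X in _ --> X](mulr0 (a ^+ 2)); apply: cvgM => //; exact: cvg_cst.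
apply/funext => j; rewrite /Dp -RintZ; last exact: intg_Dp.
by apply: eq_Rint => z; ring.
Qed.

Lemma goodB F G : good F -> good G -> good (fun x => F x - G x).
Proof.
move=> hF hG; have := goodD hF (goodZ (-1) hG).
by congr good; apply/funext => x; rewrite mulN1r.
Qed.

(** [Dp j] is bounded by four times [c] times the squared norm, uniformly in [j], so the property is
    closed in [L2]. *)
Lemma good_lim F (G : nat -> T -> R) : L2 F -> (forall n, good (G n)) ->
 \int[mu]_x ((F x - G n x) ^+ 2) @[n --> \oo] --> 0 -> good F.
Proof.
move=> hF hG h; split=> //; apply/cvgrPdist_le => e e0.
have c0 : 0 <= `|c| + 1 by rewrite addr_ge0.
(* The budget is [2 * (e / 4) + 2 * 4 * (e / 16) = e]; the [+ 1] guards against [c = 0]. *)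
have [N hN] : exists N, \int[mu]_x ((F x - G N x) ^+ 2) <= e / (16 * (`|c| + 1)).
 have /cvgrPdist_le/(_ (e / (16 * (`|c| + 1)))) := h.
 case; first by rewrite divr_gt0// mulr_gt0// ltr_wpDl.
 move=> N _ /(_ N (leqnn N)) /=; rewrite sub0r normrN ger0_norm ?Rint_ge0//.
  by move=> ?; exists N.
 by move=> x; exact: sqr_ge0.
have [hGN /cvgrPdist_le/(_ (e / 4))] := hG N.
case; first by rewrite divr_gt0.
move=> M _ hM; exists M => // j /= Mj; have /= := hM j Mj.
rewrite !sub0r !normrN !ger0_norm ?Dp_ge0// => hj.
have -> : F = fun x => G N x + (F x - G N x) by apply/funext => x; rewrite addrC subrK.
have hFG := L2B hF hGN.
apply: le_trans (DpD j hGN hFG) _.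
have h4 := Dp_le4 j hFG.
have : c * \int[mu]_x ((F x - G N x) ^+ 2) <= e / 16.
 apply: (@le_trans _ _ ((`|c| + 1) * (e / (16 * (`|c| + 1))))).
  apply: (@le_trans _ _ ((`|c| + 1) * \int[mu]_x ((F x - G N x) ^+ 2))).
   apply: ler_wpM2r; first by apply: Rint_ge0 => x; exact: sqr_ge0.
   by rewrite (le_trans (ler_norm c))// lerDl.
  by rewrite ler_wpM2l.
 apply: eq_ler; field.
 by rewrite gt_eqF// ltr_wpDl.
move: h4; lra.
Qed.

Section Dynkin.
Variables (G : set (set T)) (Q : nat -> set T).
Hypothesis GE : @measurable _ T = <<s G >>.
Hypothesis GI : setI_closed G.
Hypothesis mQ : forall n, measurable (Q n).
Hypothesis iQ : forall n, intg mu (\1_(Q n) : T -> R).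
Hypothesis ndQ : forall x, \forall n \near \oo, Q n x.
Hypothesis QT : forall n, good (\1_(Q n)).
Hypothesis GQ : forall n A, G A -> good (\1_(A `&` Q n)).

(** Dynkin's theorem inside the set [Q n] of finite measure: complements become differences there,
    and countable disjoint unions are [L2] limits by dominated convergence. *)
Let goodQ n A : measurable A -> good (\1_(A `&` Q n)).
Proof.
rewrite GE; move: A; apply: (dynkin_induction (G := G)) => //.
- by rewrite setTI.
- by move=> A; exact: GQ.
- move=> S mS gS; have := goodB (QT n) gS.
 congr good; apply/funext => x; rewrite !indicE !in_setI in_setC.
 by case: (x \in S); case: (x \in Q n); rewrite /= ?subrr ?subr0.
- move=> F mF tF gF.
 have mU : measurable (\bigcup_k F k) by exact: bigcupT_measurable.
 pose Gn N x : R := \sum_(k < N) \1_(F k `&` Q n) x.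
 have gG N : good (Gn N).
  elim: N => [|N ih].
   have := goodZ 0 (QT n); congr good; apply/funext => x.
   by rewrite /Gn big_ord0 mul0r.
  have := goodD ih (gF N); congr good; apply/funext => x.
  by rewrite /Gn big_ord_recr.
 have GnE N x : Gn N x = \1_((\bigcup_(k in [set k | (k < N)%N]) F k) `&` Q n) x.
  rewrite /Gn !indicE in_setI.
  have [[k /= kN Fk]|nF] := pselect (exists2 k, (k < N)%N & F k x).
   rewrite (bigD1 (Ordinal kN))//= big1 ?addr0.
    rewrite indicE in_setI mem_set// [in RHS]mem_set//; by exists k.
   move=> i ik; rewrite indicE memNset//= => -[Fi _].
   move/eqP: ik; apply; apply/val_inj => /=.
   by apply: (tF i k) => //; exists x.
  rewrite big1.
   by rewrite [in RHS]memNset// => -[k /= kN Fk]; apply: nF; exists k.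
  by move=> i _; rewrite indicE memNset// => -[Fi _]; apply: nF; exists (nat_of_ord i) => //=; exact: ltn_ord.
 apply: (good_lim _ gG).
  split; first by apply: mf_indic; exact: measurableI.
  apply: le_intg (iQ n); first by apply: mfunX; apply: mf_indic; exact: measurableI.
  move=> x; rewrite !indicE in_setI; case: (_ \in _) => /=; case: (_ \in _) => /=;
  by rewrite ?expr1n ?expr0n ?normr1 ?normr0.
 have [] := @Rint_dct _ _ _ mu (fun N x => (\1_((\bigcup_k F k) `&` Q n) x - Gn N x) ^+ 2) (fun=> 0) (\1_(Q n)).
 - move=> N; apply: mfunX; apply: mfunB.
   by apply: mf_indic; exact: measurableI.
  by have [[]] := gG N.
 - exact: mfun_cst.
 - exact: iQ.
 - move=> N x; rewrite GnE !indicE !in_setI.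
  have [Qx|] := boolP (x \in Q n); last by rewrite !andbF subr0 expr0n normr0.
  by rewrite !andbT; case: (_ \in _); case: (_ \in _); rewrite /= ?subrr ?subr0 ?sub0r ?sqrrN ?expr1n ?expr0n ?normr1 ?normr0.
 - apply: aeW => x; have [[k _ Fk]|nF] := pselect ((\bigcup_k F k) x).
   rewrite -(cvg_shiftn k.+1); apply: cvg_near_cst; apply: nearW => N.
   rewrite /= GnE !indicE !in_setI (mem_set (A := \bigcup_k F k)); last by exists k.
   rewrite (mem_set (A := \bigcup_(k in _) F k)) ?subrr ?expr0n//.
   by exists k => //=; rewrite addnS ltnS leq_addl.
  apply: cvg_near_cst; apply: nearW => N.
  rewrite /= GnE !indicE !in_setI (memNset (A := \bigcup_k F k))// (memNset (A := \bigcup_(k in _) F k)) ?subrr ?expr0n//.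
  by move=> [k _ Fk]; apply: nF; exists k.
 - by move=> _; rewrite Rint0.
Qed.

Lemma good_indic A : measurable A -> intg mu (\1_A : T -> R) -> good (\1_A).
Proof.
move=> mA iA; apply: (@good_lim _ (fun n => \1_(A `&` Q n))) => //.
- split; first exact: mf_indic.
 by apply: eq_intg iA => x; rewrite indicE; case: (_ \in _); rewrite ?expr1n ?expr0n.
- by move=> n; exact: goodQ.
- have [] := @Rint_dct _ _ _ mu (fun n x => (\1_A x - \1_(A `&` Q n) x) ^+ 2) (fun=> 0) (\1_A).
 + move=> N; apply: mfunX; apply: mfunB; apply: mf_indic => //.
  exact: measurableI.
 + exact: mfun_cst.
 + exact: iA.
 + move=> N x; rewrite !indicE !in_setI.
  by case: (_ \in _); case: (_ \in _); rewrite /= ?subrr ?subr0 ?sub0r ?sqrrN ?expr1n ?expr0n ?normr1 ?normr0.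
 + apply: aeW => x; apply: cvg_near_cst; apply: filterS (ndQ x) => n Qx.
  by rewrite !indicE !in_setI (mem_set Qx) andbT subrr expr0n.
 + by move=> _; rewrite Rint0.
Qed.

Import HBNNSimple.

(** The standard simple approximations increase to [F], and their squared distance to [F] is
    dominated by [F ^+ 2]. *)
Let good_nonneg F : L2 F -> (forall x, 0 <= F x) -> good F.
Proof.
move=> hF F0; have [mF iF] := hF.
have meF : mfun (EFin \o F) by exact/EFinP.
pose g := nnsfun_approx measurableT meF.
have gc x : g n x @[n --> \oo] --> F x.
 have h : (EFin \o g^~ x) @ \oo --> (F x)%:E.
  by apply: (cvg_nnsfun_approx measurableT meF) => // y _; rewrite lee_fin.
 by have /fine_cvgP[_] := h.
have gF n x : 0 <= g n x <= F x.
 rewrite fun_ge0/= -(cvg_lim _ (gc x))//; apply: nondecreasing_cvgn_le; last by apply/cvg_ex; exists (F x).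
 by move=> a b ab; exact/lefP/nd_nnsfun_approx.
have mg n : mfun (g n) by [].
apply: (@good_lim _ (fun n => g n)) => //.
- move=> n.
 have -> : (g n : T -> R) = fun x => \sum_(y \in range (g n)) (y * \1_(g n @^-1` [set y]) x).
  by apply/funext => x; rewrite -fimfunE.
 have ff : finite_set (range (g n)) by [].
 under eq_fun do rewrite fsbig_finite//=.
 elim: (finmap.enum_fset _) => [|y s ih].
  have := goodZ 0 (QT 0%N); congr good; apply/funext => x.
  by rewrite big_nil mul0r.
 under eq_fun do rewrite big_cons.
 apply: goodD => //.
 have my : measurable (g n @^-1` [set y]) by [].
 have [->|y0] := eqVneq y 0.
  by have := goodZ 0 (QT 0%N); congr good; apply/funext => x; rewrite !mul0r.
 apply: goodZ; apply: good_indic => //.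
 (* Chebyshev: since [g n <= F], a level set with nonzero value has finite measure. *)
 apply: (le_intg _ _ (intgZ (y ^- 2) iF)); first exact: mf_indic.
 move=> x; rewrite indicE.
 have [|_] := boolP (x \in g n @^-1` [set y]); last by rewrite normr0 mulr_ge0 ?sqr_ge0// invr_ge0 sqr_ge0.
 rewrite inE /= => gy; rewrite normr1 mulrC ler_pdivlMr; last by rewrite exprn_even_gt0.
 have /andP[h1 h2] := gF n x; rewrite mul1r -gy ler_sqr ?nnegrE//.
- have [] := @Rint_dct _ _ _ mu (fun n x => (F x - g n x) ^+ 2) (fun=> 0) (fun x => F x ^+ 2).
 + by move=> n; apply: mfunX; exact: mfunB.
 + exact: mfun_cst.
 + exact: iF.
 + move=> n x; have /andP[h1 h2] := gF n x; rewrite ger0_norm ?sqr_ge0//.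
  by rewrite ler_sqr ?nnegrE ?subr_ge0// lerBlDr lerDl.
 + apply: aeW => x.
  have h : F x - g n x @[n --> \oo] --> F x - F x by apply: cvgB => //; exact: cvg_cst.
  by have := cvg_sq h; rewrite subrr expr0n.
 + by move=> _; rewrite Rint0.
Qed.

Lemma good_L2 F : L2 F -> good F.
Proof.
move=> hF; have [mF iF] := hF.
have h (a : T -> R) : mfun a -> (forall x, `|a x| <= `|F x|) -> L2 a.
 move=> ma aF; split=> //; apply: le_intg iF; first exact: mfunX.
 by move=> x; rewrite normrX -[leRHS]real_normK ?num_real// ler_sqr ?nnegrE.
have mm1 : mfun (fun x => Num.max (F x) 0) by exact: measurable_maxr.
have mm2 : mfun (fun x => Num.max (- F x) 0) by apply: measurable_maxr => //; exact: mfcomp.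
have h1 : good (fun x => Num.max (F x) 0).
 apply: good_nonneg => [|x]; last by rewrite le_max lexx orbT.
 by apply: h => // x; rewrite maxEle; case: ifP => _; rewrite ?normr0.
have h2 : good (fun x => Num.max (- F x) 0).
 apply: good_nonneg => [|x]; last by rewrite le_max lexx orbT.
 by apply: h => // x; rewrite maxEle; case: ifP => _; rewrite ?normr0 ?normrN.
have := goodB h1 h2; congr good; apply/funext => x.
by rewrite !maxEle; case: ifP; case: ifP; lra.
Qed.

End Dynkin.

End ApproxId.

(** * Plancherel's theorem for the Hartley transform *)

Section Plancherel.
Context {R : realType}.
Notation RM := (measurableTypeR R).

Definition cas (y : R) := cos y + sin y.
Lemma mf_cos : mfun (@cos R).
Proof. by apply: cont_mfun; exact: continuous_cos. Qed.
Lemma mf_sin : mfun (@sin R).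
Proof. by apply: cont_mfun; exact: continuous_sin. Qed.
Lemma mf_cas : mfun cas.
Proof. by apply: mfunD; [exact: mf_cos|exact: mf_sin]. Qed.

Lemma norm_cas y : `|cas y| <= 2.
Proof.
apply: le_trans (ler_normD _ _) _; rewrite (_ : 2 = 1 + 1)// lerD//.
 by rewrite ler_norml cos_geN1 cos_le1.
by rewrite ler_norml sin_geN1 sin_le1.
Qed.

Lemma casM a b : cas a * cas b = cos (a - b) + sin (a + b).
Proof. rewrite /cas cosB sinD; ring. Qed.

(** A one-dimensional dual pair, with position measure [n] and frequency measure [m]. The weights
    [w j] are summability factors, [p j] is the kernel that they produce, and the fields say that it
    is a symmetric approximate identity of mass [2 * pi]. The kernel identities are required only on
    the full-measure set [S], which allows positions in a period or on the integers. *)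
Record dual1 (n m : sfmeas RM R) (S : R -> Prop) (w : nat -> R -> R) (p : nat -> R * R -> R) : Prop := Dual1 {
 aeS : {ae n, forall x, S x}; w01 : forall j k, 0 <= w j k <= 1; w1 : forall k, w j k @[j --> \oo] --> (1 : R);
 iw : forall j, intg m (w j); kcos : forall j x y, S x -> S y -> \int[m]_k (w j k * cos (k * (x - y))) = p j (x, y);
 ksinB : forall j x y, S x -> S y -> \int[m]_k (w j k * sin (k * (x - y))) = 0;
 ksinD : forall j x y, S x -> S y -> \int[m]_k (w j k * sin (k * (x + y))) = 0;
 mp : forall j, mfun (p j : RM * RM -> R); p0 : forall j z, 0 <= p j z; psym : forall j x y, p j (x, y) = p j (y, x);
 pint : forall j x, intg n (fun y => p j (x, y)); pc : forall j x, \int[n]_y p j (x, y) <= 2 * pi;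
 p1 : forall j, {ae n, forall x, \int[n]_y p j (x, y) = 2 * pi}; iI : forall a b, intg n (\1_(`]a, b]) : RM -> R);
 tail : forall a b, {ae n, forall x, a < x <= b ->
  \int[n]_y (\1_(~` `]a, b]) y * p j (x, y)) @[j --> \oo] --> (0 : R)} }.

Lemma indic_sq (T : Type) (A : set T) x : (\1_A x : R) ^+ 2 = \1_A x.
Proof. by rewrite indicE; case: (_ \in _); rewrite ?expr1n ?expr0n. Qed.

Lemma L2_indic d (T : measurableType d) (mu : sfmeas T R) (A : set T) :
 measurable A -> intg mu (\1_A : T -> R) -> L2 mu (\1_A).
Proof.
move=> mA iA; split; first exact: mf_indic.
by apply: eq_intg iA => x; rewrite indic_sq.
Qed.

Lemma ae_prod d1 d2 (T1 : measurableType d1) (T2 : measurableType d2) (m1 : sfmeas T1 R) (m2 : sfmeas T2 R)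
  (P : T1 -> Prop) (Q : T2 -> Prop) :
 {ae m1, forall x, P x} -> {ae m2, forall y, Q y} -> {ae (pm m1 m2), forall z, P z.1 /\ Q z.2}.
Proof.
move=> [A [mA A0 hA]] [B [mB B0 hB]].
exists ((A `*` setT) `|` (setT `*` B)); split.
- by apply: measurableU; apply: measurableX.
- apply: null_set_setU; [exact: measurableX|exact: measurableX|..].
 + transitivity (m1 A * m2 setT)%E; [exact: product_measure1E|by rewrite [X in (X * _)%E]A0 mul0e].
 + transitivity (m1 setT * m2 B)%E; [exact: product_measure1E|by rewrite [X in (_ * X)%E]B0 mule0].
- move=> [x y] /= h; have [Px|nP] := pselect (P x).
  by right; split => //; apply: hB => Qy; apply: h.
 by left; split => //; exact: hA.
Qed.

Section OneD.
Variables (n m : sfmeas RM R) (S : R -> Prop) (w : nat -> R -> R) (p : nat -> R * R -> R).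
Hypothesis D : dual1 n m S w p.

(** For almost every [x] in the interval the kernel loses no mass outside it in the limit, so the
    inner integral tends to [2 * pi]; dominated convergence does the rest. *)
Lemma good_itv a b : good n p (\1_(`]a, b]) : RM -> R).
Proof.
have mI : measurable (`]a, b]%classic : set RM) := measurable_itv _.
have L := L2_indic mI (iI D a b).
apply: (goodP (mp D) (p0 D) (psym D) (pint D) (pc D) (p1 D) L).
pose I1 : RM -> R := \1_(`]a, b]%classic); pose J1 : RM -> R := \1_(~` `]a, b]%classic).
have mI1 : mfun I1 by exact: mf_indic.
have mJ1 : mfun J1 by apply: mf_indic; exact: measurableC.
have J01 x : 0 <= J1 x <= 1 by rewrite /J1 indicE; case: (_ \in _); rewrite ?lexx ?ler01.
have E j : Ep n p j I1 = \int[n]_x (I1 x * (\int[n]_y p j (x, y) - \int[n]_y (J1 y * p j (x, y)))).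
 rewrite /Ep -(Rfubini1 (intg_Ep (mp D) (p0 D) (psym D) (pint D) (pc D) j L)).
 apply: eq_Rint => x /=.
 have i2 : intg n (fun y => J1 y * p j (x, y)).
  apply: le_intg (pint D j x).
   by apply: mfunM => //; exact: intg_mf (pint D j x).
  by move=> y; have /andP[? ?] := J01 y; rewrite normrM (ger0_norm (p0 D _ _)) ger0_norm// ler_piMl ?(p0 D)//.
 rewrite -RintB//; last exact: (pint D).
 rewrite -RintZ; last by apply: intgB => //; exact: (pint D).
 apply: eq_Rint => y; rewrite -mulrA; congr (_ * _).
 rewrite /I1 /J1 !indicE in_setC; case: (_ \in _); rewrite /=; ring.
have mpx j : mfun (fun x : RM => \int[n]_y p j (x, y)).
 by apply: mf_Rint; exact: (mp D).
have mt j : mfun (fun x : RM => \int[n]_y (J1 y * p j (x, y))).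
 apply: mf_Rint2.
 apply: mfunM; last by have := mp D j; congr measurable_fun; apply/funext => -[].
 exact: (@mfcomp _ _ _ _ _ _ J1 _ snd).
have ti j x : intg n (fun y => J1 y * p j (x, y)).
 apply: le_intg (pint D j x).
  by apply: mfunM => //; exact: intg_mf (pint D j x).
 by move=> y; have /andP[? ?] := J01 y; rewrite normrM (ger0_norm (p0 D _ _)) ger0_norm// ler_piMl ?(p0 D)//.
have tb j x : 0 <= \int[n]_y (J1 y * p j (x, y)) <= \int[n]_y p j (x, y).
 apply/andP; split; first by apply: Rint_ge0 => y; rewrite mulr_ge0// (p0 D).
 apply: le_Rint => //; first exact: (pint D).
 by move=> y; have /andP[? ?] := J01 y; rewrite ler_piMl ?(p0 D).
rewrite (_ : Ep n p ^~ I1 = fun j => \int[n]_x (I1 x * (\int[n]_y p j (x, y) - \int[n]_y (J1 y * p j (x, y))))); last exact/funext.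
rewrite (_ : 2 * pi * _ = \int[n]_x (2 * pi * I1 x)); last first.
 rewrite RintZ; last exact: (iI D).
 by congr (_ * _); apply: eq_Rint => x; rewrite indic_sq.
have [] // := @Rint_dct _ _ _ n (fun j x => I1 x * (\int[n]_y p j (x, y) - \int[n]_y (J1 y * p j (x, y))))
 (fun x => 2 * pi * I1 x) (fun x => 2 * pi * I1 x).
- by move=> j; apply: mfunM => //; exact: mfunB.
- exact: mfunM.
- exact/intgZ/(iI D).
- move=> j x; rewrite normrM [leRHS]mulrC ger0_norm /I1 ?indicE// ler_wpM2l//.
 have /andP[h1 h2] := tb j x; rewrite ger0_norm ?subr_ge0//.
 by rewrite (le_trans _ (pc D j x))// lerBlDr lerDl.
- have h : {ae n, forall x, forall j, \int[n]_y p j (x, y) = 2 * pi}.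
  by apply: ae_foralln => j; exact: (p1 D).
 apply: (ae2 h (tail D a b)) => x h1 h2.
 under eq_fun do rewrite h1 /I1 indicE.
 rewrite /I1 indicE; case: (boolP (x \in _)) => xI.
  have xab : a < x <= b by move: xI; rewrite inE /= in_itv.
  rewrite (_ : 2 * pi * true%:R = 2 * pi - 0 :> R); last by rewrite mulr1 subr0.
  under eq_fun do rewrite mul1r.
  by apply: cvgB; [exact: cvg_cst|exact: h2].
 by rewrite mulr0; under eq_fun do rewrite mul0r; exact: cvg_cst.
Qed.

Lemma good1 (F : RM -> R) : L2 n F -> good n p F.
Proof.
apply: (good_L2 (mp D) (p0 D) (psym D) (pint D) (pc D) (p1 D) (G := @ocitv R) (Q := fun N => `](- N%:R), N%:R]%classic : set RM)).
- by [].
- exact: ocitvI.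
- by move=> N; exact: measurable_itv.
- by move=> N; exact: (iI D).
- move=> x; exists (Num.bound `|x|) => // N /= hN; rewrite in_itv /=.
 have h : `|x| < N%:R.
  by rewrite (lt_le_trans (archi_boundP (normr_ge0 x)))// ler_nat.
 by move: h; rewrite ltr_norml => /andP[-> /ltW].
- by move=> N; exact: good_itv.
- move=> N A [[a b] _ <-] /=.
 have [c [e ->]] : exists c e, `]a, b]%classic `&` `](- N%:R), N%:R]%classic = `]c, e]%classic.
  exists (Num.max a (- N%:R)), (Num.min b N%:R).
  apply/seteqP; split => x /=; rewrite !in_itv /= ?gt_max ?le_min.
   by move=> [/andP[-> ->] /andP[-> ->]].
  by move=> /andP[/andP[-> ->] /andP[-> ->]].
 exact: good_itv.
Qed.

End OneD.

Lemma RintM12 d1 d2 (T1 : measurableType d1) (T2 : measurableType d2) (m1 : sfmeas T1 R) (m2 : sfmeas T2 R)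
  (g : T1 -> R) (h : T2 -> R) : intg m1 g -> intg m2 h ->
 \int[pm m1 m2]_z (g z.1 * h z.2) = \int[m1]_x g x * \int[m2]_y h y.
Proof.
move=> ig ih; rewrite -(Rfubini1 (intgM12 ig ih)) /= [RHS]mulrC -RintZ//.
by apply: eq_Rint => x; rewrite RintZ// mulrC.
Qed.

Section TwoD.
Variables (n1 m1 n2 m2 : sfmeas RM R) (S1 S2 : R -> Prop) (v1 v2 : nat -> R -> R) (q1 q2 : nat -> R * R -> R).
Hypotheses (D1 : dual1 n1 m1 S1 v1 q1) (D2 : dual1 n2 m2 S2 v2 q2).
Notation n := (pm n1 n2).
Notation m := (pm m1 m2).

Let P j (z : (RM * RM) * (RM * RM)) := q1 j (z.1.1, z.2.1) * q2 j (z.1.2, z.2.2).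
Let C : R := (2 * pi) ^+ 2.
Let W j (k : RM * RM) := v1 j k.1 * v2 j k.2.
Let mP j : mfun (P j).
Proof. have := mp D1 j; have := mp D2 j => ? ?; rewrite /P; mtac. Qed.
Let P0 j z : 0 <= P j z.
Proof. by rewrite mulr_ge0// ?(p0 D1) ?(p0 D2). Qed.
Let Psym j x y : P j (x, y) = P j (y, x).
Proof. by rewrite /P /= (psym D1) (psym D2). Qed.
Let Pint j x : intg n (fun y => P j (x, y)).
Proof. exact: (intgM12 (pint D1 j x.1) (pint D2 j x.2)). Qed.
Let PE j x : \int[n]_y P j (x, y) = \int[n1]_y q1 j (x.1, y) * \int[n2]_y q2 j (x.2, y).
Proof. exact: (RintM12 (pint D1 j x.1) (pint D2 j x.2)). Qed.

Let Pc j x : \int[n]_y P j (x, y) <= C.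
Proof.
rewrite PE /C expr2; apply: ler_pM; rewrite ?(pc D1) ?(pc D2)//.
- by apply: Rint_ge0 => y; exact: (p0 D1).
- by apply: Rint_ge0 => y; exact: (p0 D2).
Qed.

Let P1 j : {ae n, forall x, \int[n]_y P j (x, y) = C}.
Proof.
apply: filterS (ae_prod (p1 D1 j) (p1 D2 j)) => x [h1 h2].
by rewrite PE h1 h2 /C expr2.
Qed.

(** The quadratic form of a product kernel factorises on indicators of rectangles, and rectangles
    generate the product sigma-algebra. *)
Let good_prod (A B : set RM) : measurable A -> measurable B ->
 intg n1 (\1_A : RM -> R) -> intg n2 (\1_B : RM -> R) -> good n P (\1_(A `*` B)).
Proof.
move=> mA mB iA iB.
have e : (\1_(A `*` B) : RM * RM -> R) = fun x => \1_A x.1 * \1_B x.2.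
 apply/funext => x; rewrite !indicE -natrM mulnb.
 by congr (nat_of_bool _)%:R; apply/idP/andP; rewrite !inE.
have LA := L2_indic mA iA; have LB := L2_indic mB iB.
have iAB := intgM12 iA iB.
have L : L2 n (\1_(A `*` B)).
 by apply: L2_indic; [exact: measurableX|rewrite e].
apply: (goodP mP P0 Psym Pint Pc P1 L).
have i1 j x : intg n1 (fun y => \1_A y * q1 j (x, y)).
 apply: le_intg (pint D1 j x).
  by apply: mfunM; [exact: mf_indic|exact: intg_mf (pint D1 j x)].
 move=> y; rewrite normrM (ger0_norm (p0 D1 _ _)) indicE; case: (_ \in _) => /=.
  by rewrite normr1 mul1r.
 by rewrite normr0 mul0r (p0 D1).
have i2 j x : intg n2 (fun y => \1_B y * q2 j (x, y)).
 apply: le_intg (pint D2 j x).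
  by apply: mfunM; [exact: mf_indic|exact: intg_mf (pint D2 j x)].
 move=> y; rewrite normrM (ger0_norm (p0 D2 _ _)) indicE; case: (_ \in _) => /=.
  by rewrite normr1 mul1r.
 by rewrite normr0 mul0r (p0 D2).
have E j : Ep n P j (\1_(A `*` B)) = Ep n1 q1 j (\1_A) * Ep n2 q2 j (\1_B).
 rewrite /Ep -(Rfubini1 (intg_Ep mP P0 Psym Pint Pc j L)).
 have I1 := intg_Ep (mp D1) (p0 D1) (psym D1) (pint D1) (pc D1) j LA.
 have I2 := intg_Ep (mp D2) (p0 D2) (psym D2) (pint D2) (pc D2) j LB.
 rewrite -(Rfubini1 I1) -(Rfubini1 I2) -RintM12; [|exact: (intg_Rint1 I1)|exact: (intg_Rint1 I2)].
 apply: eq_Rint => x /=.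
 transitivity (\int[n]_y ((\1_A x.1 * \1_A y.1 * q1 j (x.1, y.1)) * (\1_B x.2 * \1_B y.2 * q2 j (x.2, y.2)))).
  by apply: eq_Rint => y; rewrite e /P /=; ring.
 rewrite (RintM12 (g := fun y => \1_A x.1 * \1_A y * q1 j (x.1, y)) (h := fun y => \1_B x.2 * \1_B y * q2 j (x.2, y)))//.
  by apply: eq_intg (intgZ (\1_A x.1) (i1 j x.1)) => y; rewrite mulrA.
 by apply: eq_intg (intgZ (\1_B x.2) (i2 j x.2)) => y; rewrite mulrA.
rewrite (_ : Ep n P ^~ _ = fun j => Ep n1 q1 j (\1_A) * Ep n2 q2 j (\1_B)); last exact/funext.
have -> : C * \int[n]_x (\1_(A `*` B) x ^+ 2) =
  (2 * pi * \int[n1]_x (\1_A x ^+ 2)) * (2 * pi * \int[n2]_x (\1_B x ^+ 2)).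
 rewrite (_ : \int[n]_x _ = \int[n1]_x (\1_A x ^+ 2) * \int[n2]_x (\1_B x ^+ 2)).
  by rewrite /C; ring.
 rewrite -RintM12; [|by case: LA|by case: LB].
 by apply: eq_Rint => x; rewrite e exprMn.
apply: cvgM.
- exact: (good_Ep (mp D1) (p0 D1) (psym D1) (pint D1) (pc D1) (p1 D1) (good1 D1 LA)).
- exact: (good_Ep (mp D2) (p0 D2) (psym D2) (pint D2) (pc D2) (p1 D2) (good1 D2 LB)).
Qed.

Lemma iIsub (a b : R) (A : set RM) (nn : sfmeas RM R) : measurable A ->
 intg nn (\1_(`]a, b]) : RM -> R) -> intg nn (\1_(A `&` `]a, b]) : RM -> R).
Proof.
move=> mA; apply: le_intg.
 by apply: mf_indic; apply: measurableI => //; exact: measurable_itv.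
by move=> x; rewrite !indicE in_setI; case: (_ \in A); case: (_ \in _); rewrite /= ?normr1 ?normr0.
Qed.

Lemma good2 (F : RM * RM -> R) : L2 n F -> good n P F.
Proof.
pose Q N : set RM := `](- N%:R), N%:R]%classic.
have mQ N : measurable (Q N) := measurable_itv _.
apply: (good_L2 mP P0 Psym Pint Pc P1 (G := [set A `*` B | A in measurable & B in measurable])
 (Q := fun N => Q N `*` Q N)).
- exact: measurable_prod_measurableType.
- move=> _ _ [A mA [B mB <-]] [A' mA' [B' mB' <-]]; rewrite -setXI.
 by exists (A `&` A'); [exact: measurableI|exists (B `&` B') => //; exact: measurableI].
- by move=> N; exact: measurableX.
- move=> N; have [[_ h] _] := good_prod (mQ N) (mQ N) (iI D1 _ _) (iI D2 _ _).
 by apply: eq_intg h => x; rewrite indic_sq.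
- move=> x; exists (maxn (Num.bound `|x.1|) (Num.bound `|x.2|)) => // N /=.
 rewrite geq_max => /andP[h1 h2].
 have l (y : R) : (Num.bound `|y| <= N)%N -> Q N y.
  move=> hy; have : `|y| < N%:R by rewrite (lt_le_trans (archi_boundP (normr_ge0 y)))// ler_nat.
  by rewrite ltr_norml /Q /= in_itv /= => /andP[-> /ltW].
 by split; exact: l.
- by move=> N; apply: good_prod => //; [exact: (iI D1)|exact: (iI D2)].
- move=> N _ [A mA [B mB <-]]; rewrite -setXI; apply: good_prod.
 + exact: measurableI.
 + exact: measurableI.
 + by apply: iIsub => //; exact: (iI D1).
 + by apply: iIsub => //; exact: (iI D2).
Qed.

Definition hartley (F : RM * RM -> R) (k : RM * RM) := \int[n]_x (F x * cas (dot x k)).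
Let iW j : intg m (W j).
Proof. exact: (intgM12 (iw D1 j) (iw D2 j)). Qed.

Let W01 j k : 0 <= W j k <= 1.
Proof.
have /andP[a b] := w01 D1 j k.1; have /andP[c d] := w01 D2 j k.2.
by rewrite /W mulr_ge0//= mulr_ile1.
Qed.

Lemma mf_dot : mfun (fun z : (RM * RM) * (RM * RM) => dot z.1 z.2).
Proof. by rewrite /dot; mtac. Qed.

Lemma mf_casdot :
 mfun (fun z : (RM * RM) * (RM * RM) => cas (dot z.1 z.2)).
Proof. exact: (mfcomp mf_cas mf_dot). Qed.

Lemma intg_bdd d (T : measurableType d) (mu : {measure set T -> \bar R}) (f g : T -> R) B :
 mfun g -> (forall x, `|g x| <= B) -> intg mu f -> intg mu (fun x => f x * g x).
Proof.
move=> mg gB hf; apply: le_intg (intgZ B (intg_norm hf)).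
 by apply: mfunM => //; exact: intg_mf hf.
by move=> x; rewrite normrM mulrC ler_wpM2r.
Qed.

Lemma mf_casl (k : RM * RM) : mfun (fun x : RM * RM => cas (dot x k)).
Proof. by have := mfcomp mf_casdot (measurable_pair2 k). Qed.
Lemma intg_cas (nn : {measure set (RM * RM) -> \bar R}) k f : intg nn f -> intg nn (fun x => f x * cas (dot x k)).
Proof. exact: intg_bdd (mf_casl k) (fun=> norm_cas _). Qed.
Lemma mf_casr (x : RM * RM) : mfun (fun k : RM * RM => cas (dot x k)).
Proof. by have := mfcomp mf_casdot (measurable_pair1 x). Qed.

Lemma hartley_le F k : intg n F -> `|hartley F k| <= 2 * \int[n]_x `|F x|.
Proof.
move=> iF; have i1 := intg_cas k iF.
apply: le_trans (norm_Rint i1) _; rewrite -RintZ; last exact: intg_norm.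
apply: le_Rint; [exact: intg_norm|exact/intgZ/intg_norm|].
by move=> x; rewrite normrM mulrC ler_wpM2r// norm_cas.
Qed.

Lemma mf_hartley F : mfun F -> mfun (hartley F).
Proof.
move=> mF; apply: (mf_Rint2 n (fun k x => F x * cas (dot x k))).
apply: mfunM; first by mtac.
have h : mfun (fun z : (RM * RM) * (RM * RM) => (z.2, z.1)) by mtac.
exact: (mfcomp mf_casdot h).
Qed.

(** By [casM] and the addition formulas the integrand is a sum of four products of one-dimensional
    factors. Three of them contain a sine, whose weighted integral is 0. *)
Let kernelE j x y : S1 x.1 -> S2 x.2 -> S1 y.1 -> S2 y.2 ->
 \int[m]_k (W j k * (cas (dot x k) * cas (dot y k))) = P j (x, y).
Proof.
move=> Sx1 Sx2 Sy1 Sy2.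
have B (f : R -> R) : mfun f -> (forall x, `|f x| <= 1) -> forall i (u : R),
 (i = 1%N -> intg m1 (fun k => v1 j k * f (k * u))) /\ (i = 2%N -> intg m2 (fun k => v2 j k * f (k * u))).
 move=> mf f1 i u; split=> _; apply: (intg_bdd (B := 1)) => //; try exact: (iw D1); try exact: (iw D2).
  by apply: (mfcomp mf); exact: mfunM.
 by apply: (mfcomp mf); exact: mfunM.
have c1 u : `|cos u : R| <= 1 by rewrite ler_norml cos_geN1 cos_le1.
have s1 u : `|sin u : R| <= 1 by rewrite ler_norml sin_geN1 sin_le1.
have C1 u := (B _ mf_cos c1 1%N u).1 erefl.
have C2 u := (B _ mf_cos c1 2%N u).2 erefl.
have s1' u := (B _ mf_sin s1 1%N u).1 erefl.
have s2' u := (B _ mf_sin s1 2%N u).2 erefl.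
have zero f g : intg m1 f -> intg m2 g -> \int[m1]_k f k = 0 \/ \int[m2]_k g k = 0 -> \int[m]_z (f z.1 * g z.2) = 0.
 by move=> i1 i2 [e|e]; rewrite RintM12// e ?mul0r ?mulr0.
transitivity (\int[m]_k ((v1 j k.1 * cos (k.1 * (x.1 - y.1))) * (v2 j k.2 * cos (k.2 * (x.2 - y.2)))
 - (v1 j k.1 * sin (k.1 * (x.1 - y.1))) * (v2 j k.2 * sin (k.2 * (x.2 - y.2)))
 + ((v1 j k.1 * sin (k.1 * (x.1 + y.1))) * (v2 j k.2 * cos (k.2 * (x.2 + y.2)))
 + (v1 j k.1 * cos (k.1 * (x.1 + y.1))) * (v2 j k.2 * sin (k.2 * (x.2 + y.2)))))).
 apply: eq_Rint => k; rewrite casM /W.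
 rewrite (_ : dot x k - dot y k = k.1 * (x.1 - y.1) + k.2 * (x.2 - y.2)); last by rewrite /dot; ring.
 rewrite (_ : dot x k + dot y k = k.1 * (x.1 + y.1) + k.2 * (x.2 + y.2)); last by rewrite /dot; ring.
 rewrite cosD sinD; ring.
have I1 := intgM12 (C1 (x.1 - y.1)) (C2 (x.2 - y.2)).
have I2 := intgM12 (s1' (x.1 - y.1)) (s2' (x.2 - y.2)).
have I3 := intgM12 (s1' (x.1 + y.1)) (C2 (x.2 + y.2)).
have I4 := intgM12 (C1 (x.1 + y.1)) (s2' (x.2 + y.2)).
rewrite RintD; [|exact: intgB I1 I2|exact: intgD I3 I4].
rewrite RintB// RintD//.
rewrite (zero _ _ (s1' (x.1 - y.1)) (s2' (x.2 - y.2))); last by left; exact: (ksinB D1).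
rewrite (zero _ _ (s1' (x.1 + y.1)) (C2 (x.2 + y.2))); last by left; exact: (ksinD D1).
rewrite (zero _ _ (C1 (x.1 + y.1)) (s2' (x.2 + y.2))); last by right; exact: (ksinD D2).
rewrite subr0 !addr0 (RintM12 (C1 _) (C2 _)).
by rewrite (kcos D1)// (kcos D2).
Qed.

(** The weight makes the triple integral absolutely convergent, so Fubini brings the frequency
    integral inside, where it is the kernel. *)
Let weighted F j : intg n F -> L2 n F -> \int[m]_k (hartley F k ^+ 2 * W j k) = Ep n P j F.
Proof.
move=> iF hF; have mF := intg_mf iF; have mH := mf_hartley mF.
have mcd := mf_casdot; have mW := intg_mf (iW j).
pose B := 2 * \int[n]_x `|F x|.
have swapc : mfun (fun z : (RM * RM) * (RM * RM) => cas (dot z.2 z.1)).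
 have h : mfun (fun z : (RM * RM) * (RM * RM) => (z.2, z.1)) by mtac.
 exact: (mfcomp mf_casdot h).
have J1 : intg (pm m n) (fun z => (hartley F z.1 * W j z.1) * (F z.2 * cas (dot z.2 z.1))).
 apply: le_intg (intgZ (2 * B) (intg_norm (intgM12 (iW j) iF))); first by mtac.
 move=> -[k x] /=; move: (W j k) => Wk; rewrite !normrM.
 rewrite (_ : 2 * B * _ = B * `|Wk| * (`|F x| * 2)); last by ring.
 apply: ler_pM; rewrite ?mulr_ge0 ?normr_ge0//.
  by rewrite ler_wpM2r// hartley_le.
 by rewrite ler_wpM2l// norm_cas.
transitivity (\int[m]_k \int[n]_x ((hartley F k * W j k) * (F x * cas (dot x k)))).
 apply: eq_Rint => k; rewrite RintZ; last exact: intg_bdd (mf_casl k) (fun x => norm_cas _) iF.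
 by rewrite -/(hartley F k) /=; ring.
rewrite (Rfubini J1) /Ep -(Rfubini1 (intg_Ep mP P0 Psym Pint Pc j hF)).
have aeS := ae_prod (aeS D1) (aeS D2).
apply: ae_Rint.
- apply: (mf_Rint2 m (fun x k => hartley F k * W j k * (F x * cas (dot x k)))).
 by mtac.
- by apply: mf_Rint2; have := mP j => mPj /=; mtac.
apply: (ae1 aeS) => x [Sx1 Sx2] /=.
have J2 : intg (pm m n) (fun z => (F x * cas (dot x z.1) * W j z.1) * (F z.2 * cas (dot z.2 z.1))).
 apply: le_intg (intgZ (`|F x| * 4) (intg_norm (intgM12 (iW j) iF))).
  have mcr : mfun (fun z : (RM * RM) * (RM * RM) => cas (dot x z.1)).
   exact: (mfcomp (mf_casr x) mfun_fst).
  by mtac.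
 move=> -[k y] /=; move: (W j k) => Wk; rewrite !normrM.
 rewrite (_ : `|F x| * 4 * _ = `|F x| * 2 * `|Wk| * (`|F y| * 2)); last by ring.
 apply: ler_pM; rewrite ?mulr_ge0 ?normr_ge0//.
  by rewrite ler_wpM2r// ler_wpM2l// norm_cas.
 by rewrite ler_wpM2l// norm_cas.
transitivity (\int[m]_k \int[n]_y ((F x * cas (dot x k) * W j k) * (F y * cas (dot y k)))).
 apply: eq_Rint => k; rewrite RintZ; last exact: intg_bdd (mf_casl k) (fun x => norm_cas _) iF.
 by rewrite -/(hartley F k) /=; ring.
rewrite (Rfubini J2); apply: ae_Rint.
- apply: (mf_Rint2 m (fun y k => F x * cas (dot x k) * W j k * (F y * cas (dot y k)))).
 have mcr : mfun (fun z : (RM * RM) * (RM * RM) => cas (dot x z.2)).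
  exact: (mfcomp (mf_casr x) mfun_snd).
 by mtac.
- by have := intg_mf (Pint j x) => mPx; mtac.
apply: (ae1 aeS) => y [Sy1 Sy2] /=.
rewrite -(kernelE j Sx1 Sx2 Sy1 Sy2) -RintZ.
 by apply: eq_Rint => k; ring.
apply: (intg_bdd (B := 4)) (iW j).
 by apply: mfunM; exact: mf_casr.
move=> k; rewrite normrM (_ : 4 = 2 * 2 :> R); last by ring.
by apply: ler_pM => //; exact: norm_cas.
Qed.

(** The weights stay below 1 and tend to 1. Fatou first gives square integrability of the transform;
    dominated convergence then removes the weights, while the quadratic forms converge by
    [good2]. *)
Theorem plancherel F : intg n F -> intg n (fun x => F x ^+ 2) -> intg m (fun k => hartley F k ^+ 2) /\
 \int[m]_k (hartley F k ^+ 2) = (2 * pi) ^+ 2 * \int[n]_x (F x ^+ 2).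
Proof.
move=> iF iF2; have mF := intg_mf iF; have hF : L2 n F by [].
have mH := mf_hartley mF.
have iHW j : intg m (fun k => hartley F k ^+ 2 * W j k).
 apply: le_intg (intgZ ((2 * \int[n]_x `|F x|) ^+ 2) (iW j)).
  by have := intg_mf (iW j) => mW; mtac.
 move=> k; have /andP[a b] := W01 j k; rewrite normrM (ger0_norm a) normrX ler_wpM2r//.
 by rewrite ler_sqr ?nnegrE ?(hartley_le k iF)// mulr_ge0// Rint_ge0.
have cv k : hartley F k ^+ 2 * W j k @[j --> \oo] --> hartley F k ^+ 2.
 rewrite -[X in _ --> X]mulr1; apply: cvgM; first exact: cvg_cst.
 by rewrite -[X in _ --> X]mulr1; apply: cvgM; [exact: (w1 D1)|exact: (w1 D2)].
have [] := @fatou_bound _ _ _ m (fun j k => hartley F k ^+ 2 * W j k) (fun k => hartley F k ^+ 2) (C * \int[n]_x (F x ^+ 2)).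
- exact: iHW.
- by mtac.
- by move=> j k; rewrite mulr_ge0 ?sqr_ge0//; have /andP[] := W01 j k.
- by move=> k; exact: sqr_ge0.
- exact: aeW.
- by move=> j; rewrite weighted// (Ep_le mP P0 Psym Pint Pc P1).
move=> iH _; split => //.
have [] := @Rint_dct _ _ _ m (fun j k => hartley F k ^+ 2 * W j k) (fun k => hartley F k ^+ 2) (fun k => hartley F k ^+ 2).
- by move=> j; exact: intg_mf (iHW j).
- by mtac.
- by [].
- move=> j k; have /andP[a b] := W01 j k; rewrite ger0_norm; last exact: mulr_ge0 (sqr_ge0 _) a.
 by rewrite ler_piMr// sqr_ge0.
- exact: aeW.
move=> _ c1; have c2 := good_Ep mP P0 Psym Pint Pc P1 (good2 hF).
apply: (cvg_unique _ c1) => //.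
move: c2; rewrite -(_ : (fun j => \int[m]_k (hartley F k ^+ 2 * W j k)) = Ep n P ^~ F)//.
by apply/funext => j; exact: weighted.
Qed.

End TwoD.

End Plancherel.

(** * Abel weights and Poisson kernels on the line, the circle and the integers *)

Section Kernels.
Context {R : realType}.
Notation RM := (measurableTypeR R).
Notation leb := (@lebesgue_measure R).

Definition eps (j : nat) : R := j.+1%:R^-1.
(** Abel summation: the same exponential weight produces the Poisson kernel of the half-plane on the
    line and that of the disc on the circle. *)
Definition wexp (j : nat) (k : R) := expR (- (eps j * `|k|)).
Lemma eps_gt0 j : 0 < eps j.
Proof. by rewrite invr_gt0. Qed.
Lemma cvg_eps : eps j @[j --> \oo] --> (0 : R).
Proof. exact: cvg_harmonic. Qed.
Lemma wexp01 j k : 0 <= wexp j k <= 1.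
Proof. by rewrite expR_ge0 -expR0 ler_expR oppr_le0 mulr_ge0// ltW// eps_gt0. Qed.
Lemma cvg_expR (u : nat -> R) (l : R) : u j @[j --> \oo] --> l -> expR (u j) @[j --> \oo] --> expR l.
Proof. by move=> h; apply: continuous_cvg => //; exact: continuous_expR. Qed.

Lemma cvg_wexp k : wexp j k @[j --> \oo] --> (1 : R).
Proof.
have h : - (eps j * `|k|) @[j --> \oo] --> - (0 * `|k|).
 by apply: cvgN; apply: cvgM; [exact: cvg_eps|exact: cvg_cst].
by have := cvg_expR h; rewrite mul0r oppr0 expR0.
Qed.

Lemma mf_wexp j : mfun (wexp j : RM -> R).
Proof.
have h : mfun (fun k : RM => - (eps j * `|k|)) by mtac.
by have := @mfcomp _ _ _ RM R R (@expR R) setT _ (@measurable_expR R) h.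
Qed.

Lemma Rint_reflect per a (f : RM -> R) : dualpt per a -> mfun f -> \int[mu1 per]_x f (- a - x) = \int[mu1 per]_x f x.
Proof.
move=> da mf; have me : mfun (EFin \o f) by exact/EFinP.
rewrite /Rintegral; congr fine; rewrite [LHS]integralE [RHS]integralE.
rewrite -(int_reflect da (measurable_funepos me)); last by move=> x; exact: funepos_ge0.
rewrite -(int_reflect da (measurable_funeneg me)); last by move=> x; exact: funeneg_ge0.
by congr (_ - _)%E; apply: eq_integral => x _; rewrite ?funeposE ?funenegE.
Qed.

Lemma intg_reflect per a (f : RM -> R) : dualpt per a -> intg (mu1 per) f -> intg (mu1 per) (fun x => f (- a - x)).
Proof.
move=> da hf; have mf := intg_mf hf.
have mr : mfun (fun x : RM => - a - x : RM) by apply: mfunB.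
apply/integrableP; split; first by apply/EFinP; exact: (mfcomp mf mr).
have /integrableP[_] := hf.
rewrite -(int_reflect da (f := fun x => `|(EFin \o f) x|)%E)//.
by apply: mfcomp => //; exact/EFinP.
Qed.

Lemma dualpt0 per : dualpt per (0 : R).
Proof. by move=> _; exists 0. Qed.

Lemma Rint_odd per (f : RM -> R) : intg (mu1 per) f -> (forall x, f (- x) = - f x) -> \int[mu1 per]_x f x = 0.
Proof.
move=> if_ of_; have h := Rint_reflect (@dualpt0 per) (intg_mf if_).
suff : \int[mu1 per]_x f x = - \int[mu1 per]_x f x by lra.
rewrite -{1}h -RintN//; apply: eq_Rint => x.
by rewrite oppr0 add0r.
Qed.

Lemma intg_dom (nn : {measure set RM -> \bar R}) j (f : RM -> R) : mfun f -> (forall x, `|f x| <= 1) ->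
 intg nn (wexp j) -> intg nn (fun k => wexp j k * f k).
Proof. by move=> mf f1 iw; apply: intg_bdd iw. Qed.

Lemma cosM_meas (u : R) : mfun (fun k : RM => cos (k * u)).
Proof. by apply: (mfcomp mf_cos); exact: mfunM. Qed.
Lemma sinM_meas (u : R) : mfun (fun k : RM => sin (k * u)).
Proof. by apply: (mfcomp mf_sin); exact: mfunM. Qed.
Lemma norm_cos_le1 (u : R) : `|cos u| <= 1.
Proof. by rewrite ler_norml cos_geN1 cos_le1. Qed.
Lemma norm_sin_le1 (u : R) : `|sin u| <= 1.
Proof. by rewrite ler_norml sin_geN1 sin_le1. Qed.

Section Lebesgue.

(** The primitive has to match [f] only on the positive half-line, so [f] may contain [|x|];
    evenness doubles the integral. *)
Let even_int (f F g : R -> R) (l : R) : (forall x, 0 <= f x) -> continuous f -> (forall x, f (- x) = f x) ->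
 F x @[x --> +oo] --> l -> (forall x, is_derive x (1 : R) F (g x)) -> (forall x, 0 < x -> g x = f x) ->
 intg leb f /\ \int[leb]_x f x = 2 * (l - F 0).
Proof.
move=> f0 cf ef cF dF gf.
have cF' : continuous F.
 by move=> x; apply: differentiable_continuous; apply/derivable1_diffP; have [] := dF x.
have h : (\int[leb]_x (f x)%:E = (2 * (l - F 0))%:E)%E.
 rewrite ge0_symfun_integralT//; last by move=> x /=; rewrite ef.
 rewrite (_ : [set x : R | 0 <= x] = `[0, +oo[%classic); last first.
  by apply/seteqP; split => x /=; rewrite in_itv /= andbT.
 rewrite (@ge0_continuous_FTC2y _ f F 0 l)//.
 - by apply: continuous_subspaceT.
 - by apply: cvg_at_right_filter; exact: cF'.
 - move=> x; rewrite in_itv /= andbT => x0; rewrite derive1E.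
  by have [_ ->] := dF x; exact: gf.
have hi : intg leb f.
 apply: ge0_intg => //; first exact: cont_mfun.
 by rewrite h ltry.
split=> //; have := RintE hi; rewrite h => -[].
by move=> ->.
Qed.

Let cvg_expRy (e : R) : 0 < e -> expR (- (e * x)) @[x --> +oo] --> (0 : R).
Proof.
move=> e0; have h : e * x @[x --> +oo] --> +oo by apply: gt0_cvgMry => //; exact: cvg_id.
exact: (cvg_comp _ _ h (@cvgr_expR R)).
Qed.

(** Adding 1 to the cosine makes the integrand nonnegative, so that integrability and value come
    together from a primitive. *)
Lemma leb_exp_cos (e z : R) : 0 < e -> intg leb (fun k => expR (- (e * `|k|)) * (1 + cos (k * z))) /\
 \int[leb]_k (expR (- (e * `|k|)) * (1 + cos (k * z))) = 2 * (e^-1 + e / (e ^+ 2 + z ^+ 2)).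
Proof.
move=> e0.
have d0 : e ^+ 2 + z ^+ 2 != 0 by rewrite gt_eqF// ltr_pwDl ?sqr_ge0// exprn_gt0.
pose F k := expR (- (e * k)) * (- e^-1 + (z * sin (k * z) - e * cos (k * z)) / (e ^+ 2 + z ^+ 2)).
have [] := @even_int (fun k => expR (- (e * `|k|)) * (1 + cos (k * z))) F (fun k => expR (- (e * k)) * (1 + cos (k * z))) 0.
- by move=> k; rewrite mulr_ge0 ?expR_ge0// -lerBlDl sub0r cos_geN1.
- move=> k; apply: cvgM.
  apply: continuous_comp; last exact: continuous_expR.
  by apply: cvgN; apply: cvgM; [exact: cvg_cst|exact: norm_continuous].
 apply: cvgD; first exact: cvg_cst.
 apply: continuous_comp; last exact: continuous_cos.
 by apply: cvgM; [exact: cvg_id|exact: cvg_cst].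
- by move=> k; rewrite normrN mulNr cosN.
- pose B := e^-1 + (`|z| + e) / (e ^+ 2 + z ^+ 2).
 apply: (@squeeze_cvgr _ _ _ _ (fun k => - (expR (- (e * k)) * B)) (fun k => expR (- (e * k)) * B)).
 + apply: nearW => k; rewrite -ler_norml /F normrM (ger0_norm (expR_ge0 _)) ler_wpM2l ?expR_ge0//.
  apply: (le_trans (ler_normD _ _)); rewrite normrN (gtr0_norm (_ : 0 < e^-1)) ?invr_gt0//.
  rewrite lerD2l normrM normfV (gtr0_norm (_ : 0 < e ^+ 2 + z ^+ 2)); last first.
   by rewrite ltr_pwDl ?sqr_ge0// exprn_gt0.
  rewrite ler_wpM2r ?invr_ge0 ?addr_ge0 ?sqr_ge0//.
  apply: (le_trans (ler_normB _ _)); rewrite !normrM (gtr0_norm e0).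
  by rewrite lerD// ?ler_piMr ?norm_sin_le1 ?norm_cos_le1// ltW.
 + rewrite -oppr0 -(mul0r B); apply: cvgN; apply: cvgM; [exact: cvg_expRy|exact: cvg_cst].
 + rewrite -(mul0r B); apply: cvgM; [exact: cvg_expRy|exact: cvg_cst].
- move=> k.
 have h1 := dZr z (dId k).
 have h4 := dExp (dN (dZ e (dId k))).
 have h5 := dD (dC (- e^-1) k) (dZr (e ^+ 2 + z ^+ 2)^-1 (dB (dZ z (dSin h1)) (dZ e (dCos h1)))).
 apply: dEq (dM h4 h5) _; field.
 by rewrite d0 gt_eqF.
- by move=> k k0; rewrite ger0_norm// ltW.
move=> h1 h2; split=> //; rewrite h2 /F.
rewrite mulr0 oppr0 expR0 mul0r sin0 cos0; field.
by rewrite d0 gt_eqF.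
Qed.

Lemma leb_exp j : intg leb (wexp j).
Proof.
have [h _] := leb_exp_cos 0 (eps_gt0 j).
apply: eq_intg (intgZ 2^-1 h) => k; by rewrite mulr0 cos0 /wexp; field.
Qed.

(** The Poisson kernel of the half-plane at height [eps j], normalised to mass [2 * pi]. *)
Definition pker j (z : R) : R := 2 * eps j / (eps j ^+ 2 + z ^+ 2).
Let den j (z : R) : 0 < eps j ^+ 2 + z ^+ 2.
Proof. by rewrite ltr_pwDl ?sqr_ge0// exprn_gt0// eps_gt0. Qed.

Lemma leb_expcos j z : \int[leb]_k (wexp j k * cos (k * z)) = pker j z.
Proof.
have [h0 e0] := leb_exp_cos 0 (eps_gt0 j).
have [h1 e1] := leb_exp_cos z (eps_gt0 j).
transitivity (\int[leb]_k (expR (- (eps j * `|k|)) * (1 + cos (k * z)) - 2^-1 * (expR (- (eps j * `|k|)) * (1 + cos (k * 0))))).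
 by apply: eq_Rint => k; rewrite mulr0 cos0 /wexp; field.
rewrite RintB//; last exact: intgZ.
rewrite RintZ// e0 e1 /pker; field.
by rewrite !gt_eqF ?eps_gt0 ?den.
Qed.

Lemma pker_ge0 j z : 0 <= pker j z.
Proof. by rewrite divr_ge0 ?mulr_ge0// ?ltW// ?den ?eps_gt0. Qed.
Lemma pker_even j z : pker j (- z) = pker j z.
Proof. by rewrite /pker sqrrN. Qed.

Lemma leb_pker j : intg leb (pker j) /\ \int[leb]_z pker j z = 2 * pi.
Proof.
have [] := @even_int (pker j) (fun z => 2 * atan (z * (eps j)^-1)) (pker j) pi.
- exact: pker_ge0.
- move=> z; apply: cvgM; first exact: cvg_cst.
 apply: cvgV; first by rewrite gt_eqF ?den.
 by apply: cvgD; [exact: cvg_cst|exact: exprn_continuous].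
- exact: pker_even.
- rewrite (_ : pi = 2 * (pi / 2)); last by field.
 apply: cvgM; first exact: cvg_cst.
 have h : x * (eps j)^-1 @[x --> +oo] --> +oo.
  by apply: gt0_cvgMly; [rewrite invr_gt0 eps_gt0|exact: cvg_id].
 exact: (cvg_comp _ _ h (@cvgy_atan R)).
- move=> z; have h1 := dZr (eps j)^-1 (dId z).
 apply: dEq (dZ 2 (dComp (is_derive1_atan _) h1)) _.
 rewrite /pker; field; have := den j z; have := eps_gt0 j => a b.
 by rewrite (gt_eqF a) !gt_eqF// addrC.
- by [].
move=> h ->; split=> //.
by rewrite mul0r atan0 mulr0 subr0.
Qed.

Section EqLeb.
Variable nn : sfmeas RM R.
Hypothesis eqn : forall A, measurable A -> nn A = leb A.

(** The line occurs both with Lebesgue measure and with its restriction to everything; results move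
    between the two by equality on measurable sets. *)
Lemma eqm_intg f : intg leb f <-> intg nn f.
Proof.
have e : (\int[leb]_x `|(f x)%:E| = \int[nn]_x `|(f x)%:E|)%E.
 by apply: eq_measure_integral => A mA _; exact/esym/eqn.
split=> /integrableP[mf h]; apply/integrableP; split => //.
 by move: h; rewrite (_ : integral _ _ _ = (\int[leb]_x `|(f x)%:E|)%E)// e.
by rewrite (_ : integral _ _ _ = (\int[leb]_x `|(f x)%:E|)%E)// e.
Qed.

Lemma eqm_Rint f : \int[nn]_x f x = \int[leb]_x f x.
Proof.
rewrite /Rintegral; congr fine.
by apply: eq_measure_integral => A mA _; exact: eqn.
Qed.

End EqLeb.

Lemma pker_shift j x : intg leb (fun y => pker j (x - y)) /\ \int[leb]_y pker j (x - y) = 2 * pi.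
Proof.
have [h e] := leb_pker j; have d : dualpt false (- x) by [].
split.
 by apply: eq_intg (intg_reflect d h) => y; rewrite opprK.
rewrite -e -(Rint_reflect d (intg_mf h)).
by apply: eq_Rint => y; rewrite opprK.
Qed.

Lemma dual1_line (nn mm : sfmeas RM R) :
 (forall A, measurable A -> nn A = leb A) -> (forall A, measurable A -> mm A = leb A) ->
 dual1 nn mm (fun=> True) wexp (fun j z => pker j (z.1 - z.2)).
Proof.
move=> en em.
have iw j f : mfun (f : RM -> R) -> (forall x, `|f x| <= 1) -> intg leb (fun k => wexp j k * f k).
 by move=> mf f1; apply: intg_dom => //; exact: leb_exp.
have odd j u : \int[mm]_k (wexp j k * sin (k * u)) = 0.
 rewrite (eqm_Rint em); apply: (@Rint_odd false).
  by apply: iw => [|k]; [exact: sinM_meas|exact: norm_sin_le1].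
 by move=> k; rewrite /wexp normrN mulNr sinN mulrN.
split=> //.
- by apply: aeW.
- exact: wexp01.
- exact: cvg_wexp.
- by move=> j; apply/(eqm_intg em); exact: leb_exp.
- by move=> j x y _ _; rewrite (eqm_Rint em) leb_expcos.
- move=> j; have := intg_mf (leb_pker j).1 => mp; mtac.
- by move=> j z; exact: pker_ge0.
- by move=> j x y /=; rewrite -pker_even opprB.
- by move=> j x; apply/(eqm_intg en); have [] := pker_shift j x.
- by move=> j x /=; rewrite (eqm_Rint en); have [_ ->] := pker_shift j x.
- by move=> j; apply: aeW => x /=; rewrite (eqm_Rint en); have [_ ->] := pker_shift j x.
- by move=> a b; apply/(eqm_intg en); exact: (integrable_indic_itv a b false false).
(* At [x = b] half of the mass of the kernel stays outside the interval, so this point is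
   exceptional. *)
- move=> a b; exists [set b]; split.
 + exact: measurable_set1.
 + by rewrite [LHS]en ?lebesgue_measure_set1//; exact: measurable_set1.
 move=> x /= nx; apply: contrapT => xb; apply: nx => /andP[ax xleb].
 have {xb xleb}xb : x < b by rewrite lt_neqAle xleb andbT; apply/eqP.
 (* Outside the interval [|x - y| >= dl], and there the kernel is at most [eps j * B] times the
    integrable kernel of index 0. The tail is thus of order [eps j]. *)
 pose dl := Num.min (x - a) (b - x).
 have dl0 : 0 < dl by rewrite lt_min !subr_gt0 ax.
 pose B := 1 + dl ^- 2.
 have mJ : mfun (\1_(~` `]a, b]%classic) : RM -> R).
  by apply: mf_indic; apply: measurableC; exact: measurable_itv.
 have bd j y : `|\1_(~` `]a, b]%classic) y * pker j (x - y)| <= (eps j * B) * pker 0 (x - y).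
  rewrite normrM (ger0_norm (pker_ge0 _ _)).
  have B0 : 0 <= eps j * B by rewrite mulr_ge0 ?ltW ?eps_gt0// ltr_wpDr// invr_ge0 sqr_ge0.
  rewrite indicE; case: (boolP (y \in _)) => /= [|_]; last first.
   by rewrite normr0 mul0r mulr_ge0// pker_ge0.
  rewrite inE /= in_itv /= => nI; rewrite normr1 mul1r.
  have hd : dl ^+ 2 <= (x - y) ^+ 2.
   rewrite -[leRHS]real_normK ?num_real// ler_sqr ?nnegrE ?normr_ge0 ?(ltW dl0)//.
   rewrite /dl ge_min; apply/orP; have [ya|ay] := leP y a.
    left; rewrite ger0_norm; [lra|]. lra.
   right; have : b < y by rewrite ltNge; apply/negP => yb; apply: nI; rewrite ay yb.
   by move=> by_; rewrite ler0_norm; lra.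
  have z0 : 0 < (x - y) ^+ 2 by rewrite (lt_le_trans _ hd)// exprn_gt0.
  have e0 := eps_gt0 j.
  have e1 : eps 0 = 1 by rewrite /eps invr1.
  rewrite /pker e1 expr1n mulr1.
  have hB : 1 + (x - y) ^+ 2 <= B * (x - y) ^+ 2.
   rewrite /B mulrDl mul1r addrC lerD2l mulrC ler_pdivlMr ?exprn_gt0//.
   by rewrite mul1r.
  have z1 : 0 < 1 + (x - y) ^+ 2 by rewrite ltr_pwDl ?sqr_ge0.
  have B1 : 0 <= B by rewrite addr_ge0// invr_ge0 sqr_ge0.
  rewrite ler_pdivrMr ?den//.
  rewrite (_ : eps j * B * _ * _ = 2 * eps j * (B * (eps j ^+ 2 + (x - y) ^+ 2)) / (1 + (x - y) ^+ 2)); last first.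
   by field; rewrite gt_eqF.
  by rewrite ler_pdivlMr// ler_pM2l ?mulr_gt0// (le_trans hB)// ler_wpM2l// lerDr sqr_ge0.
 have mpx j : mfun (fun y : RM => pker j (x - y)) := intg_mf (pker_shift j x).1.
 have [ip0 ep0] := pker_shift 0 x.
 apply: (@squeeze_cvgr _ _ _ _ (cst 0) (fun j => eps j * B * (2 * pi))).
 + apply: nearW => j; rewrite (eqm_Rint en) Rint_ge0 /=; last first.
   by move=> y; rewrite mulr_ge0 ?pker_ge0//.
  rewrite -ep0 -RintZ//; apply: le_Rint.
  * exact: (le_intg (mfunM mJ (mpx j)) (bd j) (intgZ _ ip0)).
  * exact: intgZ.
  * by move=> y; rewrite (le_trans (ler_norm _))// bd.
 + exact: cvg_cst.
 + apply: (@cvg_eq _ _ (0 * B * (2 * pi))); last by rewrite !mul0r.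
  by apply: cvgM; [apply: cvgM; [exact: cvg_eps|exact: cvg_cst]|exact: cvg_cst].
Qed.

End Lebesgue.

Section Circle.

Lemma periodic_int (f : R -> R) : (forall x, f (x + 2 * pi) = f x) ->
 forall (n : int) x, f (x + n%:~R * (2 * pi)) = f x.
Proof.
move=> h n x.
have hn (m : nat) y : f (y + m%:R * (2 * pi)) = f y.
 elim: m y => [|m ih] y; first by rewrite mul0r addr0.
 by rewrite -natr1 mulrDl mul1r addrA h ih.
case: n => m; first exact: hn.
by rewrite NegzE mulrNz mulNr -(hn m.+1) subrK.
Qed.

Lemma cosD2pi (x : R) : cos (x + 2 * pi) = cos x.
Proof. by rewrite mulr_natl cosD2pi. Qed.
Lemma sinD2pi (x : R) : sin (x + 2 * pi) = sin x.
Proof. by rewrite mulr_natl sinD2pi. Qed.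
Let pi2_ge0 : 0 <= 2 * pi :> R.
Proof. by rewrite mulr_ge0// pi_ge0. Qed.

Lemma nu1T_Rint (f : RM -> R) : mfun f -> \int[nu1 true]_x f x = \int[leb]_(x in `[0, 2 * pi]) f x.
Proof.
move=> mf; rewrite /Rintegral integral_mrestr; last exact/EFinP.
by congr (fine (integral _ _ _)); apply/seteqP; split => x /=; rewrite in_itv.
Qed.

Lemma nu1T_finite : (rmeas leb (meas_period true) setT < +oo)%E.
Proof.
have -> : rmeas leb (meas_period true) setT = leb `[0, 2 * pi]%classic.
 by rewrite /rmeas /mrestr setTI; congr (leb _); apply/seteqP; split => x /=; rewrite in_itv.
by rewrite lebesgue_measure_itv /=; case: ifP => _; rewrite ?ltry// -EFinB ltry.
Qed.

Lemma nu1T_bdd (f : RM -> R) B : mfun f -> (forall x, `|f x| <= B) -> intg (nu1 true) f.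
Proof.
move=> mf fB; have B0 : 0 <= B := le_trans (normr_ge0 _) (fB 0).
apply: (le_intg (g := fun=> B)) => //.
apply: ge0_intg => //; rewrite integral_cst// lte_mul_pinfty// ?lee_fin// .
exact: nu1T_finite.
Qed.

(** The phase [c] covers cosine and sine together: [c = 0] gives one and [c = - (pi / 2)] the
    other. *)
Lemma circ_int (u : R) c : dualpt true u -> \int[nu1 true]_k cos (k * u + c) = if u == 0 then 2 * pi * cos c else 0.
Proof.
move=> /(_ isT)[n un].
have mc : mfun (fun k : RM => cos (k * u + c)).
 apply: (mfcomp mf_cos); apply: mfunD => //; exact: mfunM.
rewrite nu1T_Rint//; case: ifPn => [/eqP ->|u0].
 under eq_Rintegral do rewrite mulr0 add0r.
 rewrite /Rintegral integral_cst//= lebesgue_measure_itv /= lte_fin mulr_gt0 ?pi_gt0//= subr0; ring.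
have h1 (k : R) : is_derive k (1 : R) (fun k => sin (k * u + c) / u) (cos (k * u + c)).
 by apply: dEq (dZr u^-1 (dSin (dD (dZr u (dId k)) (dC c k)))) _; field.
have h2 : continuous (fun k : R => cos (k * u + c)).
 move=> k; apply: continuous_comp; last exact: continuous_cos.
 by apply: cvgD; [apply: cvgM; [exact: cvg_id|exact: cvg_cst]|exact: cvg_cst].
by rewrite (FTC pi2_ge0 h1 h2) mul0r add0r un [2 * pi * n%:~R]mulrC [_ + c]addrC (periodic_int sinD2pi) subrr.
Qed.

Lemma circ_cos (u : R) : dualpt true u -> \int[nu1 true]_k cos (k * u) = if u == 0 then 2 * pi else 0.
Proof.
move=> du; have := circ_int 0 du; rewrite cos0 mulr1 => <-.
by apply: eq_Rint => k; rewrite addr0.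
Qed.

Lemma circ_sin (u : R) : dualpt true u -> \int[nu1 true]_k sin (k * u) = 0.
Proof.
move=> du; have := circ_int (- (pi / 2)) du; rewrite cosN cos_pihalf mulr0 if_same => <-.
by apply: eq_Rint => k; rewrite cosD cosN sinN cos_pihalf sin_pihalf mulr0 add0r mulrN opprK mulr1.
Qed.

(** The terms are nonnegative, so the sum is already determined by the symmetric partial sums. *)
Lemma zmeas_val (f : RM -> R) l : mfun f -> (forall x, 0 <= f x) ->
 \sum_(0 <= k < N.*2.+1) f (zenum k)%:~R @[N --> \oo] --> l -> intg (@zmeas R) f /\ \int[zmeas]_x f x = l.
Proof.
move=> mf f0 hl.
have me : mfun (EFin \o f) by exact/EFinP.
have h : (\int[zmeas]_x (f x)%:E = l%:E)%E.
 rewrite integral_zmeas_series//.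
 have c1 : (\sum_(0 <= k < N) (f (zenum k)%:~R)%:E)%E @[N --> \oo] --> (\sum_(k <oo) (f (zenum k)%:~R)%:E)%E.
  by apply: is_cvg_nneseries => k _ _; rewrite lee_fin.
 have c2 : N.*2.+1 @[N --> \oo] --> \oo.
  by move=> A [M _ MA]; exists M => // N /= MN; apply: MA => /=; lia.
 have c3 := cvg_comp _ _ c2 c1.
 apply: (cvg_unique _ c3) => //=.
 have := cvgEFin hl; rewrite (_ : (fun n => _) = (fun N => \sum_(0 <= k < N.*2.+1) (f (zenum k)%:~R)%:E)%E)//.
 by apply/funext => N; rewrite sumEFin.
have hi : intg (@zmeas R) f by apply: ge0_intg => //; rewrite h ltry.
by split=> //; have := RintE hi; rewrite h => -[].
Qed.

Let r j : R := expR (- eps j).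
Let r01 j : 0 < r j < 1.
Proof. by rewrite expR_gt0 -expR0 ltr_expR oppr_lt0 eps_gt0. Qed.
Let wexp_nat j (n : nat) : wexp j n%:R = r j ^+ n.
Proof. by rewrite /wexp /r -expRM_natl ger0_norm// mulrN mulrC. Qed.
Let den j (u : R) := 1 - 2 * r j * cos u + r j ^+ 2.

Let den_ge j u : (1 - r j) ^+ 2 <= den j u.
Proof.
have /andP[a b] := r01 j; have := cos_le1 u; rewrite /den => c.
have : 0 <= r j * (1 - cos u) by rewrite mulr_ge0 ?subr_ge0// ltW.
lra.
Qed.

Let den_gt0 j u : 0 < den j u.
Proof.
apply: lt_le_trans (den_ge j u); have /andP[a b] := r01 j.
by rewrite exprn_gt0// subr_gt0.
Qed.

(** The Poisson kernel of the disc at radius [r j = expR (- eps j)]. *)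
Definition pcirc j (u : R) := (1 - r j ^+ 2) / den j u.

Lemma pcirc_ge0 j u : 0 <= pcirc j u.
Proof.
have /andP[a b] := r01 j; rewrite divr_ge0// ?(ltW (den_gt0 _ _))//.
by rewrite subr_ge0 expr_le1// ltW.
Qed.

(** Induction adding the two terms of modulus [N.+1]. The correction to the Poisson kernel carries
    the factor [r j ^+ N.+1] and vanishes in the limit. *)
Let geom j u N : \sum_(0 <= k < N.*2.+1) (wexp j (zenum k)%:~R * cos ((zenum k)%:~R * u)) =
 (1 - r j ^+ 2 - 2 * r j ^+ N.+1 * (cos (N.+1%:R * u) - r j * cos (N%:R * u))) / den j u.
Proof.
have d0 := den_gt0 j u.
elim: N => [|N ih].
 rewrite big_nat1 /zenum /= mul0r cos0 (wexp_nat j 0) mul1r.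
 by apply: (mulIf (lt0r_neq0 d0)); rewrite divfK ?gt_eqF// /den !mul1r mulr1; ring.
rewrite doubleS 2?big_nat_recr// ih.
rewrite /zenum /= odd_double /= uphalf_double doubleK NegzE.
rewrite mulrNz mulNr cosN (_ : wexp j (- N.+1%:~R) = r j ^+ N.+1); last by rewrite -wexp_nat /wexp normrN.
rewrite (_ : wexp j _ = r j ^+ N.+1); last exact: wexp_nat.
rewrite (_ : N.+1%:~R = N.+1%:R)//.
have e1 : cos (N.+2%:R * u) = cos (N.+1%:R * u) * cos u - sin (N.+1%:R * u) * sin u.
 by rewrite -cosD -natr1 mulrDl mul1r.
have e2 : cos (N%:R * u) = cos (N.+1%:R * u) * cos u + sin (N.+1%:R * u) * sin u.
 by rewrite -cosB -[N.+1%:R]natr1 mulrDl mul1r addrK.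
rewrite e1 e2 (exprS _ N.+1) (exprS _ N); move: (r j ^+ N) => rN.
by apply: (mulIf (lt0r_neq0 d0)); rewrite !mulrDl !divfK ?gt_eqF// /den; ring.
Qed.

Let geom_cvg j u : \sum_(0 <= k < N.*2.+1) (wexp j (zenum k)%:~R * cos ((zenum k)%:~R * u)) @[N --> \oo] --> pcirc j u.
Proof.
under eq_fun do rewrite geom.
have /andP[a b] := r01 j.
apply: cvgM; last exact: cvg_cst.
rewrite -[X in _ --> X]subr0; apply: cvgB; first exact: cvg_cst.
apply: (@squeeze_cvgr _ _ _ _ (fun N => - (4 * r j ^+ N.+1)) (fun N => 4 * r j ^+ N.+1)).
- apply: nearW => N; rewrite -ler_norml normrM ger0_norm; last by rewrite mulr_ge0// exprn_ge0// ltW.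
 rewrite (_ : 4 * _ = 2 * r j ^+ N.+1 * (1 + 1)); last by ring.
 rewrite ler_wpM2l//; first by rewrite mulr_ge0// exprn_ge0// ltW.
 apply: (le_trans (ler_normB _ _)); rewrite lerD ?norm_cos_le1// normrM (gtr0_norm a).
 by rewrite mulr_ile1 ?norm_cos_le1// ltW.
- rewrite -oppr0 -(mulr0 4); apply: cvgN; apply: cvgM; first exact: cvg_cst.
 by rewrite (cvg_shiftS (fun N => r j ^+ N)); apply: cvg_expr; rewrite gtr0_norm.
- rewrite -(mulr0 4); apply: cvgM; first exact: cvg_cst.
 by rewrite (cvg_shiftS (fun N => r j ^+ N)); apply: cvg_expr; rewrite gtr0_norm.
Qed.

Lemma zmeas_wexp j : intg (@zmeas R) (wexp j) /\ \int[@zmeas R]_k wexp j k = pcirc j 0.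
Proof.
apply: zmeas_val; [exact: mf_wexp|by move=> x; have /andP[] := wexp01 j x|].
have := @geom_cvg j 0; rewrite (_ : (fun N => _) = (fun N => \sum_(0 <= k < N.*2.+1) wexp j (zenum k)%:~R))//.
by apply/funext => N; apply: eq_bigr => k _; rewrite mulr0 cos0 mulr1.
Qed.

Lemma zmeas_expcos j u : \int[@zmeas R]_k (wexp j k * cos (k * u)) = pcirc j u.
Proof.
have [iw ew] := zmeas_wexp j.
have ic : intg (@zmeas R) (fun k => wexp j k * cos (k * u)).
 by apply: intg_dom => //; [exact: cosM_meas|move=> k; exact: norm_cos_le1].
(* Adding the weight makes the summands nonnegative; its own sum is subtracted at the end. *)
have [] := @zmeas_val (fun k => wexp j k + wexp j k * cos (k * u)) (pcirc j 0 + pcirc j u).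
- by apply: mfunD; [exact: mf_wexp|exact: intg_mf ic].
- move=> k; rewrite -{1}[wexp j k]mulr1 -mulrDr; apply: mulr_ge0; first by have /andP[] := wexp01 j k.
 by have := cos_geN1 (k * u); lra.
- have -> : (fun N => \sum_(0 <= k < N.*2.+1) (wexp j (zenum k)%:~R + wexp j (zenum k)%:~R * cos ((zenum k)%:~R * u))) =
   (fun N => \sum_(0 <= k < N.*2.+1) (wexp j (zenum k)%:~R * cos ((zenum k)%:~R * 0)) +
    \sum_(0 <= k < N.*2.+1) (wexp j (zenum k)%:~R * cos ((zenum k)%:~R * u))).
  apply/funext => N; rewrite big_split /=; congr (_ + _).
  by apply: eq_bigr => k _; rewrite mulr0 cos0 mulr1.
 by apply: cvgD; exact: geom_cvg.
by move=> _; rewrite RintD// ew => /addrI.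
Qed.

Lemma zmeas_pt (x : R) : [/\ intg (@zmeas R) (\1_[set x] : RM -> R),
 \int[@zmeas R]_k \1_[set x] k <= 1 & dualpt true x -> \int[@zmeas R]_k \1_[set x] k = 1].
Proof.
have m1 : mfun (\1_[set x] : RM -> R) by apply: mf_indic; exact: measurable_set1.
have [[n ->]|nx] := pselect (exists n : int, x = n%:~R).
 have [i ni] : exists i, zenum i = n by have [_ _ s] := zenum_bij; have [i _ <-] := s n I; exists i.
 have [] := @zmeas_val (\1_[set n%:~R]) 1.
 - apply: mf_indic; exact: measurable_set1.
 - by move=> y; rewrite indicE; case: (_ \in _).
 - apply: cvg_near_cst; exists i => // N /= iN.
  rewrite (bigD1_seq i) ?iota_uniq ?mem_index_iota//=; last by lia.
  rewrite big1 ?addr0 => [|k ki]; first by rewrite indicE mem_set//= ni.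
  rewrite indicE memNset//= => /intr_inj; rewrite -ni => /zenum_inj ki'.
  by rewrite ki' eqxx in ki.
 by move=> h ->; split.
have ae0 : {ae @zmeas R, forall k, (0 : R) = \1_[set x] k}.
 apply: ae1 (@ae_dualpt R true) _ => k /(_ isT)[m km]; rewrite indicE memNset//= => kx.
 by apply: nx; exists m; rewrite -kx.
split.
- exact: ae_intg m1 ae0 (intg0 _).
- by rewrite -(ae_Rint _ m1 ae0) ?Rint0.
- by move=> /(_ isT).
Qed.

Let Pm : set RM := period true.
Let mPm : measurable Pm := meas_period true.

(** Integrating the Fourier series of the kernel term by term leaves only the frequency 0, of weight
    1. *)
Let pint0 j x : intg (nu1 true) (fun y : RM => pcirc j (x - y)) /\ \int[nu1 true]_y pcirc j (x - y) = 2 * pi.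
Proof.
have [iw ew] := zmeas_wexp j.
have ic : intg (nu1 true) (fun _ : RM => 1 : R) by apply: (@nu1T_bdd _ 1) => // y; rewrite normr1.
pose F (z : RM * RM) := wexp j z.2 * cos (z.2 * (x - z.1)).
have mw := mf_wexp j.
have mF : mfun F.
 have h : mfun (fun z : RM * RM => z.2 * (x - z.1)) by mtac.
 have := mfcomp mf_cos h => h2; rewrite /F; mtac.
have iF : intg (pm (nu1 true) (@zmeas R)) F.
 apply: (le_intg mF) (intgM12 ic iw) => z.
 rewrite mul1r /F normrM ger0_norm; last by have /andP[] := wexp01 j z.2.
 by rewrite ler_piMr ?norm_cos_le1//; have /andP[] := wexp01 j z.2.
have e1 y : \int[@zmeas R]_k F (y, k) = pcirc j (x - y).
 exact: (zmeas_expcos j (x - y)).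
split; first by apply: eq_intg (intg_Rint1 iF) => y; rewrite e1.
transitivity (\int[nu1 true]_y \int[@zmeas R]_k F (y, k)); first by apply: eq_Rint => y; rewrite e1.
rewrite Rfubini//.
have [i0 _ e0] := zmeas_pt 0.
transitivity (\int[@zmeas R]_k (2 * pi * \1_[set 0] k)); last by rewrite RintZ// e0 ?mulr1//; exact: dualpt0.
apply: ae_Rint; first exact: (intg_mf (intg_Rint2 iF)).
 by apply: mfunM => //; exact: intg_mf i0.
apply: ae1 (@ae_dualpt R true) _ => k dk.
have dk' : dualpt true (- k) by move=> _; have [n ->] := dk isT; exists (- n); rewrite mulrNz.
transitivity (\int[nu1 true]_y (wexp j k * cos (y * (- k) + k * x))).
 by apply: eq_Rint => y; rewrite /F /=; congr (_ * cos _); ring.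
rewrite RintZ; last first.
 apply: (@nu1T_bdd _ 1) => [|y]; last exact: norm_cos_le1.
 apply: (mfcomp mf_cos); apply: mfunD => //; exact: mfunM.
rewrite circ_int// oppr_eq0 indicE; case: eqP => [->|k0].
 by rewrite mem_set//= mul0r cos0 /wexp normr0 mulr0 oppr0 expR0; ring.
by rewrite memNset//= !mulr0.
Qed.

Let r_cvg : r j @[j --> \oo] --> (1 : R).
Proof. by rewrite -expR0 -oppr0; apply: cvg_expR; apply: cvgN; exact: cvg_eps. Qed.

Let cos_far (dl u : R) : 0 < dl <= `|u| -> `|u| <= 2 * pi - dl -> cos u <= cos dl.
Proof.
move=> /andP[d0 du] ud; rewrite -(@cos_norm _ u); move: `|u| du ud => {}u du ud.
have [up|pu] := leP u pi.
 by rewrite leNgt (@ltr_cos _ u dl) -?leNgt//= in_itv /=; apply/andP; split; lra.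
rewrite (_ : cos u = cos (2 * pi - u)); last by rewrite cosB [2 * pi]mulr_natl cos2pi sin2pi mul1r mul0r addr0.
by rewrite leNgt (@ltr_cos _ (2 * pi - u) dl) -?leNgt//=; try (rewrite in_itv /=; apply/andP; split); lra.
Qed.

(** The indicators confine the periodic kernel to one period in both variables; almost all positions
    lie there. *)
Lemma dual1_circle : dual1 (nu1 true) (@zmeas R) (@period R true) wexp
 (fun j z => pcirc j (z.1 - z.2) * (\1_Pm z.1 * \1_Pm z.2)).
Proof.
have mpc j : mfun (pcirc j : RM -> R).
 apply: cont_mfun => u; apply: cvgM; first exact: cvg_cst.
 apply: cvgV; first by rewrite gt_eqF ?den_gt0.
 apply: cvgD; last exact: cvg_cst.
 apply: cvgB; first exact: cvg_cst.
 by apply: cvgM; [exact: cvg_cst|exact: continuous_cos].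
have mP : mfun (\1_Pm : RM -> R) by exact: mf_indic.
have mpx j x : mfun (fun y : RM => pcirc j (x - y)) := intg_mf (pint0 j x).1.
have p0 j z : 0 <= pcirc j (z.1 - z.2) * (\1_Pm z.1 * \1_Pm z.2) by rewrite mulr_ge0 ?pcirc_ge0// mulr_ge0// indicE; case: (_ \in _).
have ind1 x : \1_Pm x <= 1 :> R by rewrite indicE; case: (_ \in _).
have ip j x : intg (nu1 true) (fun y => pcirc j (x - y) * (\1_Pm x * \1_Pm y)).
 have [h _] := pint0 j x; apply: le_intg h; first by apply: mfunM => //; exact: mfunM.
 move=> y; rewrite normrM ger0_norm ?pcirc_ge0// ler_piMr ?pcirc_ge0//.
 by rewrite ger0_norm ?mulr_ge0// mulr_ile1.
have aeP : {ae nu1 true, forall x : R, period true x}.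
 exists (~` Pm); split => //; first exact: measurableC.
 by rewrite /= /rmeas /mrestr setICl measure0.
have odd j u : \int[@zmeas R]_k (wexp j k * sin (k * u)) = 0.
 apply: (@Rint_odd true) => [|k]; last by rewrite /wexp normrN mulNr sinN mulrN.
 by apply: intg_dom; [exact: sinM_meas|move=> k; exact: norm_sin_le1|have [] := zmeas_wexp j].
split=> //.
- exact: wexp01.
- exact: cvg_wexp.
- by move=> j; have [] := zmeas_wexp j.
- move=> j x y hx hy /=; rewrite zmeas_expcos !indicE !mem_set// !mulr1 //.
- move=> j; have mj := mpc j; mtac.
- move=> j x y /=; rewrite [\1_Pm y * _]mulrC; congr (_ * _).
 by rewrite /pcirc /den -[in RHS](opprB x y) cosN.
- move=> j x /=; have [h e] := pint0 j x.
 apply: (le_trans _ (_ : Rintegral (rmeas leb (meas_period true)) setT (fun y => pcirc j (x - y)) <= 2 * pi)); last by rewrite e.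
 apply: le_Rint => // y.
 by rewrite ler_piMr ?pcirc_ge0// mulr_ile1.
- move=> j; apply: (ae1 aeP) => x Px; have [h e] := pint0 j x.
 transitivity (\int[rmeas leb (meas_period true)]_y pcirc j (x - y)); last exact: e.
 apply: ae_Rint => //; first exact: intg_mf (ip j x).
 by apply: (ae1 aeP) => y Py /=; rewrite !indicE !mem_set// !mulr1.
- move=> a b; apply: (@nu1T_bdd _ 1); first by apply: mf_indic; exact: measurable_itv.
 by move=> x; rewrite indicE; case: (_ \in _); rewrite ?normr1 ?normr0.
- move=> a b.
 (* The endpoints of the period are excluded too: seen from 0, the periodic kernel also concentrates
    at [2 * pi]. *)
 exists [set b; 0; 2 * pi]; split.
 + by apply: measurableU; [apply: measurableU|]; exact: measurable_set1.
 + apply/eqP; rewrite -measure_le0 /= /rmeas /mrestr.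
  apply: (@le_trans _ _ (leb [set b; 0; 2 * pi])).
   apply: le_measure; rewrite ?inE; [apply: measurableI => //| |exact: subIsetl].
    by apply: measurableU; [apply: measurableU|]; exact: measurable_set1.
   by apply: measurableU; [apply: measurableU|]; exact: measurable_set1.
  have ms c : measurable ([set c] : set RM) by exact: measurable_set1.
  have l1 c : leb [set c] = 0%E by exact: lebesgue_measure_set1.
  have l2 : leb [set b; 0] = 0%E by apply: null_set_setU; [exact: ms|exact: ms|exact: l1|exact: l1].
  have l3 : leb [set b; 0; 2 * pi] = 0%E by apply: null_set_setU; [apply: measurableU; exact: ms|exact: ms|exact: l2|exact: l1].
  by rewrite l3.
 move=> x /= nx; apply: contrapT => xb; apply: nx => /andP[ax xleb].
 have x_b : x != b by apply/eqP => e; apply: xb; left; left.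
 have x_0 : x != 0 by apply/eqP => e; apply: xb; left; right.
 have x_p : x != 2 * pi by apply/eqP => e; apply: xb; right.
 have [Px|nPx] := pselect (Pm x); last first.
  rewrite (_ : (fun j => _) = cst 0); first exact: cvg_cst.
  apply/funext => j /=; transitivity (\int[nu1 true]_y (0 : R)); last exact: Rint0.
  by apply: eq_Rint => y; rewrite [\1_Pm x]indicE memNset//= mul0r !mulr0.
 have := Px; rewrite /Pm /period /= => /andP[x0 xpi].
 have {}xb : x < b by rewrite lt_neqAle xleb x_b.
 have {x_0}x0 : 0 < x by rewrite lt_neqAle x0 eq_sym x_0.
 have {x_p}xpi : x < 2 * pi by rewrite lt_neqAle xpi x_p.
 pose dl := Num.min (Num.min (x - a) (b - x)) (Num.min x (2 * pi - x)).
 have dl0 : 0 < dl by rewrite !lt_min !subr_gt0 ax xb x0.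
 have [d1 d2 d3 d4] : [/\ dl <= x - a, dl <= b - x, dl <= x & dl <= 2 * pi - x].
  by rewrite /dl; split; rewrite !ge_min lexx ?orbT.
 have dpi : dl <= pi by lra.
 have cdl : cos dl < 1 by rewrite -cos0 ltr_cos// in_itv /= ?lexx ?pi_ge0// (ltW dl0).
 (* The denominator equals [(1 - r j) ^+ 2 + 2 * r j * (1 - cos (x - y))]; outside the interval the
    second term is at least [B^-1], because [r 0 <= r j]. *)
 pose B := (2 * r 0 * (1 - cos dl))^-1.
 have B0 : 0 < B by rewrite invr_gt0 !mulr_gt0 ?subr_gt0//; have /andP[] := r01 0.
 have bd j y : `|\1_(~` `]a, b]%classic) y * (pcirc j (x - y) * (\1_Pm x * \1_Pm y))| <= (1 - r j ^+ 2) * B.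
  have /andP[rj0 rj1] := r01 j; have /andP[r00 r01'] := r01 0.
  have r2 : 0 <= 1 - r j ^+ 2 by rewrite subr_ge0 expr_le1// ltW.
  have R0 : 0 <= (1 - r j ^+ 2) * B by rewrite mulr_ge0// ltW.
  rewrite !indicE; case: (boolP (y \in ~` _)) => /= [|_]; last by rewrite mul0r normr0.
  rewrite inE /= in_itv /= => nI; rewrite mem_set//= mul1r.
  case: (boolP (y \in _)) => /= [|_]; last by rewrite !mulr0 normr0.
  rewrite inE /Pm /period /= mul1r mulr1 => /andP[y0 ypi].
  rewrite ger0_norm ?pcirc_ge0// /pcirc ler_wpM2l//.
  have rr : r 0 <= r j.
   by rewrite ler_expR lerN2 /eps lef_pV2 ?posrE ?ltr0Sn// ler_nat.
  have hu : dl <= `|x - y|.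
   have [ya|ay] := leP y a; first by apply: le_trans d1 (le_trans _ (ler_norm _)); rewrite lerD2l lerN2.
   have : b < y by rewrite ltNge; apply/negP => yb; apply: nI; rewrite ay yb.
   by move=> by_; rewrite distrC; apply: le_trans d2 (le_trans _ (ler_norm _)); rewrite lerD2r ltW.
  have hu2 : `|x - y| <= 2 * pi - dl by rewrite ler_norml; apply/andP; split; lra.
  have hc : cos (x - y) <= cos dl by apply: cos_far => //; rewrite dl0.
  rewrite lef_pV2 ?posrE ?den_gt0 ?mulr_gt0 ?subr_gt0//.
  rewrite /den (_ : 1 - _ + _ = (1 - r j) ^+ 2 + 2 * r j * (1 - cos (x - y))); last by ring.
  rewrite -[leLHS]add0r lerD ?sqr_ge0// -!mulrA ler_pM2l//.
  by apply: ler_pM; rewrite ?(ltW r00) ?subr_ge0 ?(ltW cdl)// lerB.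
 have mJ : mfun (\1_(~` `]a, b]%classic) : RM -> R).
  by apply: mf_indic; apply: measurableC; exact: measurable_itv.
 have mf j : mfun (fun y : RM => \1_(~` `]a, b]%classic) y * (pcirc j (x - y) * (\1_Pm x * \1_Pm y))).
  apply: mfunM => //; exact: intg_mf (ip j x).
 have ic j : intg (nu1 true) (fun _ : RM => (1 - r j ^+ 2) * B).
  by apply: (@nu1T_bdd _ `|(1 - r j ^+ 2) * B|).
 apply: (@squeeze_cvgr _ _ _ _ (cst 0) (fun j => (1 - r j ^+ 2) * B * (2 * pi))).
 + apply: nearW => j; rewrite Rint_ge0 /=; last first.
   by move=> y; apply: mulr_ge0; [rewrite indicE; case: (_ \in _)|exact: (p0 j (x, y))].
  apply: (@le_trans _ _ (\int[nu1 true]_y ((1 - r j ^+ 2) * B))).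
   apply: (le_Rint (le_intg (mf j) (bd j) (ic j)) (ic j)) => y.
   by rewrite (le_trans (ler_norm _))// bd.
  rewrite nu1T_Rint// /Rintegral integral_cst//= lebesgue_measure_itv /= lte_fin mulr_gt0 ?pi_gt0//= subr0 //.
 + exact: cvg_cst.
 + apply: (@cvg_eq _ _ ((1 - 1) * B * (2 * pi))); last by rewrite subrr !mul0r.
  apply: cvgM; last exact: cvg_cst.
  apply: cvgM; last exact: cvg_cst.
  by apply: cvgB; [exact: cvg_cst|have := cvg_sq r_cvg; rewrite expr1n].
Qed.

(** With integer positions and circular frequencies no summability factor is needed: orthogonality
    of characters makes the kernel [2 * pi] times the Kronecker symbol. *)
Lemma dual1_int : dual1 (@zmeas R) (nu1 true) (@dualpt R true) (fun _ _ => 1)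
 (fun _ z => 2 * pi * \1_[set 0] (z.1 - z.2)).
Proof.
have e (x y : R) : \1_[set 0] (x - y) = \1_[set x] y :> R.
 by rewrite !indicE; congr ((nat_of_bool _)%:R); apply/idP/idP; rewrite !inE /= => h; lra.
have dB (x y : R) : dualpt true x -> dualpt true y -> dualpt true (x - y).
 by move=> hx hy _; have [n ->] := hx isT; have [m ->] := hy isT; exists (n - m); rewrite intrB.
have dD (x y : R) : dualpt true x -> dualpt true y -> dualpt true (x + y).
 by move=> hx hy _; have [n ->] := hx isT; have [m ->] := hy isT; exists (n + m); rewrite intrD.
have m0 : mfun (\1_[set 0] : RM -> R) by apply: mf_indic; exact: measurable_set1.
have pi0 := @pi_ge0 R.
split=> //.
- exact: (@ae_dualpt R true).
- by move=> _ _; rewrite ler01 lexx.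
- by move=> k; exact: cvg_cst.
- by move=> j; apply: (@nu1T_bdd _ 1) => // k; rewrite normr1.
- move=> j x y dx dy /=; under eq_Rintegral do rewrite mul1r.
 rewrite circ_cos ?indicE; last exact: dB.
 case: eqP => [->|h]; first by rewrite mem_set//= mulr1.
 by rewrite memNset//= mulr0.
- move=> j x y dx dy; under eq_Rintegral do rewrite mul1r.
 by apply: circ_sin; exact: dB.
- move=> j x y dx dy; under eq_Rintegral do rewrite mul1r.
 by apply: circ_sin; exact: dD.
- by move=> _; mtac.
- by move=> _ z; rewrite !mulr_ge0.
- by move=> _ x y /=; rewrite !e !indicE; congr (_ * (nat_of_bool _)%:R); apply/idP/idP; rewrite !inE /= => ->.
- move=> _ x; have [h _ _] := zmeas_pt x; apply: eq_intg (intgZ (2 * pi) h) => y; by rewrite /= e.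
- move=> _ x /=; have [h h1 _] := zmeas_pt x.
 under eq_Rintegral do rewrite e.
 by rewrite RintZ// ler_piMr// mulr_ge0.
- move=> _; apply: ae1 (@ae_dualpt R true) _ => x dx /=; have [h _ h1] := zmeas_pt x.
 under eq_Rintegral do rewrite e.
 by rewrite RintZ// h1// mulr1.
(* On []a, b]] the summable weight [wexp 0] is at least [expR (- (]|a| + [|b|))], which dominates
   the indicator up to a constant. *)
- move=> a b; have [iw _] := zmeas_wexp 0.
 apply: le_intg (intgZ (expR (`|a| + `|b|)) iw).
  by apply: mf_indic; exact: measurable_itv.
 move=> x; rewrite indicE; case: (boolP (_ \in _)) => [|_] /=; last first.
  by rewrite normr0 mulr_ge0 ?expR_ge0//; have /andP[] := wexp01 0 x.
 rewrite inE /= in_itv /= => /andP[ax xb]; rewrite normr1 /wexp -expRD -expR0 ler_expR.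
 rewrite /eps invr1 mul1r subr_ge0 ler_norml; have := ler_norm (- a); have := ler_norm b.
 by rewrite normrN => h1 h2; have := normr_ge0 a; have := normr_ge0 b => *; apply/andP; split; lra.
- move=> a b; apply: aeW => x /= hx.
 rewrite (_ : (fun j => _) = cst 0); first exact: cvg_cst.
 apply/funext => j /=; transitivity (\int[@zmeas R]_y (0 : R)); last exact: Rint0.
 apply: eq_Rint => y; rewrite e !indicE; case: (boolP (y \in [set x])); last by rewrite !mulr0.
 by rewrite inE /= => ->; rewrite memNset ?mul0r//= => h; apply: h; rewrite in_itv.
Qed.

End Circle.

Lemma dual_nu_mu (per : bool) : exists S w p, dual1 (rmeas leb (meas_period per)) (mu1 per) S w p.
Proof.
case: per; first by do 3 eexists; exact: dual1_circle.
do 3 eexists; apply: dual1_line => // A mA.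
by rewrite /= /rmeas /mrestr setIT.
Qed.

Lemma dual_mu_nu (per : bool) : exists S w p, dual1 (mu1 per) (rmeas leb (meas_period per)) S w p.
Proof.
case: per; first by do 3 eexists; exact: dual1_int.
do 3 eexists; apply: dual1_line => // A mA.
by rewrite /= /rmeas /mrestr setIT.
Qed.

End Kernels.

(** * Measure-preserving maps *)

Section Preserve.
Context {R : realType}.

(** Stated through integrals of nonnegative functions: this form composes with Tonelli directly and
    extends to real functions by positive and negative parts. *)
Definition pres d (T : measurableType d) (nu : {measure set T -> \bar R}) (phi : T -> T) :=
 mfun phi /\ forall f : T -> \bar R, mfun f -> (forall x, 0 <= f x)%E -> (\int[nu]_x f (phi x) = \int[nu]_x f x)%E.

Section One.
Context d (T : measurableType d) (nu : sfmeas T R).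

Lemma mf_inv (f : T -> R) : mfun f -> (forall x, 0 < f x) -> mfun (fun x => (f x)^-1).
Proof.
move=> mf f0; rewrite (_ : (fun x => _) = (fun x => f x `^ (-1))).
 exact: (mfcomp (measurable_powR (-1)) mf).
by apply/funext => x; rewrite powR_inv1// ltW.
Qed.

Lemma pres_comp (phi psi : T -> T) : pres nu phi -> pres nu psi -> pres nu (fun x => phi (psi x)).
Proof.
move=> [m1 h1] [m2 h2]; split; first exact: mfcomp m1 m2.
move=> f mf f0; rewrite (h2 (fun x => f (phi x)))//; first exact: h1.
exact: mfcomp mf m1.
Qed.

Lemma pres_id : pres nu id.
Proof. by split. Qed.

Variable phi : T -> T.
Hypothesis P : pres nu phi.

Lemma pres_Rint (f : T -> R) : mfun f -> \int[nu]_x f (phi x) = \int[nu]_x f x.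
Proof.
move=> mf; have [mp h] := P; have me : mfun (EFin \o f) by exact/EFinP.
rewrite /Rintegral; congr fine; rewrite [LHS]integralE [RHS]integralE.
rewrite -(h _ (measurable_funepos me)); last by move=> x; exact: funepos_ge0.
rewrite -(h _ (measurable_funeneg me)); last by move=> x; exact: funeneg_ge0.
by congr (_ - _)%E; apply: eq_integral => x _; rewrite ?funeposE ?funenegE.
Qed.

Lemma pres_intg (f : T -> R) : intg nu f -> intg nu (fun x => f (phi x)).
Proof.
move=> hf; have mf := intg_mf hf; have [mp h] := P.
apply/integrableP; split; first by apply/EFinP; exact: (mfcomp mf mp).
have /integrableP[_] := hf.
rewrite -(h (fun x => `|(EFin \o f) x|)%E)//.
by apply: mfcomp => //; exact/EFinP.
Qed.

End One.

Section Two.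
Context d1 d2 (T1 : measurableType d1) (T2 : measurableType d2) (m1 : sfmeas T1 R) (m2 : sfmeas T2 R).

Lemma ge0_ae_eq d (T : measurableType d) (nu : {measure set T -> \bar R}) (f g : T -> \bar R) :
 mfun f -> mfun g -> {ae nu, forall x, f x = g x} -> (\int[nu]_x f x = \int[nu]_x g x)%E.
Proof. by move=> mf mg h; apply: ae_eq_integral => //; apply: filterS h => x /= -> _. Qed.

(** Preservation is asked only for almost every fibre, since a translation preserves the dual
    measure only when its parameter lies in the dual group. *)
Lemma pres_fiber (psi : T1 -> T2 -> T2) : mfun (fun z : T1 * T2 => psi z.1 z.2) ->
 {ae m1, forall x, pres m2 (psi x)} -> pres (pm m1 m2) (fun z => (z.1, psi z.1 z.2)).
Proof.
move=> mpsi h; have mphi : mfun (fun z : T1 * T2 => (z.1, psi z.1 z.2)).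
 by apply: mfun_pair.
split=> // f mf f0.
have mf' : mfun (fun z : T1 * T2 => f (z.1, psi z.1 z.2)) by exact: mfcomp mf mphi.
rewrite (fubini_tonelli1 _ mf' (fun=> f0 _)) (fubini_tonelli1 _ mf f0).
apply: ge0_ae_eq.
- exact: (measurable_fun_fubini_tonelli_F _ mf').
- exact: (measurable_fun_fubini_tonelli_F _ mf).
apply: ae1 h _ => x [mp hx]; rewrite /fubini_F /= (hx (fun y => f (x, y)))//.
by apply: mfcomp mf _; exact: measurable_pair1.
Qed.

End Two.

Lemma pres_swap d (T : measurableType d) (m : sfmeas T R) :
 pres (pm m m) (fun z => (z.2, z.1)).
Proof.
split; first by apply: mfun_pair.
move=> f mf f0.
have mf' : mfun (fun z : T * T => f (z.2, z.1)).
 by apply: mfcomp mf _; apply: mfun_pair.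
rewrite (fubini_tonelli1 _ mf' (fun=> f0 _)) (fubini_tonelli2 _ mf f0)//.
Qed.

Lemma pres_prod d1 d2 (T1 : measurableType d1) (T2 : measurableType d2)
 (m1 : sfmeas T1 R) (m2 : sfmeas T2 R) phi1 phi2 :
 pres m1 phi1 -> pres m2 phi2 -> pres (pm m1 m2) (fun z => (phi1 z.1, phi2 z.2)).
Proof.
move=> [mp1 h1] [mp2 h2].
have mphi : mfun (fun z : T1 * T2 => (phi1 z.1, phi2 z.2)).
 by apply: mfun_pair; [exact: mfcomp mp1 _|exact: mfcomp mp2 _].
split=> // f mf f0.
have mf' : mfun (fun z : T1 * T2 => f (phi1 z.1, phi2 z.2)) by exact: mfcomp mf mphi.
rewrite (fubini_tonelli1 _ mf' (fun=> f0 _)) (fubini_tonelli1 _ mf f0) /fubini_F /=.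
transitivity (\int[m1]_x \int[m2]_y f (phi1 x, y))%E.
 apply: eq_integral => x _; rewrite (h2 (fun y => f (phi1 x, y)))//.
 by apply: mfcomp mf _; exact: measurable_pair1.
rewrite (h1 (fun x => \int[m2]_y f (x, y))%E)//; first exact: (measurable_fun_fubini_tonelli_F _ mf).
by move=> x; exact: integral_ge0.
Qed.

End Preserve.

Create HintDb mf.

Ltac mhyp := match goal with
 | H : integrable _ _ (EFin \o ?f) |- measurable_fun _ ?f => exact (intg_mf H)
 | H : L2 _ ?f |- measurable_fun _ ?f => exact (proj1 H)
 end.
Ltac mhint := match goal with
 | |- measurable_fun _ (fun x => ?F (@?f x)) => apply: (@measurableT_comp _ _ _ _ _ _ F _ f); [solve [mhyp | auto 3 with mf nocore]|]
 | |- measurable_fun _ _ => solve [mhyp | auto 3 with mf nocore]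
 end.
Ltac mtac ::= repeat first [mstep | mhint].

(** * The Hartley transform on the domain and its link with the Fourier transform *)

Section Main.
Context {R : realType} (Omega : domain).
Notation RM := (measurableTypeR R).
Notation K := (RM * RM)%type.
Notation leb := (@lebesgue_measure R).
Notation mu := (mu2 Omega).
Notation n1 := (rmeas leb (meas_period (per1 Omega))).
Notation n2 := (rmeas leb (meas_period (per2 Omega))).
Notation nu := (pm n1 n2).
Notation M2 := (pm mu mu).

#[local] Hint Extern 1 (measurable_fun _ _) => mhyp : mf.
#[local] Hint Resolve measurable_indic measurable_itv measurable_set1 measurableC mf_cos mf_sin mf_cas mf_casl mf_casr
 mf_dot mf_casdot mf_hartley : mf.
Lemma pres_reflect1 per (a : R) : dualpt per a -> pres (mu1 per) (fun x : RM => - a - x : RM).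
Proof.
move=> da; split; first by apply: mfunB => //; exact: mfun_cst.
by move=> f mf f0; exact: (int_reflect da mf f0).
Qed.

Lemma pres_reflect (a : R * R) : dualpt (per1 Omega) a.1 -> dualpt (per2 Omega) a.2 ->
 pres mu (fun k : K => (- a.1 - k.1, - a.2 - k.2) : K).
Proof. by move=> d1 d2; exact: pres_prod (pres_reflect1 d1) (pres_reflect1 d2). Qed.

Definition negK (k : K) : K := (- k.1, - k.2).

Lemma pres_neg : pres mu negK.
Proof.
have := @pres_reflect (0, 0) (@dualpt0 R _) (@dualpt0 R _).
rewrite (_ : (fun k => _) = negK)//; apply/funext => k.
by rewrite /negK /= oppr0 !sub0r.
Qed.

(** With [z = (a, k)] and [b = - a - k] this exchanges [b] and [k]. Together with [swp], which
    exchanges [a] and [k], it generates all six permutations of a triple of sum 0. *)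
Definition shear (z : K * K) : K * K := (z.1, (- z.1.1 - z.2.1, - z.1.2 - z.2.2)).

Lemma pres_shear : pres (pm mu mu) shear.
Proof.
apply: (@pres_fiber _ _ _ K K mu mu (fun a k => (- a.1 - k.1, - a.2 - k.2))).
 by mtac.
apply: ae1 (ae_prod (@ae_dualpt R (per1 Omega)) (@ae_dualpt R (per2 Omega))) _ => a [d1 d2].
exact: pres_reflect.
Qed.

Definition swp (z : K * K) : K * K := (z.2, z.1).
Lemma pres_swp : pres (pm mu mu) swp.
Proof. exact: pres_swap. Qed.
Definition neg2 (z : K * K) : K * K := (negK z.1, negK z.2).
Lemma pres_neg2 : pres (pm mu mu) neg2.
Proof. exact: pres_prod pres_neg pres_neg. Qed.
Definition conv2 (z : K * K) : K * K := (z.1, (z.2.1 - z.1.1, z.2.2 - z.1.2)).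

Lemma pres_conv2 : pres (pm mu mu) conv2.
Proof.
have := pres_comp pres_shear (pres_prod (pres_id mu) pres_neg).
rewrite (_ : (fun x => _) = conv2)//; apply/funext => z.
by rewrite /conv2 /shear /negK /= !opprK; congr (_, (_, _)); exact: addrC.
Qed.

Lemma intg_invsq per : intg (mu1 per) (fun x : RM => (1 + x ^+ 2)^-1).
Proof.
case: per; last first.
 have [h _] := @leb_pker R 0; apply: eq_intg (intgZ 2^-1 h) => x.
 by rewrite /pker /eps invr1 expr1n; field; rewrite gt_eqF// ltr_pwDl ?sqr_ge0.
have c0 (x : R) : 0 < 1 + x ^+ 2 by rewrite ltr_pwDl ?sqr_ge0.
have mf : mfun (fun x : RM => (1 + x ^+ 2)^-1).
 apply: cont_mfun => u; apply: cvgV; first by rewrite gt_eqF.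
 by apply: cvgD; [exact: cvg_cst|exact: exprn_continuous].
apply: ge0_intg => //; first by move=> x; rewrite invr_ge0 ltW.
rewrite integral_zmeas_series; [|exact/EFinP|by move=> x; rewrite lee_fin invr_ge0 ltW].
apply: (@le_lt_trans _ _ 8%:E); last exact: ltry.
apply: lime_le; first by apply: is_cvg_nneseries => k _ _; rewrite lee_fin invr_ge0 ltW.
(* The enumeration satisfies [k <= 2 * |zenum k|], so the terms are below the telescoping
   [8 / ((k + 1) * (k + 2))]. *)
apply: nearW => N; apply: (@le_trans _ _ (\sum_(0 <= k < N) (8 * (k.+1%:R^-1 - k.+2%:R^-1))%:E)%E).
 apply: lee_sum => k _; rewrite lee_fin.
 rewrite (_ : 8 * _ = (k.+1%:R * k.+2%:R / 8)^-1); last first.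
  have h1 : k.+1%:R != 0 :> R by rewrite pnatr_eq0.
  have h2 : k.+1%:R + 1 != 0 :> R by rewrite natr1 pnatr_eq0.
  by rewrite -(natr1 k.+1); move: (k.+1%:R) h1 h2 => y h1 h2; field; rewrite ?h1 ?h2.
 have h8 : 0 < k.+1%:R * k.+2%:R / 8 :> R by rewrite divr_gt0// mulr_gt0.
 rewrite lef_pV2 ?posrE ?h8 ?c0//.
 have hz : k%:R ^+ 2 <= 4 * ((zenum k)%:~R : R) ^+ 2.
  have hk : ((k%:Z) ^+ 2 <= 4 * (zenum k) ^+ 2)%R.
   rewrite /zenum -{1}(odd_double_half k); case: (odd k) => /=.
    by move: (k./2) => n; rewrite NegzE; nia.
   by move: (k./2) => n; nia.
  by move: hk; rewrite -(ler_int R) rmorphXn rmorphM rmorphXn.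
 rewrite -(natr1 k.+1) -(natr1 k); move: (k%:R) hz => y; have := sqr_ge0 (y - 3/2); nra.
rewrite sumEFin lee_fin -mulr_sumr.
have -> : \sum_(0 <= k < N) (k.+1%:R^-1 - k.+2%:R^-1) = 1 - N.+1%:R^-1 :> R.
 elim: N => [|N ih]; first by rewrite big_nil invr1 subrr.
 by rewrite big_nat_recr//= ih; ring.
by rewrite mulrBr mulr1 gerBl mulr_ge0// invr_ge0.
Qed.

Definition J (k : K) : R := 1 + (k.1 ^+ 2 + k.2 ^+ 2).
Lemma J_ge1 k : 1 <= J k.
Proof. by rewrite lerDl addr_ge0 ?sqr_ge0. Qed.
Lemma J_gt0 k : 0 < J k.
Proof. exact: lt_le_trans (J_ge1 k). Qed.
Lemma mf_J : mfun J.
Proof. rewrite /J; mtac. Qed.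

(** [J ^+ 2] dominates the product of the two one-dimensional weights. *)
Lemma intg_J2 : intg mu (fun k => (J k ^+ 2)^-1).
Proof.
have c0 (x : R) : 0 < 1 + x ^+ 2 by rewrite ltr_pwDl ?sqr_ge0.
apply: le_intg (intgM12 (intg_invsq (per1 Omega)) (intg_invsq (per2 Omega))).
 have mJ := mf_J; apply: mf_inv; first by mtac.
 by move=> k; rewrite exprn_gt0// J_gt0.
move=> k; rewrite ger0_norm ?invr_ge0 ?sqr_ge0// -invfM lef_pV2 ?posrE ?mulr_gt0 ?exprn_gt0 ?J_gt0//.
by rewrite /J; have := sqr_ge0 k.1; have := sqr_ge0 k.2; nra.
Qed.

Definition TX (F : K -> R) : K -> R := hartley n1 n2 F.
Definition TK (H : K -> R) : K -> R := hartley (mu1 (per1 Omega)) (mu1 (per2 Omega)) H.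
Definition cF : R := ((2 * pi) ^+ 2)^-1.
Definition inv (H : K -> R) (x : K) : R := cF * TK H x.
Lemma pi2_gt0 : 0 < (2 * pi) ^+ 2 :> R.
Proof. by rewrite exprn_gt0// mulr_gt0// pi_gt0. Qed.
Lemma cF_gt0 : 0 < cF.
Proof. by rewrite invr_gt0 pi2_gt0. Qed.

Lemma plX F : intg nu F -> intg nu (fun x => F x ^+ 2) ->
 intg mu (fun k => TX F k ^+ 2) /\ \int[mu]_k (TX F k ^+ 2) = (2 * pi) ^+ 2 * \int[nu]_x (F x ^+ 2).
Proof.
have [S1 [w1 [p1 D1]]] := @dual_nu_mu R (per1 Omega).
have [S2 [w2 [p2 D2]]] := @dual_nu_mu R (per2 Omega).
exact: (plancherel D1 D2).
Qed.

Lemma plK F : intg mu F -> intg mu (fun x => F x ^+ 2) ->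
 intg nu (fun k => TK F k ^+ 2) /\ \int[nu]_k (TK F k ^+ 2) = (2 * pi) ^+ 2 * \int[mu]_x (F x ^+ 2).
Proof.
have [S1 [w1 [p1 D1]]] := @dual_mu_nu R (per1 Omega).
have [S2 [w2 [p2 D2]]] := @dual_mu_nu R (per2 Omega).
exact: (plancherel D1 D2).
Qed.

Lemma dotC (x k : K) : dot x k = dot k x.
Proof. by rewrite /dot [x.1 * _]mulrC [x.2 * _]mulrC. Qed.

Lemma hartley_adj (F H : K -> R) : intg nu F -> intg mu H -> \int[mu]_k (TX F k * H k) = \int[nu]_x (F x * TK H x).
Proof.
move=> iF iH; have mF := intg_mf iF; have mH := intg_mf iH.
have mc := @mf_casdot R.
have i1 : intg (pm mu nu) (fun z => (H z.1 * F z.2) * cas (dot z.1 z.2)).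
 exact: (intg_bdd mc (fun z => norm_cas _) (intgM12 iH iF)).
transitivity (\int[mu]_k \int[nu]_x (H k * F x * cas (dot k x))).
 apply: eq_Rint => k; rewrite mulrC /TX /hartley -RintZ.
  by apply: eq_Rint => x; rewrite dotC mulrA.
 exact: (intg_cas k iF).
rewrite (Rfubini i1); apply: eq_Rint => x /=.
rewrite /TK /hartley -RintZ; first by apply: eq_Rint => k; ring.
exact: (intg_bdd (mf_casl x) (fun x => norm_cas _) iH).
Qed.

Definition box (N : nat) : set K := [set x | `|x.1| <= N%:R /\ `|x.2| <= N%:R].

Lemma meas_box N : measurable (box N).
Proof.
have m1 : measurable ([set x | `|x| <= N%:R] : set RM).
 rewrite (_ : [set x | _] = `[- N%:R, N%:R]%classic); first exact: measurable_itv.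
 by apply/seteqP; split => x /=; rewrite in_itv /= ler_norml.
have := measurableX m1 m1; rewrite (_ : _ `*` _ = box N)//.
Qed.

Definition trc (f : K -> R) (N : nat) (x : K) : R := f x * \1_(box N) x.
Lemma ind01 (T : Type) (A : set T) x : 0 <= (\1_A x : R) <= 1.
Proof. by rewrite indicE; case: (_ \in _); rewrite ?lexx ?ler01. Qed.

Lemma intg_box N : intg nu (\1_(box N) : K -> R).
Proof.
have i1 (per : bool) : intg (rmeas leb (meas_period per)) (\1_(`](- N%:R - 1), N%:R]) : RM -> R).
 by have [S [w [p D]]] := @dual_nu_mu R per; exact: (iI D).
apply: le_intg (intgM12 (i1 _) (i1 _)).
 by apply: mf_indic; exact: meas_box.
have h (y : R) : `|y| <= N%:R -> y \in `](- N%:R - 1), N%:R]%classic.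
 by rewrite ler_norml => /andP[a b]; rewrite inE /= in_itv /=; apply/andP; split; lra.
move=> x; rewrite !indicE; case: (boolP (x \in _)) => /= [|_]; last by rewrite normr0 mulr_ge0.
by rewrite inE => -[h1 h2]; rewrite !h// mulr1 normr1.
Qed.

Lemma trc_L f N : L2 nu f -> intg nu (trc f N) /\ intg nu (fun x => trc f N x ^+ 2).
Proof.
move=> [mf if2]; have mb : mfun (\1_(box N) : K -> R) by apply: mf_indic; exact: meas_box.
have mt : mfun (trc f N) by exact: mfunM.
have h : intg nu (fun x => trc f N x ^+ 2).
 apply: le_intg if2; first exact: mfunX.
 move=> x; have /andP[a b] := ind01 (box N) x; rewrite ger0_norm ?sqr_ge0//.
 rewrite /trc exprMn ler_piMr ?sqr_ge0// expr_le1//.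
split=> //; apply: le_intg (intgD if2 (intg_box N)) => // x.
have := sqr_ge0 (`|f x| - 1); have := real_normK (num_real (f x)) => e1.
rewrite /trc normrM; rewrite indicE; case: (_ \in _) => /=; rewrite ?normr1 ?normr0 ?mulr0 ?mulr1 ?addr0 ?sqr_ge0//.
by rewrite -e1; have := normr_ge0 (f x); nra.
Qed.

Lemma trc_near f x : \forall N \near \oo, trc f N x = f x.
Proof.
exists (maxn (Num.bound `|x.1|) (Num.bound `|x.2|)) => // N /=; rewrite geq_max => /andP[h1 h2].
rewrite /trc indicE mem_set ?mulr1//; split.
 by rewrite ltW// (lt_le_trans (archi_boundP (normr_ge0 _)))// ler_nat.
by rewrite ltW// (lt_le_trans (archi_boundP (normr_ge0 _)))// ler_nat.
Qed.

Lemma trc_cvg f : L2 nu f -> \int[nu]_x (trc f N x ^+ 2) @[N --> \oo] --> \int[nu]_x (f x ^+ 2).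
Proof.
move=> Lf; have [mf if2] := Lf.
have m1 N : mfun (fun x => trc f N x ^+ 2) by have [_ /intg_mf] := trc_L N Lf.
have b1 N x : `|trc f N x ^+ 2| <= f x ^+ 2.
 have /andP[a b] := ind01 (box N) x; rewrite ger0_norm ?sqr_ge0//.
 by rewrite /trc exprMn ler_piMr ?sqr_ge0// expr_le1.
have c1 : {ae nu, forall x, trc f N x ^+ 2 @[N --> \oo] --> f x ^+ 2}.
 by apply: aeW => x; apply: cvg_near_cst; apply: filterS (trc_near f x) => N ->.
by have [] := Rint_dct m1 (mfunX 2 mf) if2 b1 c1.
Qed.

Lemma in_L2P (f : R * R -> R) : in_L2 Omega f -> L2 nu f.
Proof.
move=> [_ mf fi]; split; first exact: mf.
have mf' : mfun (f : K -> R) := mf.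
apply: ge0_intg; [exact: mfunX|by move=> x; exact: sqr_ge0|].
rewrite -cell_int//; apply/EFinP; exact: mfunX.
Qed.

(** The real counterpart of [is_fourier]: an [L2] limit of transforms of truncations, since an [L2]
    function on the plane need not be integrable. *)
Definition isH (f : R * R -> R) (H : K -> R) := [/\ in_L2 Omega f, L2 mu H &
 \int[mu]_k ((H k - TX (trc f N) k) ^+ 2) @[N --> \oo] --> (0 : R)].

Lemma TX_L2 f N : L2 nu f -> L2 mu (TX (trc f N)).
Proof.
move=> Lf; have [i1 i2] := trc_L N Lf; split; last by have [] := plX i1 i2.
by apply: mf_hartley; exact: intg_mf i1.
Qed.

Lemma le0_cvg (x : R) (u : nat -> R) : u N @[N --> \oo] --> (0 : R) -> (forall N, x <= u N) -> x <= 0.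
Proof.
move=> hu h; have := hu; move/cvg_lim => <- //.
by apply: limr_ge; [exact: (cvgP _ hu)|exact: nearW].
Qed.

Lemma L2_dist d (T : measurableType d) (m : sfmeas T R) (f g h : T -> R) :
 L2 m (fun x => f x - h x) -> L2 m (fun x => g x - h x) ->
 \int[m]_x ((f x - g x) ^+ 2) <= 2 * \int[m]_x ((f x - h x) ^+ 2) + 2 * \int[m]_x ((g x - h x) ^+ 2).
Proof.
move=> h1 h2; have [m3 i3] := L2B h1 h2; have [m1 i1] := h1; have [m2 i2] := h2.
rewrite -!RintZ// -RintD; [|exact: intgZ|exact: intgZ].
apply: le_Rint; [|by apply: intgD; exact: intgZ|].
 by apply: eq_intg i3 => x; congr (_ ^+ 2); ring.
by move=> x; have := sqr_ge0 ((f x - h x) + (g x - h x)); nra.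
Qed.

Lemma L2_eq0 d (T : measurableType d) (m : sfmeas T R) (f : T -> R) :
 L2 m f -> \int[m]_x (f x ^+ 2) <= 0 -> {ae m, forall x, f x = 0}.
Proof.
move=> [mf if2] h; have e : \int[m]_x (f x ^+ 2) = 0.
 by apply/eqP; rewrite eq_le h Rint_ge0// => x; exact: sqr_ge0.
apply: ae1 (Rint_eq0 if2 _ e) _ => [x|x /eqP]; first exact: sqr_ge0.
by rewrite sqrf_eq0 => /eqP.
Qed.

Lemma cvg_twice (u v : nat -> R) : u N @[N --> \oo] --> (0 : R) -> v N @[N --> \oo] --> (0 : R) ->
 2 * u N + 2 * v N @[N --> \oo] --> (0 : R).
Proof.
move=> hu hv; apply: (@cvg_eq _ _ (2 * 0 + 2 * 0)); last by ring.
by apply: cvgD; apply: cvgM => //; exact: cvg_cst.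
Qed.

Lemma isH_unique f H H' : isH f H -> isH f H' -> {ae mu, forall k, H k = H' k}.
Proof.
move=> [Lf LH c1] [_ LH' c2]; have Lf' := in_L2P Lf.
have h := L2_eq0 (L2B LH LH') (le0_cvg (cvg_twice c1 c2) _).
apply: ae1 (h _) _ => [N|k /eqP]; last by rewrite subr_eq0 => /eqP.
by apply: L2_dist; apply: L2B => //; exact: TX_L2.
Qed.

Lemma mf_TK H : mfun H -> mfun (TK H).
Proof. exact: mf_hartley. Qed.

Lemma inv_L2 H : intg mu H -> L2 mu H -> L2 nu (inv H).
Proof.
move=> iH [mH iH2]; apply: L2Z; split; first exact: mf_TK.
by have [] := plK iH iH2.
Qed.

Lemma cas_int (y : R) (n : int) : cas (y + 2 * pi * n%:~R) = cas y.
Proof.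
rewrite [2 * pi * _]mulrC /cas; congr (_ + _).
 exact: (periodic_int (@cosD2pi R)).
exact: (periodic_int (@sinD2pi R)).
Qed.

Lemma inv_domain H : mfun H -> on_domain Omega (inv H).
Proof.
move=> mH; have ae := ae_prod (@ae_dualpt R (per1 Omega)) (@ae_dualpt R (per2 Omega)).
have h (x y : K) : (forall k : K, dualpt (per1 Omega) k.1 -> dualpt (per2 Omega) k.2 ->
  cas (dot x k) = cas (dot y k)) -> inv H x = inv H y.
 move=> e; rewrite /inv /TK /hartley; congr (_ * _); apply: ae_Rint.
 - by mtac.
 - by mtac.
 - by apply: ae1 ae _ => k [d1 d2]; rewrite dotC e// dotC.
split=> per x; apply: h => k d1 d2.
 have [n kn] := d1 per; rewrite /dot /= kn -[RHS](cas_int _ n); congr cas; ring.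
have [n kn] := d2 per; rewrite /dot /= kn -[RHS](cas_int _ n); congr cas; ring.
Qed.

Lemma in_L2_of (f : R * R -> R) : on_domain Omega f -> L2 nu f -> in_L2 Omega f.
Proof.
move=> df [mf if2]; split; [exact: df|exact: mf|].
have m2 : mfun (EFin \o (fun x => f x ^+ 2) : K -> \bar R).
 by apply/EFinP; exact: mfunX.
by rewrite (cell_int Omega m2) (_ : integral _ _ _ = (\int[nu]_x (f x ^+ 2)%:E)%E)// RintE// ltry.
Qed.

Lemma inv_in_L2 H : intg mu H -> L2 mu H -> in_L2 Omega (inv H).
Proof.
by move=> iH LH; apply: in_L2_of; [apply: inv_domain; exact: intg_mf iH|exact: inv_L2].
Qed.

(** Expanding the square, the cross term is moved to the position side by [hartley_adj], where it is
    a multiple of the squared norm of the truncation. What remains is [\int H ^+ 2] minus a quantity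
    that increases to it, by Plancherel for [TK]. *)
Lemma isH_inv H : intg mu H -> L2 mu H -> isH (inv H) H.
Proof.
move=> iH LH; have [mH iH2] := LH; have Lf := inv_L2 iH LH; have [mf if2] := Lf.
split=> //; first exact: inv_in_L2.
have e N : \int[mu]_k ((H k - TX (trc (inv H) N) k) ^+ 2) =
  \int[mu]_k (H k ^+ 2) - (2 * pi) ^+ 2 * \int[nu]_x (trc (inv H) N x ^+ 2).
 have [mT iT2] := TX_L2 N Lf; have [i1 i2] := trc_L N Lf.
 have iTH := intg_sqM mT mH iT2 iH2.
 transitivity (\int[mu]_k (H k ^+ 2 - 2 * (TX (trc (inv H) N) k * H k) + TX (trc (inv H) N) k ^+ 2)).
  by apply: eq_Rint => k; ring.
 rewrite RintD//; last by apply: intgB => //; exact: intgZ.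
 rewrite RintB//; last exact: intgZ.
 rewrite RintZ// hartley_adj//; have [_ ->] := plX i1 i2.
 have -> : \int[nu]_x (trc (inv H) N x * TK H x) = (2 * pi) ^+ 2 * \int[nu]_x (trc (inv H) N x ^+ 2).
  rewrite -RintZ//; apply: eq_Rint => x.
  rewrite /trc /inv /cF indicE; case: (_ \in _) => /=; last by rewrite mulr0 mul0r expr0n mulr0.
  by have := pi2_gt0; move: ((2 * pi) ^+ 2) => y y0; field; rewrite gt_eqF.
 ring.
under eq_fun do rewrite e.
have [_ pl] := plK iH iH2.
apply: (@cvg_eq _ _ (\int[mu]_k (H k ^+ 2) - (2 * pi) ^+ 2 * \int[nu]_x (inv H x ^+ 2))).
 by apply: cvgB; [exact: cvg_cst|apply: cvgM; [exact: cvg_cst|exact: trc_cvg]].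
have -> : \int[nu]_x (inv H x ^+ 2) = cF ^+ 2 * \int[nu]_x (TK H x ^+ 2).
 rewrite -RintZ; first by apply: eq_Rint => x; rewrite exprMn.
 by have [] := plK iH iH2.
rewrite pl /cF; have h0 : (2 * pi) ^+ 2 != 0 :> R by rewrite gt_eqF// pi2_gt0.
by move: ((2 * pi) ^+ 2) h0 => y y0; field.
Qed.

Lemma isH_norm f H : isH f H -> (2 * pi) ^+ 2 * \int[nu]_x (f x ^+ 2) <= 2 * \int[mu]_k (H k ^+ 2).
Proof.
move=> [/in_L2P Lf LH c0]; have c1 := trc_cvg Lf.
suff h N : (2 * pi) ^+ 2 * \int[nu]_x (trc f N x ^+ 2) <= 2 * \int[mu]_k (H k ^+ 2) +
  2 * \int[mu]_k ((H k - TX (trc f N) k) ^+ 2).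
 have c2 : (2 * pi) ^+ 2 * \int[nu]_x (trc f N x ^+ 2) @[N --> \oo] --> (2 * pi) ^+ 2 * \int[nu]_x (f x ^+ 2).
  by apply: cvgM => //; exact: cvg_cst.
 have c3 : 2 * \int[mu]_k (H k ^+ 2) + 2 * \int[mu]_k ((H k - TX (trc f N) k) ^+ 2) @[N --> \oo] -->
   2 * \int[mu]_k (H k ^+ 2).
  apply: (@cvg_eq _ _ (2 * \int[mu]_k (H k ^+ 2) + 2 * 0)); last by rewrite mulr0 addr0.
  by apply: cvgD; [exact: cvg_cst|apply: cvgM => //; exact: cvg_cst].
 by apply: (ler_cvg_to c2 c3); exact: nearW.
have [i1 i2] := trc_L N Lf; have [_ <-] := plX i1 i2.
have LT := TX_L2 N Lf; have [mD iD] := L2B LH LT.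
rewrite -!RintZ//; [|by case: LH]; rewrite -RintD; [|by apply: intgZ; case: LH|exact: intgZ].
apply: le_Rint; [by case: LT|by apply: intgD; apply: intgZ => //; case: LH|].
by move=> k; have := sqr_ge0 (2 * H k - TX (trc f N) k); nra.
Qed.

(** The transforms of the truncations of [f - f'] tend to 0, and Plancherel carries this back to the
    truncations themselves. *)
Lemma isH_inj f f' H : isH f H -> isH f' H -> {ae nu, forall x, f x = f' x}.
Proof.
move=> [/in_L2P Lf LH c1] [/in_L2P Lf' _ c2].
have Ld := L2B Lf Lf'.
have h : \int[nu]_x ((f x - f' x) ^+ 2) <= 0.
 have c3 := trc_cvg Ld.
 suff c4 : \int[nu]_x (trc (fun x => f x - f' x) N x ^+ 2) @[N --> \oo] --> (0 : R).
  by rewrite (cvg_unique _ c3 c4).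
 have k N : 0 <= \int[nu]_x (trc (fun x => f x - f' x) N x ^+ 2) <=
   cF * (2 * \int[mu]_k ((H k - TX (trc f N) k) ^+ 2) + 2 * \int[mu]_k ((H k - TX (trc f' N) k) ^+ 2)).
  rewrite Rint_ge0 /=; last by move=> x; exact: sqr_ge0.
  have [i1 i2] := trc_L N Ld; have [_ pl] := plX i1 i2.
  rewrite /cF mulrC ler_pdivlMr ?pi2_gt0// mulrC -pl.
  have LT := TX_L2 N Lf; have LT' := TX_L2 N Lf'.
  have hd := L2_dist (L2B LT LH) (L2B LT' LH).
  apply: le_trans (le_trans _ hd) _.
  - apply: eq_ler; apply: eq_Rint => k; congr (_ ^+ 2).
   have [j1 _] := trc_L N Lf; have [j2 _] := trc_L N Lf'.
   rewrite /TX /hartley -RintB; [|exact: (intg_cas k j1)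
    |exact: (intg_cas k j2)].
   by apply: eq_Rint => x; rewrite /trc; ring.
  - apply: eq_ler.
   by congr (_ * _ + _ * _); apply: eq_Rint => k; ring.
 apply: (@squeeze_cvgr _ _ _ _ (cst 0) (fun N => cF * (2 * \int[mu]_k ((H k - TX (trc f N) k) ^+ 2) +
   2 * \int[mu]_k ((H k - TX (trc f' N) k) ^+ 2)))); [exact: nearW|exact: cvg_cst|].
 apply: (@cvg_eq _ _ (cF * 0)); last by rewrite mulr0.
 have c5 := cvg_twice c1 c2.
 by apply: cvgM; [exact: cvg_cst|exact: c5].
by apply: ae1 (L2_eq0 Ld h) _ => x /eqP; rewrite subr_eq0 => /eqP.
Qed.

Lemma isH_eq f H : isH f H -> intg mu H -> {ae nu, forall x, f x = inv H x}.
Proof. by move=> hf iH; have [_ LH _] := hf; exact: (isH_inj hf (isH_inv iH LH)). Qed.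
(** The Fourier transform of a real function from its Hartley transform: the even part is the real
    part, the odd part is minus the imaginary part. *)
Definition herm (H : K -> R) (k : K) : R[i] := Complex ((H k + H (negK k)) / 2) (- ((H k - H (negK k)) / 2)).

Lemma truncE (f : R * R -> R) N k : L2 nu f -> trunc_fourier Omega f N k = herm (TX (trc f N)) k.
Proof.
move=> Lf; have [i1 _] := trc_L N Lf; have [mf _] := Lf.
have md (h : RM -> R) : mfun h -> mfun (fun x : K => h (dot x k)).
 by move=> mh; apply: (mfcomp mh); rewrite /dot; mtac.
have e (h : RM -> R) : mfun h -> \int[leb2 R]_(x in cell Omega `&` box N) (f x * h (dot x k)) =
  \int[nu]_x (trc f N x * h (dot x k)).
 move=> mh; have m1 := md _ mh.
 have mb : mfun (\1_(box N) : K -> R) by apply: mf_indic; exact: meas_box.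
 have m2 : mfun (fun x : K => trc f N x * h (dot x k)).
  exact: (mfunM (intg_mf i1) m1).
 rewrite -cell_Rint// Rintegral_mkcondr; congr Rintegral; apply/funext => x.
 by rewrite patchE /trc indicE; case: (_ \in _); rewrite ?mulr1// mulr0 mul0r.
rewrite /trunc_fourier /herm -/(box N) (e _ mf_cos) (e _ mf_sin).
have b1 (x : K) : `|cos (dot x k)| <= 1 := norm_cos_le1 _.
have b2 (x : K) : `|sin (dot x k)| <= 1 := norm_sin_le1 _.
have ic := intg_bdd (md _ mf_cos) b1 i1.
have is_ := intg_bdd (md _ mf_sin) b2 i1.
have eT : TX (trc f N) k = \int[nu]_x (trc f N x * cos (dot x k)) + \int[nu]_x (trc f N x * sin (dot x k)).
 by rewrite -RintD//; apply: eq_Rint => x; rewrite /cas mulrDr.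
have eT' : TX (trc f N) (negK k) = \int[nu]_x (trc f N x * cos (dot x k)) - \int[nu]_x (trc f N x * sin (dot x k)).
 rewrite -RintB//; apply: eq_Rint => x; rewrite /cas (_ : dot x (negK k) = - dot x k).
  by rewrite cosN sinN mulrBr.
 by rewrite /dot /=; ring.
by rewrite eT eT'; congr Complex; field.
Qed.

Lemma mf_hermR H : mfun H -> mfun (fun k => complex.Re (herm H k)) /\ mfun (fun k => complex.Im (herm H k)).
Proof.
move=> mH; have [mn _] := pres_neg; have mHn := mfcomp mH mn.
split; rewrite /=.
 by mtac.
by mtac.
Qed.

Lemma sqnorm_herm H T k : sqnormC (herm H k - herm T k) = ((H k - T k) ^+ 2 + (H (negK k) - T (negK k)) ^+ 2) / 2.
Proof. by rewrite /sqnormC /=; field. Qed.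

Lemma mf_sqnorm (g h : K -> R[i]) :
 mfun (fun k => complex.Re (g k)) -> mfun (fun k => complex.Im (g k)) ->
 mfun (fun k => complex.Re (h k)) -> mfun (fun k => complex.Im (h k)) -> mfun (fun k => sqnormC (g k - h k)).
Proof.
move=> m1 m2 m3 m4.
rewrite (_ : (fun k => _) = (fun k => (complex.Re (g k) - complex.Re (h k)) ^+ 2 + (complex.Im (g k) - complex.Im (h k)) ^+ 2)).
 by mtac.
by apply/funext => k; rewrite /sqnormC; case: (g k) (h k) => [a b] [c d].
Qed.

Lemma sqnormC_ge0 (z : R[i]) : 0 <= sqnormC z.
Proof. by rewrite addr_ge0// sqr_ge0. Qed.

Lemma intg_refl2 (q : K -> R) : intg mu q -> intg mu (fun k => (q k + q (negK k)) / 2) /\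
 \int[mu]_k ((q k + q (negK k)) / 2) = \int[mu]_k q k.
Proof.
move=> iq; have iq' := pres_intg (pres_neg) iq.
have h : intg mu (fun k => 2^-1 * (q k + q (negK k))) by apply: intgZ; exact: intgD.
split; first by apply: eq_intg h => k; rewrite mulrC.
transitivity (\int[mu]_k (2^-1 * (q k + q (negK k)))); first by apply: eq_Rint => k; rewrite mulrC.
rewrite RintZ; last exact: intgD.
by rewrite RintD// (pres_Rint (pres_neg) (intg_mf iq)); field.
Qed.

Lemma isH_fourier f H : isH f H -> is_fourier Omega f (herm H).
Proof.
move=> [fL2 LH c0]; have Lf := in_L2P fL2; have [mH _] := LH.
have [mR mI] := mf_hermR mH.
split=> //.
have e N : dual_int Omega (fun k => (sqnormC (herm H k - trunc_fourier Omega f N k))%:E) =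
  (\int[mu]_k ((H k - TX (trc f N) k) ^+ 2))%:E.
 have [mT _] := TX_L2 N Lf; have [mTR mTI] := mf_hermR mT.
 have [_ iD] := L2B LH (TX_L2 N Lf).
 rewrite (_ : (fun k => _) = (fun k => (sqnormC (herm H k - herm (TX (trc f N)) k))%:E)); last first.
  by apply/funext => k; rewrite truncE.
 rewrite dual_intE; [|apply/EFinP; exact: mf_sqnorm|by move=> k; rewrite lee_fin sqnormC_ge0].
 have [i2 <-] := intg_refl2 iD.
 rewrite -RintE//; apply: eq_integral => k _; by rewrite sqnorm_herm.
by rewrite (_ : (fun N => _) = (fun N => (\int[mu]_k ((H k - TX (trc f N) k) ^+ 2))%:E));
 [exact: cvgEFin|exact/funext].
Qed.

Definition hreal (g : K -> R[i]) (k : K) := complex.Re (g k) - complex.Im (g k).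

(** A given [g] is only an [L2] limit and not known to be Hermitian. It is compared with the
    Hermitian transforms of truncations, which shows that [Re - Im] loses no information almost
    everywhere. *)
Lemma fourier_isH f g : is_fourier Omega f g -> isH f (hreal g) /\ {ae mu, forall k, g k = herm (hreal g) k}.
Proof.
move=> [fL2 mR mI c0]; have Lf := in_L2P fL2.
pose s N (k : K) := sqnormC (g k - herm (TX (trc f N)) k).
have ms N : mfun (s N).
 have [mT _] := TX_L2 N Lf; have [mTR mTI] := mf_hermR mT; exact: mf_sqnorm.
have s0 N k : 0 <= s N k by exact: sqnormC_ge0.
have {}c0 : (\int[mu]_k (s N k)%:E)%E @[N --> \oo] --> 0%E.
 move: c0; rewrite (_ : (fun N => _) = (fun N => (\int[mu]_k (s N k)%:E)%E))//.
 apply/funext => N; rewrite -dual_intE; [|by apply/EFinP; exact: ms|by move=> k; rewrite lee_fin; exact: s0].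
 by congr (dual_int _ _); apply/funext => k; rewrite truncE.
have /fine_cvgP[fin c1] := c0.
have is_ : \forall N \near \oo, intg mu (s N).
 by apply: filterS fin => N hN; apply: (ge0_intg (ms N) (s0 N)); rewrite ltey; move: hN; rewrite fin_numE => /andP[].
have {}c1 : \int[mu]_k s N k @[N --> \oo] --> (0 : R) := c1.
pose e N (k : K) := hreal g k - TX (trc f N) k.
have mh : mfun (hreal g) by exact: mfunB.
have me N : mfun (e N) by apply: mfunB => //; have [] := TX_L2 N Lf.
have es N k : e N k ^+ 2 <= 2 * s N k.
 rewrite /e /s /hreal /sqnormC; case: (g k) => a b /=.
 set T := TX _ k; set T' := TX _ _.
 have -> : a - b - T = (a - (T + T') / 2) - (b + (T - T') / 2) by field.
 move: (a - (T + T') / 2) => u; rewrite opprK; move: (b + _) => v.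
 by have := sqr_ge0 (u + v); nra.
have ie : \forall N \near \oo, intg mu (fun k => e N k ^+ 2).
 apply: filterS is_ => N hN; apply: le_intg (intgZ 2 hN); first exact: mfunX.
 by move=> k; rewrite ger0_norm ?sqr_ge0.
have Lh : L2 mu (hreal g).
 split=> //; have [N _ hN] := ie; have [mT iT] := TX_L2 N Lf.
 apply: le_intg (intgD (intgZ 2 (hN N (leqnn N))) (intgZ 2 iT)); first exact: mfunX.
 by move=> k; rewrite ger0_norm ?sqr_ge0// /e; have := sqr_ge0 (hreal g k - 2 * TX (trc f N) k); nra.
have ie' N : intg mu (fun k => e N k ^+ 2) by have [] := L2B Lh (TX_L2 N Lf).
split.
 split=> //; apply: (@squeeze_cvgr _ _ _ _ (cst 0) (fun N => 2 * \int[mu]_k s N k)).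
 - apply: filterS is_ => N hN; rewrite Rint_ge0 /=; last by move=> k; exact: sqr_ge0.
  rewrite -RintZ//; exact: (le_Rint (ie' N) (intgZ 2 hN) (es N)).
 - exact: cvg_cst.
 - by apply: (@cvg_eq _ _ (2 * 0)); [apply: cvgM => //; exact: cvg_cst|rewrite mulr0].
pose q (k : K) := sqnormC (g k - herm (hreal g) k).
have mq : mfun q by have [? ?] := mf_hermR mh; exact: mf_sqnorm.
have qb N k : q k <= 4 * s N k + 2 * s N (negK k).
 have := es N k; have := es N (negK k).
 set sm := s N (negK k); rewrite /q /s /e /sqnormC; case: (g k) => a b /=.
 set T := TX _ k; set T' := TX _ _; set h := hreal g k; set h' := hreal g _.
 move=> h1 h2.
 set u := a - (T + T') / 2 in h2 *; set v := b - - ((T - T') / 2) in h2 *.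
 have -> : a - (h + h') / 2 = u - ((h - T) + (h' - T')) / 2 by rewrite /u; field.
 have -> : b - - ((h - h') / 2) = v + ((h - T) - (h' - T')) / 2 by rewrite /v; field.
 move: (h - T) (h' - T') h1 h2 => x y h1 h2.
 have h3 := sqr_ge0 (u + (x + y) / 2); have h4 := sqr_ge0 (v - (x - y) / 2); nra.
have iq : intg mu q.
 have [N _ hN] := is_; have iN := hN N (leqnn N).
 apply: le_intg (intgD (intgZ 4 iN) (intgZ 2 (pres_intg (pres_neg) iN))) => // k.
 by rewrite ger0_norm ?sqnormC_ge0.
have q0 : \int[mu]_k q k <= 0.
 have [N0 _ hN] := is_.
 apply: (@le0_cvg _ (fun N => 6 * \int[mu]_k s (N + N0)%N k)).
  apply: (@cvg_eq _ _ (6 * 0)); last by rewrite mulr0.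
  apply: cvgM; first exact: cvg_cst.
  by rewrite (cvg_shiftn N0 (fun N => \int[mu]_k s N k)).
 move=> N; have iN := hN (N + N0)%N (leq_addl _ _).
 have iN' := pres_intg (pres_neg) iN.
 rewrite (_ : 6 * _ = 4 * \int[mu]_k s (N + N0)%N k + 2 * \int[mu]_k s (N + N0)%N k); last by ring.
 rewrite -{2}(pres_Rint pres_neg (ms (N + N0)%N)) -(RintZ 4 iN) -(RintZ 2 iN') -RintD; [|exact: intgZ|exact: intgZ].
 exact: (le_Rint iq (intgD (intgZ 4 iN) (intgZ 2 iN')) (qb _)).
have {}q0 : \int[mu]_k q k = 0 by apply/eqP; rewrite eq_le q0 Rint_ge0// => k; exact: sqnormC_ge0.
apply: ae1 (Rint_eq0 iq (fun k => sqnormC_ge0 _) q0) _ => k /eqP.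
rewrite /q /sqnormC paddr_eq0 ?sqr_ge0// !sqrf_eq0.
case: (g k) => a b; rewrite /herm /= => /andP[/eqP h1 /eqP h2].
by apply/eqP; rewrite eq_complex /=; apply/andP; split; apply/eqP; lra.
Qed.

(** * Pointwise bounds on the logarithm, the Sobolev weight and their commutators *)

Section Symbols.

Implicit Types (a b k : K).

Definition cr a b : R := a.1 * b.2 - a.2 * b.1.
Definition third a k : K := (- a.1 - k.1, - a.2 - k.2).
Definition Lw k : R := log_symbol (norm2 k).
Definition jap k : R := 1 + norm2 k.
Lemma norm2_ge0 k : 0 <= norm2 k.
Proof. exact: sqrtr_ge0. Qed.
Lemma norm2_sq k : norm2 k ^+ 2 = k.1 ^+ 2 + k.2 ^+ 2.
Proof. by rewrite sqr_sqrtr// addr_ge0// sqr_ge0. Qed.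
Lemma norm2_neg k : norm2 (negK k) = norm2 k.
Proof. by rewrite /norm2 /= !sqrrN. Qed.

Lemma le_sq (x y : R) : 0 <= y -> x ^+ 2 <= y ^+ 2 -> x <= y.
Proof.
move=> y0 h; rewrite leNgt; apply/negP => yx.
suff : y ^+ 2 < x ^+ 2 by rewrite ltNge h.
by rewrite ltr_pXn2r// nnegrE ltW// (le_lt_trans y0).
Qed.

Lemma cr_le a b : `|cr a b| <= norm2 a * norm2 b.
Proof.
apply: le_sq; first by rewrite mulr_ge0 ?norm2_ge0.
rewrite real_normK ?num_real// exprMn !norm2_sq /cr.
by have := sqr_ge0 (a.1 * b.1 + a.2 * b.2); nra.
Qed.

Lemma norm2_tri a b k : k.1 = - a.1 - b.1 -> k.2 = - a.2 - b.2 -> norm2 k <= norm2 a + norm2 b.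
Proof.
move=> e1 e2; apply: le_sq; first by rewrite addr_ge0 ?norm2_ge0.
rewrite sqrrD !norm2_sq e1 e2.
have h : a.1 * b.1 + a.2 * b.2 <= norm2 a * norm2 b.
 apply: le_sq; first by rewrite mulr_ge0 ?norm2_ge0.
 by rewrite exprMn !norm2_sq; have := sqr_ge0 (cr a b); rewrite /cr; nra.
by nra.
Qed.

Lemma norm2_conv a k : norm2 k <= norm2 a + norm2 (k.1 - a.1, k.2 - a.2).
Proof. by rewrite -(norm2_neg a) -(norm2_neg (k.1 - a.1, k.2 - a.2)); apply: norm2_tri => /=; ring. Qed.
Lemma jap_ge1 k : 1 <= jap k.
Proof. by rewrite lerDl norm2_ge0. Qed.
Lemma jap_gt0 k : 0 < jap k.
Proof. exact: lt_le_trans (jap_ge1 k). Qed.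
Lemma norm2_jap k : norm2 k <= jap k.
Proof. by rewrite lerDr. Qed.
Lemma ln_le (x y : R) : 0 < x -> x <= y -> ln x <= ln y.
Proof. by move=> x0 xy; rewrite ler_ln ?posrE// (lt_le_trans x0). Qed.

Lemma ln_dist (x y : R) : 0 < x -> x <= y -> ln y - ln x <= (y - x) / x.
Proof.
move=> x0 xy; have y0 := lt_le_trans x0 xy.
rewrite -ln_div ?posrE// (_ : (y - x) / x = y / x - 1); last by field; rewrite gt_eqF.
have p : 0 < y / x by rewrite divr_gt0.
by have := @le_ln1Dx R (y / x - 1); rewrite subrKC => h; apply: h; lra.
Qed.

Lemma ln10 : 1 / 2 <= ln (10 : R).
Proof.
have := @le_ln1Dx R (10^-1 - 1); rewrite subrKC lnV ?posrE// => h.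
have h1 : (-1 : R) < 10^-1 - 1 by lra.
have := h h1; lra.
Qed.

Lemma log_ge (x : R) : 0 <= x -> 1 / 2 <= ln (10 + x).
Proof. by move=> x0; apply: le_trans ln10 _; apply: ln_le; lra. Qed.
Lemma Lw_ge k : 1 / 2 <= Lw k.
Proof. exact/log_ge/norm2_ge0. Qed.
Lemma Lw_gt0 k : 0 < Lw k.
Proof. by have := Lw_ge k; lra. Qed.

Lemma Lw_le k : Lw k <= 9 * jap k.
Proof.
have k0 := norm2_ge0 k; have h := @ln_dist 1 (10 + norm2 k).
by have := h ltr01; rewrite ln1 /Lw /log_symbol /jap; lra.
Qed.

Lemma Lw_neg k : Lw (negK k) = Lw k.
Proof. by rewrite /Lw norm2_neg. Qed.

Lemma mf_norm2 : mfun (norm2 : K -> R).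
Proof.
have h : mfun (fun k : K => k.1 ^+ 2 + k.2 ^+ 2) by mtac.
apply: (@mfcomp _ _ _ _ _ _ (@Num.sqrt R) _ _ _ h).
by apply: cont_mfun; exact: sqrt_continuous.
Qed.

Lemma mf_Lw : mfun (Lw : K -> R).
Proof.
apply: (@mfcomp _ _ _ _ _ _ (@ln R) _ (fun k : K => 10 + norm2 k)).
 by mtac.
by have h := mf_norm2; mtac.
Qed.

Lemma mf_jap : mfun (jap : K -> R).
Proof. by apply: mfunD => //; exact: mf_norm2. Qed.
Lemma cr_third a k : cr a (third a k) = - cr a k.
Proof. by rewrite /cr /third /=; ring. Qed.
Lemma crC a k : cr k a = - cr a k.
Proof. by rewrite /cr /=; ring. Qed.

Lemma jap_conv a k : jap k <= jap a * jap (k.1 - a.1, k.2 - a.2).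
Proof.
have := norm2_conv a k; have := norm2_ge0 a; have := norm2_ge0 (k.1 - a.1, k.2 - a.2).
by rewrite /jap; nra.
Qed.

Lemma jap_conv'' a k : jap a <= jap (k.1 - a.1, k.2 - a.2) * jap k.
Proof.
have h : norm2 a <= norm2 (k.1 - a.1, k.2 - a.2) + norm2 k.
 by rewrite -(norm2_neg k); apply: norm2_tri => /=; ring.
have := norm2_ge0 k; have := norm2_ge0 (k.1 - a.1, k.2 - a.2).
by rewrite /jap; nra.
Qed.

(** Since [cr] is alternating, either argument may be replaced by the difference of the two. This
    and the next two bounds differ only in which frequencies carry the powers. *)
Lemma sym_bd1 a k : `|Lw a * cr a k| <= 9 * (jap a ^+ 2 * jap (k.1 - a.1, k.2 - a.2)).
Proof.
rewrite normrM (ger0_norm (ltW (Lw_gt0 a))).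
have -> : cr a k = cr a (k.1 - a.1, k.2 - a.2) by rewrite /cr /=; ring.
apply: (@le_trans _ _ (9 * jap a * (jap a * jap (k.1 - a.1, k.2 - a.2)))); last by apply: eq_ler; ring.
apply: ler_pM; rewrite ?(ltW (Lw_gt0 a)) ?Lw_le// (le_trans (cr_le _ _))//.
by apply: ler_pM; rewrite ?norm2_ge0 ?norm2_jap.
Qed.

Lemma sym_bd2 a k : `|Lw a * cr a k| <= 9 * (jap (k.1 - a.1, k.2 - a.2) ^+ 2 * jap k ^+ 2).
Proof.
rewrite normrM (ger0_norm (ltW (Lw_gt0 a))).
have -> : cr a k = cr k (k.1 - a.1, k.2 - a.2) by rewrite /cr /=; ring.
have h := jap_conv'' a k; set b := (_, _) in h *.
apply: (@le_trans _ _ (9 * (jap b * jap k) * (jap k * jap b))); last by apply: eq_ler; ring.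
apply: ler_pM; rewrite ?(ltW (Lw_gt0 a)) ?normr_ge0//.
 by rewrite (le_trans (Lw_le a))// ler_pM2l.
rewrite (le_trans (cr_le _ _))//.
by apply: ler_pM; rewrite ?norm2_ge0 ?norm2_jap.
Qed.

Lemma sym_bd3 a k : `|Lw a * cr a k| <= 9 * (jap a ^+ 2 * jap k).
Proof.
rewrite normrM (ger0_norm (ltW (Lw_gt0 a))).
apply: (@le_trans _ _ (9 * jap a * (jap a * jap k))); last by apply: eq_ler; ring.
apply: ler_pM; rewrite ?(ltW (Lw_gt0 a)) ?Lw_le// (le_trans (cr_le _ _))//.
by apply: ler_pM; rewrite ?norm2_ge0 ?norm2_jap.
Qed.

Lemma Lw_dist a b (x : R) : norm2 b <= norm2 a -> norm2 a <= norm2 b + x -> `|Lw a - Lw b| <= x / (10 + norm2 b).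
Proof.
move=> ba ax; have b0 := norm2_ge0 b.
have h0 : Lw b <= Lw a by apply: ln_le; lra.
rewrite ger0_norm ?subr_ge0//.
have h := @ln_dist (10 + norm2 b) (10 + norm2 a).
apply: le_trans (h _ _) _; [lra|lra|].
by rewrite ler_wpM2r ?invr_ge0; lra.
Qed.

(** Write [b] for the third frequency. Then [|cr a k|] is at most [|b|] times the smaller of [|a|]
    and [|k|], while the logarithms differ by at most [|b|] divided by 10 plus that smaller modulus.
    The commutator thus leaves no derivative on [a] or [k]. *)
Lemma sym_bd4 a k : `|(Lw a - Lw k) * cr a k| <= norm2 (third a k) ^+ 2.
Proof.
have gen a' k' : norm2 k' <= norm2 a' -> `|(Lw a' - Lw k') * cr a' k'| <= norm2 (third a' k') ^+ 2.
 move=> ka; have h1 : norm2 a' <= norm2 k' + norm2 (third a' k').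
  by rewrite addrC; apply: norm2_tri; rewrite /third /=; ring.
 have h2 := Lw_dist ka h1.
 have -> : cr a' k' = cr k' (third a' k') by rewrite /cr /third /=; ring.
 rewrite normrM; apply: (@le_trans _ _ (norm2 (third a' k') / (10 + norm2 k') * (norm2 k' * norm2 (third a' k')))).
  by apply: ler_pM => //; exact: cr_le.
 have := norm2_ge0 k'; have := norm2_ge0 (third a' k'); move: (norm2 (third _ _)) (norm2 k') => y x y0 x0.
 rewrite (_ : _ * _ = y ^+ 2 * (x / (10 + x))); last by field; rewrite gt_eqF//; lra.
 by rewrite ler_piMr ?sqr_ge0// ler_pdivrMr; lra.
have [|/ltW] := leP (norm2 k) (norm2 a); first exact: gen.
move/gen; rewrite crC (_ : third k a = third a k); last by rewrite /third; congr (_, _); ring.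
by rewrite mulrN normrN -normrN -mulNr opprB.
Qed.

Section Weight.
Variable s : R.
Hypothesis s4 : 4 < s.

Definition Wt k : R := J k `^ s.
Lemma norm2_J k : 1 + norm2 k ^+ 2 = J k.
Proof. by rewrite norm2_sq. Qed.
Lemma Wt_gt0 k : 0 < Wt k.
Proof. by rewrite powR_gt0// J_gt0. Qed.

Lemma Wt_ge1 k : 1 <= Wt k.
Proof.
have h4 := s4.
rewrite -(powRr0 (J k)); apply: ler_powR; last lra.
exact: J_ge1.
Qed.

Lemma Wt_neg k : Wt (negK k) = Wt k.
Proof. by rewrite /Wt /J /= !sqrrN. Qed.
Lemma J_jap k : jap k ^+ 2 <= 2 * J k.
Proof. by rewrite -norm2_J /jap; have := sqr_ge0 (norm2 k - 1); nra. Qed.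
Lemma J_le_jap k : J k <= jap k ^+ 2.
Proof. by rewrite -norm2_J /jap; have := norm2_ge0 k; nra. Qed.

(** Here [4 < s] is used: the weight dominates [J ^+ 4], and [jap ^+ 2 <= 2 * J]. *)
Lemma Wt_jap k : jap k ^+ 8 <= 16 * Wt k.
Proof.
have h4 := s4.
have h : J k ^+ 4 <= Wt k.
 by rewrite -powR_mulrn ?(ltW (J_gt0 k))//; apply: ler_powR; [exact: J_ge1|lra].
apply: (@le_trans _ _ (16 * J k ^+ 4)); last by rewrite ler_pM2l.
rewrite (_ : 16 * _ = (2 * J k) ^+ 4); last by ring.
rewrite (exprM _ 2 4); apply: lerXn2r; rewrite ?nnegrE ?sqr_ge0 ?J_jap//.
by rewrite mulr_ge0// ltW// J_gt0.
Qed.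

Lemma mf_Wt : mfun Wt.
Proof. exact: (mfcomp (measurable_powR s) (@mf_J)). Qed.

(** A mean value bound without differentiation, from [1 - expR (- u) <= u] with
    [u = s * (ln y - ln x)]. *)
Lemma powR_dist (x y : R) : 0 < x -> x <= y -> y `^ s - x `^ s <= s * y `^ s * ((y - x) / x).
Proof.
have h4 := s4.
move=> x0 xy; have y0 := lt_le_trans x0 xy.
have y1 : 0 < y `^ s by rewrite powR_gt0.
have e : x `^ s = y `^ s * expR (- (s * (ln y - ln x))).
 rewrite /powR !gt_eqF// -expRD; congr expR; ring.
have h1 := expR_ge1Dx (- (s * (ln y - ln x))).
have h2 := ln_dist x0 xy.
rewrite e; have : 1 - expR (- (s * (ln y - ln x))) <= s * ((y - x) / x).
 by apply: (@le_trans _ _ (s * (ln y - ln x))); [lra|rewrite ler_wpM2l//; lra].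
by move=> h; have := ler_wpM2l (ltW y1) h; lra.
Qed.

(** The first summand bounds the increment of the weight over a doubling of the frequency, where [J]
    grows at most fourfold; the 2 compensates the lower bound [1 / 2] of the logarithm. *)
Definition Cs : R := 3 * s * 4 `^ s + 2.
Lemma Cs_gt0 : 0 < Cs.
Proof. have h4 := s4; by rewrite /Cs; have := powR_ge0 (4 : R) s; nra. Qed.
(** Minus the determinant of the rows [(1, Lw, Wt)] at [a], [b], [k]. It is alternating, as is [cr]
    on triples of sum 0, so their product is symmetric. *)
Definition Sy a b k : R := (Lw a - Lw b) * (Wt k - Wt b) + (Wt b - Wt a) * (Lw k - Lw b).
Definition WL k : R := Wt k * Lw k.
Lemma WL_gt0 k : 0 < WL k.
Proof. by rewrite mulr_gt0 ?Wt_gt0 ?Lw_gt0. Qed.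

Lemma Wt_le a b : norm2 a <= norm2 b -> Wt a <= Wt b.
Proof.
have h4 := s4.
move=> h; apply: ge0_ler_powR; rewrite ?nnegrE ?(ltW (J_gt0 _)) //; first lra.
by rewrite -!norm2_J lerD2l lerXn2r// nnegrE norm2_ge0.
Qed.

Lemma Lw_mono a b : norm2 a <= norm2 b -> Lw a <= Lw b.
Proof. by move=> h; apply: ln_le; have := norm2_ge0 a; lra. Qed.

(** With [a] smallest, [|k| <= 2 * |b|]. Each product in [Sy] contains one difference between the
    comparable frequencies [b] and [k], and that difference gains the factor [|a| / |b|]. *)
Let core a b k : norm2 a <= norm2 b -> norm2 b <= norm2 k -> norm2 k <= norm2 a + norm2 b ->
 `|Sy a b k| * (norm2 a * norm2 b) <= Cs * norm2 a ^+ 2 * WL b.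
Proof.
have h4 := s4.
move=> ab bk kab; have a0 := norm2_ge0 a; have b0 := norm2_ge0 b; have k0 := norm2_ge0 k.
have Wb := Wt_gt0 b; have Lb := Lw_ge b.
have h1 : `|Lw a - Lw b| <= Lw b.
 by rewrite ler0_norm ?subr_le0 ?Lw_mono//; have := Lw_gt0 a; lra.
have h2 : `|Wt k - Wt b| * norm2 b <= 3 * s * 4 `^ s * norm2 a * Wt b.
 rewrite ger0_norm ?subr_ge0 ?Wt_le//.
 have Jbk : J b <= J k by rewrite -!norm2_J lerD2l lerXn2r// nnegrE.
 have hW : Wt k <= 4 `^ s * Wt b.
  rewrite -powRM ?(ltW (J_gt0 _))//; apply: ge0_ler_powR; rewrite ?nnegrE ?mulr_ge0 ?(ltW (J_gt0 _))//; first lra.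
  by rewrite -!norm2_J; nra.
 have hd := powR_dist (J_gt0 b) Jbk.
 apply: le_trans (ler_wpM2r b0 hd) _.
 have hJ : (J k - J b) / J b * norm2 b <= 3 * norm2 a.
  rewrite mulrAC ler_pdivrMr ?J_gt0// -!norm2_J.
  have : (norm2 k - norm2 b) * (norm2 k + norm2 b) <= norm2 a * (3 * norm2 b) by apply: ler_pM; lra.
  nra.
 apply: (@le_trans _ _ (s * Wt k * (3 * norm2 a))).
  have q0 : 0 <= s * Wt k by rewrite mulr_ge0//; [lra|exact/ltW/Wt_gt0].
  by have := ler_wpM2l q0 hJ; rewrite -/(Wt k); lra.
 rewrite (_ : 3 * s * _ * _ * _ = s * (4 `^ s * Wt b) * (3 * norm2 a)); last by ring.
 by rewrite ler_wpM2r ?mulr_ge0// ler_wpM2l//; lra.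
have h3 : `|Wt b - Wt a| <= Wt b.
 by rewrite ger0_norm ?subr_ge0 ?Wt_le//; have := Wt_gt0 a; lra.
have {}h4 : `|Lw k - Lw b| * norm2 b <= norm2 a.
 have kb : norm2 k <= norm2 b + norm2 a by rewrite addrC.
 have := Lw_dist bk kb => h.
 apply: le_trans (ler_wpM2r b0 h) _.
 by rewrite mulrAC ler_pdivrMr; [nra|lra].
have hs : `|Sy a b k| <= `|Lw a - Lw b| * `|Wt k - Wt b| + `|Wt b - Wt a| * `|Lw k - Lw b|.
 by rewrite -!normrM; exact: ler_normD.
have A0 : 0 <= norm2 a * norm2 b by rewrite mulr_ge0.
apply: le_trans (ler_wpM2r A0 hs) _.
rewrite [leLHS](_ : _ = norm2 a * (`|Lw a - Lw b| * (`|Wt k - Wt b| * norm2 b)) + norm2 a * (`|Wt b - Wt a| * (`|Lw k - Lw b| * norm2 b))); last by ring.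
have c4 := powR_ge0 (4 : R) s.
have p1 : `|Lw a - Lw b| * (`|Wt k - Wt b| * norm2 b) <= Lw b * (3 * s * 4 `^ s * norm2 a * Wt b).
 by apply: ler_pM => //; rewrite mulr_ge0.
have p2 : `|Wt b - Wt a| * (`|Lw k - Lw b| * norm2 b) <= Wt b * norm2 a.
 by apply: ler_pM => //; rewrite mulr_ge0.
have p3 : Wt b * norm2 a <= 2 * (Wt b * Lw b) * norm2 a by rewrite ler_wpM2r//; nra.
apply: (@le_trans _ _ (norm2 a * (Lw b * (3 * s * 4 `^ s * norm2 a * Wt b)) + norm2 a * (2 * (Wt b * Lw b) * norm2 a))).
 by apply: lerD; rewrite ler_wpM2l//; exact: le_trans p2 p3.
by apply: eq_ler; rewrite /Cs /WL; ring.
Qed.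

Lemma WL_le a b : norm2 a <= norm2 b -> WL a <= WL b.
Proof.
have h4 := s4.
by move=> h; apply: ler_pM; rewrite ?(ltW (Wt_gt0 _)) ?(ltW (Lw_gt0 _)) ?Wt_le ?Lw_mono.
Qed.

Lemma sqrtM_ge (x y : R) : 0 <= x -> x <= y -> x <= Num.sqrt x * Num.sqrt y.
Proof.
have h4 := s4.
move=> x0 xy; rewrite -{1}(sqr_sqrtr x0) expr2 ler_wpM2l ?sqrtr_ge0//.
by rewrite ler_wsqrtr.
Qed.

Definition sW k : R := Num.sqrt (WL k).

Let core2 a b k : norm2 a <= norm2 b -> norm2 a <= norm2 k -> k.1 = - a.1 - b.1 -> k.2 = - a.2 - b.2 ->
 `|Sy a b k * cr a b| <= Cs * norm2 a ^+ 2 * (sW b * sW k).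
Proof.
have h4 := s4.
move=> ab ak e1 e2; have C0 := Cs_gt0.
have C1 : 0 <= Cs * norm2 a ^+ 2 by rewrite mulr_ge0 ?sqr_ge0// ltW.
have [bk|/ltW kb] := leP (norm2 b) (norm2 k).
 apply: (@le_trans _ _ (`|Sy a b k| * (norm2 a * norm2 b))).
  by rewrite normrM ler_wpM2l//; exact: cr_le.
 apply: le_trans (core ab bk (norm2_tri e1 e2)) _.
 by rewrite ler_wpM2l// sqrtM_ge ?WL_le// ltW// WL_gt0.
(* Both factors change sign when [b] and [k] are exchanged, so the larger of the two may be taken
   last. *)
have -> : Sy a b k * cr a b = Sy a k b * cr a k.
 rewrite (_ : cr a k = - cr a b); last by rewrite /cr e1 e2; ring.
 by rewrite /Sy; ring.
apply: (@le_trans _ _ (`|Sy a k b| * (norm2 a * norm2 k))).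
 by rewrite normrM ler_wpM2l//; exact: cr_le.
apply: le_trans (core ak kb _) _.
 by apply: norm2_tri; rewrite ?e1 ?e2; ring.
by rewrite ler_wpM2l// mulrC sqrtM_ge ?WL_le// ltW// WL_gt0.
Qed.

(** The smallest frequency takes the two derivatives and the two others share the weight [WL]
    through its square root. Summing the three cases avoids an ordering in the statement. *)
Lemma Sy_bound a b k : k.1 = - a.1 - b.1 -> k.2 = - a.2 - b.2 ->
 `|Sy a b k * cr a b| <= Cs * (norm2 a ^+ 2 * (sW b * sW k) + norm2 b ^+ 2 * (sW k * sW a) + norm2 k ^+ 2 * (sW a * sW b)).
Proof.
have h4 := s4.
move=> e1 e2.
have p x y z : 0 <= Cs * norm2 x ^+ 2 * (sW y * sW z).
 by rewrite !mulr_ge0 ?sqrtr_ge0 ?sqr_ge0// ltW// Cs_gt0.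
have pa := p a b k; have pb := p b k a; have pc := p k a b.
have cyc1 : Sy a b k * cr a b = Sy b k a * cr b k.
 rewrite (_ : cr b k = cr a b); last by rewrite /cr e1 e2; ring.
 by rewrite /Sy; ring.
have cyc2 : Sy a b k * cr a b = Sy k a b * cr k a.
 rewrite (_ : cr k a = cr a b); last by rewrite /cr e1 e2; ring.
 by rewrite /Sy; ring.
have [ab|/ltW ba] := leP (norm2 a) (norm2 b); have [ak|/ltW ka] := leP (norm2 a) (norm2 k).
- by have := core2 ab ak e1 e2; lra.
- have := @core2 k a b ka (le_trans ka ab); rewrite -cyc2 => h.
 have {}h : `|Sy a b k * cr a b| <= Cs * norm2 k ^+ 2 * (sW a * sW b) by apply: h; rewrite ?e1 ?e2; ring.
 lra.
- have := @core2 b k a (le_trans ba ak) ba; rewrite -cyc1 => h.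
 have {}h : `|Sy a b k * cr a b| <= Cs * norm2 b ^+ 2 * (sW k * sW a) by apply: h; rewrite ?e1 ?e2; ring.
 lra.
- have [bk|/ltW kb] := leP (norm2 b) (norm2 k).
  have := @core2 b k a bk ba; rewrite -cyc1 => h.
  have {}h : `|Sy a b k * cr a b| <= Cs * norm2 b ^+ 2 * (sW k * sW a) by apply: h; rewrite ?e1 ?e2; ring.
  lra.
 have := @core2 k a b ka kb; rewrite -cyc2 => h.
 have {}h : `|Sy a b k * cr a b| <= Cs * norm2 k ^+ 2 * (sW a * sW b) by apply: h; rewrite ?e1 ?e2; ring.
 lra.
Qed.

End Weight.

Section Damping.
Variable beta : R.
Hypothesis b1 : 1 < beta.

Definition mB k : R := Lw k `^ beta.
Lemma mB_ge0 k : 0 <= mB k.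
Proof. exact: powR_ge0. Qed.
Lemma mf_mB : mfun mB.
Proof. exact: (mfcomp (measurable_powR beta) mf_Lw). Qed.

(** From [ln y <= beta * y ^ (1 / beta)]: the power [beta] of the logarithm is at most [beta ^ beta]
    times [y = 10 + |k|]. *)
Lemma mB_le k : mB k <= 10 * beta `^ beta * jap k.
Proof.
have h4 := b1.
have k0 := norm2_ge0 k; have j1 := jap_ge1 k.
pose y := 10 + norm2 k; have y0 : 0 < y by rewrite /y; lra.
have yj : y <= 10 * jap k by rewrite /y /jap; lra.
have h : Lw k <= beta * y `^ (beta^-1).
 have p0 : 0 < y `^ beta^-1 by exact: powR_gt0.
 have := @ln_dist 1 (y `^ beta^-1); rewrite ln1 subr0 ln_powR divr1 => hh.
 have bI : beta * beta^-1 = 1 by rewrite divff// gt_eqF//; lra.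
 have y1 : 1 <= y `^ beta^-1.
  by rewrite -(powRr0 y); apply: ler_powR; [rewrite /y; lra|rewrite invr_ge0; lra].
 have {hh} := hh ltr01 y1 => hh.
 have -> : Lw k = beta * (beta^-1 * ln y) by rewrite mulrA bI mul1r.
 by rewrite ler_wpM2l; lra.
apply: (@le_trans _ _ ((beta * y `^ beta^-1) `^ beta)).
 apply: ge0_ler_powR; rewrite ?nnegrE//; [lra|exact/ltW/Lw_gt0|].
 by rewrite mulr_ge0 ?powR_ge0//; lra.
rewrite powRM ?powR_ge0//; last lra.
rewrite -powRrM mulVf ?powRr1 ?(ltW y0)//; last by rewrite gt_eqF//; lra.
by rewrite [10 * _]mulrC -mulrA ler_wpM2l// powR_ge0.
Qed.

(** Beyond the threshold [l], where [x ^ (beta - 1) = c / kappa], the damping wins; below it the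
    linear term is at most [c * l]. This is where [beta > 1] is essential. *)
Lemma damping (c kappa : R) : 0 <= c -> 0 < kappa ->
 exists2 C, 0 <= C & forall x, 0 <= x -> c * x - kappa * x `^ beta <= C.
Proof.
have h4 := b1.
move=> c0 k0; pose l := (c / kappa) `^ (beta - 1)^-1.
have l0 : 0 <= l by exact: powR_ge0.
exists (c * l); first by rewrite mulr_ge0.
move=> x x0; have [xl|lx] := leP x l.
 have : 0 <= kappa * x `^ beta by rewrite mulr_ge0 ?powR_ge0// ltW.
 have : c * x <= c * l by rewrite ler_wpM2l.
 lra.
have xp : 0 < x := le_lt_trans l0 lx.
have e : x `^ beta = x * x `^ (beta - 1).
 by rewrite -[X in X * _](powRr1 (ltW xp)) -powRD; [congr (_ `^ _); ring|apply/implyP => _; rewrite gt_eqF].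
have h : c / kappa <= x `^ (beta - 1).
 have -> : c / kappa = l `^ (beta - 1).
  rewrite /l -powRrM mulVf ?powRr1//; first by rewrite divr_ge0// ltW.
  by rewrite gt_eqF// subr_gt0.
 by apply: ge0_ler_powR; rewrite ?nnegrE ?(ltW xp) ?(ltW lx)//; lra.
have : c * x <= kappa * x `^ beta.
 rewrite e mulrCA [c * x]mulrC ler_wpM2l// ?(ltW xp)//.
 by move: h; rewrite ler_pdivrMr// mulrC.
have : 0 <= c * l by rewrite mulr_ge0.
lra.
Qed.

End Damping.

End Symbols.

#[local] Hint Resolve meas_box mf_TK mf_norm2 mf_Lw mf_jap mf_Wt mf_mB : mf.

(** * Trilinear forms on frequency triples of sum zero *)

Section Bilinear.

Implicit Types (F G E H D : K -> R).

(** Triples [a + b + k = 0] are parametrised by [(a, k)]. A permutation of the arguments of [Phi] is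
    then a measure-preserving change of variables. *)
Definition ev3 (Phi : K -> K -> K -> R) (z : K * K) := Phi z.1 (third z.1 z.2) z.2.
Lemma third_third (a k : K) : third a (third a k) = k.
Proof. by case: k => x y; rewrite /third /=; congr (_, _); ring. Qed.
Lemma thirdC (a k : K) : third k a = third a k.
Proof. by rewrite /third; congr (_, _); ring. Qed.
Lemma third_l (a k : K) : third (third a k) k = a.
Proof. by rewrite (thirdC k (third a k)) -(thirdC a k) third_third. Qed.
Lemma ev3_swp Phi : (fun z => ev3 Phi (swp z)) = ev3 (fun a b k => Phi k b a).
Proof. by apply/funext => z; rewrite /ev3 /= thirdC. Qed.
Lemma ev3_shear Phi : (fun z => ev3 Phi (shear z)) = ev3 (fun a b k => Phi a k b).
Proof. by apply/funext => z; rewrite /ev3 /= -[(_, _)]/(third z.1 z.2) third_third. Qed.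

Lemma swp_ev3 Phi : intg M2 (ev3 Phi) -> intg M2 (ev3 (fun a b k => Phi k b a)) /\
 \int[M2]_z ev3 (fun a b k => Phi k b a) z = \int[M2]_z ev3 Phi z.
Proof.
move=> h; rewrite -ev3_swp; split; first exact: (pres_intg (pres_swp) h).
exact: (pres_Rint (pres_swp) (intg_mf h)).
Qed.

Lemma shear_ev3 Phi : intg M2 (ev3 Phi) -> intg M2 (ev3 (fun a b k => Phi a k b)) /\
 \int[M2]_z ev3 (fun a b k => Phi a k b) z = \int[M2]_z ev3 Phi z.
Proof.
move=> h; rewrite -ev3_shear; split; first exact: (pres_intg (pres_shear) h).
exact: (pres_Rint (pres_shear) (intg_mf h)).
Qed.

Lemma mf_third : mfun (fun z : K * K => third z.1 z.2).
Proof. by apply: mfun_pair; mtac. Qed.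

Section Tri.
Variables A B C : K -> R.
Hypotheses (iA : intg mu A) (LB : L2 mu B) (LC : L2 mu C).

Let mA := intg_mf iA.
Let mB' : mfun B. Proof. by mtac. Qed.
Let mC : mfun C. Proof. by mtac. Qed.
Let Th a b k := `|A a| * (B b ^+ 2 + C k ^+ 2) / 2.

Let i2 (q : K -> R) : intg mu q -> intg M2 (ev3 (fun a b k => `|A a| * q b)) /\
 \int[M2]_z ev3 (fun a b k => `|A a| * q b) z = (\int[mu]_a `|A a|) * \int[mu]_k q k.
Proof.
move=> iq; have h : intg M2 (ev3 (fun a b k => `|A a| * q k)) := intgM12 (intg_norm iA) iq.
have [h1 h2] := shear_ev3 h; split=> //; rewrite h2.
rewrite -(Rfubini1 h) /ev3 /=.
under eq_Rintegral do rewrite RintZ//.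
rewrite -[RHS]mulrC -RintZ; last exact: intg_norm.
by apply: eq_Rint => x; rewrite mulrC.
Qed.

Let i1 (q : K -> R) : intg mu q -> intg M2 (ev3 (fun a b k => `|A a| * q k)) /\
 \int[M2]_z ev3 (fun a b k => `|A a| * q k) z = (\int[mu]_a `|A a|) * \int[mu]_k q k.
Proof. by move=> iq; have [/shear_ev3[h1 e1] e2] := i2 iq; rewrite -e2 -e1. Qed.

(** One factor in [L1] and two in [L2]; the elementary [2xy <= x^2 + y^2] takes the place of
    Holder's inequality. *)
Lemma tri_dom : intg M2 (ev3 Th) /\
 \int[M2]_z ev3 Th z = (\int[mu]_a `|A a|) * (\int[mu]_k (B k ^+ 2) + \int[mu]_k (C k ^+ 2)) / 2.
Proof.
have [h1 e1] := i2 (proj2 LB); have [h2 e2] := i1 (proj2 LC).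
have h := intgZ 2^-1 (intgD h1 h2); split.
 by apply: eq_intg h => z; rewrite /ev3 /Th; field.
transitivity (\int[M2]_z (2^-1 * (ev3 (fun a b k => `|A a| * B b ^+ 2) z + ev3 (fun a b k => `|A a| * C k ^+ 2) z))).
 by apply: eq_Rint => z; rewrite /ev3 /Th; field.
rewrite RintZ; last exact: intgD.
by rewrite RintD// e1 e2; field.
Qed.

Lemma le_tri (a b k : K) : `|A a| * `|B b| * `|C k| <= Th a b k.
Proof.
rewrite /Th -!mulrA ler_wpM2l//.
have := sqr_ge0 (`|B b| - `|C k|); have := real_normK (num_real (B b)); have := real_normK (num_real (C k)); nra.
Qed.

Lemma tri_intg (Phi : K -> K -> K -> R) : mfun (ev3 Phi) ->
 (forall z, `|ev3 Phi z| <= `|A z.1| * `|B (third z.1 z.2)| * `|C z.2|) ->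
 intg M2 (ev3 Phi) /\ \int[M2]_z `|ev3 Phi z| <=
  (\int[mu]_a `|A a|) * (\int[mu]_k (B k ^+ 2) + \int[mu]_k (C k ^+ 2)) / 2.
Proof.
move=> mP bP; have [h1 e1] := tri_dom.
have b2 z : `|ev3 Phi z| <= ev3 Th z by apply: le_trans (bP z) _; exact: le_tri.
have h := le_intg mP b2 h1; split=> //.
by rewrite -e1; apply: le_Rint => //; exact: intg_norm.
Qed.

End Tri.

Definition ev H k := (H k + H (negK k)) / 2.
Definition od H k := (H k - H (negK k)) / 2.
(** The modulus of the Fourier transform: an even majorant, up to a constant, with the same
    even-weighted norms as [H]. *)
Definition gm H k := Num.sqrt ((H k ^+ 2 + H (negK k) ^+ 2) / 2).
(** The real part of the product of the three complex numbers [ev + i od]. It is symmetric under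
    simultaneous permutation, and bounded by the product of moduli. *)
Definition T3 F G E (a b k : K) := ev F a * (ev G b * ev E k - od G b * od E k) - od F a * (ev G b * od E k + od G b * ev E k).
(** The convolution rule of the Hartley transform: four sign combinations replace the single product
    of the Fourier case. *)
Definition Qb F G (a b : K) := 2^-1 * (F a * G b + F (negK a) * G b + F a * G (negK b) - F (negK a) * G (negK b)).
Lemma negKK (k : K) : negK (negK k) = k.
Proof. by case: k => x y; rewrite /negK /= !opprK. Qed.
Lemma gm_ge0 H k : 0 <= gm H k.
Proof. exact: sqrtr_ge0. Qed.
Lemma gm_sq H k : gm H k ^+ 2 = (H k ^+ 2 + H (negK k) ^+ 2) / 2.
Proof. by rewrite sqr_sqrtr// divr_ge0// addr_ge0// sqr_ge0. Qed.
Lemma mf_neg F : mfun F -> mfun (fun k => F (negK k)).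
Proof. by move=> mF; have [mn _] := pres_neg; exact: mfcomp mF mn. Qed.

Lemma mf_gm H : mfun H -> mfun (gm H).
Proof.
move=> mH; have mH' := mf_neg mH.
have h : mfun (fun k : K => (H k ^+ 2 + H (negK k) ^+ 2) / 2) by mtac.
apply: (@mfcomp _ _ _ _ _ _ (@Num.sqrt R) _ _ _ h).
by apply: cont_mfun; exact: sqrt_continuous.
Qed.

Lemma gm_int H (w : K -> R) : mfun w -> (forall k, w (negK k) = w k) ->
 intg mu (fun k => w k * H k ^+ 2) -> intg mu (fun k => w k * gm H k ^+ 2) /\
 \int[mu]_k (w k * gm H k ^+ 2) = \int[mu]_k (w k * H k ^+ 2).
Proof.
move=> mw ew h; have [h1 h2] := intg_refl2 h.
have e k : (w k * H k ^+ 2 + w (negK k) * H (negK k) ^+ 2) / 2 = w k * gm H k ^+ 2.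
 by rewrite gm_sq ew; field.
by rewrite -h2; split; [apply: eq_intg h1 => k; rewrite e|apply: eq_Rint => k; rewrite e].
Qed.

Lemma gm_L2 H : L2 mu H -> L2 mu (gm H) /\ \int[mu]_k (gm H k ^+ 2) = \int[mu]_k (H k ^+ 2).
Proof.
move=> [mH iH]; have m1 : mfun (fun _ : K => 1 : R) by [].
have h0 : intg mu (fun k => 1 * H k ^+ 2) by apply: eq_intg iH => k; rewrite mul1r.
have [h1 h2] := gm_int m1 (fun=> erefl) h0.
split; first by split; [exact: mf_gm|apply: eq_intg h1 => k; rewrite mul1r].
by rewrite -[LHS](eq_Rint _ (fun k => mul1r _)) h2; apply: eq_Rint => k; rewrite mul1r.
Qed.

Lemma ev_od H k : ev H k ^+ 2 + od H k ^+ 2 = gm H k ^+ 2.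
Proof. by rewrite gm_sq /ev /od; field. Qed.

Lemma T3_bound F G E a b k : `|T3 F G E a b k| <= gm F a * gm G b * gm E k.
Proof.
apply: le_sq; first by rewrite !mulr_ge0 ?gm_ge0.
rewrite real_normK ?num_real// !exprMn -!ev_od /T3.
set x := ev F a; set y := od F a; set u := ev G b; set v := od G b; set p := ev E k; set q := od E k.
by have := sqr_ge0 (x * (u * q + v * p) + y * (u * p - v * q)); nra.
Qed.

Lemma abs_gm H k : `|H k| + `|H (negK k)| <= 2 * gm H k.
Proof.
apply: le_sq; first by rewrite mulr_ge0 ?gm_ge0.
rewrite exprMn gm_sq; have := sqr_ge0 (`|H k| - `|H (negK k)|).
by have := real_normK (num_real (H k)); have := real_normK (num_real (H (negK k))); nra.
Qed.

Lemma Qb_bound F G a b : `|Qb F G a b| <= 2 * (gm F a * gm G b).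
Proof.
apply: (@le_trans _ _ (2^-1 * ((`|F a| + `|F (negK a)|) * (`|G b| + `|G (negK b)|)))).
 rewrite /Qb normrM (ger0_norm (_ : 0 <= 2^-1))// ler_wpM2l//.
 apply: (le_trans (ler_normB _ _)); rewrite normrM.
 apply: (@le_trans _ _ (`|F a| * `|G b| + `|F (negK a)| * `|G b| + `|F a| * `|G (negK b)| + `|F (negK a)| * `|G (negK b)|)).
  rewrite lerD2r; apply: (le_trans (ler_normD _ _)); rewrite normrM lerD2r.
  by apply: (le_trans (ler_normD _ _)); rewrite !normrM.
 by apply: eq_ler; ring.
rewrite (_ : 2 * _ = 2^-1 * ((2 * gm F a) * (2 * gm G b))); last by field.
by rewrite ler_wpM2l//; apply: ler_pM; rewrite ?addr_ge0// abs_gm.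
Qed.

Lemma mf_nK : mfun (negK : K -> K).
Proof. by have [] := pres_neg. Qed.
Lemma mf_cr : mfun (fun z : K * K => cr z.1 z.2).
Proof. rewrite /cr; mtac. Qed.
Definition cv (a k : K) : K := (k.1 - a.1, k.2 - a.2).
Lemma mf_cv : mfun (fun z : K * K => cv z.1 z.2).
Proof. by apply: mfun_pair; mtac. Qed.
(** The symbol of the transport term, with the logarithm on the first argument. [cr a k] equals
    [cr a (k - a)], the product of a perpendicular gradient with a gradient. *)
Definition nf F G (a k : K) := Lw a * cr a k * Qb F G a (cv a k).
Lemma mf_at1 d (T : measurableType d) (F : K -> T) : mfun F -> mfun (fun z : K * K => F z.1).
Proof. by move=> mF; exact: mfcomp mF mfun_fst. Qed.
Lemma mf_at2 d (T : measurableType d) (F : K -> T) : mfun F -> mfun (fun z : K * K => F z.2).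
Proof. by move=> mF; exact: mfcomp mF mfun_snd. Qed.
Lemma mf_atc d (T : measurableType d) (F : K -> T) : mfun F -> mfun (fun z : K * K => F (cv z.1 z.2)).
Proof. by move=> mF; exact: mfcomp mF mf_cv. Qed.
Lemma mf_att d (T : measurableType d) (F : K -> T) : mfun F -> mfun (fun z : K * K => F (third z.1 z.2)).
Proof. by move=> mF; exact: mfcomp mF mf_third. Qed.

Lemma mf_nf F G : mfun F -> mfun G -> mfun (fun z : K * K => nf F G z.1 z.2).
Proof.
move=> mF mG; rewrite /nf /Qb.
have m1 := mf_at1 (@mf_Lw); have m2 := mf_cr.
have m3 := mf_at1 mF; have m4 := mf_at1 (mf_neg mF).
have m5 := mf_atc mG; have m6 := mf_atc (mf_neg mG).
by mtac.
Qed.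

Definition NN F G (k : K) := @cF * \int[mu]_a nf F G a k.

Lemma mf_NN F G : mfun F -> mfun G -> mfun (NN F G).
Proof.
move=> mF mG; apply: mfunM; first exact: mfun_cst.
apply: (mf_Rint2 mu (fun k a => nf F G a k)).
have h : mfun (fun z : K * K => (z.2, z.1)) by mtac.
exact: (mfcomp (mf_nf mF mG) h).
Qed.

Lemma young_arith (g l X a : R) : 0 < l -> a <= l -> 0 <= X - 2 * (g / l) * g + (g / l) ^+ 2 * a -> g ^+ 2 <= l * X.
Proof.
move=> l0 al h.
have h1 : (g / l) ^+ 2 * a <= (g / l) ^+ 2 * l by rewrite ler_wpM2l ?sqr_ge0.
have h2 : (g / l) * g = g ^+ 2 / l by field; rewrite gt_eqF.
have h3 : (g / l) ^+ 2 * l = g ^+ 2 / l by field; rewrite gt_eqF.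
by rewrite -ler_pdivrMl// mulrC; lra.
Qed.

(** Cauchy-Schwarz with respect to the weight [A ^~ k], whose mass is at most [al]; the weighted
    square of [B] is then integrated over both variables. The mass bound holds only for almost every
    [k], as translation invariance does. *)
Lemma young (A B f : K -> K -> R) (al : R) :
 mfun (fun z => f z.1 z.2) -> mfun (fun z => A z.1 z.2) -> mfun (fun z => B z.1 z.2) -> (forall a k, 0 <= A a k) ->
 {ae mu, forall k, intg mu (A ^~ k) /\ \int[mu]_a A a k <= al} ->
 intg M2 (fun z => A z.1 z.2 * B z.1 z.2 ^+ 2) -> 0 <= al -> (forall a k, `|f a k| <= A a k * `|B a k|) ->
 [/\ {ae mu, forall k, intg mu (f ^~ k)}, L2 mu (fun k => \int[mu]_a f a k) &
  \int[mu]_k ((\int[mu]_a f a k) ^+ 2) <= (1 + al) * \int[M2]_z (A z.1 z.2 * B z.1 z.2 ^+ 2)].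
Proof.
move=> mf mA mB A0 hA iAB al0 fAB.
have hsw : mfun (fun z : K * K => (z.2, z.1)) by mtac.
have sec (g : K -> K -> R) k : mfun (fun z : K * K => g z.1 z.2) -> mfun (g ^~ k).
 by move=> mg; have := mfcomp mg (measurable_pair2 k).
have iAB2 := ae_intg1 (intg_swap iAB).
have pt : {ae mu, forall k, intg mu (f ^~ k) /\
 (\int[mu]_a f a k) ^+ 2 <= (1 + al) * \int[mu]_a (A a k * B a k ^+ 2)}.
 apply: ae2 hA iAB2 _ => k [iA Aal] /= iB.
 have iABs : intg mu (fun a => A a k * `|B a k|).
  apply: le_intg (intgD iA iB) => [|a].
   by mtac.
  have := A0 a k; have := real_normK (num_real (B a k)) => e hA0.
  rewrite ger0_norm ?mulr_ge0// -e; have := sqr_ge0 (`|B a k| - 1) => h.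
  by have := mulr_ge0 hA0 h; have := normr_ge0 (B a k); nra.
 have if_ : intg mu (f ^~ k) by apply: le_intg iABs => //; exact: sec mf.
 split=> //; pose g := \int[mu]_a (A a k * `|B a k|).
 have fg : `|\int[mu]_a f a k| <= g.
  by apply: le_trans (norm_Rint if_) _; apply: le_Rint => //; exact: intg_norm.
 have g0 : 0 <= g by exact: le_trans (normr_ge0 _) fg.
 (* The near-optimal shift in the discriminant argument; [1 + al] avoids division by 0. *)
 pose x := g / (1 + al).
 have ix : intg mu (fun a => A a k * (`|B a k| - x) ^+ 2).
  apply: eq_intg (intgD (intgB iB (intgZ (2 * x) iABs)) (intgZ (x ^+ 2) iA)) => a.
  by rewrite -(real_normK (num_real (B a k))); ring.
 have h0 : 0 <= \int[mu]_a (A a k * (`|B a k| - x) ^+ 2).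
  by apply: Rint_ge0 => a; rewrite mulr_ge0// sqr_ge0.
 have e0 : \int[mu]_a (A a k * (`|B a k| - x) ^+ 2) =
   \int[mu]_a (A a k * B a k ^+ 2) - 2 * x * g + x ^+ 2 * \int[mu]_a A a k.
  rewrite /g -!RintZ// -RintB//; last exact: intgZ.
  rewrite -RintD; [|by apply: intgB => //; exact: intgZ|exact: intgZ].
  by apply: eq_Rint => a; rewrite -(real_normK (num_real (B a k))); ring.
 have : g ^+ 2 <= (1 + al) * \int[mu]_a (A a k * B a k ^+ 2).
  apply: (@young_arith _ _ _ (\int[mu]_a A a k)); last by rewrite -/x -e0.
   by rewrite ltr_pwDl.
  by rewrite (le_trans Aal)// lerDr.
 apply: le_trans; rewrite -(real_normK (num_real (\int[mu]_a _))).
 by rewrite ler_sqr// nnegrE.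
have iB1 := intg_Rint1 (intg_swap iAB).
have mI : mfun (fun k => \int[mu]_a f a k).
 by apply: (mf_Rint2 mu (fun k a => f a k)); exact: mfcomp mf hsw.
pose Y k := \int[mu]_a (A a k * B a k ^+ 2).
have Y0 k : 0 <= Y k by apply: Rint_ge0 => a; rewrite mulr_ge0 ?sqr_ge0.
have iq : intg mu (fun k => (\int[mu]_a f a k) ^+ 2).
 have iY : intg mu (fun k => (1 + al) * Y k) by exact: intgZ.
 (* The minimum obeys the bound everywhere and coincides with the square almost everywhere. *)
 pose q k := Num.min ((\int[mu]_a f a k) ^+ 2) ((1 + al) * Y k).
 have mq : mfun q.
  by apply: measurable_minr; [exact: mfunX|exact: intg_mf iY].
 have q1 k : `|q k| <= (1 + al) * Y k.
  rewrite ger0_norm; first by rewrite /q ge_min lexx orbT.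
  by rewrite /q le_min sqr_ge0; apply: mulr_ge0 => //; clear -al0; lra.
 apply: (ae_intg _ _ (le_intg mq q1 iY)); first exact: mfunX.
 by apply: ae1 pt _ => k [_ h]; rewrite /q min_l.
split.
- by apply: ae1 pt _ => k [].
- by split.
- rewrite -(Rfubini2 iAB) -(RintZ _ iB1).
 have mY : mfun (fun k => (1 + al) * Y k) by exact: (intg_mf (intgZ _ iB1)).
 pose q k := Num.max ((\int[mu]_a f a k) ^+ 2) ((1 + al) * Y k).
 have mq : mfun q by apply: measurable_maxr => //; exact: mfunX.
 have eq_ : {ae mu, forall k, (1 + al) * Y k = q k} by apply: ae1 pt _ => k [_ h]; rewrite /q max_r.
 rewrite (ae_Rint mY mq eq_); apply: le_Rint => //.
  by apply: (ae_intg mq eq_); exact: intgZ.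
 by move=> k; rewrite /q le_max lexx.
Qed.

End Bilinear.

#[local] Hint Resolve mf_neg mf_gm mf_nK mf_third mf_cr mf_cv mf_NN : mf.

(** * Weighted bounds on the nonlinearity *)

Section Estimates.

Implicit Types (F G E H D : K -> R).

Lemma ae_le_Rint d (T : measurableType d) (m : {measure set T -> \bar R}) (f g : T -> R) :
 intg m f -> intg m g -> {ae m, forall x, f x <= g x} -> \int[m]_x f x <= \int[m]_x g x.
Proof.
move=> hf hg h; have mf := intg_mf hf; have mg := intg_mf hg.
have mq : mfun (fun x => Num.max (f x) (g x)) by exact: measurable_maxr.
have e : {ae m, forall x, g x = Num.max (f x) (g x)} by apply: ae1 h _ => x h; rewrite max_r.
rewrite (ae_Rint mg mq e); apply: le_Rint => //; first exact: ae_intg mq e hg.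
by move=> x; rewrite le_max lexx.
Qed.

Lemma Rint_scale d (T : measurableType d) (m : {measure set T -> \bar R}) (c : R) (f : T -> R) :
 intg m (fun x => c * f x) -> \int[m]_x (c * f x) = c * \int[m]_x f x.
Proof.
move=> h; have [->|c0] := eqVneq c 0.
 by rewrite mul0r; under eq_Rintegral do rewrite mul0r; rewrite Rint0.
by apply: RintZ; apply: eq_intg (intgZ c^-1 h) => x; rewrite mulrA mulVf// mul1r.
Qed.

Lemma perm_ab (Phi : K -> K -> K -> R) : mfun (ev3 Phi) -> mfun (ev3 (fun a b k => Phi b a k)).
Proof.
move=> m; have [ms _] := pres_swp; have [mh _] := pres_shear.
have := mfcomp (mfcomp (mfcomp m ms) mh) ms.
rewrite (_ : _ \o _ = ev3 (fun a b k => Phi b a k))//.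
apply/funext => z; transitivity (Phi (third z.2 z.1) (third (third z.2 z.1) z.2) z.2) => //.
by rewrite (thirdC z.2 (third z.2 z.1)) third_third (thirdC z.1 z.2).
Qed.

Lemma ab_ev3 (Phi : K -> K -> K -> R) : intg M2 (ev3 (fun a b k => Phi b a k)) ->
 intg M2 (ev3 Phi) /\ \int[M2]_z ev3 Phi z = \int[M2]_z ev3 (fun a b k => Phi b a k) z.
Proof.
move=> h; have [h1 e1] := swp_ev3 h; have [h2 e2] := shear_ev3 h1; have [h3 e3] := swp_ev3 h2.
by split=> //; rewrite -e1 -e2 -e3.
Qed.

Section Tri.
Variables (A B C : K -> R) (Phi : K -> K -> K -> R).
Hypotheses (iA : intg mu A) (LB : L2 mu B) (LC : L2 mu C) (mP : mfun (ev3 Phi)).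

Lemma tri_a : (forall a k, `|Phi a (third a k) k| <= `|A a| * `|B (third a k)| * `|C k|) ->
 intg M2 (ev3 Phi) /\ \int[M2]_z `|ev3 Phi z| <=
  (\int[mu]_a `|A a|) * (\int[mu]_k (B k ^+ 2) + \int[mu]_k (C k ^+ 2)) / 2.
Proof. by move=> h; apply: (tri_intg iA LB LC mP) => z; exact: h. Qed.

Lemma tri_b : (forall a k, `|Phi a (third a k) k| <= `|A (third a k)| * `|B a| * `|C k|) ->
 intg M2 (ev3 Phi) /\ \int[M2]_z `|ev3 Phi z| <=
  (\int[mu]_a `|A a|) * (\int[mu]_k (B k ^+ 2) + \int[mu]_k (C k ^+ 2)) / 2.
Proof.
move=> h; have [|h1 h2] := tri_intg iA LB LC (perm_ab mP).
 move=> z; have := h (third z.1 z.2) z.2.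
 by rewrite third_l.
have [h3 _] := ab_ev3 h1; split=> //; apply: le_trans h2.
have [_ e] := @ab_ev3 (fun a b k => `|Phi a b k|) (intg_norm h1).
exact: eq_ler e.
Qed.

End Tri.

Definition nk (z : K * K) : K * K := (z.1, negK z.2).
Lemma pres_nk : pres M2 nk.
Proof. exact: pres_prod (pres_id mu) (pres_neg). Qed.
Lemma cv_neg (a k : K) : cv a (negK k) = third a k.
Proof. by rewrite /cv /third /negK /=; congr (_, _); exact: addrC. Qed.
Lemma cv_neg' (a k : K) : cv (negK a) k = negK (third a k).
Proof. by rewrite /cv /third /negK /=; congr (_, _); ring. Qed.

(** The sign of [k] is flipped to pass from convolution triples, [b = k - a], to symmetric triples
    of sum 0. *)
Lemma conv_ev3 (Phi : K -> K -> K -> R) (z : K * K) :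
 ev3 (fun a b k => Phi a b (negK k)) (nk z) = Phi z.1 (cv z.1 z.2) z.2.
Proof. by rewrite /ev3 /nk /= negKK -cv_neg negKK. Qed.

Lemma mf_conv (Phi : K -> K -> K -> R) : mfun (fun z => Phi z.1 (cv z.1 z.2) z.2) ->
 mfun (ev3 (fun a b k => Phi a b (negK k))).
Proof.
move=> m; have [mn _] := pres_nk; have := mfcomp m mn.
rewrite (_ : _ \o _ = ev3 (fun a b k => Phi a b (negK k)))//.
by apply/funext => z; rewrite /= cv_neg.
Qed.

Lemma neg_int F : intg mu F -> intg mu (fun k => F (negK k)).
Proof. exact: (pres_intg (pres_neg)). Qed.
Lemma neg_L2 F : L2 mu F -> L2 mu (fun k => F (negK k)).
Proof. by move=> [mF iF]; split; [exact: (mf_neg)|exact: (neg_int iF)]. Qed.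

Lemma trans_ae (A : K -> R) : intg mu A -> {ae mu, forall k, intg mu (fun a => A (cv a k)) /\ \int[mu]_a A (cv a k) = \int[mu]_a A a}.
Proof.
move=> iA; apply: ae1 (ae_prod (@ae_dualpt R (per1 Omega)) (@ae_dualpt R (per2 Omega))) _ => k [d1 d2].
have dn per (x : R) : dualpt per x -> dualpt per (- x).
 by move=> h p; have [n ->] := h p; exists (- n); rewrite mulrNz.
have P := @pres_reflect (negK k) (dn _ _ d1) (dn _ _ d2).
have e a : (- (negK k).1 - a.1, - (negK k).2 - a.2) = cv a k by rewrite /= !opprK.
split.
 by apply: eq_intg (pres_intg P iA) => a; rewrite e.
by rewrite -(pres_Rint P (intg_mf iA)); apply: eq_Rint => a; rewrite e.
Qed.

Section YoungN.
Variables F G w P Q : K -> R.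
Hypotheses (mF : mfun F) (mG : mfun G) (mw : mfun w).
Hypotheses (P0 : forall k, 0 <= P k) (Q0 : forall k, 0 <= Q k).
Hypothesis wPQ : forall a k, `|w k| * `|Lw a * cr a k| <= P a * Q (cv a k).

Let PF k := P k * gm F k.
Let QG k := Q k * gm G k.
Let f a k := w k * nf F G a k.

Let mf : mfun (fun z : K * K => f z.1 z.2).
Proof.
by apply: mfunM; [exact: mf_at2|exact: (mf_nf)].
Qed.

Let f_le a k : `|f a k| <= 2 * (PF a * QG (cv a k)).
Proof.
rewrite /f /nf normrM normrM mulrA.
rewrite (_ : 2 * _ = P a * Q (cv a k) * (2 * (gm F a * gm G (cv a k)))); last by rewrite /PF /QG; ring.
by apply: ler_pM; rewrite ?mulr_ge0// Qb_bound.
Qed.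

Let PF0 k : 0 <= PF k. Proof. by rewrite mulr_ge0 ?gm_ge0. Qed.
Let QG0 k : 0 <= QG k. Proof. by rewrite mulr_ge0 ?gm_ge0. Qed.

Let out (C : R) : {ae mu, forall k, intg mu (f ^~ k)} -> L2 mu (fun k => \int[mu]_a f a k) ->
 \int[mu]_k ((\int[mu]_a f a k) ^+ 2) <= C ->
 L2 mu (fun k => w k * NN F G k) /\ \int[mu]_k ((w k * NN F G k) ^+ 2) <= @cF ^+ 2 * C.
Proof.
move=> ha hL hC; have [mI iI] := hL; have c0 := @cF_gt0.
have e : {ae mu, forall k, cF * \int[mu]_a f a k = w k * NN F G k}.
 apply: ae1 ha _ => k ik; rewrite /NN mulrCA; congr (_ * _).
 exact: Rint_scale.
have mN : mfun (fun k => w k * NN F G k).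
 exact: (mfunM mw (mf_NN mF mG)).
have mcf : mfun (fun k => cF * \int[mu]_a f a k) by mtac.
have i2 : intg mu (fun k => (cF * \int[mu]_a f a k) ^+ 2).
 by apply: eq_intg (intgZ (cF ^+ 2) iI) => k; rewrite exprMn.
split.
 split=> //; apply: ae_intg i2; first exact: mfunX.
 by apply: ae1 e _ => k ->.
rewrite -(ae_Rint (f := fun k => (cF * \int[mu]_a f a k) ^+ 2)); [|exact: mfunX|exact: mfunX|].
 under eq_Rintegral do rewrite exprMn.
 by rewrite RintZ// ler_wpM2l// sqr_ge0.
by apply: ae1 e _ => k ->.
Qed.

(** The logarithm sits on the first argument, so the roles of [F] and [G] are not exchangeable: here
    [F] is measured in [L2] and [G] in [L1], in the companion lemma the reverse. *)
Lemma NN_young1 : L2 mu PF -> intg mu QG -> L2 mu (fun k => w k * NN F G k) /\ \int[mu]_k ((w k * NN F G k) ^+ 2) <=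
  @cF ^+ 2 * ((1 + \int[mu]_k QG k) * (4 * (\int[mu]_k (PF k ^+ 2) * \int[mu]_k QG k))).
Proof.
move=> LP iQ; have [mP iP] := LP; have mQ := intg_mf iQ.
have i1 := intgM12 iP iQ; have P1 := pres_conv2.
have e1 z : (PF z.1 ^+ 2 * QG (cv z.1 z.2)) * 4 = QG (cv z.1 z.2) * (2 * PF z.1) ^+ 2 by ring.
have i2 : intg M2 (fun z => QG (cv z.1 z.2) * (2 * PF z.1) ^+ 2).
 by apply: eq_intg (intgZ 4 (pres_intg P1 i1)) => z; rewrite -e1 mulrC.
have a0 : 0 <= \int[mu]_k QG k by exact: Rint_ge0.
have mA : mfun (fun z : K * K => QG (cv z.1 z.2)) by mtac.
have mB : mfun (fun z : K * K => 2 * PF z.1).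
 by mtac.
have hA : {ae mu, forall k, intg mu (fun a => QG (cv a k)) /\ \int[mu]_a QG (cv a k) <= \int[mu]_k QG k}.
 by apply: ae1 (trans_ae iQ) _ => k [h1 h2]; rewrite h2.
have fAB a k : `|f a k| <= QG (cv a k) * `|2 * PF a|.
 by apply: le_trans (f_le a k) _; rewrite normrM !ger0_norm//; apply: eq_ler; ring.
have A0 (a k : K) : 0 <= QG (cv a k) by [].
have [h1 h2 h3] := young mf mA mB A0 hA i2 a0 fAB.
apply: out => //; apply: le_trans h3 _; rewrite ler_wpM2l ?addr_ge0//.
apply: eq_ler.
rewrite -(RintM12 iP iQ) -(pres_Rint P1 (intg_mf i1)) -RintZ; last exact: (pres_intg P1 i1).
by apply: eq_Rint => z; rewrite -e1 mulrC.
Qed.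

Lemma NN_young2 : intg mu PF -> L2 mu QG -> L2 mu (fun k => w k * NN F G k) /\ \int[mu]_k ((w k * NN F G k) ^+ 2) <=
  @cF ^+ 2 * ((1 + \int[mu]_k PF k) * (4 * (\int[mu]_k PF k * \int[mu]_k (QG k ^+ 2)))).
Proof.
move=> iP LQ; have [mQ iQ] := LQ; have mP := intg_mf iP.
have i1 := intgM12 iP iQ; have P1 := pres_conv2.
have e1 z : (PF z.1 * QG (cv z.1 z.2) ^+ 2) * 4 = PF z.1 * (2 * QG (cv z.1 z.2)) ^+ 2 by ring.
have i2 : intg M2 (fun z => PF z.1 * (2 * QG (cv z.1 z.2)) ^+ 2).
 by apply: eq_intg (intgZ 4 (pres_intg P1 i1)) => z; rewrite -e1 mulrC.
have a0 : 0 <= \int[mu]_k PF k by exact: Rint_ge0.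
have mA : mfun (fun z : K * K => PF z.1) by mtac.
have mB : mfun (fun z : K * K => 2 * QG (cv z.1 z.2)).
 by mtac.
have hA : {ae mu, forall k : K, intg mu (fun a => PF a) /\ \int[mu]_a PF a <= \int[mu]_k PF k}.
 exact: aeW.
have fAB a k : `|f a k| <= PF a * `|2 * QG (cv a k)|.
 by apply: le_trans (f_le a k) _; rewrite normrM !ger0_norm//; apply: eq_ler; ring.
have A0 (a k : K) : 0 <= PF a by [].
have [h1 h2 h3] := young mf mA mB A0 hA i2 a0 fAB.
apply: out => //; apply: le_trans h3 _; rewrite ler_wpM2l ?addr_ge0//.
apply: eq_ler.
rewrite -(RintM12 iP iQ) -(pres_Rint P1 (intg_mf i1)) -RintZ; last exact: (pres_intg P1 i1).
by apply: eq_Rint => z; rewrite -e1 mulrC.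
Qed.

End YoungN.

(** Four derivatives in [L2], the fixed regularity in which all nonlinear estimates are stated.
    Working below [s] keeps the constants free of the Sobolev weight. *)
Definition adm H := mfun H /\ intg mu (fun k => jap k ^+ 8 * H k ^+ 2).

Ltac mhyp ::= match goal with
 | H : integrable _ _ (EFin \o ?f) |- measurable_fun _ ?f => exact (intg_mf H)
 | H : L2 _ ?f |- measurable_fun _ ?f => exact (proj1 H)
 | H : adm ?f |- measurable_fun _ ?f => exact (proj1 H)
 end.

Definition N8 H := \int[mu]_k (jap k ^+ 8 * H k ^+ 2).
Definition cJ : R := \int[mu]_k ((jap (k : K) ^+ 4)^-1 : R).

Lemma intg_cJ : intg mu (fun k : K => (jap k ^+ 4)^-1).
Proof.
have mj := @mf_jap; apply: le_intg (@intg_J2).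
 by apply: mf_inv => [|k]; [mtac|rewrite exprn_gt0// jap_gt0].
move=> k; rewrite ger0_norm ?invr_ge0 ?exprn_ge0 ?(ltW (jap_gt0 k))//.
rewrite lef_pV2 ?posrE ?exprn_gt0 ?J_gt0 ?jap_gt0// (exprM _ 2 2).
by apply: lerXn2r; rewrite ?nnegrE ?(ltW (J_gt0 k)) ?sqr_ge0// J_le_jap.
Qed.

Lemma cJ_ge0 : 0 <= cJ.
Proof. by apply: Rint_ge0 => k; rewrite invr_ge0 exprn_ge0// ltW// jap_gt0. Qed.
Lemma N8_ge0 H : 0 <= N8 H.
Proof. by apply: Rint_ge0 => k; rewrite mulr_ge0 ?sqr_ge0 ?exprn_ge0// ltW// jap_gt0. Qed.

Lemma adm_gm H : adm H -> adm (gm H) /\ N8 (gm H) = N8 H.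
Proof.
move=> [mH iH]; have mj := @mf_jap.
have m8 : mfun (fun k : K => jap k ^+ 8) by mtac.
have e8 (k : K) : jap (negK k) ^+ 8 = jap k ^+ 8 by rewrite /jap norm2_neg.
have [h1 h2] := gm_int m8 e8 iH.
by split; [split => //; exact: (mf_gm)|exact: h2].
Qed.

Lemma adm_L2 H j : (j <= 4)%N -> adm H -> L2 mu (fun k => jap k ^+ j * H k) /\
 \int[mu]_k ((jap k ^+ j * H k) ^+ 2) <= N8 H.
Proof.
move=> j4 [mH iH]; have mj := @mf_jap.
have m1 : mfun (fun k : K => jap k ^+ j * H k) by mtac.
have b k : (jap k ^+ j * H k) ^+ 2 <= jap k ^+ 8 * H k ^+ 2.
 rewrite exprMn -exprM ler_wpM2r ?sqr_ge0// ler_weXn2l ?jap_ge1//.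
 by move: j4; clear; lia.
have i2 : intg mu (fun k => (jap k ^+ j * H k) ^+ 2).
 apply: le_intg iH; first exact: mfunX.
 by move=> k; rewrite ger0_norm ?sqr_ge0.
by split=> //; apply: le_Rint.
Qed.

(** Split [jap ^+ 2 * H] as [(jap ^+ 4 * H) * (jap ^+ 2)^-1]: the first factor is square integrable
    by [adm], the second because [(jap ^+ 4)^-1] is integrable in dimension two. *)
Lemma adm_L1 H j : (j <= 2)%N -> adm H -> (forall k, 0 <= H k) -> intg mu (fun k => jap k ^+ j * H k) /\
 \int[mu]_k (jap k ^+ j * H k) <= N8 H + cJ.
Proof.
move=> j2 [mH iH] H0; have mj := @mf_jap.
have m1 : mfun (fun k : K => jap k ^+ j * H k) by mtac.
have h := intgD iH intg_cJ.
have b k : jap k ^+ j * H k <= jap k ^+ 8 * H k ^+ 2 + (jap k ^+ 4)^-1.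
 have j1 := jap_ge1 k; have j0 := jap_gt0 k.
 apply: (@le_trans _ _ (jap k ^+ 2 * H k)); first by rewrite ler_wpM2r// ler_weXn2l.
 have p4 : 0 < jap k ^+ 4 by rewrite exprn_gt0.
 have e : jap k ^+ 2 * H k = (jap k ^+ 4 * H k) * (jap k ^+ 2)^-1 by field; rewrite gt_eqF.
 rewrite e (_ : jap k ^+ 8 * _ = (jap k ^+ 4 * H k) ^+ 2); last by ring.
 rewrite (_ : (jap k ^+ 4)^-1 = ((jap k ^+ 2)^-1) ^+ 2); last by field; rewrite gt_eqF.
 move: (jap k ^+ 4 * H k) ((jap k ^+ 2)^-1) => x y; have := sqr_ge0 (x - y); have := sqr_ge0 (x + y); nra.
have b' k : `|jap k ^+ j * H k| <= jap k ^+ 8 * H k ^+ 2 + (jap k ^+ 4)^-1.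
 by rewrite ger0_norm// mulr_ge0// exprn_ge0// ltW// jap_gt0.
have i1 := le_intg m1 b' h; split=> //.
by rewrite /N8 /cJ -RintD//; [apply: le_Rint|exact: intg_cJ].
Qed.

Lemma adm0_L2 H : adm H -> L2 mu H.
Proof.
move=> h; have [[m i] _] := @adm_L2 H 0 isT h.
by split; [have [] := h|apply: eq_intg i => k; rewrite mul1r].
Qed.

Lemma adm_le H (w : K -> R) : mfun H -> mfun w -> (forall k, jap k ^+ 8 <= w k) ->
 intg mu (fun k => w k * H k ^+ 2) -> adm H /\ N8 H <= \int[mu]_k (w k * H k ^+ 2).
Proof.
move=> mH mw jw iw; have mj := @mf_jap.
have b k : jap k ^+ 8 * H k ^+ 2 <= w k * H k ^+ 2 by rewrite ler_wpM2r ?sqr_ge0.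
have i1 : intg mu (fun k => jap k ^+ 8 * H k ^+ 2).
 apply: le_intg iw; first by mtac.
 by move=> k; rewrite ger0_norm// mulr_ge0 ?sqr_ge0 ?exprn_ge0// ltW// jap_gt0.
by split=> //; apply: le_Rint.
Qed.

Lemma japX_ge0 (k : K) j : 0 <= jap k ^+ j :> R.
Proof. by rewrite exprn_ge0// ltW// jap_gt0. Qed.
Lemma mf_japX j : mfun (fun k : K => jap k ^+ j : R).
Proof. by mtac. Qed.

(** The extra power of [jap k] is distributed by [jap k <= jap a * jap (k - a)]. In total three
    powers fall on [F] in [L2] and two on [G] in [L1], within the range of [adm]. *)
Lemma NN_jap M : exists2 C, 0 <= C & forall F G, adm F -> adm G -> N8 F <= M -> N8 G <= M ->
 L2 mu (fun k => jap k * NN F G k) /\ \int[mu]_k ((jap k * NN F G k) ^+ 2) <= C.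
Proof.
have c0 := cJ_ge0.
pose a := 9 * (`|M| + cJ); have a0 : 0 <= a by rewrite /a mulr_ge0// addr_ge0.
exists (@cF ^+ 2 * ((1 + a) * (4 * (`|M| * a)))).
 by apply: mulr_ge0; [exact: sqr_ge0|do ![apply: mulr_ge0 => //]; apply: addr_ge0].
move=> F G hF hG FM GM; have [mF _] := hF; have [mG _] := hG.
have [gF eF] := adm_gm hF; have [gG eG] := adm_gm hG.
have [L1 b1] := @adm_L2 _ 3 isT gF; have [I1 b2] := @adm_L1 _ 2 isT gG (gm_ge0 G).
have mj := @mf_jap.
have sb (x k : K) : `|jap k| * `|Lw x * cr x k| <= jap x ^+ 3 * (9 * jap (cv x k) ^+ 2) :> R.
 have := sym_bd1 x k; rewrite -/(cv x k) => h; have h2 := jap_conv x k; rewrite -/(cv x k) in h2.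
 rewrite (ger0_norm (ltW (jap_gt0 k))).
 apply: le_trans (ler_pM (ltW (jap_gt0 k)) (normr_ge0 _) h2 h) _.
 by apply: eq_ler; ring.
have iQ : intg mu (fun k => 9 * jap k ^+ 2 * gm G k) by apply: eq_intg (intgZ 9 I1) => k; rewrite mulrA.
have [h1 h2] := @NN_young1 F G jap (fun k => jap k ^+ 3) (fun k => 9 * jap k ^+ 2) mF mG mj
 (fun k => japX_ge0 k 3) (fun k => mulr_ge0 (ler0n _ 9) (japX_ge0 k 2)) sb L1 iQ.
split=> //; apply: le_trans h2 _.
rewrite ler_wpM2l ?sqr_ge0//.
have q0 : 0 <= \int[mu]_k (9 * jap k ^+ 2 * gm G k).
 by apply: Rint_ge0 => k; rewrite mulr_ge0 ?gm_ge0// mulr_ge0// japX_ge0.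
have qa : \int[mu]_k (9 * jap k ^+ 2 * gm G k) <= a.
 rewrite (_ : \int[mu]_k _ = 9 * \int[mu]_k (jap k ^+ 2 * gm G k)).
  by rewrite ler_pM2l//; apply: le_trans b2 _; rewrite lerD2r eG (le_trans GM)// ler_norm.
 by rewrite -RintZ//; apply: eq_Rint => k; rewrite mulrA.
have p0 : 0 <= \int[mu]_k ((jap k ^+ 3 * gm F k) ^+ 2) by apply: Rint_ge0 => k; exact: sqr_ge0.
have pM : \int[mu]_k ((jap k ^+ 3 * gm F k) ^+ 2) <= `|M|.
 by apply: le_trans b1 _; rewrite eF (le_trans FM)// ler_norm.
apply: ler_pM; rewrite ?addr_ge0 ?mulr_ge0//; first by rewrite lerD2l.
by rewrite ler_pM2l//; apply: ler_pM.
Qed.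

Lemma low_arith (c Q a I : R) : 0 <= I -> 0 <= Q -> Q <= a -> c ^+ 2 * ((1 + Q) * (4 * (I * Q))) <= c ^+ 2 * ((1 + a) * (4 * a)) * I.
Proof.
move=> I0 Q0 Qa; have k : (1 + Q) * Q <= (1 + a) * a.
 by apply: ler_pM => //; [rewrite addr_ge0|rewrite lerD2l].
have q : 0 <= c ^+ 2 * 4 * I.
 by apply: mulr_ge0 => //; apply: mulr_ge0 => //; exact: sqr_ge0.
apply: le_trans (le_trans _ (ler_wpM2l q k)) _; apply: eq_ler; ring.
Qed.

Lemma jap_inv2 (k : K) : 0 <= (jap k ^+ 2)^-1 :> R.
Proof. by rewrite invr_ge0 japX_ge0. Qed.
Lemma mf_jinv : mfun (fun k : K => (jap k ^+ 2)^-1 : R).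
Proof. by apply: mf_inv => [|k]; [exact: mf_japX|rewrite exprn_gt0// jap_gt0]. Qed.

(** Dividing by [jap k ^+ 2] moves all derivatives off [D], so the bound is linear in the squared
    [L2] norm of [D], whichever argument [D] occupies. *)
Lemma NN_low M : exists2 C, 0 <= C & forall D G, L2 mu D -> adm G -> N8 G <= M ->
 [/\ L2 mu (fun k => (jap k ^+ 2)^-1 * NN D G k), L2 mu (fun k => (jap k ^+ 2)^-1 * NN G D k),
  \int[mu]_k (((jap k ^+ 2)^-1 * NN D G k) ^+ 2) <= C * \int[mu]_k (D k ^+ 2) &
  \int[mu]_k (((jap k ^+ 2)^-1 * NN G D k) ^+ 2) <= C * \int[mu]_k (D k ^+ 2)].
Proof.
have c0 := cJ_ge0.
pose a := 9 * (`|M| + cJ); have a0 : 0 <= a by rewrite /a mulr_ge0// addr_ge0.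
exists (@cF ^+ 2 * ((1 + a) * (4 * a))).
 by apply: mulr_ge0; [exact: sqr_ge0|do ![apply: mulr_ge0 => //]; apply: addr_ge0].
move=> D G LD hG GM; have [mD _] := LD; have [mG _] := hG.
have [gG eG] := adm_gm hG; have [gD eD] := gm_L2 LD.
have [I1 b2] := @adm_L1 _ 2 isT gG (gm_ge0 G).
have sb1 (x k : K) : `|(jap k ^+ 2)^-1| * `|Lw x * cr x k| <= 1 * (9 * jap (cv x k) ^+ 2) :> R.
 have := sym_bd2 x k; rewrite -/(cv x k) => h.
 rewrite (ger0_norm (jap_inv2 k)) mulrC ler_pdivrMr ?exprn_gt0 ?jap_gt0//.
 by apply: le_trans h _; apply: eq_ler; ring.
have sb2 (x k : K) : `|(jap k ^+ 2)^-1| * `|Lw x * cr x k| <= (9 * jap x ^+ 2) * 1 :> R.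
 have h := sym_bd3 x k.
 rewrite (ger0_norm (jap_inv2 k)) mulrC ler_pdivrMr ?exprn_gt0 ?jap_gt0//.
 apply: le_trans h _; rewrite mulr1 mulrA; apply: ler_wpM2l; first by rewrite mulr_ge0// japX_ge0.
 by have j1 := jap_ge1 k; rewrite expr2 ler_peMl// (le_trans ler01).
have iQ : intg mu (fun k => 9 * jap k ^+ 2 * gm G k) by apply: eq_intg (intgZ 9 I1) => k; rewrite mulrA.
have L1 : L2 mu (fun k => 1 * gm D k) by have := L2Z 1 gD.
have p1 (k : K) : 0 <= 9 * jap k ^+ 2 :> R by rewrite mulr_ge0// japX_ge0.
have p2 (k : K) : 0 <= 1 :> R by [].
have [h1 h2] := @NN_young1 D G (fun k => (jap k ^+ 2)^-1) (fun k => 1) (fun k => 9 * jap k ^+ 2) mD mG mf_jinv p2 p1 sb1 L1 iQ.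
have [h3 h4] := @NN_young2 G D (fun k => (jap k ^+ 2)^-1) (fun k => 9 * jap k ^+ 2) (fun k => 1) mG mD mf_jinv p1 p2 sb2 iQ L1.
have q0 : 0 <= \int[mu]_k (9 * jap k ^+ 2 * gm G k).
 by apply: Rint_ge0 => k; rewrite mulr_ge0 ?gm_ge0.
have qa : \int[mu]_k (9 * jap k ^+ 2 * gm G k) <= a.
 rewrite (_ : \int[mu]_k _ = 9 * \int[mu]_k (jap k ^+ 2 * gm G k)).
  by rewrite ler_pM2l//; apply: le_trans b2 _; rewrite lerD2r eG (le_trans GM)// ler_norm.
 by rewrite -RintZ//; apply: eq_Rint => k; rewrite mulrA.
have e1 : \int[mu]_k ((1 * gm D k) ^+ 2) = \int[mu]_k (D k ^+ 2).
 by rewrite -eD; apply: eq_Rint => k; rewrite mul1r.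
have d0 : 0 <= \int[mu]_k (D k ^+ 2) by apply: Rint_ge0 => k; exact: sqr_ge0.
split=> //.
 by apply: le_trans h2 _; rewrite e1; exact: low_arith.
by apply: le_trans h4 _; rewrite e1 [X in 4 * X]mulrC; exact: low_arith.
Qed.

Lemma nf_intg F G : adm F -> adm G -> intg M2 (fun z => nf F G z.1 z.2) /\
 \int[M2]_z `|nf F G z.1 z.2| <= 18 * ((N8 F + cJ) * (N8 G + cJ)).
Proof.
move=> hF hG; have [mF _] := hF; have [mG _] := hG.
have [gF eF] := adm_gm hF; have [gG eG] := adm_gm hG.
have [i1 b1] := @adm_L1 _ 2 isT gF (gm_ge0 F); have [i2 b2] := @adm_L1 _ 1 isT gG (gm_ge0 G).
have i3 := intgM12 i1 i2; have P1 := pres_conv2.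
have i4 := intgZ 18 (pres_intg P1 i3).
have b z : `|nf F G z.1 z.2| <= 18 * ((jap z.1 ^+ 2 * gm F z.1) * (jap (cv z.1 z.2) ^+ 1 * gm G (cv z.1 z.2))).
 rewrite /nf normrM expr1; have := sym_bd1 z.1 z.2; rewrite -/(cv z.1 z.2) => h.
 apply: le_trans (ler_pM (normr_ge0 _) (normr_ge0 _) h (Qb_bound _ _ _ _)) _.
 by apply: eq_ler; ring.
have h := le_intg (mf_nf mF mG) b i4; split=> //.
apply: (@le_trans _ _ (\int[M2]_z (18 * ((jap z.1 ^+ 2 * gm F z.1) * (jap (cv z.1 z.2) ^+ 1 * gm G (cv z.1 z.2)))))).
 by apply: le_Rint => //; exact: intg_norm.
rewrite RintZ; last exact: (pres_intg P1 i3).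
rewrite ler_pM2l//; apply: le_trans (eq_ler (etrans (pres_Rint P1 (intg_mf i3)) (RintM12 i1 i2))) _.
have ge j H : 0 <= \int[mu]_k (jap k ^+ j * gm H k).
 by apply: Rint_ge0 => k; rewrite mulr_ge0 ?gm_ge0// japX_ge0.
by rewrite -eF -eG; apply: ler_pM.
Qed.

End Estimates.

#[local] Hint Resolve mf_japX mf_jinv : mf.

(** * Cancellations in the quadratic and cubic pairings *)

Section Pairings.

Implicit Types (F G E H D : K -> R).

Lemma NN_L1 F G : adm F -> adm G -> intg mu (NN F G) /\
 \int[mu]_k `|NN F G k| <= @cF * (18 * ((N8 F + cJ) * (N8 G + cJ))).
Proof.
move=> hF hG; have [i1 b1] := nf_intg hF hG; have c0 := @cF_gt0.
have i2 := intgZ cF (intg_Rint2 i1); split=> //.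
have i3 := intg_Rint2 (intg_norm i1).
apply: (@le_trans _ _ (\int[mu]_k (cF * \int[mu]_a `|nf F G a k|))).
 apply: ae_le_Rint; [exact: intg_norm i2|exact: intgZ i3|].
 apply: ae1 (ae_intg1 (intg_swap i1)) _ => k ik.
 by rewrite /NN normrM (gtr0_norm c0) ler_pM2l//; exact: (norm_Rint ik).
by rewrite RintZ// ler_pM2l// (Rfubini2 (intg_norm i1)).
Qed.

Section Pair.
Variables E F G : K -> R.
Hypotheses (mE : mfun E) (mF : mfun F) (mG : mfun G).
Hypothesis iI : intg M2 (fun z => E z.2 * nf F G z.1 z.2).

Let Psi (a b k : K) := Lw a * cr a k * T3 F G E a b k.

(** Flip [k] to reach symmetric triples, then average with the simultaneous reversal of all
    frequencies. What remains of the four sign combinations is exactly [T3]. *)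
Lemma pairing : intg M2 (ev3 Psi) /\ \int[mu]_k (E k * NN F G k) = - (@cF * \int[M2]_z ev3 Psi z).
Proof.
pose I (z : K * K) := E z.2 * nf F G z.1 z.2.
have i1 := pres_intg (pres_nk) iI; have i2 := pres_intg (pres_neg2) i1.
have e1 := pres_Rint (pres_nk) (intg_mf iI); have e2 := pres_Rint (pres_neg2) (intg_mf i1).
have pt z : - 2^-1 * (I (nk z) + I (nk (neg2 z))) = ev3 Psi z.
 case: z => a k; rewrite /ev3 /I /nf /= !negKK cv_neg cv_neg' (Lw_neg a).
 rewrite (_ : cr a (negK k) = - cr a k); last by rewrite /cr /negK /=; ring.
 rewrite (_ : cr (negK a) k = - cr a k); last by rewrite /cr /negK /=; ring.
 by rewrite /Psi /T3 /Qb /ev /od !negKK; field.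
have i3 := intgZ (- 2^-1) (intgD i1 i2).
split; first by apply: eq_intg i3 => z; rewrite -pt.
have -> : \int[M2]_z ev3 Psi z = - \int[M2]_z I z.
 transitivity (\int[M2]_z (- 2^-1 * (I (nk z) + I (nk (neg2 z))))); first by apply: eq_Rint => z; rewrite pt.
 rewrite RintZ; last exact: intgD i1 i2.
 by rewrite (RintD i1 i2) e2 e1; field.
rewrite mulrN opprK -(Rfubini2 iI) -RintZ; last exact: (intg_Rint2 iI).
apply: ae_Rint.
- by mtac.
- by apply: mfunM; [exact: mfun_cst|exact: (intg_mf (intg_Rint2 iI))].
- apply: ae1 (ae_intg1 (intg_swap iI)) _ => k ik.
 rewrite /NN mulrCA; congr (_ * _).
 exact/esym/(Rint_scale (c := E k) (f := fun a => nf F G a k) ik).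
Qed.

End Pair.

Lemma mf_T3 F G E : mfun F -> mfun G -> mfun E -> mfun (ev3 (T3 F G E)).
Proof.
move=> mF mG mE.
have he H : mfun H -> mfun (ev H).
 by move=> mH; have mH' := mf_neg mH; apply: mfunM => //; exact: mfunD.
have ho H : mfun H -> mfun (od H).
 by move=> mH; have mH' := mf_neg mH; apply: mfunM => //; exact: mfunB.
have m1 := mf_at1 (he _ mF); have m2 := mf_at1 (ho _ mF).
have m3 := mf_att (he _ mG); have m4 := mf_att (ho _ mG).
have m5 := mf_at2 (he _ mE); have m6 := mf_at2 (ho _ mE).
rewrite /ev3 /T3; apply: mfunB; apply: mfunM => //.
 by mtac.
by mtac.
Qed.

Lemma mf_Phi E F G : mfun F -> mfun G -> mfun E ->
 mfun (ev3 (fun a b k => E (negK k) * (Lw a * cr a (negK k) * Qb F G a b))).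
Proof.
move=> mF mG mE; apply: (@mf_conv (fun a b k => E k * (Lw a * cr a k * Qb F G a b))).
apply: mfunM; first exact: mf_at2.
exact: (mf_nf).
Qed.

Lemma Phi_intg E F G : intg M2 (ev3 (fun a b k => E (negK k) * (Lw a * cr a (negK k) * Qb F G a b))) ->
 intg M2 (fun z => E z.2 * nf F G z.1 z.2).
Proof.
move=> h; apply: eq_intg (pres_intg (pres_nk) h) => z.
by rewrite (conv_ev3 (fun a b k => E k * (Lw a * cr a k * Qb F G a b))).
Qed.

Lemma Lwcr_neg1 (a k : K) : `|Lw a * cr a (negK k)| <= 9 * (jap a ^+ 2 * jap (third a k)) :> R.
Proof. by have := sym_bd1 a (negK k); rewrite -/(cv a (negK k)) cv_neg. Qed.
Lemma Lwcr_neg3 (a k : K) : `|Lw a * cr a (negK k)| <= 9 * (jap a ^+ 2 * jap k) :> R.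
Proof. by have := sym_bd3 a (negK k); rewrite {2}/jap norm2_neg. Qed.
Lemma jap_neg (k : K) : jap (negK k) = jap k :> R.
Proof. by rewrite /jap norm2_neg. Qed.

(** [D] occupies both the argument under the logarithm and the pairing. Symmetrising these two
    produces the difference of logarithms of [sym_bd4], which throws both derivatives on [H]. *)
Lemma stab1 M : exists2 C, 0 <= C & forall H D, adm H -> adm D -> N8 H <= M ->
 `|\int[mu]_k (D k * NN D H k)| <= C * \int[mu]_k (D k ^+ 2).
Proof.
have c0 := cJ_ge0; have cF0 := @cF_gt0.
exists (cF * (`|M| + cJ)); first by rewrite mulr_ge0 ?addr_ge0// ltW.
move=> H D hH hD HM; have [mH _] := hH; have [mD _] := hD; have LD := adm0_L2 hD.
have [gH eH] := adm_gm hH; have [gD eD] := adm_gm hD; have [LgD egD] := gm_L2 LD.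
have [iA bA] := @adm_L1 _ 1 isT gH (gm_ge0 H).
have [iA2 bA2] := @adm_L1 _ 2 isT gH (gm_ge0 H).
have [LB _] := @adm_L2 _ 2 isT gD.
have LB' := L2Z 18 LB.
have [|h1 _] := @tri_b _ _ _ _ iA LB' (neg_L2 LD) (mf_Phi mD mH mD).
 move=> a k; rewrite [leLHS]normrM.
 have h := ler_pM (normr_ge0 _) (normr_ge0 _) (Lwcr_neg1 a k) (Qb_bound D H a (third a k)).
 rewrite -normrM in h.
 apply: le_trans (ler_wpM2l (normr_ge0 _) h) _.
 have q1 : 0 <= jap (third a k) ^+ 1 * gm H (third a k) by rewrite mulr_ge0 ?gm_ge0 ?japX_ge0.
 have q2 : 0 <= 18 * (jap a ^+ 2 * gm D a) by rewrite mulr_ge0// mulr_ge0 ?gm_ge0 ?japX_ge0.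
 by rewrite (ger0_norm q1) (ger0_norm q2) expr1; apply: eq_ler; ring.
have [iP eP] := pairing mD mD mH (Phi_intg h1).
have [iP2 eP2] := swp_ev3 iP.
pose Th (a b k : K) := (Lw a - Lw k) * cr a k * T3 D H D a b k.
have mTh : mfun (ev3 Th).
 have ml1 := mf_at1 (@mf_Lw); have ml2 := mf_at2 (@mf_Lw).
 apply: mfunM; last exact: (mf_T3 mD mH mD).
 by mtac.
have [|iT bT] := @tri_b _ _ _ _ iA2 LgD LgD mTh.
 move=> a k; rewrite /Th normrM.
 have h := ler_pM (normr_ge0 _) (normr_ge0 _) (sym_bd4 a k) (T3_bound D H D a (third a k) k).
 apply: le_trans h _.
 have q1 : 0 <= jap (third a k) ^+ 2 * gm H (third a k) by rewrite mulr_ge0 ?gm_ge0 ?japX_ge0.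
 rewrite (ger0_norm q1) (ger0_norm (gm_ge0 D a)) (ger0_norm (gm_ge0 D k)).
 rewrite [leRHS](_ : _ = jap (third a k) ^+ 2 * (gm D a * gm H (third a k) * gm D k)); last by ring.
 rewrite ler_wpM2r ?mulr_ge0 ?gm_ge0//; apply: lerXn2r; rewrite ?nnegrE ?norm2_ge0 ?norm2_jap//.
 exact/ltW/jap_gt0.
(* Exchanging [a] and [k] changes the sign of [cr] and fixes [T3 D H D]. *)
have e2 : \int[M2]_z ev3 Th z = 2 * \int[M2]_z ev3 (fun a b k => Lw a * cr a k * T3 D H D a b k) z.
 rewrite (_ : 2 * _ = \int[M2]_z ev3 (fun a b k => Lw a * cr a k * T3 D H D a b k) z +
  \int[M2]_z ev3 (fun a b k => Lw k * cr k a * T3 D H D k b a) z); last by rewrite eP2; ring.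
 rewrite -RintD//; apply: eq_Rint => z; rewrite /ev3 /Th crC /T3; ring.
have I0 : 0 <= \int[mu]_k (D k ^+ 2) by apply: Rint_ge0 => k; exact: sqr_ge0.
have a1 : \int[mu]_k `|jap k ^+ 2 * gm H k| <= `|M| + cJ.
 apply: (@le_trans _ _ (\int[mu]_k (jap k ^+ 2 * gm H k))).
  by apply: eq_ler; apply: eq_Rint => k; rewrite ger0_norm// mulr_ge0 ?gm_ge0 ?japX_ge0.
 by apply: le_trans bA2 _; rewrite lerD2r eH (le_trans HM)// ler_norm.
have : `|\int[M2]_z ev3 Th z| <= (`|M| + cJ) * \int[mu]_k (D k ^+ 2).
 apply: le_trans (norm_Rint iT) _; apply: le_trans bT _; rewrite egD.
 by apply: le_trans (ler_wpM2r I0 a1); apply: eq_ler; field.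
rewrite e2 normrM ger0_norm// eP normrN normrM (gtr0_norm cF0) -mulrA ler_pM2l// => h.
by apply: le_trans h; rewrite mulr_natl mulr2n lerDl.
Qed.

(** The velocity built from [H] is divergence free: exchanging the two frequencies of [D] changes
    the sign of [cr] and of nothing else, so the integral equals its own negative. *)
Lemma stab0 H D : adm H -> adm D -> \int[mu]_k (D k * NN H D k) = 0.
Proof.
move=> hH hD; have [mH _] := hH; have [mD _] := hD; have LD := adm0_L2 hD.
have [gH eH] := adm_gm hH; have [LgD egD] := gm_L2 LD.
have [iA bA] := @adm_L1 _ 2 isT gH (gm_ge0 H); have iA' := intgZ 18 iA.
have [LC0 _] := @adm_L2 _ 1 isT hD; have LC := neg_L2 LC0.
have [|h1 _] := @tri_a _ _ _ _ iA' LgD LC (mf_Phi mH mD mD).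
 move=> a k; rewrite [leLHS]normrM.
 have h := ler_pM (normr_ge0 _) (normr_ge0 _) (Lwcr_neg3 a k) (Qb_bound H D a (third a k)).
 rewrite -normrM in h.
 apply: le_trans (ler_wpM2l (normr_ge0 _) h) _.
 have q1 : 0 <= 18 * (jap a ^+ 2 * gm H a) by rewrite mulr_ge0// mulr_ge0 ?gm_ge0 ?japX_ge0.
 rewrite (ger0_norm q1) (ger0_norm (gm_ge0 _ _)) expr1 [`|jap (negK k) * _|]normrM jap_neg (ger0_norm (ltW (jap_gt0 k))).
 by apply: eq_ler; ring.
have [iP eP] := pairing mD mH mD (Phi_intg h1).
have [iP2 eP2] := shear_ev3 iP; rewrite eP.
set X := \int[M2]_z ev3 (fun a b k => Lw a * cr a k * T3 H D D a b k) z in eP2 *.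
suff -> : X = 0 by rewrite mulr0 oppr0.
suff : \int[M2]_z ev3 (fun a b k => Lw a * cr a b * T3 H D D a k b) z = - X by rewrite eP2; move: (X) => x; clear; lra.
rewrite /X -RintN//; apply: eq_Rint => z; rewrite /ev3 cr_third /T3; ring.
Qed.

Lemma admB F G : adm F -> adm G -> adm (fun k => F k - G k).
Proof.
move=> [mF iF] [mG iG]; have mD : mfun (fun k => F k - G k) by exact: mfunB.
have mj := @mf_japX 8.
split=> //; apply: le_intg (intgD (intgZ 2 iF) (intgZ 2 iG)); first by apply: mfunM => //; exact: mfunX.
move=> k; rewrite ger0_norm; last by apply: mulr_ge0; [exact: japX_ge0|exact: sqr_ge0].
have h : (F k - G k) ^+ 2 <= 2 * F k ^+ 2 + 2 * G k ^+ 2 by have := sqr_ge0 (F k + G k); nra.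
by apply: le_trans (ler_wpM2l (japX_ge0 k 8) h) _; apply: eq_ler; ring.
Qed.

Lemma NN_bilin F G : adm F -> adm G ->
 {ae mu, forall k, NN F F k - NN G G k = NN (fun k => F k - G k) F k + NN G (fun k => F k - G k) k}.
Proof.
move=> hF hG; have hD := admB hF hG.
have [i1 _] := nf_intg hF hF; have [i2 _] := nf_intg hG hG; have [i3 _] := nf_intg hD hF; have [i4 _] := nf_intg hG hD.
apply: ae2 (ae2 (ae_intg1 (intg_swap i1)) (ae_intg1 (intg_swap i2)) (fun x a b => conj a b))
 (ae2 (ae_intg1 (intg_swap i3)) (ae_intg1 (intg_swap i4)) (fun x a b => conj a b)) _ => k [a1 a2] [a3 a4].
rewrite /NN -mulrBr -mulrDr -(RintB a1 a2) -(RintD a3 a4); congr (_ * _).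
by apply: eq_Rint => a; rewrite /nf /Qb /=; ring.
Qed.

Lemma NN_L2 F G : adm F -> adm G -> L2 mu (NN F G).
Proof.
move=> hF hG; have [C _ h] := NN_jap (Num.max (N8 F) (N8 G)).
have [] := h F G hF hG; rewrite ?le_max ?lexx ?orbT// => -[mL iL] _.
have mN : mfun (NN F G) by apply: mf_NN; [case: hF|case: hG].
split=> //; apply: le_intg iL; first exact: mfunX.
by move=> k; rewrite ger0_norm ?sqr_ge0// [(jap k * _) ^+ 2]exprMn ler_peMl ?sqr_ge0// exprn_ege1// jap_ge1.
Qed.

(** The difference of nonlinearities is [NN D F + NN G D]. The second part is annihilated by
    [stab0], so only the bound on [F] enters the constant. *)
Lemma stability M : exists2 C, 0 <= C & forall F G, adm F -> adm G -> N8 F <= M ->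
 `|\int[mu]_k ((F k - G k) * (NN F F k - NN G G k))| <= C * \int[mu]_k ((F k - G k) ^+ 2).
Proof.
have [C C0 hC] := stab1 M; exists C => // F G hF hG FM; have hD := admB hF hG.
have [mD _] := hD; have [_ iD] := adm0_L2 hD.
have i1 := intg_sqM mD (proj1 (NN_L2 hD hF)) iD (proj2 (NN_L2 hD hF)).
have i2 := intg_sqM mD (proj1 (NN_L2 hG hD)) iD (proj2 (NN_L2 hG hD)).
have e : \int[mu]_k ((F k - G k) * (NN F F k - NN G G k)) =
  \int[mu]_k ((F k - G k) * NN (fun k => F k - G k) F k + (F k - G k) * NN G (fun k => F k - G k) k).
 apply: ae_Rint.
 - apply: mfunM => //; apply: mfunB; first by case: (NN_L2 hF hF).
  by case: (NN_L2 hG hG).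
 - exact: intg_mf (intgD i1 i2).
 - by apply: ae1 (NN_bilin hF hG) _ => k ->; rewrite mulrDr.
rewrite e RintD// (stab0 hG hD) addr0.
exact: hC.
Qed.

Lemma arith6 (x c b : R) : 0 <= x -> 6 * x <= c * (3 * b) -> x <= c * b.
Proof. by move=> x0; rewrite [c * _]mulrCA => h; lra. Qed.

Section Energy.
Variable s : R.
Hypothesis s4 : 4 < s.

Lemma Wt_adm H : mfun H -> L2 mu (fun k => Wt s k * H k) -> adm H.
Proof.
move=> mH [_ iW]; have mj := @mf_japX 8.
have iW2 : intg mu (fun k => 16 * Wt s k ^+ 2 * H k ^+ 2).
 by apply: eq_intg (intgZ 16 iW) => k; rewrite exprMn mulrA.
have mw : mfun (fun k : K => 16 * Wt s k ^+ 2).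
 by mtac.
have hb (k : K) : jap k ^+ 8 <= 16 * Wt s k ^+ 2.
 apply: le_trans (Wt_jap s4 k) _; rewrite ler_pM2l//.
 by have W1 := Wt_ge1 s4 k; rewrite expr2 ler_peMl// (le_trans ler01).
by have [] := adm_le mH mw hb iW2.
Qed.

Lemma WL_intg H : mfun H -> L2 mu (fun k => Wt s k * H k) -> intg mu (fun k => WL s k * H k ^+ 2).
Proof.
move=> mH [_ iW]; have mL := @mf_Lw; have mW := @mf_Wt s.
apply: le_intg (intgZ 144 iW).
 by rewrite /WL; apply: mfunM; [exact: mfunM|exact: mfunX].
move=> k; have W1 := Wt_ge1 s4 k; have W0 := Wt_gt0 s k; have := Lw_le k; have L0 := Lw_gt0 k.
have j8 : jap k <= 16 * Wt s k.
 by apply: le_trans (Wt_jap s4 k); rewrite -[leLHS]expr1 ler_weXn2l ?jap_ge1.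
move=> L9; rewrite ger0_norm; last by rewrite mulr_ge0 ?sqr_ge0// ltW// WL_gt0.
rewrite [(Wt s k * _) ^+ 2]exprMn [144 * _]mulrA ler_wpM2r ?sqr_ge0//.
have h : Lw k <= 144 * Wt s k by lra.
by apply: le_trans (ler_wpM2l (ltW W0) h) _; apply: eq_ler; ring.
Qed.

(** The bound is by the norm with weight [WL], one logarithm more than the energy itself. This
    excess is what the damping has to pay for. *)
Lemma energy M : exists2 C, 0 <= C & forall H, mfun H -> L2 mu (fun k => Wt s k * H k) -> N8 H <= M ->
 `|\int[mu]_k (Wt s k * H k * NN H H k)| <= C * \int[mu]_k (WL s k * H k ^+ 2).
Proof.
have c0 := cJ_ge0; have cF0 := @cF_gt0; have Cs0 := Cs_gt0 s4.
exists (cF * (Cs s * (`|M| + cJ))).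
 by apply: mulr_ge0; [exact: ltW|apply: mulr_ge0; [exact: ltW|exact: addr_ge0]].
move=> H mH LE HM; have hH := Wt_adm mH LE; have [mE _] := LE.
have iWL := WL_intg mH LE.
have [gH eH] := adm_gm hH.
have [iA bA] := @adm_L1 _ 2 isT gH (gm_ge0 H).
have [LB _] := @adm_L2 _ 1 isT gH; have LB' := L2Z 18 LB.
have [|h1 _] := @tri_a _ _ _ _ iA LB' (neg_L2 LE) (mf_Phi mH mH mE).
 move=> a k; rewrite [leLHS]normrM.
 have h := ler_pM (normr_ge0 _) (normr_ge0 _) (Lwcr_neg1 a k) (Qb_bound H H a (third a k)).
 rewrite -normrM in h.
 apply: le_trans (ler_wpM2l (normr_ge0 _) h) _.
 have q1 : 0 <= jap a ^+ 2 * gm H a by rewrite mulr_ge0 ?gm_ge0 ?japX_ge0.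
 have q2 : 0 <= 18 * (jap (third a k) ^+ 1 * gm H (third a k)) by rewrite mulr_ge0// mulr_ge0 ?gm_ge0 ?japX_ge0.
 by rewrite (ger0_norm q1) (ger0_norm q2) expr1; apply: eq_ler; ring.
have [iP eP] := pairing mE mH mH (Phi_intg h1).
pose T a b k := T3 H H H a b k.
have eT (a b k : K) : Lw a * cr a k * T3 H H (fun k => Wt s k * H k) a b k = Wt s k * Lw a * cr a k * T a b k.
 by rewrite /T /T3 /ev /od Wt_neg; field.
pose P0 (a b k : K) := Wt s k * Lw a * cr a k * T a b k.
have i0 : intg M2 (ev3 P0) by apply: eq_intg iP => z; rewrite /ev3 eT.
have e0 : \int[mu]_k (Wt s k * H k * NN H H k) = - (cF * \int[M2]_z ev3 P0 z).
 by rewrite eP; congr (- (_ * _)); apply: eq_Rint => z; rewrite /ev3 eT.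
have [i1 e1] := swp_ev3 i0; have [i2 e2] := shear_ev3 i0.
have [i3 e3] := swp_ev3 i2; have [i4 e4] := shear_ev3 i1; have [i5 e5] := swp_ev3 i4.
pose Th (a b k : K) := Sy s a b k * cr a b * T a b k.
(* [T] is invariant under the six permutations and [cr] changes only by signs, so the coefficients
   combine into the determinant [Sy]. *)
have sum6 z : ev3 P0 z + ev3 (fun a b k => P0 k b a) z + ev3 (fun a b k => P0 a k b) z +
  (ev3 (fun a b k => P0 k a b) z + ev3 (fun a b k => P0 b k a) z + ev3 (fun a b k => P0 b a k) z) = - ev3 Th z.
 rewrite /ev3 /Th /P0; have -> : cr z.1 z.2 = - cr z.1 (third z.1 z.2) by rewrite cr_third opprK.
 set b := third z.1 z.2; move: (z.1) (z.2) @b => a k b.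
 have -> : cr k a = cr a b by clear; rewrite /cr /b /third /=; ring.
 have -> : cr k b = - cr a b by clear; rewrite /cr /b /third /=; ring.
 have -> : cr b k = cr a b by clear; rewrite /cr /b /third /=; ring.
 have -> : cr b a = - cr a b by clear; rewrite /cr /=; ring.
 by clear; rewrite /Sy /T /T3; ring.
have j1 := intgD (intgD i0 i1) i2; have j2 := intgD (intgD i3 i4) i5; have j3 := intgD j1 j2.
have iTh : intg M2 (ev3 Th) by apply: eq_intg (intgN j3) => z; rewrite sum6 opprK.
have six : 6 * \int[M2]_z ev3 P0 z = - \int[M2]_z ev3 Th z.
 rewrite -RintN// -(eq_Rint _ sum6) (RintD j1 j2) (RintD (intgD i0 i1) i2) (RintD i0 i1).
 rewrite (RintD (intgD i3 i4) i5) (RintD i3 i4) e5 e4 e3 e2 e1; clear; ring.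
(* The three terms of [Sy_bound] are products of one [A], placed in [L1], and two [V], placed in
   [L2]. *)
pose A k := norm2 k ^+ 2 * gm H k; pose V k := sW s k * gm H k.
have mg := mf_gm mH; have mn := @mf_norm2.
have A0 k : 0 <= A k by rewrite mulr_ge0 ?gm_ge0 ?sqr_ge0.
have leA k : A k <= jap k ^+ 2 * gm H k.
 rewrite ler_wpM2r ?gm_ge0//.
 by apply: lerXn2r; rewrite ?nnegrE ?norm2_ge0 ?norm2_jap// ltW// jap_gt0.
have iA2 : intg mu A.
 apply: le_intg iA; first by apply: mfunM; [exact: mfunX|].
 by move=> k; rewrite ger0_norm.
have bA2 : \int[mu]_k `|A k| <= `|M| + cJ.
 apply: le_trans (_ : \int[mu]_k (jap k ^+ 2 * gm H k) <= _); last first.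
  by apply: le_trans bA _; rewrite lerD2r eH (le_trans HM)// ler_norm.
 apply: le_Rint; [exact: intg_norm|exact: iA|].
 by move=> k; rewrite ger0_norm.
have mWL : mfun (WL s : K -> R).
 by apply: mfunM; [exact: mf_Wt|exact: mf_Lw].
have WLn (k : K) : WL s (negK k) = WL s k by rewrite /WL Wt_neg Lw_neg.
have [iV eV] := gm_int mWL WLn iWL.
have V2 k : V k ^+ 2 = WL s k * gm H k ^+ 2 by rewrite exprMn sqr_sqrtr// ltW// WL_gt0.
have LV : L2 mu V.
 split; last by apply: eq_intg iV => k; rewrite V2.
 apply: mfunM => //; apply: (@mfcomp _ _ _ _ _ _ (@Num.sqrt R) _ _ _ mWL).
 by apply: cont_mfun; exact: sqrt_continuous.
have eV2 : \int[mu]_k (V k ^+ 2) = \int[mu]_k (WL s k * H k ^+ 2).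
 by rewrite -eV; apply: eq_Rint => k; rewrite V2.
have mV := proj1 LV; have mA := intg_mf iA2.
have V0 k : 0 <= V k by rewrite mulr_ge0 ?gm_ge0 ?sqrtr_ge0.
have mt (X Y Z : K -> R) : mfun X -> mfun Y -> mfun Z -> mfun (ev3 (fun a b k => X a * Y b * Z k)).
 move=> mX mY mZ; apply: mfunM; last exact: mf_at2.
 by mtac.
have [|t1 b1] := @tri_a _ _ _ _ iA2 LV LV (mt _ _ _ mA mV mV).
 by move=> a k; rewrite !normrM.
have [|t2 b2] := @tri_b _ _ _ _ iA2 LV LV (mt _ _ _ mV mA mV).
 by move=> a k; rewrite !normrM; apply: eq_ler; clear; ring.
have [t3 e3'] := swp_ev3 t1.
have bd z : `|ev3 Th z| <= Cs s * (ev3 (fun a b k => A a * V b * V k) z + ev3 (fun a b k => V a * A b * V k) z +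
  ev3 (fun a b k => A k * V b * V a) z).
 rewrite /ev3 /Th; set a := z.1; set k := z.2; set b := third a k.
 have h := @Sy_bound s s4 a b k (ltac:(clear; rewrite /b /third /=; ring)) (ltac:(clear; rewrite /b /third /=; ring)).
 rewrite normrM; apply: le_trans (ler_pM (normr_ge0 _) (normr_ge0 _) h (T3_bound _ _ _ _ _ _)) _.
 by apply: eq_ler; rewrite /A /V; clear; ring.
have i123 := intgD (intgD t1 t2) t3.
have I0 : 0 <= \int[mu]_k (WL s k * H k ^+ 2).
 by apply: Rint_ge0 => k; rewrite mulr_ge0 ?sqr_ge0 ?(ltW (WL_gt0 _ _)).
have bound : `|\int[M2]_z ev3 Th z| <= Cs s * (3 * ((`|M| + cJ) * \int[mu]_k (WL s k * H k ^+ 2))).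
 apply: le_trans (norm_Rint iTh) _.
 apply: le_trans (le_Rint (intg_norm iTh) (intgZ _ i123) bd) _.
 rewrite RintZ// ler_pM2l// (RintD (intgD t1 t2) t3) (RintD t1 t2) e3'.
 rewrite eV2 in b1 b2.
 have nn (q : K * K -> R) : intg M2 q -> \int[M2]_z q z <= \int[M2]_z `|q z|.
  by move=> iq; exact: le_trans (ler_norm _) (norm_Rint iq).
 have hB : (\int[mu]_a `|A a|) * (\int[mu]_k (WL s k * H k ^+ 2) + \int[mu]_k (WL s k * H k ^+ 2)) / 2 <=
   (`|M| + cJ) * \int[mu]_k (WL s k * H k ^+ 2).
  by apply: le_trans (ler_wpM2r I0 bA2); apply: eq_ler; clear; field.
 have c1 := le_trans (le_trans (nn _ t1) b1) hB; have c2 := le_trans (le_trans (nn _ t2) b2) hB.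
 rewrite [leRHS](_ : _ = (`|M| + cJ) * \int[mu]_k (WL s k * H k ^+ 2) + (`|M| + cJ) * \int[mu]_k (WL s k * H k ^+ 2) +
  (`|M| + cJ) * \int[mu]_k (WL s k * H k ^+ 2)); last by clear; ring.
 exact: (lerD (lerD c1 c2) c1).
rewrite e0 normrN normrM (gtr0_norm cF0) -!mulrA ler_pM2l//.
apply: arith6; first exact: normr_ge0.
by rewrite -[6](@ger0_norm R)// -normrM six normrN.
Qed.

End Energy.

End Pairings.

(** * Null sections and integration over a time interval *)

Section Sections.
Context d1 d2 (T1 : measurableType d1) (T2 : measurableType d2) (m1 : sfmeas T1 R) (m2 : sfmeas T2 R).

Lemma ae_sec1 (Q : T1 * T2 -> Prop) : {ae (pm m1 m2), forall z, Q z} ->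
 {ae m1, forall x, {ae m2, forall y, Q (x, y)}}.
Proof.
move=> [A [mA A0 hA]].
have mI : mfun (\1_A : T1 * T2 -> R) by mtac.
have I0 z : 0 <= \1_A z :> R by rewrite indicE; case: (_ \in _).
have e0 : (\int[pm m1 m2]_z (\1_A z : R)%:E = 0)%E by rewrite integral_indic// setIT.
have iI : intg (pm m1 m2) (\1_A : T1 * T2 -> R) by apply: ge0_intg => //; rewrite e0.
have e1 : \int[pm m1 m2]_z (\1_A z : R) = 0 by rewrite /Rintegral e0.
have h1 : {ae m1, forall x, \int[m2]_y (\1_A (x, y) : R) = 0}.
 apply: Rint_eq0; [exact: intg_Rint1|by move=> x; exact: Rint_ge0|].
 by rewrite (Rfubini1 iI).
apply: ae2 h1 (ae_intg1 iI) _ => x hx ix.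
apply: ae1 (Rint_eq0 ix (fun y => I0 _) hx) _ => y.
rewrite indicE; case: (boolP (_ \in A)) => [_ /eqP|nA _]; first by rewrite oner_eq0.
by apply: contrapT => nQ; move/negP: nA; apply; rewrite inE; exact: hA.
Qed.

End Sections.

Section Sections2.
Context d1 d2 (T1 : measurableType d1) (T2 : measurableType d2) (m1 : sfmeas T1 R) (m2 : sfmeas T2 R).

Lemma ae_sec2 (Q : T1 * T2 -> Prop) : {ae (pm m1 m2), forall z, Q z} ->
 {ae m2, forall y, {ae m1, forall x, Q (x, y)}}.
Proof.
move=> [A [mA A0 hA]].
have mI : mfun (\1_A : T1 * T2 -> R) by mtac.
have I0 z : 0 <= \1_A z :> R by rewrite indicE; case: (_ \in _).
have e0 : (\int[pm m1 m2]_z (\1_A z : R)%:E = 0)%E by rewrite integral_indic// setIT.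
have iI : intg (pm m1 m2) (\1_A : T1 * T2 -> R) by apply: ge0_intg => //; rewrite e0.
have e1 : \int[pm m1 m2]_z (\1_A z : R) = 0 by rewrite /Rintegral e0.
have h1 : {ae m2, forall y, \int[m1]_x (\1_A (x, y) : R) = 0}.
 apply: Rint_eq0; [exact: intg_Rint2|by move=> y; exact: Rint_ge0|].
 by rewrite (Rfubini2 iI).
apply: ae2 h1 (ae_intg1 (intg_swap iI)) _ => y hy iy.
apply: ae1 (Rint_eq0 iy (fun x => I0 _) hy) _ => x.
rewrite indicE; case: (boolP (_ \in A)) => [_ /eqP|nA _]; first by rewrite oner_eq0.
by apply: contrapT => nQ; move/negP: nA; apply; rewrite inE; exact: hA.
Qed.

End Sections2.

Section TimeInterval.
Variable T : R.
Hypothesis T0 : 0 <= T.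

Lemma itv01 : [set t : R | 0 <= t <= T] = `[0, T]%classic.
Proof. by apply/seteqP; split => x /=; rewrite in_itv. Qed.
Lemma mT : measurable ([set t | 0 <= t <= T] : set RM).
Proof. by rewrite itv01; exact: measurable_itv. Qed.
Definition tm := rmeas leb mT.

Lemma tm_itv (f : RM -> R) : mfun f -> \int[tm]_x f x = \int[leb]_(x in [set t | 0 <= t <= T]) f x.
Proof.
by move=> mf; rewrite /Rintegral integral_mrestr//; exact/EFinP.
Qed.

Lemma ae_tm : {ae tm, forall t, 0 <= t <= T}.
Proof.
exists (~` [set t | 0 <= t <= T]); split => //; first by apply: measurableC; exact: mT.
by rewrite /= /tm /rmeas /mrestr setICl measure0.
Qed.

Lemma tm_setT : tm setT = T%:E.
Proof.
have -> : tm setT = leb `[0, T]%classic by rewrite /tm /rmeas /mrestr setTI -itv01.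
by rewrite lebesgue_measure_itv /= lte_fin; case: ltP T0 => [_|h1 h2]; rewrite ?sube0//; congr (_%:E); lra.
Qed.

Lemma tm_cst c : intg tm (fun _ : RM => c) /\ \int[tm]_(x in setT) c = T * c.
Proof.
have h c' : (\int[tm]_(x in setT) c'%:E = (T * c')%:E)%E by rewrite integral_cst// -[X in (_ * X)%E]/(tm setT) tm_setT muleC.
split; last by rewrite /Rintegral h.
apply: (le_intg (g := fun=> `|c|)) => //.
by apply: ge0_intg => //; rewrite h ltry.
Qed.

Lemma tm_bdd (f : RM -> R) B : mfun f -> (forall x, `|f x| <= B) -> intg tm f.
Proof. by move=> mf fB; apply: le_intg mf fB (proj1 (tm_cst B)). Qed.

Lemma tm_L1 (f : RM -> R) : L2 tm f -> intg tm f.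
Proof.
move=> [mf if2]; have [h1 _] := tm_cst 1; apply: le_intg mf _ (intgD h1 if2) => x.
by have := sqr_ge0 (`|f x| - 1); have := real_normK (num_real (f x)); have := normr_ge0 (f x); nra.
Qed.

(** The truth value of [a <= b], as an indicator of a half-line evaluated at [b - a], which makes
    joint measurability immediate. *)
Definition le1 (a b : R) : R := \1_(`[0, +oo[%classic : set RM) (b - a).

Lemma le1E a b : le1 a b = (nat_of_bool (a <= b)%R)%:R.
Proof.
rewrite /le1 indicE; congr ((nat_of_bool _)%:R); apply/idP/idP.
 by rewrite inE /= in_itv /= andbT subr_ge0.
by move=> h; rewrite inE /= in_itv /= andbT subr_ge0.
Qed.

Lemma le1_01 a b : 0 <= le1 a b <= 1.
Proof. by rewrite le1E; case: (a <= b); rewrite ?lexx ?ler01. Qed.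

Lemma mf_le1 d (X : measurableType d) (f g : X -> RM) : mfun f -> mfun g -> mfun (fun x => le1 (f x) (g x)).
Proof.
move=> mf mg; have mI : mfun (\1_(`[0, +oo[%classic : set RM) : RM -> R).
 by mtac.
have h : mfun (fun x => g x - f x : RM) by mtac.
exact: (mfcomp mI h).
Qed.

Lemma norm_le1 a b : `|le1 a b| <= 1.
Proof. by have /andP[h1 h2] := le1_01 a b; rewrite ger0_norm. Qed.

Lemma int_le1 a : 0 <= a <= T -> \int[tm]_t le1 a t = T - a.
Proof.
move=> /andP[a0 aT].
have m : mfun (fun t : RM => le1 a t) by apply: mf_le1.
rewrite tm_itv// itv01 /le1.
transitivity (\int[leb]_(x in `[0, T]) (\1_(`[a, +oo[%classic) x)).
 apply: eq_Rintegral => x _; rewrite !indicE; congr ((nat_of_bool _)%:R).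
 by apply/idP/idP; rewrite !inE /= !in_itv /= !andbT subr_ge0.
have mi : measurable (`[a, +oo[%classic : set RM) by exact: measurable_itv.
rewrite /Rintegral integral_indic//.
rewrite (_ : _ `&` _ = `[a, T]%classic); last first.
 apply/seteqP; split => x /=; rewrite !in_itv /= ?andbT; first by move=> [-> /andP[]].
 by move=> /andP[ax xT]; rewrite ax xT (le_trans a0 ax).
have e : leb `[a, T]%classic = (T - a)%:E.
 by rewrite lebesgue_measure_itv /= lte_fin; case: ltP => // h; congr (_%:E); lra.
exact: (congr1 fine e).
Qed.

(** The remaining time [T - t], clipped so as to be bounded on the whole line; the two agree on the
    interval. *)
Definition rest (t : R) : R := Num.max 0 (Num.min T (T - t)).
Lemma mf_rest : mfun (rest : RM -> R).
Proof. by apply: measurable_maxr => //; apply: measurable_minr => //; apply: mfunB. Qed.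
Lemma rest_ge0 t : 0 <= rest t.
Proof. by rewrite /rest le_max lexx. Qed.
Lemma rest_le t : rest t <= T.
Proof. by rewrite /rest ge_max T0 ge_min lexx. Qed.
Lemma norm_rest t : `|rest t| <= T.
Proof. by rewrite ger0_norm ?rest_ge0 ?rest_le. Qed.
Lemma restE t : 0 <= t <= T -> rest t = T - t.
Proof. by move=> /andP[h1 h2]; rewrite /rest min_r ?max_r//; lra. Qed.

Section Square.
Variables (g : RM -> R) (D0 : R).
Hypothesis ig : intg tm g.

Definition cum (t : R) : R := \int[tm]_a (le1 a t * g a).
Let mg := intg_mf ig.

Lemma cum_intg t : intg tm (fun a => le1 a t * g a).
Proof.
have m : mfun (fun a : RM => le1 a t) by exact: mf_le1.
by apply: eq_intg (intg_bdd m (fun a => norm_le1 _ _) ig) => a; exact: mulrC.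
Qed.

Lemma mf_cum : mfun (cum : RM -> R).
Proof.
apply: (mf_Rint2 tm (fun t a => le1 a t * g a)).
by apply: mfunM; [exact: mf_le1|exact: mfcomp mg _].
Qed.

Lemma cum_le t : `|cum t| <= \int[tm]_a `|g a|.
Proof.
apply: le_trans (norm_Rint (cum_intg t)) _; apply: le_Rint; [exact: intg_norm (cum_intg t)|exact: intg_norm|].
by move=> a; rewrite normrM ler_piMl// norm_le1.
Qed.

Let i1 : intg (pm tm tm) (fun z => le1 z.2 z.1 * g z.2).
Proof.
have h := intgM12 (proj1 (tm_cst 1)) ig.
have m : mfun (fun z : RM * RM => le1 z.2 z.1) by exact: mf_le1.
by apply: eq_intg (intg_bdd m (fun z => norm_le1 _ _) h) => z; rewrite mul1r mulrC.
Qed.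

Lemma int_cum : \int[tm]_t cum t = \int[tm]_a ((T - a) * g a).
Proof.
rewrite (Rfubini i1) /=; apply: ae_Rint.
- exact: intg_mf (intg_Rint2 i1).
- by mtac.
apply: ae1 ae_tm _ => a ha.
rewrite -(int_le1 ha) mulrC -RintZ; last first.
 by apply: (@tm_bdd _ 1) => [|t]; [exact: mf_le1|exact: norm_le1].
by apply: eq_Rint => t; rewrite mulrC.
Qed.

Let Q (z : RM * RM) : R := \int[tm]_t (le1 z.1 t * le1 z.2 t).
Let gg (z : RM * RM) : R := g z.1 * g z.2.
Let igg : intg (pm tm tm) gg := intgM12 ig ig.

Let Q_bd z : `|Q z| <= T.
Proof.
have m : mfun (fun t : RM => le1 z.1 t * le1 z.2 t).
 by apply: mfunM; exact: mf_le1.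
have b t : `|le1 z.1 t * le1 z.2 t| <= 1 by rewrite normrM mulr_ile1 ?norm_le1.
have [i2 e2] := tm_cst 1.
have i3 := tm_bdd m b; rewrite -[T]mulr1 -e2.
apply: le_trans (norm_Rint i3) _; exact: (le_Rint (intg_norm i3) i2 b).
Qed.

Let mQ : mfun Q.
Proof.
apply: (mf_Rint2 tm (fun z t => le1 z.1 t * le1 z.2 t)).
have m1 : mfun (fun x : (RM * RM) * RM => x.1.1) by mtac.
have m2 : mfun (fun x : (RM * RM) * RM => x.1.2) by mtac.
by apply: mfunM; exact: mf_le1.
Qed.

Let mle1 : mfun (fun z : RM * RM => le1 z.2 z.1).
Proof. exact: mf_le1. Qed.
Let mle2 : mfun (fun z : RM * RM => le1 z.1 z.2).
Proof. exact: mf_le1. Qed.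
Let iggQ : intg (pm tm tm) (fun z => gg z * Q z) := intg_bdd mQ Q_bd igg.

Let int_cum2 : \int[tm]_t (cum t ^+ 2) = 2 * \int[tm]_a ((T - a) * cum a * g a).
Proof.
have i3 : intg (pm tm (pm tm tm)) (fun y => (le1 y.2.1 y.1 * le1 y.2.2 y.1) * gg y.2).
 have h := intgM12 (proj1 (tm_cst 1)) igg.
 have m1 : mfun (fun x : RM * (RM * RM) => x.2.1) by mtac.
 have m2 : mfun (fun x : RM * (RM * RM) => x.2.2) by mtac.
 have m : mfun (fun y : RM * (RM * RM) => le1 y.2.1 y.1 * le1 y.2.2 y.1).
  by apply: mfunM; exact: mf_le1.
 have b (y : RM * (RM * RM)) : `|le1 y.2.1 y.1 * le1 y.2.2 y.1| <= 1 by rewrite normrM mulr_ile1 ?norm_le1.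
 by apply: eq_intg (intg_bdd m b h) => y; rewrite mul1r mulrC.
transitivity (\int[tm]_t \int[pm tm tm]_z ((le1 z.1 t * le1 z.2 t) * gg z)).
 apply: eq_Rint => t; rewrite expr2 -(RintM12 (cum_intg t) (cum_intg t)).
 by apply: eq_Rint => z; rewrite /gg; ring.
rewrite (Rfubini i3) /=.
transitivity (\int[pm tm tm]_z (gg z * Q z)).
 apply: eq_Rint => z; rewrite /Q -[RHS]RintZ; first by apply: eq_Rint => t; rewrite mulrC.
 apply: (@tm_bdd _ 1) => [|t]; last by rewrite normrM mulr_ile1 ?norm_le1.
 by apply: mfunM; exact: mf_le1.
have j1 : intg (pm tm tm) (fun z => gg z * Q z * le1 z.2 z.1) := intg_bdd mle1 (fun z => norm_le1 _ _) iggQ.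
have j2 : intg (pm tm tm) (fun z => gg z * Q z * le1 z.1 z.2) := intg_bdd mle2 (fun z => norm_le1 _ _) iggQ.
have e1 : \int[pm tm tm]_z (gg z * Q z) = \int[pm tm tm]_z (gg z * Q z * le1 z.2 z.1) + \int[pm tm tm]_z (gg z * Q z * le1 z.1 z.2).
 rewrite -RintD// -(Rfubini1 iggQ) -(Rfubini1 (intgD j1 j2)).
 apply: eq_Rint => a; have s1 (f : RM * RM -> R) : mfun f -> mfun (fun y => f (a, y)).
  by move=> mf; exact: mfcomp mf (measurable_pair1 a).
 apply: ae_Rint; [exact: s1 (intg_mf iggQ)|exact: s1 (intg_mf (intgD j1 j2))|].
 (* On the diagonal both indicators are 1 and the splitting would count twice; for fixed [a] this is
    one null point. *)
 exists [set a]; split; first exact: measurable_set1.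
  apply/eqP; rewrite -measure_le0 /= /tm /rmeas /mrestr; apply: (@le_trans _ _ (leb [set a])).
   apply: le_measure; rewrite ?inE; [apply: measurableI; [exact: measurable_set1|exact: mT]|exact: measurable_set1|].
   exact: subIsetl.
  by rewrite [leb _]lebesgue_measure_set1.
 move=> y /= ny; have [//|ya] := eqVneq y a; exfalso; apply: ny; rewrite !le1E -mulrDr.
 have [h|h|h] := ltgtP y a; rewrite ?addr0 ?add0r ?mulr1//.
 by rewrite h eqxx in ya.
have e2 : \int[pm tm tm]_z (gg z * Q z * le1 z.1 z.2) = \int[pm tm tm]_z (gg z * Q z * le1 z.2 z.1).
 rewrite -(pres_Rint (pres_swap tm) (intg_mf j2)); apply: eq_Rint => z.
 rewrite /gg /Q /=; congr (_ * _ * _); first exact: mulrC.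
 by apply: eq_Rint => t; exact: mulrC.
transitivity (2 * \int[pm tm tm]_z (gg z * Q z * le1 z.2 z.1)); first by rewrite e1 e2; ring.
congr (_ * _).
rewrite -(Rfubini1 j1); apply: ae_Rint.
- exact: intg_mf (intg_Rint1 j1).
- apply: mfunM => //; apply: mfunM; last exact: mf_cum.
 by mtac.
apply: ae1 ae_tm _ => a ha /=.
rewrite [RHS](_ : _ = ((T - a) * g a) * cum a); last by ring.
rewrite /cum -RintZ; last exact: cum_intg.
apply: eq_Rint => b; rewrite /gg /= le1E; case: (leP b a) => ba; last by rewrite !mulr0 mul0r mulr0.
have eQ : Q (a, b) = T - a.
 rewrite -(int_le1 ha) /Q /=; apply: eq_Rint => t; rewrite !le1E; case: (leP a t) => h; last by rewrite mul0r.
 by rewrite (le_trans ba h) mulr1.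
by rewrite eQ; ring.
Qed.

Lemma square_int : \int[tm]_t ((D0 + cum t) ^+ 2) = T * D0 ^+ 2 + 2 * \int[tm]_a ((T - a) * ((D0 + cum a) * g a)).
Proof.
have mc := mf_cum.
have bc t : `|cum t| <= \int[tm]_a `|g a| := cum_le t.
have ic : intg tm cum by exact: tm_bdd mc bc.
have ic2 : intg tm (fun t => cum t ^+ 2).
 by apply: eq_intg (intg_bdd mc bc ic) => t; rewrite expr2.
have [icst ecst] := tm_cst (D0 ^+ 2).
have igc : intg tm (fun a => g a * cum a) := intg_bdd mc bc ig.
have bt a : 0 <= a <= T -> `|T - a| <= T by move=> /andP[h1 h2]; rewrite ger0_norm; lra.
have ibt f : intg tm f -> intg tm (fun a => (T - a) * f a).
 move=> if_; have mf := intg_mf if_.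
 apply: (ae_intg _ _ (intg_bdd mf_rest norm_rest if_)).
  by mtac.
 by apply: ae1 ae_tm _ => a ha; rewrite mulrC restE.
transitivity (\int[tm]_t (D0 ^+ 2 + (2 * D0) * cum t + cum t ^+ 2)).
 by apply: eq_Rint => t; ring.
rewrite RintD//; last by apply: intgD => //; exact: intgZ.
rewrite RintD//; last exact: intgZ.
rewrite RintZ// ecst int_cum int_cum2.
have -> : \int[tm]_a ((T - a) * ((D0 + cum a) * g a)) = D0 * \int[tm]_a ((T - a) * g a) + \int[tm]_a ((T - a) * cum a * g a).
 rewrite -RintZ; last exact: ibt.
 rewrite -RintD.
 - by apply: eq_Rint => a; ring.
 - by apply: intgZ; exact: ibt.
 - by apply: eq_intg (ibt _ igc) => a; ring.
by ring.
Qed.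

End Square.

End TimeInterval.

Variables (beta kappa s : R).
Hypotheses (b1 : 1 < beta) (k0 : 0 < kappa) (s4 : 4 < s).

(** * The right-hand side of the evolution equation and stability in time *)

Section Evolution.

Implicit Types (F G H D : K -> R).

Definition FF H (k : K) : R := - NN H H k - kappa * (mB beta k * H k).
Lemma FFE H k : FF H k = - NN H H k - kappa * (mB beta k * H k).
Proof. by []. Qed.
Definition cB : R := 10 * beta `^ beta.
Lemma cB_ge0 : 0 <= cB.
Proof. by rewrite mulr_ge0// powR_ge0. Qed.

Lemma mf_FF H : mfun H -> mfun (FF H).
Proof.
move=> mH; have mN := mf_NN mH mH; have mm := mf_mB beta.
apply: mfunB; first by apply: mfcomp => //; exact: oppr_measurable.
by mtac.
Qed.

Lemma mf_FF2 d (X : measurableType d) (U : X -> K -> R) :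
 mfun (fun z : X * K => U z.1 z.2) -> mfun (fun z : X * K => FF (U z.1) z.2).
Proof.
move=> mU.
have mc (f : (X * K) * K -> X) (g : (X * K) * K -> K) : mfun f -> mfun g -> mfun (fun y => U (f y) (g y)).
 move=> mf mg; have h : mfun (fun y => (f y, g y)) by exact: mfun_pair.
 exact: (mfcomp mU h).
have p1 : mfun (fun y : (X * K) * K => y.1.1) by mtac.
have p2 : mfun (fun y : (X * K) * K => y.2) by mtac.
have p3 : mfun (fun y : (X * K) * K => y.1.2) by mtac.
have p23 : mfun (fun y : (X * K) * K => (y.2, y.1.2)) by mtac.
have pn := mfcomp (@mf_nK) p2.
have pc := mfcomp (@mf_cv) p23.
have pnc := mfcomp (@mf_nK) pc.
have mm : mfun (fun z : X * K => mB beta z.2).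
 by mtac.
apply: mfunB; last by apply: mfunM => //; exact: mfunM.
apply: mfcomp; first exact: oppr_measurable.
apply: mfunM; first exact: mfun_cst.
apply: (mf_Rint2 mu (fun (z : X * K) (a : K) => nf (U z.1) (U z.1) a z.2)).
apply: mfunM.
 apply: mfunM; first exact: (mfcomp (@mf_Lw) p2).
 exact: (mfcomp (@mf_cr) p23).
apply: mfunM => //; apply: mfunB; last by apply: mfunM; apply: mc.
by apply: mfunD; [apply: mfunD|]; apply: mfunM; apply: mc.
Qed.

(** The damping symbol costs at most one power of [jap], so it is covered by the second power
    available on [H]. *)
Lemma FF_jap M : exists2 C, 0 <= C & forall H, adm H -> N8 H <= M ->
 L2 mu (fun k => jap k * FF H k) /\ \int[mu]_k ((jap k * FF H k) ^+ 2) <= C.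
Proof.
have [C C0 hC] := NN_jap M.
pose q := kappa * cB; exists (2 * C + 2 * (q ^+ 2 * `|M|)).
 by apply: addr_ge0; apply: mulr_ge0 => //; apply: mulr_ge0 => //; exact: sqr_ge0.
move=> H hH HM; have [mH _] := hH; have [[mN iN] bN] := hC H H hH hH HM HM.
have [[m2 i2] b2] := @adm_L2 H 2 isT hH.
have mF : mfun (fun k => jap k * FF H k).
 by apply: mfunM; [exact: mf_jap|exact: mf_FF].
have bd k : (jap k * FF H k) ^+ 2 <= 2 * (jap k * NN H H k) ^+ 2 + 2 * (q ^+ 2 * (jap k ^+ 2 * H k) ^+ 2).
 have hm : (kappa * (mB beta k * (jap k * H k))) ^+ 2 <= q ^+ 2 * (jap k ^+ 2 * H k) ^+ 2.
  have h1 := mB_le b1 k; have h0 := mB_ge0 beta k; have j0 := jap_gt0 k.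
  rewrite (_ : q ^+ 2 * _ = (kappa * (cB * jap k * (jap k * H k))) ^+ 2); last by rewrite /q; ring.
  rewrite !exprMn; apply: ler_wpM2l; first exact: sqr_ge0.
  apply: ler_wpM2r; first by apply: mulr_ge0; exact: sqr_ge0.
  by rewrite -!exprMn; apply: lerXn2r; rewrite ?nnegrE//; exact: le_trans h1.
 have -> : jap k * FF H k = - (jap k * NN H H k + kappa * (mB beta k * (jap k * H k))) by rewrite /FF; ring.
 rewrite sqrrN; move: (jap k * NN H H k) (kappa * _) hm => x y hm.
 by have := sqr_ge0 (x - y); nra.
have iq := intgD (intgZ 2 iN) (intgZ 2 (intgZ (q ^+ 2) i2)).
have iF : intg mu (fun k => (jap k * FF H k) ^+ 2).
 by apply: le_intg (mfunX 2 mF) _ iq => k; rewrite ger0_norm ?sqr_ge0.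
split=> //; apply: le_trans (le_Rint iF iq bd) _.
rewrite RintD; [|exact: intgZ|by apply: intgZ; exact: intgZ].
rewrite !RintZ//; last exact: intgZ.
apply: lerD; rewrite ler_pM2l//; apply: ler_wpM2l; first exact: sqr_ge0.
by apply: le_trans b2 _; apply: le_trans HM _; exact: ler_norm.
Qed.

Lemma FF_L2 H : adm H -> L2 mu (FF H) /\ \int[mu]_k (FF H k ^+ 2) <= \int[mu]_k ((jap k * FF H k) ^+ 2).
Proof.
move=> hH; have [C _ h] := FF_jap (N8 H); have [[m i] _] := h H hH (lexx _).
have mF := mf_FF (proj1 hH).
have b k : FF H k ^+ 2 <= (jap k * FF H k) ^+ 2.
 by rewrite [(jap k * _) ^+ 2]exprMn ler_peMl ?sqr_ge0// exprn_ege1// jap_ge1.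
have iF : intg mu (fun k => FF H k ^+ 2).
 by apply: le_intg (mfunX 2 mF) _ i => k; rewrite ger0_norm ?sqr_ge0.
by split=> //; exact: le_Rint.
Qed.

Lemma sq3 (x y z : R) : (x + y + z) ^+ 2 <= 3 * x ^+ 2 + 3 * y ^+ 2 + 3 * z ^+ 2.
Proof. by have := sqr_ge0 (x - y); have := sqr_ge0 (x - z); have := sqr_ge0 (y - z); nra. Qed.
Lemma low3 (a b C D q : R) : a <= C * D -> b <= C * D -> 3 * a + 3 * b + 3 * q ^+ 2 * D <= (3 * C + 3 * C + 3 * q ^+ 2) * D.
Proof. by move=> h1 h2; lra. Qed.

(** Lipschitz continuity in a norm weaker by two powers: it controls Euler residuals and the passage
    to the limit, where no cancellation is at hand. *)
Lemma FF_low M : exists2 C, 0 <= C & forall F G, adm F -> adm G -> N8 F <= M -> N8 G <= M ->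
 intg mu (fun k => ((jap k ^+ 2)^-1 * (FF F k - FF G k)) ^+ 2) /\
 \int[mu]_k (((jap k ^+ 2)^-1 * (FF F k - FF G k)) ^+ 2) <= C * \int[mu]_k ((F k - G k) ^+ 2).
Proof.
have [C C0 hC] := NN_low M; pose q := kappa * cB.
exists (3 * C + 3 * C + 3 * q ^+ 2).
 by apply: addr_ge0; [apply: addr_ge0|]; apply: mulr_ge0 => //; exact: sqr_ge0.
move=> F G hF hG FM GM; have hD := admB hF hG; have LD := adm0_L2 hD; have [mD iD] := LD.
have [[m1 i1] _ b1' _] := hC _ F LD hF FM; have [_ [m2 i2] _ b2'] := hC _ G LD hG GM.
set j := fun k : K => (jap k ^+ 2)^-1.
have mF : mfun (fun k => j k * (FF F k - FF G k)).
 apply: mfunM; first exact: mf_jinv.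
 by apply: mfunB; apply: mf_FF; [case: hF|case: hG].
have bd : {ae mu, forall k, (j k * (FF F k - FF G k)) ^+ 2 <=
  3 * (j k * NN (fun k => F k - G k) F k) ^+ 2 + 3 * (j k * NN G (fun k => F k - G k) k) ^+ 2 + 3 * q ^+ 2 * (F k - G k) ^+ 2}.
 apply: ae1 (NN_bilin hF hG) _ => k e.
 have j0 := jap_inv2 k; have h1 := mB_le b1 k; have h0 := mB_ge0 beta k; have jp := jap_gt0 k.
 have hm : (kappa * (j k * mB beta k * (F k - G k))) ^+ 2 <= q ^+ 2 * (F k - G k) ^+ 2.
  rewrite /q !exprMn -[leRHS]mulrA; apply: ler_wpM2l; first exact: sqr_ge0.
  apply: ler_wpM2r; first exact: sqr_ge0.
  rewrite -!exprMn; apply: lerXn2r; rewrite ?nnegrE; [exact: mulr_ge0|exact: cB_ge0|].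
  rewrite mulrC ler_pdivrMr ?exprn_gt0//; apply: le_trans h1 _; apply: ler_wpM2l; first exact: cB_ge0.
  by rewrite expr2 ler_peMl ?jap_ge1// ltW.
 have -> : j k * (FF F k - FF G k) = - (j k * NN (fun k => F k - G k) F k + j k * NN G (fun k => F k - G k) k + kappa * (j k * mB beta k * (F k - G k))).
  rewrite -[X in _ = - (X + _)]mulrDr -e /FF; ring.
 rewrite sqrrN; apply: le_trans (sq3 _ _ _) _; apply: lerD => //.
 by rewrite -[leRHS]mulrA; apply: ler_wpM2l.
have iq := intgD (intgD (intgZ 3 i1) (intgZ 3 i2)) (intgZ (3 * q ^+ 2) iD).
have iF : intg mu (fun k => (j k * (FF F k - FF G k)) ^+ 2).
 pose p k := Num.min ((j k * (FF F k - FF G k)) ^+ 2) (3 * (j k * NN (fun k => F k - G k) F k) ^+ 2 + 3 * (j k * NN G (fun k => F k - G k) k) ^+ 2 + 3 * q ^+ 2 * (F k - G k) ^+ 2).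
 have mp : mfun p.
  by apply: measurable_minr; [exact: mfunX|exact: intg_mf iq].
 have bp k : `|p k| <= 3 * (j k * NN (fun k => F k - G k) F k) ^+ 2 + 3 * (j k * NN G (fun k => F k - G k) k) ^+ 2 + 3 * q ^+ 2 * (F k - G k) ^+ 2.
  rewrite ger0_norm /p ?ge_min ?lexx ?orbT// le_min sqr_ge0 /=.
  have t1 := sqr_ge0 (j k * NN (fun k => F k - G k) F k); have t2 := sqr_ge0 (j k * NN G (fun k => F k - G k) k).
  have t3 := mulr_ge0 (sqr_ge0 q) (sqr_ge0 (F k - G k)).
  by rewrite -[3 * q ^+ 2 * _]mulrA !addr_ge0// mulr_ge0.
 apply: (ae_intg (mfunX 2 mF) _ (le_intg mp bp iq)).
 by apply: ae1 bd _ => k h; rewrite /p min_l.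
split=> //; apply: le_trans (ae_le_Rint iF iq bd) _.
rewrite RintD; [|by apply: intgD; exact: intgZ|exact: intgZ].
rewrite RintD; [|exact: intgZ|exact: intgZ].
rewrite (RintZ _ i1) (RintZ _ i2) (RintZ _ iD).
exact: (low3 _ b1' b2').
Qed.

(** The damping contributes with a favourable sign and is dropped. Only an upper bound is claimed,
    without absolute value. *)
Lemma FF_stab M : exists2 C, 0 <= C & forall F G, adm F -> adm G -> N8 F <= M ->
 intg mu (fun k => (F k - G k) * (FF F k - FF G k)) /\
 \int[mu]_k ((F k - G k) * (FF F k - FF G k)) <= C * \int[mu]_k ((F k - G k) ^+ 2).
Proof.
have [C C0 hC] := stability M; exists C => // F G hF hG FM.
have hD := admB hF hG; have [mD iD] := adm0_L2 hD.
have [mF iF] := L2B (proj1 (FF_L2 hF)) (proj1 (FF_L2 hG)).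
have i1 := intg_sqM mD mF iD iF.
have [mN iN] := L2B (NN_L2 hF hF) (NN_L2 hG hG).
have i2 := intg_sqM mD mN iD iN.
split=> //; apply: le_trans (hC F G hF hG FM).
apply: (@le_trans _ _ (\int[mu]_k (- ((F k - G k) * (NN F F k - NN G G k))))); last first.
 by rewrite RintN//; apply: le_trans (ler_norm _) _; rewrite normrN.
apply: le_Rint => //; first exact: intgN.
move=> k; rewrite /FF.
have : 0 <= kappa * (mB beta k * (F k - G k) ^+ 2).
 by apply: mulr_ge0; [exact: ltW|apply: mulr_ge0; [exact: mB_ge0|exact: sqr_ge0]].
move: (NN F F k) (NN G G k) (mB beta k) (F k) (G k) => x y m f g h; nra.
Qed.

Section Time.
Variable T : R.
Hypothesis T0 : 0 <= T.
Notation tmT := (tm T).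
Notation P := (pm tmT mu).

Definition traj (U : RM -> K -> R) := mfun (fun z : RM * K => U z.1 z.2).
Lemma traj_t U t : traj U -> mfun (U t).
Proof. by move=> m; exact: (mfcomp m (measurable_pair1 t)). Qed.
Lemma traj_k U k : traj U -> mfun (U ^~ k).
Proof. by move=> m; exact: (mfcomp m (measurable_pair2 k)). Qed.

Lemma L2_seck (U : RM -> K -> R) : L2 P (fun z => U z.1 z.2) -> {ae mu, forall k, L2 tmT (U ^~ k)}.
Proof.
move=> [mU iU]; apply: ae1 (ae_intg1 (intg_swap iU)) _ => k h; split=> //.
exact: (@traj_k U).
Qed.

Lemma L2_sect (U : RM -> K -> R) : L2 P (fun z => U z.1 z.2) -> {ae tmT, forall t, L2 mu (U t)}.
Proof.
move=> [mU iU]; apply: ae1 (ae_intg1 iU) _ => t h; split=> //.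
exact: (@traj_t U).
Qed.

Lemma mul_am (x y z : R) : y * (x + z) <= y * x + (1 / 2 * y ^+ 2 + 1 / 2 * z ^+ 2).
Proof. by have := sqr_ge0 (y - z); nra. Qed.

(** Half of [Y] is absorbed on the left thanks to the smallness of [T]; this short-time step stands
    in for Gronwall's inequality. *)
Lemma absorb C (a x Y S : R) : 2 * T * (C + 1 / 2) <= 1 / 2 -> 0 <= Y ->
 Y = T * a + 2 * x -> x <= T * ((C + 1 / 2) * Y + 1 / 2 * S) -> Y <= 2 * T * (a + S).
Proof.
move=> h Y0 e hx; have := ler_wpM2r Y0 h => h'.
have -> : 2 * T * (a + S) = 2 * (T * a) + 2 * (T * S) by ring.
have : T * ((C + 1 / 2) * Y + 1 / 2 * S) = 1 / 2 * (2 * T * (C + 1 / 2) * Y) + 1 / 2 * (T * S) by field.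
lra.
Qed.

(** [square_int] at almost every frequency, then Fubini. *)
Lemma energy_time (D g : RM -> K -> R) (A : K -> R) : L2 P (fun z => D z.1 z.2) -> L2 P (fun z => g z.1 z.2) ->
 L2 mu A -> {ae P, forall z, D z.1 z.2 = A z.2 + cum T (g ^~ z.2) z.1} ->
 \int[P]_z (D z.1 z.2 ^+ 2) = T * \int[mu]_k (A k ^+ 2) + 2 * \int[P]_z ((T - z.1) * (D z.1 z.2 * g z.1 z.2)).
Proof.
move=> LD Lg [mA iA] eD; have [mD iD] := LD; have [mg ig] := Lg.
have iDg := intg_sqM mD mg iD ig.
have iw : intg P (fun z => (T - z.1) * (D z.1 z.2 * g z.1 z.2)).
 have mw : mfun (fun z : RM * K => rest T z.1).
  exact: (mfcomp (mf_rest T) mfun_fst).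
 apply: (ae_intg _ _ (intg_bdd mw (fun z => norm_rest T0 _) iDg)).
  by mtac.
 have t0 : {ae mu, forall k : K, True} by exact: aeW.
 by apply: ae1 (ae_prod (@ae_tm T) t0) _ => z [h _]; rewrite mulrC restE.
rewrite -(Rfubini2 iD) -(Rfubini2 iw) -!RintZ//; [|exact: intg_Rint2 iw].
rewrite -RintD; [|exact: intgZ|by apply: intgZ; exact: intg_Rint2 iw].
apply: ae_Rint.
- exact: intg_mf (intg_Rint2 iD).
- exact: intg_mf (intgD (intgZ T iA) (intgZ 2 (intg_Rint2 iw))).
apply: ae2 (ae_sec2 eD) (L2_seck Lg) _ => k ek Lgk /=.
have igk := tm_L1 T0 Lgk; have mgk := intg_mf igk; have mDk := @traj_k D k mD.
have mc := mf_cum igk.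
have e1 : \int[tmT]_t (D t k ^+ 2) = \int[tmT]_t ((A k + cum T (g ^~ k) t) ^+ 2).
 apply: ae_Rint; [exact: mfunX|by apply: mfunX; exact: mfunD|].
 by apply: ae1 ek _ => t /= ->.
have e2 : \int[tmT]_t ((T - t) * (D t k * g t k)) = \int[tmT]_t ((T - t) * ((A k + cum T (g ^~ k) t) * g t k)).
 apply: ae_Rint.
 - by mtac.
 - by mtac.
 by apply: ae1 ek _ => t /= ->.
by rewrite e1 e2 (square_int T0).
Qed.

(** [g1] and [g2] need not solve the equation: the residuals [g - FF U] appear in the bound. Thus
    one statement serves the Cauchy property of the approximations and the uniqueness of
    solutions. *)
Lemma stab_time M C (U1 U2 g1 g2 : RM -> K -> R) (A : K -> R) :
 (forall F G, adm F -> adm G -> N8 F <= M -> intg mu (fun k => (F k - G k) * (FF F k - FF G k)) /\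
  \int[mu]_k ((F k - G k) * (FF F k - FF G k)) <= C * \int[mu]_k ((F k - G k) ^+ 2)) ->
 0 <= C -> 2 * T * (C + 1 / 2) <= 1 / 2 -> L2 P (fun z => U1 z.1 z.2) -> L2 P (fun z => U2 z.1 z.2) ->
 L2 P (fun z => g1 z.1 z.2) -> L2 P (fun z => g2 z.1 z.2) -> L2 mu A ->
 L2 P (fun z => g1 z.1 z.2 - FF (U1 z.1) z.2 - (g2 z.1 z.2 - FF (U2 z.1) z.2)) ->
 {ae tmT, forall t, [/\ adm (U1 t), adm (U2 t) & N8 (U1 t) <= M]} ->
 {ae P, forall z, U1 z.1 z.2 - U2 z.1 z.2 = A z.2 + cum T (fun t => g1 t z.2 - g2 t z.2) z.1} ->
 \int[P]_z ((U1 z.1 z.2 - U2 z.1 z.2) ^+ 2) <=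
  2 * T * (\int[mu]_k (A k ^+ 2) + \int[P]_z ((g1 z.1 z.2 - FF (U1 z.1) z.2 - (g2 z.1 z.2 - FF (U2 z.1) z.2)) ^+ 2)).
Proof.
move=> hC C0 hT LU1 LU2 Lg1 Lg2 LA Lr hadm eD.
pose D t k := U1 t k - U2 t k; pose g t k := g1 t k - g2 t k.
pose r t k := g1 t k - FF (U1 t) k - (g2 t k - FF (U2 t) k).
have LD : L2 P (fun z => D z.1 z.2) by exact: L2B.
have Lg : L2 P (fun z => g z.1 z.2) by exact: L2B.
have [mD iD] := LD; have [mg ig] := Lg; have [mr ir] := Lr.
have e := @energy_time D g A LD Lg LA eD.
have iDg := intg_sqM mD mg iD ig.
pose Y := \int[P]_z (D z.1 z.2 ^+ 2); pose S := \int[P]_z (r z.1 z.2 ^+ 2).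
have Y0 : 0 <= Y by apply: Rint_ge0 => z; exact: sqr_ge0.
have S0 : 0 <= S by apply: Rint_ge0 => z; exact: sqr_ge0.
have key : \int[P]_z ((T - z.1) * (D z.1 z.2 * g z.1 z.2)) <= T * ((C + 1 / 2) * Y + 1 / 2 * S).
 pose B t := (C + 1 / 2) * \int[mu]_k (D t k ^+ 2) + 1 / 2 * \int[mu]_k (r t k ^+ 2).
 have iB : intg tmT B := intgD (intgZ _ (intg_Rint1 iD)) (intgZ _ (intg_Rint1 ir)).
 have -> : T * ((C + 1 / 2) * Y + 1 / 2 * S) = \int[tmT]_t (T * B t).
  rewrite RintZ// RintD; [|exact: (intgZ _ (intg_Rint1 iD))|exact: (intgZ _ (intg_Rint1 ir))].
  by rewrite (RintZ _ (intg_Rint1 iD)) (RintZ _ (intg_Rint1 ir)) (Rfubini1 iD) (Rfubini1 ir).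
 pose w := rest T; have mw : mfun (w : RM -> R) := mf_rest T.
 have bw t : `|w t| <= T := norm_rest T0 t.
 have iw : intg P (fun z => w z.1 * (D z.1 z.2 * g z.1 z.2)).
  by apply: eq_intg (intg_bdd (mfcomp mw mfun_fst) (fun z => bw z.1) iDg) => z; rewrite mulrC.
 have -> : \int[P]_z ((T - z.1) * (D z.1 z.2 * g z.1 z.2)) = \int[P]_z (w z.1 * (D z.1 z.2 * g z.1 z.2)).
  apply: ae_Rint; [|exact: intg_mf iw|].
   by mtac.
  have t0 : {ae mu, forall k : K, True} by exact: aeW.
  by apply: ae1 (ae_prod (@ae_tm T) t0) _ => z [h _]; rewrite /w restE.
 rewrite -(Rfubini1 iw); apply: ae_le_Rint; [exact: (intg_Rint1 iw)|exact: intgZ|].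
 have aeD := @L2_sect D LD; have aer := @L2_sect r Lr; have aeg := ae_intg1 iDg.
 apply: ae2 (ae2 hadm aeg (fun _ a b => conj a b)) (ae2 aeD aer (fun _ a b => conj a b)) _ => t /= [[a1 a2 a3] igt] [[mDt iDt] [mrt irt]].
 have [i1 h1] := hC _ _ a1 a2 a3.
 have i2 := intg_sqM mDt mrt iDt irt.
 have i3 := intgD (intgZ (1 / 2) iDt) (intgZ (1 / 2) irt).
 have Xle : \int[mu]_k (D t k * g t k) <= B t.
  apply: (@le_trans _ _ (\int[mu]_k (D t k * (FF (U1 t) k - FF (U2 t) k) + (1 / 2 * D t k ^+ 2 + 1 / 2 * r t k ^+ 2)))).
   apply: le_Rint => //; first exact: intgD.
   move=> k; have -> : g t k = (FF (U1 t) k - FF (U2 t) k) + r t k by rewrite /g /r; ring.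
   exact: mul_am.
  rewrite RintD// RintD; [|exact: intgZ|exact: intgZ].
  rewrite (RintZ _ iDt) (RintZ _ irt) /B mulrDl addrA.
  by apply: lerD => //; apply: lerD.
 have B0 : 0 <= B t.
  rewrite /B; apply: addr_ge0; apply: mulr_ge0; rewrite ?addr_ge0//; apply: Rint_ge0 => k; exact: sqr_ge0.
 rewrite RintZ//; apply: (@le_trans _ _ (w t * B t)).
  by apply: ler_wpM2l => //; exact: rest_ge0.
 by apply: ler_wpM2r => //; exact: rest_le.
have {}e : Y = T * \int[mu]_k (A k ^+ 2) + 2 * \int[P]_z ((T - z.1) * (D z.1 z.2 * g z.1 z.2)) := e.
exact: (absorb hT Y0 e key).
Qed.

End Time.

End Evolution.

#[local] Hint Resolve mf_FF : mf.

(** * Energy of Euler steps for the truncated equation *)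

Section Galerkin.

Implicit Types (F G H D V : K -> R).

Definition EW H : R := \int[mu]_k (Wt s k * H k ^+ 2).
Lemma Wt_ge0 (k : K) : 0 <= Wt s k.
Proof. apply: ltW; exact: Wt_gt0. Qed.
Lemma EW_ge0 H : 0 <= EW H.
Proof. by apply: Rint_ge0 => k; rewrite mulr_ge0 ?Wt_ge0 ?sqr_ge0. Qed.

Lemma EW_adm H : mfun H -> intg mu (fun k => Wt s k * H k ^+ 2) -> adm H /\ N8 H <= 16 * EW H.
Proof.
move=> mH iH.
have mW : mfun (fun k : K => 16 * Wt s k).
 by mtac.
have := @adm_le H (fun k => 16 * Wt s k) mH mW (fun k => Wt_jap s4 k).
have i16 : intg mu (fun k => 16 * Wt s k * H k ^+ 2).
 by apply: eq_intg (intgZ 16 iH) => k; rewrite mulrA.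
move=> /(_ i16)[h1 h2]; split=> //; apply: le_trans h2 _.
by rewrite /EW -RintZ//; apply: eq_ler; apply: eq_Rint => k; rewrite mulrA.
Qed.

(** On functions supported in [jap k <= r] all weights are bounded, so every weighted norm is
    finite, with constants depending on [r]. *)
Definition gal (r : R) H := L2 mu H /\ forall k, r < jap k -> H k = 0.

Lemma galM r (w : K -> R) B H : mfun w -> (forall k, jap k <= r -> `|w k| <= B) ->
 gal r H -> L2 mu (fun k => w k * H k) /\ \int[mu]_k ((w k * H k) ^+ 2) <= B ^+ 2 * \int[mu]_k (H k ^+ 2).
Proof.
move=> mw wB [[mH iH] H0].
have bd k : (w k * H k) ^+ 2 <= B ^+ 2 * H k ^+ 2.
 have [h|h] := leP (jap k) r; last by rewrite H0// mulr0 expr0n mulr0.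
 have := wB k h => hw; rewrite exprMn; apply: ler_wpM2r; first exact: sqr_ge0.
 by rewrite -real_normK ?num_real//; apply: lerXn2r; rewrite ?nnegrE//; exact: le_trans hw.
have m2 : mfun (fun k => w k * H k) by mtac.
have i2 : intg mu (fun k => (w k * H k) ^+ 2).
 by apply: le_intg (mfunX 2 m2) _ (intgZ (B ^+ 2) iH) => k; rewrite ger0_norm ?sqr_ge0.
split; first by split.
by rewrite -RintZ//; apply: le_Rint => //; exact: intgZ.
Qed.

Definition Wr (r : R) : R := (r ^+ 2) `^ s.

Lemma Wt_r r (k : K) : jap k <= r -> `|Wt s k| <= Wr r.
Proof.
move=> h; have := Wt_ge0 k => W0; rewrite ger0_norm// /Wt /Wr.
have s0 : 0 <= s by have := s4; lra.
have j0 := jap_gt0 k; have J0 := J_gt0 k.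
apply: ge0_ler_powR; rewrite ?nnegrE ?sqr_ge0//; first exact: ltW.
apply: le_trans (J_le_jap k) _; apply: lerXn2r; rewrite ?nnegrE//; first exact: ltW.
by apply: le_trans h; exact: ltW.
Qed.

Lemma Wr_ge0 r : 0 <= Wr r. Proof. exact: powR_ge0. Qed.

Lemma mB_r r (k : K) : jap k <= r -> `|mB beta k| <= cB * r.
Proof.
move=> h; rewrite ger0_norm ?mB_ge0//; apply: le_trans (mB_le b1 k) _.
by apply: ler_wpM2l => //; exact: cB_ge0.
Qed.

Lemma gal_W r H : gal r H -> L2 mu (fun k => Wt s k * H k).
Proof. by move=> gH; have [] := galM (mf_Wt s) (@Wt_r r) gH. Qed.

Lemma gal_EW r H : gal r H -> intg mu (fun k => Wt s k * H k ^+ 2).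
Proof.
move=> gH; have [mW iW] := gal_W gH; have [[mH iH] _] := gH.
by apply: eq_intg (intg_sqM mW mH iW iH) => k; rewrite -mulrA expr2.
Qed.

Lemma gal_EW_le r H : gal r H -> EW H <= Wr r * \int[mu]_k (H k ^+ 2).
Proof.
move=> gH; have [[mH iH] H0] := gH; rewrite /EW -(RintZ _ iH); apply: (le_Rint (gal_EW gH) (intgZ _ iH)).
move=> k; have [h|h] := leP (jap k) r; last by rewrite H0// expr0n !mulr0.
by apply: ler_wpM2r; [exact: sqr_ge0|apply: le_trans (ler_norm _) (Wt_r h)].
Qed.

Lemma gal_adm r H : gal r H -> adm H /\ N8 H <= 16 * EW H.
Proof. by move=> gH; apply: EW_adm (gal_EW gH); case: gH => -[]. Qed.

Lemma FF_bound M : exists2 C, 0 <= C & forall H, adm H -> N8 H <= M ->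
 [/\ L2 mu (FF H), \int[mu]_k (FF H k ^+ 2) <= C, L2 mu (fun k => jap k * FF H k) &
  \int[mu]_k ((jap k * FF H k) ^+ 2) <= C].
Proof.
have [C C0 hC] := FF_jap M; exists C => // H hH HM.
have [h1 h2] := hC H hH HM; have [h3 h4] := FF_L2 hH.
by split=> //; exact: le_trans h4 h2.
Qed.

(** Frequency by frequency the logarithmic excess of [energy] is beaten by the damping, up to a
    constant that does not depend on [r]. *)
Lemma energy_gal M : exists2 C, 0 <= C & forall r H, gal r H -> EW H <= M ->
 intg mu (fun k => Wt s k * H k * FF H k) /\ \int[mu]_k (Wt s k * H k * FF H k) <= C * EW H.
Proof.
have [C C0 hC] := energy s4 (16 * M).
have [Cd Cd0 hd] := damping b1 C0 k0; exists Cd => // r H gH EM.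
have [aH nH] := gal_adm gH; have [mW iW] := gal_W gH; have [mH _] := aH.
have [mN iN] := NN_L2 aH aH; have [mm im] := proj1 (galM (mf_mB beta) (@mB_r r) gH).
have [mF iF] := proj1 (FF_L2 aH).
have i1 := intg_sqM mW mN iW iN; have i2 := intg_sqM mW mm iW im.
have i3 := intg_sqM mW mF iW iF; split=> //.
have iL := WL_intg s4 mH (conj mW iW); have iE := gal_EW gH.
have nM : N8 H <= 16 * M by clear -nH EM; lra.
have hE := hC H mH (conj mW iW) nM.
apply: (@le_trans _ _ (C * \int[mu]_k (WL s k * H k ^+ 2) - kappa * \int[mu]_k (Wt s k * H k * (mB beta k * H k)))).
 have -> : \int[mu]_k (Wt s k * H k * FF H k) = - (\int[mu]_k (Wt s k * H k * NN H H k)) - kappa * \int[mu]_k (Wt s k * H k * (mB beta k * H k)).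
  rewrite -RintN// -RintZ// -RintB; [|exact: intgN|exact: intgZ].
  by apply: eq_Rint => k; rewrite FFE; ring.
 by apply: lerD => //; apply: le_trans (ler_norm _) _; rewrite normrN.
rewrite -(RintZ C iL) -(RintZ kappa i2) -RintB; [|exact: intgZ|exact: intgZ].
rewrite /EW -RintZ//; apply: le_Rint; [by apply: intgB; exact: intgZ|exact: intgZ|].
move=> k; have L0 : 0 <= Lw k by exact/ltW/Lw_gt0.
have := ler_wpM2r (mulr_ge0 (Wt_ge0 k) (sqr_ge0 (H k))) (hd _ L0).
rewrite /WL /mB; move: (Wt s k) (H k) (Lw k) (Lw k `^ beta) => w x l m h.
have -> : C * (w * l * x ^+ 2) - kappa * (w * x * (m * x)) = (C * l - kappa * m) * (w * x ^+ 2) by ring.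
by [].
Qed.

Definition PF r H (k : K) : R := le1 (jap k) r * FF H k.

Lemma gal_PF r H : adm H -> gal r (PF r H) /\ \int[mu]_k (PF r H k ^+ 2) <= \int[mu]_k (FF H k ^+ 2).
Proof.
move=> hH; have [[mF iF] _] := FF_L2 hH.
have mP : mfun (PF r H).
 by apply: mfunM; [apply: mf_le1; [exact: mf_jap|exact: mfun_cst]|].
have bd k : PF r H k ^+ 2 <= FF H k ^+ 2.
 rewrite /PF le1E; case: (jap k <= r); first by rewrite mul1r.
 by rewrite mul0r expr0n; exact: sqr_ge0.
have iP : intg mu (fun k => PF r H k ^+ 2).
 by apply: le_intg (mfunX 2 mP) _ iF => k; rewrite ger0_norm ?sqr_ge0.
split; last exact: le_Rint.
by split=> // k h; rewrite /PF le1E leNgt h mul0r.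
Qed.

Definition eul r h H (k : K) : R := H k + h * PF r H k.

Lemma gal_lin r h H V : gal r H -> gal r V -> gal r (fun k => H k + h * V k).
Proof.
move=> [LH H0] [LV V0]; split; first by apply: L2D => //; exact: L2Z.
by move=> k hk; rewrite H0// V0// mulr0 addr0.
Qed.

(** Expanding the square, the quadratic remainder is bounded by [B], which may be huge in [r], but
    it carries an extra factor [h]. *)
Lemma euler_step M r : exists2 B, 0 <= B & forall H, gal r H -> EW H <= M ->
 [/\ gal r (PF r H), \int[mu]_k (PF r H k ^+ 2) <= B & forall C h, 0 <= h -> (forall H', gal r H' -> EW H' <= M ->
   \int[mu]_k (Wt s k * H' k * FF H' k) <= C * EW H') -> EW (eul r h H) <= EW H + h * (2 * (C * EW H) + h * B)].
Proof.
have [C1 C10 h1] := FF_bound (16 * M); exists (Wr r * C1 + C1).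
 by apply: addr_ge0 => //; apply: mulr_ge0 => //; exact: Wr_ge0.
move=> H gH EM; have [aH nH] := gal_adm gH; have [gV V1] := gal_PF r aH.
have nM : N8 H <= 16 * M by lra.
have [LF F1 _ _] := h1 H aH nM; have V2 := le_trans V1 F1.
have W1 := mulr_ge0 (Wr_ge0 r) C10.
split=> //; first by clear -V2 F1 W1 C10; lra.
move=> C h h0 hE; have [mW iW] := gal_W gH; have [mF iF] := LF.
have iE := gal_EW gH; have iV := gal_EW gV; have i2 := intg_sqM mW mF iW iF.
have -> : EW (eul r h H) = EW H + h * (2 * \int[mu]_k (Wt s k * H k * FF H k) + h * EW (PF r H)).
 have -> (a b : R) : h * (2 * a + h * b) = 2 * h * a + h ^+ 2 * b by ring.
 rewrite /EW -!RintZ// -RintD; [|exact: intgZ|exact: intgZ].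
 rewrite -RintD//; last by apply: intgD; exact: intgZ.
 apply: eq_Rint => k; rewrite /eul.
 (* Where [H] lives the truncation is the identity, so the cross term may be written with the
    untruncated [FF]. *)
 have [e|e] := leP (jap k) r; first by rewrite /PF le1E e mul1r; move: (FF H k) => y; ring.
 by rewrite (proj2 gH k e) /PF le1E leNgt e; ring.
rewrite lerD2l; apply: ler_wpM2l => //; apply: lerD; first by apply: ler_wpM2l => //; exact: hE.
apply: ler_wpM2l => //; apply: le_trans (gal_EW_le gV) _.
have : Wr r * \int[mu]_k (PF r H k ^+ 2) <= Wr r * C1 by apply: ler_wpM2l => //; exact: Wr_ge0.
clear -C10; lra.
Qed.

Section Iterate.
Variables (r h : R) (H0 : K -> R).

Fixpoint Gs (j : nat) : K -> R := if j is i.+1 then eul r h (Gs i) else H0.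

(** A bootstrap on the cap [M]: as long as the energy stays below it, the growth per unit of time is
    at most [2 * (C * M) + 1], the 1 paying for [h * B]. By hypothesis the total growth over [m]
    steps fits under the cap. *)
Lemma Gs_energy M B C (m : nat) : gal r H0 -> 0 <= M -> 0 <= h -> 0 <= C -> 0 <= B -> h * B <= 1 ->
 EW H0 + m%:R * h * (2 * (C * M) + 1) <= M -> (forall H, gal r H -> EW H <= M -> gal r (PF r H) /\
  forall h', 0 <= h' -> EW (eul r h' H) <= EW H + h' * (2 * (C * EW H) + h' * B)) ->
 forall j t, (j <= m)%N -> 0 <= t <= h ->
 gal r (eul r t (Gs j)) /\ EW (eul r t (Gs j)) <= EW H0 + (j%:R * h + t) * (2 * (C * M) + 1).
Proof.
move=> g0 M0 h0 C0 B0 hB hm hs.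
set q := 2 * (C * M) + 1.
have q0 : 0 <= q by rewrite /q; apply: addr_ge0 => //; do 2 apply: mulr_ge0 => //.
have step j t : gal r (Gs j) -> EW (Gs j) <= EW H0 + j%:R * h * q -> EW (Gs j) <= M -> 0 <= t <= h ->
  gal r (eul r t (Gs j)) /\ EW (eul r t (Gs j)) <= EW H0 + (j%:R * h + t) * q.
 move=> gj Ej EM /andP[t0 th]; have [gP e] := hs _ gj EM.
 split; first exact: gal_lin.
 apply: le_trans (e t t0) _.
 have : 2 * (C * EW (Gs j)) + t * B <= q.
  rewrite /q; apply: lerD; last by apply: le_trans hB; exact: ler_wpM2r.
  by do 2 apply: ler_wpM2l => //.
 move=> hq; have := ler_wpM2l t0 hq.
 by rewrite [in X in _ -> X]mulrDl; lra.
have jM j : (j <= m)%N -> EW H0 + j%:R * h * q <= M.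
 move=> jm; apply: le_trans hm; rewrite lerD2l; apply: ler_wpM2r => //; apply: ler_wpM2r => //.
 by rewrite ler_nat.
have ind j : (j <= m)%N -> gal r (Gs j) /\ EW (Gs j) <= EW H0 + j%:R * h * q.
 elim: j => [|j IH] jm; first by rewrite !mul0r addr0.
 have [gj Ej] := IH (ltnW jm); have EM := le_trans Ej (jM j (ltnW jm)).
 have := @step j h gj Ej EM; rewrite h0 lexx /= => /(_ isT)[g1 e1]; split=> //.
 by rewrite -natr1 mulrDl mul1r.
move=> j t jm ht; have [gj Ej] := ind j jm; exact: (step j t gj Ej (le_trans Ej (jM j jm)) ht).
Qed.

End Iterate.

End Galerkin.

Lemma ae_le_intg d (T : measurableType d) (m : {measure set T -> \bar R}) (f g : T -> R) :
 mfun f -> intg m g -> {ae m, forall x, `|f x| <= g x} -> intg m f.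
Proof.
move=> mf ig h; have mg := intg_mf ig.
pose p x := Num.min `|f x| `|g x|.
have mp : mfun p by apply: measurable_minr; exact: mfcomp.
have ip : intg m p.
 apply: le_intg mp _ (intg_norm ig) => x.
 by rewrite ger0_norm /p ?ge_min ?lexx ?orbT// le_min !normr_ge0.
have mnf : mfun (fun x => `|f x|) by mtac.
have i2 : intg m (fun x => `|f x|).
 apply: (ae_intg mnf _ ip); apply: ae1 h _ => x hx; rewrite /p min_l//.
 by apply: le_trans hx (ler_norm _).
by apply: le_intg mf _ i2.
Qed.

Section Slices.
Context d1 d2 (T1 : measurableType d1) (T2 : measurableType d2).
Variables (m1 : sfmeas T1 R) (m2 : sfmeas T2 R).
Variables (c C : R) (f : T1 * T2 -> R).
Hypotheses (m1T : m1 setT = c%:E) (C0 : 0 <= C).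

(** Tonelli with a uniform bound on almost every slice: the usual route from estimates at fixed time
    to estimates on the slab. *)
Lemma slice_bd : mfun f -> (forall z, 0 <= f z) ->
 {ae m1, forall x, intg m2 (fun y => f (x, y)) /\ \int[m2]_y f (x, y) <= C} ->
 intg (pm m1 m2) f /\ \int[pm m1 m2]_z f z <= C * c.
Proof.
move=> mf f0 h.
have mE : mfun (EFin \o f) by exact/EFinP.
have le : (\int[pm m1 m2]_z (f z)%:E <= (C * c)%:E)%E.
 rewrite fubini_tonelli1//= /fubini_F.
 have -> : (C * c)%:E = (\int[m1]_x (cst C%:E x))%E by rewrite integral_cst//= m1T EFinM.
 apply: ae_ge0_le_integral => //.
 - by move=> x _; apply: integral_ge0 => y _; rewrite lee_fin.
 - exact: (@measurable_fun_fubini_tonelli_F _ _ _ _ _ m2 (EFin \o f) mE).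
 - apply: ae1 h _ => x [i1 i2] _ /=; rewrite RintE// lee_fin//.
have if_ : intg (pm m1 m2) f by apply: ge0_intg => //; apply: le_lt_trans le _; rewrite ltry.
by split=> //; rewrite -lee_fin -RintE.
Qed.

End Slices.

(** * The piecewise linear interpolant of Euler steps *)

Section Euler.
Variable T : R.
Hypothesis T0 : 0 < T.
Notation tmT := (tm T).
Notation P := (pm tmT mu).

Let T0' : 0 <= T := ltW T0.

Lemma ae_neq (c : R) : {ae tmT, forall t : RM, t != c}.
Proof.
exists [set c]; split; first exact: measurable_set1.
 apply/eqP; rewrite -measure_le0 /= /tm /rmeas /mrestr.
 apply: (@le_trans _ _ (@lebesgue_measure R [set c])).
  apply: le_measure; rewrite ?inE; [apply: measurableI; [exact: measurable_set1|exact: mT]|exact: measurable_set1|].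
  exact: subIsetl.
 by rewrite [lebesgue_measure _]lebesgue_measure_set1.
by move=> y /= /negP; rewrite negbK => /eqP.
Qed.

Lemma intg_le1 b : intg tmT (fun t => le1 b t).
Proof.
by apply: (tm_bdd T0' _ (norm_le1 b)); apply: mf_le1; [exact: mfun_cst|exact: measurable_id].
Qed.

Lemma cum_le1 b t : 0 <= b <= T -> 0 <= t <= T -> cum T (le1 b) t = Num.max b t - b.
Proof.
move=> hb ht; have hm : 0 <= Num.max b t <= T.
 by rewrite le_max ge_max; case/andP: hb => -> ->; case/andP: ht => _ ->.
have -> : Num.max b t - b = (T - b) - (T - Num.max b t) by ring.
rewrite -(int_le1 hb) -(int_le1 hm) -RintB; [|exact: intg_le1|exact: intg_le1].
have mid := @measurable_id _ RM setT.
have ml (x : R) : mfun (fun a : RM => le1 x a) by apply: mf_le1.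
apply: ae_Rint.
- by apply: mfunM => //; apply: mf_le1.
- by mtac.
apply: ae1 (ae_neq (Num.max b t)) _ => a; rewrite !le1E.
rewrite ge_max; case: (leP b a) => ba /=; case: (leP a t) => at_ /=; rewrite ?mulr0 ?mul1r ?subr0 ?subrr//.
 case: (leP t a) => ta /=; last by rewrite subr0.
 by rewrite (max_r (le_trans ba at_)) eq_le at_ ta.
by rewrite (ltW at_) mul0r subrr.
Qed.

Lemma L2_tensor (a : RM -> R) B (V : K -> R) : mfun a -> (forall t, `|a t| <= B) -> L2 mu V ->
 L2 P (fun z => a z.1 * V z.2).
Proof.
move=> ma aB [mV iV].
have m2 : mfun (fun z : RM * K => a z.1 * V z.2).
 by mtac.
split=> //.
have ia : intg tmT (fun t => a t ^+ 2).
 apply: (@tm_bdd _ T0' _ (B ^+ 2)); first exact: mfunX.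
 move=> t; rewrite normrX; apply: lerXn2r; rewrite ?nnegrE//; exact: le_trans (aB t).
by apply: eq_intg (intgM12 ia iV) => z; rewrite exprMn.
Qed.

Lemma L2_sum (m : nat) (f : nat -> RM * K -> R) : (forall j, (j < m)%N -> L2 P (f j)) ->
 L2 P (fun z => \sum_(j < m) f j z).
Proof.
elim: m => [|m IH] h.
 have e : (fun z : RM * K => \sum_(j < 0) f j z) = (fun=> 0) by apply/funext => z; rewrite big_ord0.
 rewrite e; split=> //.
 by apply: eq_intg (@intg0 _ _ _ P) => z; rewrite expr0n.
have e : (fun z : RM * K => \sum_(j < m.+1) f j z) = (fun z => (\sum_(j < m) f j z) + f m z).
 by apply/funext => z; rewrite big_ord_recr.
by rewrite e; apply: L2D; [apply: IH => j jm; apply: h; exact: ltnW|exact: h].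
Qed.

Variables (h : R) (m : nat) (V : nat -> K -> R) (G : nat -> K -> R).
Hypotheses (h0 : 0 < h) (hm : m%:R * h = T).
Hypothesis GS : forall j k, G j.+1 k = G j k + h * V j k.
Hypothesis L2V : forall j, (j < m)%N -> L2 mu (V j).
Hypothesis L2G : L2 mu (G 0).

Let natS (j : nat) : j.+1%:R * h = j%:R * h + h.
Proof. by rewrite -natr1 mulrDl mul1r. Qed.
Let hmul i j : (i <= j)%N -> i%:R * h <= j%:R * h.
Proof. by move=> ij; apply: ler_wpM2r; [exact: ltW|rewrite ler_nat]. Qed.
(** For [t >= 0] this is the time spent in the [j]-th cell up to [t]. Sums of such ramps, and of the
    step functions in [gE], make the integral of the velocity a linear computation without case
    analysis. *)
Definition cj (j : nat) (t : R) : R := Num.max (j%:R * h) t - j%:R * h - (Num.max (j.+1%:R * h) t - j.+1%:R * h).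
Definition gE (n : nat) (t : RM) (k : K) : R := \sum_(j < n) (le1 (j%:R * h) t - le1 (j.+1%:R * h) t) * V j k.
Definition GE (n : nat) (t : RM) (k : K) : R := G 0 k + \sum_(j < n) cj j t * V j k.

Lemma GE_hi n t k : n%:R * h <= t -> GE n t k = G n k.
Proof.
elim: n => [|n IH] ht; first by rewrite /GE big_ord0 addr0.
have hn : n%:R * h <= t by apply: le_trans ht; exact: hmul.
rewrite GS -IH// /GE big_ord_recr /= addrA; congr (_ + _ * _).
by rewrite /cj !max_r// natS; ring.
Qed.

Lemma gE_hi n t k : n%:R * h <= t -> gE n t k = 0.
Proof.
elim: n => [|n IH] ht; first by rewrite /gE big_ord0.
have hn : n%:R * h <= t by apply: le_trans ht; exact: hmul.
by rewrite /gE big_ord_recr /= -/(gE n t k) IH// !le1E hn ht subrr mul0r addr0.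
Qed.

Lemma GE_cell n j t k : (j < n)%N -> j%:R * h <= t -> t < j.+1%:R * h -> GE n t k = G j k + (t - j%:R * h) * V j k.
Proof.
move=> + h1 h2; elim: n => // n IH; rewrite ltnS leq_eqVlt => /orP[/eqP e|jn].
 rewrite -(GE_hi k h1) -e /GE big_ord_recr /= addrA; congr (_ + _ * _).
 by rewrite /cj (max_r h1) (max_l (ltW h2)); ring.
rewrite -IH// /GE big_ord_recr /= addrA /cj.
have ht : t <= n%:R * h by apply: le_trans (ltW h2) _; exact: hmul.
have ht' : t <= n.+1%:R * h by apply: le_trans ht _; exact: hmul.
by rewrite (max_l ht) (max_l ht') !subrr mul0r addr0.
Qed.

Lemma gE_cell n j t k : (j < n)%N -> j%:R * h <= t -> t < j.+1%:R * h -> gE n t k = V j k.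
Proof.
move=> + h1 h2; elim: n => // n IH; rewrite ltnS leq_eqVlt => /orP[/eqP e|jn].
 by rewrite /gE big_ord_recr /= -/(gE n t k) -e gE_hi// !le1E h1 leNgt h2 subr0 mul1r add0r.
rewrite /gE big_ord_recr /= -/(gE n t k) IH// !le1E.
have ht : t < n%:R * h by apply: lt_le_trans h2 _; exact: hmul.
have ht' : t < n.+1%:R * h by apply: lt_le_trans ht _; exact: hmul.
by rewrite !leNgt ht ht' subrr mul0r addr0.
Qed.

Lemma cellE t : 0 <= t -> t < T -> exists2 j, (j < m)%N & j%:R * h <= t /\ t < j.+1%:R * h.
Proof.
move=> t0 tT; have [n /= hn] : exists n : nat, Num.truncn (t / h) = n by exists (Num.truncn (t / h)).
have := truncn_itv (divr_ge0 t0 (ltW h0)); rewrite hn => /andP[h1 h2].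
have e1 : n%:R * h <= t by rewrite -ler_pdivlMr.
have e2 : t < n.+1%:R * h by rewrite -ltr_pdivrMr.
exists n => //; rewrite -(ltr_nat R) -(ltr_pM2r h0) hm; exact: le_lt_trans tT.
Qed.

(** Integrating the jump at [b] up to [t] gives [Num.max b t - b]; the sum over the cells is then
    linear. *)
Lemma cum_gE n t k : (n <= m)%N -> 0 <= t <= T -> intg tmT (gE n ^~ k) /\ cum T (gE n ^~ k) t = GE n t k - G 0 k.
Proof.
move=> + ht; elim: n => [|n IH] nm.
 have e : gE 0 ^~ k = (fun=> 0) by apply/funext => a; rewrite /gE big_ord0.
 rewrite e; split; first exact: intg0.
 rewrite /GE big_ord0 addr0 subrr /cum -[RHS](@Rint0 _ _ _ tmT).
 by apply: eq_Rint => a; rewrite mulr0.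
have [i1 e1] := IH (ltnW nm).
have b0 i : (i <= m)%N -> 0 <= i%:R * h <= T.
 by move=> im; rewrite mulr_ge0 ?ler0n ?(ltW h0)//= -hm; exact: hmul.
have i2 : intg tmT (fun a => le1 (n%:R * h) a) := intg_le1 _.
have i3 : intg tmT (fun a => le1 (n.+1%:R * h) a) := intg_le1 _.
have e : gE n.+1 ^~ k = (fun a => gE n a k + V n k * (le1 (n%:R * h) a - le1 (n.+1%:R * h) a)).
 by apply/funext => a; rewrite /gE big_ord_recr /= [X in _ + X]mulrC.
have i4 := intgZ (V n k) (intgB i2 i3); rewrite e; split; first exact: intgD.
rewrite /cum.
transitivity (cum T (gE n ^~ k) t + V n k * (cum T (le1 (n%:R * h)) t - cum T (le1 (n.+1%:R * h)) t)).
 rewrite /cum -RintB; [|exact: cum_intg|exact: cum_intg].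
 rewrite -RintZ; last by apply: intgB; exact: cum_intg.
 rewrite -RintD; [|exact: cum_intg|by apply: intgZ; apply: intgB; exact: cum_intg].
 by apply: eq_Rint => a; ring.
rewrite e1 !cum_le1//; [|exact: b0|by apply: b0; exact: ltnW].
by rewrite /GE big_ord_recr /= -/(cj n t); ring.
Qed.

Lemma L2_gE : L2 P (fun z => gE m z.1 z.2).
Proof.
apply: (@L2_sum m (fun j z => (le1 (j%:R * h) z.1 - le1 (j.+1%:R * h) z.1) * V j z.2)) => j jm.
apply: (@L2_tensor (fun t => le1 (j%:R * h) t - le1 (j.+1%:R * h) t) 2); last exact: L2V.
 by apply: mfunB; apply: mf_le1.
move=> t; apply: le_trans (ler_normB _ _) _; have := norm_le1 (j%:R * h) t; have := norm_le1 (j.+1%:R * h) t; lra.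
Qed.

Lemma L2_GE : L2 P (fun z => GE m z.1 z.2).
Proof.
apply: L2D.
 have := @L2_tensor (fun=> 1) 1 (G 0) => /(_ _ _ L2G) H.
 have [] := H (mfun_cst _) _; first by move=> t; rewrite normr1.
 move=> m1 i1; split; first by apply: eq_measurable_fun m1 => z _; rewrite mul1r.
 by apply: eq_intg i1 => z; rewrite mul1r.
apply: (@L2_sum m (fun j z => cj j z.1 * V j z.2)) => j jm; apply: (@L2_tensor (cj j) h); last exact: L2V.
 by apply: mfunB; apply: mfunB => //; apply: measurable_maxr.
move=> t; rewrite /cj natS; move: (j%:R * h) => x; have := h0 => h0'.
rewrite ler_norml; case: (leP x t) => h1; case: (leP (x + h) t) => h2; apply/andP; split; lra.
Qed.

End Euler.

(** * Approximate solutions with small residual *)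

Section Approximation.

Implicit Types (F G H D V : K -> R).

Lemma eul0 r H : eul r 0 H = H.
Proof. by apply/funext => k; rewrite /eul mul0r addr0. Qed.

(** Inside the ball of radius [r] the residual is a difference of values of [FF], and undoing the
    weight of [FF_low] costs [r ^+ 4]. Outside it is [FF U] alone, and the extra power in [FF_jap]
    gains [r ^- 2]. Hence [r] is fixed first and the step afterwards. *)
Lemma rho_slice M : exists Cl Cb, [/\ 0 <= Cl, 0 <= Cb & forall r G U (t B : R), 1 <= r -> adm G -> N8 G <= M ->
 adm U -> N8 U <= M -> (forall k, U k = G k + t * PF r G k) -> \int[mu]_k (PF r G k ^+ 2) <= B ->
 intg mu (fun k => (PF r G k - FF U k) ^+ 2) /\
 \int[mu]_k ((PF r G k - FF U k) ^+ 2) <= r ^+ 4 * (Cl * (t ^+ 2 * B)) + (r ^+ 2)^-1 * Cb].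
Proof.
have [Cl Cl0 hl] := FF_low M; have [Cb Cb0 hb] := FF_bound M.
exists Cl, Cb; split=> // r G U t B r1 aG nG aU nU e hB.
have [iL IL] := hl G U aG aU nG nU; have [[mF iF] _ [mj ij] Ij] := hb U aU nU.
have [[[mP iP] P0] _] := gal_PF r aG.
have r0 : 0 < r := lt_le_trans ltr01 r1.
have mr : mfun (fun k => PF r G k - FF U k) by mtac.
have bd k : (PF r G k - FF U k) ^+ 2 <= r ^+ 4 * ((jap k ^+ 2)^-1 * (FF G k - FF U k)) ^+ 2 + (r ^+ 2)^-1 * (jap k * FF U k) ^+ 2.
 have j0 := jap_gt0 k; have [h|h] := leP (jap k) r.
  have -> : PF r G k = FF G k by rewrite /PF le1E h mul1r.
  apply: ler_wpDr; first by apply: mulr_ge0; [rewrite invr_ge0; exact: sqr_ge0|exact: sqr_ge0].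
  rewrite (_ : r ^+ 4 = (r ^+ 2) ^+ 2); last by rewrite -exprM.
  rewrite -exprMn mulrA exprMn; apply: ler_peMl; first exact: sqr_ge0.
  apply: exprn_ege1; rewrite ler_pdivlMr ?exprn_gt0// mul1r.
  by apply: lerXn2r; rewrite ?nnegrE//; exact: ltW.
 rewrite (P0 k h) sub0r sqrrN; apply: ler_wpDl.
  by apply: mulr_ge0; [apply: exprn_ge0; exact: ltW|exact: sqr_ge0].
 rewrite [(jap k * _) ^+ 2]exprMn mulrA; apply: ler_peMl; first exact: sqr_ge0.
 rewrite mulrC ler_pdivlMr ?exprn_gt0// mul1r.
 by apply: lerXn2r; rewrite ?nnegrE//; exact: ltW.
have iq := intgD (intgZ (r ^+ 4) iL) (intgZ (r ^+ 2)^-1 ij).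
have ir : intg mu (fun k => (PF r G k - FF U k) ^+ 2).
 by apply: le_intg (mfunX 2 mr) _ iq => k; rewrite ger0_norm ?sqr_ge0.
split=> //; apply: le_trans (le_Rint ir iq bd) _.
rewrite RintD; [|exact: intgZ|exact: intgZ].
rewrite (RintZ _ iL) (RintZ _ ij); apply: lerD.
 apply: ler_wpM2l; first by apply: exprn_ge0; exact: ltW.
 apply: le_trans IL _; apply: ler_wpM2l => //.
 have -> : \int[mu]_k ((G k - U k) ^+ 2) = t ^+ 2 * \int[mu]_k (PF r G k ^+ 2).
  by rewrite -RintZ//; apply: eq_Rint => k; rewrite e; ring.
 by apply: ler_wpM2l => //; exact: sqr_ge0.
by apply: ler_wpM2l => //; rewrite invr_ge0; exact: sqr_ge0.
Qed.

Lemma add3_ge (b q : R) : 0 <= b -> 0 <= q -> [/\ 0 <= 1 + b + q, b <= 1 + b + q, 1 <= 1 + b + q & q <= 1 + b + q].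
Proof. by move=> *; split; lra. Qed.
Lemma half_le (x d : R) : 2 * x <= 1 * d -> x <= d / 2.
Proof. lra. Qed.
Lemma quarter_le (x y e : R) : x <= e / 4 -> y <= e / 4 -> 2 * (x + y) <= e.
Proof. lra. Qed.

Section Construct.
Variables M C T : R.
Hypotheses (M0 : 0 <= M) (C0 : 0 <= C) (T0 : 0 < T).
Hypothesis hC : forall r H, gal r H -> EW H <= M -> \int[mu]_k (Wt s k * H k * FF H k) <= C * EW H.
Notation P := (pm (tm T) mu).

(** [U] has derivative [g] and initial value [A] in integrated form; datum and equation hold up to
    [delta] in squared [L2], while the energy bound [M] does not depend on [delta]. *)
Definition approx (delta : R) H (U g : RM -> K -> R) (A : K -> R) :=
 [/\ L2 P (fun z => U z.1 z.2), L2 P (fun z => g z.1 z.2), L2 mu A & \int[mu]_k ((A k - H k) ^+ 2) <= delta] /\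
 [/\ {ae tm T, forall t, intg mu (fun k => Wt s k * U t k ^+ 2) /\ EW (U t) <= M},
   {ae P, forall z, U z.1 z.2 = A z.2 + cum T (g ^~ z.2) z.1}, L2 P (fun z => g z.1 z.2 - FF (U z.1) z.2) &
   \int[P]_z ((g z.1 z.2 - FF (U z.1) z.2) ^+ 2) <= delta].

Lemma radius (X Y d r : R) : 0 <= Y -> Y <= X -> 0 < d -> r = 1 + X / d -> 1 <= r /\ (r ^+ 2)^-1 * Y <= d.
Proof.
move=> Y0 YX d0 er; have X0 := le_trans Y0 YX; have q0 : 0 <= X / d by apply: divr_ge0 => //; exact: ltW.
have r1 : 1 <= r by rewrite er lerDl.
split=> //; rewrite mulrC ler_pdivrMr; last by apply: exprn_gt0; exact: lt_le_trans r1.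
apply: le_trans YX _; have -> : X = d * (X / d) by rewrite mulrC divfK// gt_eqF.
apply: ler_wpM2l; first exact: ltW.
have h : X / d <= r by rewrite er; lra.
by apply: le_trans h _; rewrite expr2 ler_peMl//; lra.
Qed.

Lemma half_add (x y d : R) : x <= d / 2 -> y <= d -> x + 1 / 2 * y <= d.
Proof. by move=> h1 h2; lra. Qed.

Lemma stepsize (Y : R) : 0 <= Y -> exists2 m : nat, (0 < m)%N & T / m%:R * Y <= 1.
Proof.
move=> Y0; exists (Num.truncn (T * Y)).+1 => //.
rewrite mulrAC ler_pdivrMr ?ltr0n// mul1r; exact/ltW/truncnS_gt.
Qed.

Lemma approx_exists H delta : mfun H -> intg mu (fun k => Wt s k * H k ^+ 2) ->
 EW H + T * (2 * (C * M) + 1) <= M -> 0 < delta -> exists U g A, approx delta H U g A.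
Proof.
move=> mH iH hM d0; have [aH nH] := EW_adm mH iH.
have [Cl [Cb [Cl0 Cb0 hrho]]] := rho_slice (16 * M).
have TCb : 0 <= 2 * (T * Cb) by apply: mulr_ge0 => //; apply: mulr_ge0 => //; exact: ltW.
(* One radius controls both errors of order [r ^- 2]: the tail of the datum and the truncation part
   of the residual. *)
pose r := 1 + (N8 H + 2 * (T * Cb)) / delta.
have [r1 hr1] := @radius (N8 H + 2 * (T * Cb)) (N8 H) delta r (N8_ge0 _) (ler_wpDr TCb (lexx _)) d0 (erefl _).
have [_ hr2] := @radius (N8 H + 2 * (T * Cb)) _ delta r TCb (ler_wpDl (N8_ge0 _) (lexx _)) d0 (erefl _).
have r0 : 0 < r := lt_le_trans ltr01 r1.
have [B B0 hB] := @euler_step M r.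
pose A k := le1 (jap k) r * H k.
have mA : mfun A.
 by apply: mfunM => //; apply: mf_le1 => //; exact: mf_jap.
have [[mH1 iH1] H1] := @adm_L2 H 1 isT aH.
have iH0 := proj2 (adm0_L2 aH).
have AE k : A k = (if jap k <= r then H k else 0).
 by rewrite /A le1E; case: (jap k <= r); rewrite ?mul1r ?mul0r.
have iA : intg mu (fun k => A k ^+ 2).
 apply: le_intg (mfunX 2 mA) _ iH0 => k; rewrite ger0_norm ?sqr_ge0// AE.
 by case: (jap k <= r) => //; rewrite expr0n sqr_ge0.
have gA : gal r A by split=> // k hk; rewrite AE leNgt hk.
have EA : EW A <= EW H.
 have iEA := gal_EW gA; apply: le_Rint => // k; apply: ler_wpM2l; first exact: Wt_ge0.
 by rewrite AE; case: (jap k <= r) => //; rewrite expr0n sqr_ge0.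
have dA : \int[mu]_k ((A k - H k) ^+ 2) <= delta.
 apply: le_trans _ hr1; apply: le_trans (ler_wpM2l _ H1); last by rewrite invr_ge0; exact: sqr_ge0.
 rewrite -RintZ//; apply: le_Rint; [|exact: intgZ|].
  exact: (proj2 (L2B (conj mA iA) (conj mH iH0))).
 move=> k; rewrite AE; case: (leP (jap k) r) => h.
  by rewrite subrr expr0n; apply: mulr_ge0; [rewrite invr_ge0|]; exact: sqr_ge0.
 rewrite sub0r sqrrN [(jap k ^+ 1 * _) ^+ 2]exprMn mulrA; apply: ler_peMl; first exact: sqr_ge0.
 rewrite expr1 mulrC ler_pdivlMr ?exprn_gt0// mul1r.
 by apply: lerXn2r; rewrite ?nnegrE; [exact: ltW|exact/ltW/jap_gt0|exact: ltW].
pose Z := r ^+ 4 * (Cl * B).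
have Z0 : 0 <= Z by apply: mulr_ge0; [apply: exprn_ge0; exact: ltW|exact: mulr_ge0].
(* A step with [h * Y <= 1] meets all three demands: [h <= 1], [h * B <= 1] for the energy, and
   [h * Z * T <= delta / 2] for the residual. *)
pose Y := 1 + B + 2 * (T * Z) / delta.
have TZ0 : 0 <= 2 * (T * Z) / delta.
 by apply: divr_ge0; [apply: mulr_ge0 => //; apply: mulr_ge0 => //|]; exact: ltW.
have [Y0 YB Y1 YZ] : [/\ 0 <= Y, B <= Y, 1 <= Y & 2 * (T * Z) / delta <= Y] := add3_ge B0 TZ0.
have [m m0 hY] := stepsize Y0.
pose h := T / m%:R; have mm0 : 0 < m%:R :> R by rewrite ltr0n.
have h0 : 0 < h by exact: divr_gt0.
have hm : m%:R * h = T by rewrite mulrC divfK// gt_eqF.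
have hpart x : x <= Y -> h * x <= 1 by move=> hx; exact: le_trans (ler_wpM2l (ltW h0) hx) hY.
have hB1 := hpart _ YB; have hZ := hpart _ YZ.
have h1 : h <= 1 by rewrite -[h]mulr1; exact: hpart.
have {}hZ : h * Z * T <= delta / 2.
 have : h * (2 * (T * Z) / delta) * delta <= 1 * delta by apply: ler_wpM2r => //; exact: ltW.
 have -> : h * (2 * (T * Z) / delta) * delta = 2 * (h * Z * T) by field; rewrite gt_eqF.
 exact: half_le.

have q0 : 0 <= 2 * (C * M) + 1 by apply: addr_ge0 => //; apply: mulr_ge0 => //; exact: mulr_ge0.
have hMA : EW A + m%:R * h * (2 * (C * M) + 1) <= M by rewrite hm; apply: le_trans hM; rewrite lerD2r.
have hs H' : gal r H' -> EW H' <= M -> gal r (PF r H') /\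
  forall h', 0 <= h' -> EW (eul r h' H') <= EW H' + h' * (2 * (C * EW H') + h' * B).
 move=> g' E'; have [g1 _ e1] := hB _ g' E'; split=> // h' h'0.
 by apply: (e1 C h' h'0) => H2 g2 E2; exact: hC g2 E2.
have key := @Gs_energy r h A M B C m gA M0 (ltW h0) C0 B0 hB1 hMA hs.
have keyM j t : (j < m)%N -> 0 <= t <= h -> gal r (eul r t (Gs r h A j)) /\ EW (eul r t (Gs r h A j)) <= M.
 move=> jm ht; have [g1 e1] := key j t (ltnW jm) ht; split=> //; apply: le_trans e1 _.
 apply: le_trans hMA; rewrite lerD2l; apply: ler_wpM2r => //.
 apply: (@le_trans _ _ (j.+1%:R * h)).
  by rewrite -natr1 mulrDl mul1r lerD2l; case/andP: ht.
 by apply: ler_wpM2r; [exact: ltW|rewrite ler_nat].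
have keyG j : (j < m)%N -> gal r (Gs r h A j) /\ EW (Gs r h A j) <= M.
 by move=> jm; have := keyM j 0 jm; rewrite eul0 lexx (ltW h0) => /(_ isT).
pose V j := PF r (Gs r h A j).
have GS j k : Gs r h A j.+1 k = Gs r h A j k + h * V j k by [].
have L2V j : (j < m)%N -> L2 mu (V j).
 by move=> jm; have [gj Ej] := keyG j jm; have [[]] := hs _ gj Ej.
have LA : L2 mu (Gs r h A 0) by [].
pose U := GE h V (Gs r h A) m; pose g := gE h V m.
have LU : L2 P (fun z => U z.1 z.2) := L2_GE T0 h0 L2V LA.
have Lg : L2 P (fun z => g z.1 z.2) := L2_gE T0 h L2V.
have cell t : 0 <= t <= T -> t != T -> exists j tau, [/\ (j < m)%N, 0 <= tau <= h, U t = eul r tau (Gs r h A j) & g t = V j].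
 move=> /andP[t0 tT] tn; have tT' : t < T by rewrite lt_neqAle tn.
 have [j jm [j1 j2]] := cellE h0 hm t0 tT'; exists j, (t - j%:R * h); split=> //.
 - by rewrite subr_ge0 j1 /=; move: j2; rewrite -natr1 mulrDl mul1r lerBlDl => /ltW.
 - by apply/funext => k; rewrite /U (GE_cell h0 GS k jm j1 j2).
 - by apply/funext => k; exact: gE_cell.
(* Cells are half open, so the final time belongs to none of them. *)
have aeT : {ae tm T, forall t, 0 <= t <= T /\ t != T}.
 by apply: ae2 (@ae_tm T) (ae_neq T T) _ => t h2 h3.
pose b := r ^+ 4 * (Cl * (h * B)) + (r ^+ 2)^-1 * Cb.
have b0 : 0 <= b.
 apply: addr_ge0; apply: mulr_ge0 => //; first by apply: exprn_ge0; exact: ltW.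
  by apply: mulr_ge0 => //; apply: mulr_ge0 => //; exact: ltW.
 by rewrite invr_ge0; exact: sqr_ge0.
have bT : b * T <= delta.
 have -> : b * T = h * Z * T + 1 / 2 * ((r ^+ 2)^-1 * (2 * (T * Cb))).
  by rewrite /b /Z; field; rewrite gt_eqF.
 exact: half_add hZ hr2.
pose rho (z : RM * K) := g z.1 z.2 - FF (U z.1) z.2.
have mrho : mfun rho.
 by apply: mfunB; [exact: (proj1 Lg)|exact: mf_FF2 (proj1 LU)].
have [irho Irho] : intg P (fun z => rho z ^+ 2) /\ \int[P]_z (rho z ^+ 2) <= b * T.
 apply: (slice_bd (tm_setT (ltW T0)) b0 (mfunX 2 mrho)); first by move=> z; exact: sqr_ge0.
 apply: ae1 aeT _ => t [t1 t2]; have [j [tau [jm ht eU eg]]] := cell t t1 t2.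
 have [gj Ej] := keyG j jm; have [gu Eu] := keyM j tau jm ht.
 have [aj nj] := gal_adm gj; have [au nu] := gal_adm gu; have [_ VB _] := hB _ gj Ej.
 have nj' : N8 (Gs r h A j) <= 16 * M by apply: le_trans nj _; rewrite ler_pM2l.
 have nu' : N8 (eul r tau (Gs r h A j)) <= 16 * M by apply: le_trans nu _; rewrite ler_pM2l.
 have [i1 I1] := hrho r _ _ tau B r1 aj nj' au nu' (fun k => erefl _) VB.
 rewrite /rho /= eU eg; split=> //; apply: le_trans I1 _; rewrite lerD2r.
 apply: ler_wpM2l; first by apply: exprn_ge0; exact: ltW.
 apply: ler_wpM2l => //; apply: ler_wpM2r => //.
 case/andP: ht => tau0 tauh; apply: (le_trans (ler_wpM2l tau0 tauh)).
 by apply: ler_piMl; [exact: ltW|exact: le_trans h1].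
exists U, g, A; split; split=> //.
- apply: ae1 aeT _ => t [t1 t2]; have [j [tau [jm ht eU eg]]] := cell t t1 t2.
 by have [gu Eu] := keyM j tau jm ht; rewrite eU; split=> //; exact: (gal_EW gu).
- have t0 : {ae mu, forall k : K, True} by exact: aeW.
 apply: ae1 (ae_prod (@ae_tm T) t0) _ => z [hz _].
 have [_ e] := cum_gE T0 V (Gs r h A) h0 hm z.2 (leqnn m) hz.
 by rewrite [cum _ _ _]e addrCA subrr addr0.
- exact: le_trans Irho bT.
Qed.

End Construct.

End Approximation.

Lemma L2B_le d (X : measurableType d) (m : sfmeas X R) (f g : X -> R) : L2 m f -> L2 m g ->
 \int[m]_x ((f x - g x) ^+ 2) <= 2 * \int[m]_x (f x ^+ 2) + 2 * \int[m]_x (g x ^+ 2).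
Proof.
move=> Lf Lg; have [_ i] := L2B Lf Lg; have [_ i1] := Lf; have [_ i2] := Lg.
rewrite -(RintZ 2 i1) -(RintZ 2 i2) -RintD; [|exact: intgZ|exact: intgZ].
apply: le_Rint => //; first by apply: intgD; exact: intgZ.
by move=> x; have := sqr_ge0 (f x + g x); move: (f x) (g x) => a b; nra.
Qed.

(** * Passage to the limit and local existence in frequency space *)

Section OnSlab.
Variable T : R.
Hypothesis T0 : 0 <= T.
Notation P := (pm (tm T) mu).

Lemma cumB (f g : RM -> R) t : intg (tm T) f -> intg (tm T) g ->
 cum T (fun a => f a - g a) t = cum T f t - cum T g t.
Proof.
move=> i1 i2; rewrite /cum -RintB; [|exact: cum_intg|exact: cum_intg].
by apply: eq_Rint => a; rewrite mulrBr.
Qed.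

Lemma cumZ c (f : RM -> R) t : intg (tm T) f -> cum T (fun a => c * f a) t = c * cum T f t.
Proof.
by move=> i1; rewrite /cum -RintZ; [apply: eq_Rint => a; rewrite mulrCA|exact: cum_intg].
Qed.

Lemma cum_sq (f : RM -> R) t : L2 (tm T) f -> cum T f t ^+ 2 <= T * \int[tm T]_a (f a ^+ 2).
Proof.
move=> [mf if_].
have ml : mfun (fun a : RM => le1 a t) by apply: mf_le1.
have l2 a : le1 a t ^+ 2 = le1 a t by rewrite le1E; case: (a <= t); rewrite ?expr1n ?expr0n.
have il : intg (tm T) (fun a => le1 a t ^+ 2).
 by apply: (@tm_bdd _ T0 _ 1); [exact: mfunX|move=> a; rewrite l2 norm_le1].
apply: le_trans (cauchy_schwarz ml mf il if_) _.
apply: ler_wpM2r; first by apply: Rint_ge0 => a; exact: sqr_ge0.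
have [i1 e1] := tm_cst T0 1; rewrite mulr1 in e1; rewrite -[leRHS]e1.
apply: le_Rint => // a; rewrite l2; exact: le_trans (ler_norm _) (norm_le1 _ _).
Qed.

Lemma cum_slab (f : RM -> K -> R) : L2 P (fun z => f z.1 z.2) -> L2 P (fun z => cum T (f ^~ z.2) z.1) /\
 \int[P]_z (cum T (f ^~ z.2) z.1 ^+ 2) <= T ^+ 2 * \int[P]_z (f z.1 z.2 ^+ 2).
Proof.
move=> Lf; have [mf if_] := Lf.
have mc : mfun (fun z : RM * K => cum T (f ^~ z.2) z.1).
 apply: (mf_Rint2 (tm T) (fun (z : RM * K) a => le1 a z.1 * f a z.2)).
 apply: mfunM; first by apply: mf_le1; mtac.
 have h : mfun (fun y : (RM * K) * RM => (y.2, y.1.2)) by mtac.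
 exact: (mfcomp mf h).
pose q k := \int[tm T]_a (f a k ^+ 2).
have iq : intg mu q := intg_Rint2 if_.
have [ic ec] := tm_cst T0 T.
have ib : intg P (fun z => T * q z.2) := intgM12 ic iq.
have bd : {ae P, forall z, cum T (f ^~ z.2) z.1 ^+ 2 <= T * q z.2}.
 have t0 : {ae tm T, forall t : RM, True} by exact: aeW.
 by apply: ae1 (ae_prod t0 (L2_seck Lf)) _ => z [_ hz]; exact: cum_sq.
have i2 : intg P (fun z => cum T (f ^~ z.2) z.1 ^+ 2).
 apply: (ae_le_intg (mfunX 2 mc) ib); apply: ae1 bd _ => z; by rewrite ger0_norm ?sqr_ge0.
split=> //; apply: le_trans (ae_le_Rint i2 ib bd) _.
rewrite -(Rfubini1 ib) -(Rfubini2 if_) -/q.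
have -> : \int[tm T]_x \int[mu]_y (T * q (x, y).2) = \int[tm T]_x (T * \int[mu]_y q y).
 by apply: eq_Rint => x /=; rewrite RintZ.
have [ic' ec'] := tm_cst T0 (T * \int[mu]_y q y); rewrite ec' mulrA expr2; exact: lexx.
Qed.

End OnSlab.

Lemma sq4 (a b c d : R) : (a + b + c + d) ^+ 2 <= 4 * a ^+ 2 + 4 * b ^+ 2 + 4 * c ^+ 2 + 4 * d ^+ 2.
Proof.
by have := sqr_ge0 (a - b); have := sqr_ge0 (a - c); have := sqr_ge0 (a - d);
have := sqr_ge0 (b - c); have := sqr_ge0 (b - d); have := sqr_ge0 (c - d); nra.
Qed.

Lemma FF_slab M T U : 0 <= T -> traj U -> {ae tm T, forall t, adm (U t) /\ N8 (U t) <= M} ->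
 L2 (pm (tm T) mu) (fun z => FF (U z.1) z.2).
Proof.
move=> T0 mU h; have [C C0 hC] := FF_bound M.
have mF := @mf_FF2 _ _ U mU; split=> //.
apply: (proj1 (slice_bd (tm_setT T0) C0 (mfunX 2 mF) _ _)); first by move=> z; exact: sqr_ge0.
by apply: ae1 h _ => t [a n]; have [[]] := hC _ a n.
Qed.

(** The integrated equation at almost every pair of time and frequency, with no pointwise meaning
    attached to the value at time 0. *)
Definition mild T (H0 : K -> R) (H : RM -> K -> R) :=
 {ae pm (tm T) mu, forall z, H z.1 z.2 = H0 z.2 + cum T (fun t => FF (H t) z.2) z.1}.
Definition Ebound T M (H : RM -> K -> R) :=
 {ae tm T, forall t, intg mu (fun k => Wt s k * H t k ^+ 2) /\ EW (H t) <= M}.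

Lemma Ebound_adm T M H : traj H -> Ebound T M H -> {ae tm T, forall t, adm (H t) /\ N8 (H t) <= 16 * M}.
Proof.
move=> mH h; apply: ae1 h _ => t [i e]; have [a n] := EW_adm (traj_t t mH) i; split=> //; lra.
Qed.

Lemma small_eq0 (x c : R) : 0 <= x -> 0 <= c -> (forall e, 0 < e -> x <= c * e) -> x = 0.
Proof.
move=> x0 c0 h; apply/eqP; rewrite eq_le x0 andbT; apply/ler_addgt0Pl => e e0.
have c1 : 0 < c + 1 by lra.
have := h (e / (c + 1)) (divr_gt0 e0 c1); rewrite mulrA => hx; rewrite addr0; apply: le_trans hx _.
by rewrite ler_pdivrMr//; rewrite mulrC ler_pM2l//; lra.
Qed.

Lemma cauchy_arith (T a b x y : R) : 0 <= T -> T <= 1 / 4 -> 0 <= x -> 0 <= y ->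
 a <= 2 * x + 2 * y -> b <= 2 * x + 2 * y -> 2 * T * (a + b) <= 2 * (x + y).
Proof. by move=> T0 T1 x0 y0 ha hb; nra. Qed.

Lemma four_terms (x1 x2 x3 x4 x5 c : R) : x2 <= x5 -> x3 <= x5 -> x4 <= c * x1 ->
 4 * x1 + 4 * x2 + 4 * x3 + 4 * x4 <= (4 + 4 * c) * x1 + 8 * x5.
Proof. by move=> h1 h2 h3; lra. Qed.

(** The stability estimate and the smallness of [T] are returned with the solution, since uniqueness
    on the same interval reuses exactly these constants. *)
Lemma local_existence (H0 : K -> R) : mfun H0 -> intg mu (fun k => Wt s k * H0 k ^+ 2) ->
 exists T M C H, [/\ 0 < T, 0 <= C, 2 * T * (C + 1 / 2) <= 1 / 2, forall F G, adm F -> adm G -> N8 F <= 16 * M ->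
   intg mu (fun k => (F k - G k) * (FF F k - FF G k)) /\
   \int[mu]_k ((F k - G k) * (FF F k - FF G k)) <= C * \int[mu]_k ((F k - G k) ^+ 2)
  & [/\ traj H, Ebound T M H & mild T H0 H]].
Proof.
move=> mH0 iH0; pose M := EW H0 + 1.
have E0 : 0 <= EW H0 := EW_ge0 _; have M0 : 0 <= M by rewrite /M; lra.
have [C1 C10 hC1] := energy_gal M.
have [C C0 hC] := FF_stab (16 * M).
(* The first two summands bound the energy growth and the last two the stability constant;
   [T * q = 1 / 4] makes both small enough. *)
pose q := 2 * (C1 * M) + 1 + (C + 1).
have CM : 0 <= C1 * M by exact: mulr_ge0.
have q1 : 1 <= q by rewrite /q; lra.
pose T := (4 * q)^-1; have T0 : 0 < T by rewrite invr_gt0; lra.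
have T0' := ltW T0.
have Tq : T * q = 1 / 4 by rewrite /T; field; rewrite gt_eqF//; lra.
have Tle x : x <= q -> T * x <= 1 / 4 by move=> xq; rewrite -Tq; exact: ler_wpM2l.
have T1 : T <= 1 / 4 by rewrite -[T]mulr1; exact: Tle.
have T1' : T <= 1 by lra.
have T2 : T ^+ 2 <= 1 := exprn_ile1 _ T0' T1'.
have hT : 2 * T * (C + 1 / 2) <= 1 / 2.
 have : T * (C + 1 / 2) <= 1 / 4 by apply: Tle; rewrite /q; clear -CM; lra.
 clear -C10; lra.
have hM : EW H0 + T * (2 * (C1 * M) + 1) <= M.
 have : T * (2 * (C1 * M) + 1) <= 1 / 4 by apply: Tle; rewrite /q; clear -C0; lra.
 rewrite /M; clear; lra.
have hC1' r H : gal r H -> EW H <= M -> \int[mu]_k (Wt s k * H k * FF H k) <= C1 * EW H.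
 by move=> g e; have [] := hC1 r H g e.
pose dl (n : nat) : R := n.+1%:R^-1.
have dl0 n : 0 < dl n by rewrite invr_gt0 ltr0n.
have /choice[f hf] : forall n : nat, exists w : (RM -> K -> R) * (RM -> K -> R) * (K -> R),
  approx M T (dl n) H0 w.1.1 w.1.2 w.2.
 move=> n; have [U [g [A h]]] := @approx_exists M C1 T M0 C10 T0 hC1' H0 (dl n) mH0 iH0 hM (dl0 n).
 by exists (U, g, A).
pose U n := (f n).1.1; pose g n := (f n).1.2; pose A n := (f n).2.
pose P := pm (tm T) mu.
have LU n : L2 P (fun z => U n z.1 z.2) by have [[]] := hf n.
have Lg n : L2 P (fun z => g n z.1 z.2) by have [[]] := hf n.
have LA n : L2 mu (A n) by have [[]] := hf n.
have dA n : \int[mu]_k ((A n k - H0 k) ^+ 2) <= dl n by have [[]] := hf n.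
have EU n : Ebound T M (U n) by have [_ []] := hf n.
have eU n : {ae P, forall z, U n z.1 z.2 = A n z.2 + cum T (g n ^~ z.2) z.1} by have [_ []] := hf n.
pose rho n (t : RM) (k : K) := g n t k - FF (U n t) k.
have Lr n : L2 P (fun z => rho n z.1 z.2) by have [_ []] := hf n.
have dr n : \int[P]_z (rho n z.1 z.2 ^+ 2) <= dl n by have [_ []] := hf n.
have [aH0 _] := EW_adm mH0 iH0; have LH0 := adm0_L2 aH0.
have LAH n : L2 mu (fun k => A n k - H0 k) := L2B (LA n) LH0.
have aU n : {ae tm T, forall t, adm (U n t) /\ N8 (U n t) <= 16 * M} by apply: Ebound_adm (EU n); exact: (proj1 (LU n)).
have t0 : {ae tm T, forall t : RM, True} by exact: aeW.
have seck (F : RM -> K -> R) : L2 P (fun z => F z.1 z.2) -> {ae P, forall z, intg (tm T) (F ^~ z.2)}.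
 by move=> LF; apply: ae1 (ae_prod t0 (L2_seck LF)) _ => z [_ hz]; exact: tm_L1.
have cauchy n m : \int[P]_z ((U n z.1 z.2 - U m z.1 z.2) ^+ 2) <= 2 * (dl n + dl m).
 have LAA : L2 mu (fun k => A n k - A m k) := L2B (LA n) (LA m).
 have eD : {ae P, forall z, U n z.1 z.2 - U m z.1 z.2 = (A n z.2 - A m z.2) + cum T (fun t => g n t z.2 - g m t z.2) z.1}.
  apply: ae2 (ae2 (eU n) (eU m) (fun _ a b => conj a b)) (ae2 (seck _ (Lg n)) (seck _ (Lg m)) (fun _ a b => conj a b)) _.
  by move=> z [-> ->] [i1 i2]; rewrite cumB//; ring.
 have aa : {ae tm T, forall t, [/\ adm (U n t), adm (U m t) & N8 (U n t) <= 16 * M]}.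
  by apply: ae2 (aU n) (aU m) _ => t [h1 h2] [h3 _].
 have := @stab_time T T0' (16 * M) C (U n) (U m) (g n) (g m) (fun k => A n k - A m k)
  hC C0 hT (LU n) (LU m) (Lg n) (Lg m) LAA (L2B (Lr n) (Lr m)) aa eD.
 move=> h; apply: le_trans h _.
 have h1 : \int[mu]_k ((A n k - A m k) ^+ 2) <= 2 * dl n + 2 * dl m.
  have -> : \int[mu]_k ((A n k - A m k) ^+ 2) = \int[mu]_k ((A n k - H0 k - (A m k - H0 k)) ^+ 2).
   by apply: eq_Rint => k; congr (_ ^+ 2); ring.
  by apply: le_trans (L2B_le (LAH n) (LAH m)) _; apply: lerD; rewrite ler_pM2l.
 have h2 : \int[P]_z ((rho n z.1 z.2 - rho m z.1 z.2) ^+ 2) <= 2 * dl n + 2 * dl m.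
  by apply: le_trans (L2B_le (Lr n) (Lr m)) _; apply: lerD; rewrite ler_pM2l.
 exact: cauchy_arith T0' T1 (ltW (dl0 n)) (ltW (dl0 m)) h1 h2.
have dl_small e : 0 < e -> exists N : nat, forall n, (N <= n)%N -> dl n <= e.
 move=> e0; exists (Num.truncn (e^-1)) => n Nn; rewrite /dl -[e]invrK lef_pV2 ?posrE ?invr_gt0 ?ltr0n//.
 by apply: ltW; apply: lt_le_trans (truncnS_gt _) _; rewrite ler_nat ltnS.
have hcauchy e : 0 < e -> exists N, forall n m, (N <= n)%N -> (N <= m)%N ->
  \int[P]_z ((U n z.1 z.2 - U m z.1 z.2) ^+ 2) <= e.
 move=> e0; have e4 : 0 < e / 4 by apply: divr_gt0.
 have [N hN] := dl_small _ e4; exists N => n m hn hm; apply: le_trans (cauchy n m) _.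
 exact: quarter_le (hN n hn) (hN m hm).
have [H' [phi hphi [mH' cv idH dH]]] := @L2_complete _ _ R P (fun n z => U n z.1 z.2)
 (fun n => proj1 (LU n)) (fun n m => proj2 (L2B (LU n) (LU m))) hcauchy.
pose H (t : RM) (k : K) := H' (t, k).
have HE : (fun z => H z.1 z.2) = H' by apply/funext => -[].
have mH : traj H by rewrite /traj HE.
have LD n : L2 P (fun z => U n z.1 z.2 - H z.1 z.2).
 have e : (fun z : RM * K => U n z.1 z.2 - H z.1 z.2) = (fun z => U n z.1 z.2 - H' z) by apply/funext => -[].
 by rewrite e; split; [apply: mfunB => //; exact: (proj1 (LU n))|exact: idH].
have LH : L2 P (fun z => H z.1 z.2).
 have e : (fun z : RM * K => H z.1 z.2) = (fun z => U 0 z.1 z.2 - (U 0 z.1 z.2 - H z.1 z.2)).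
  by apply/funext => z; ring.
 by rewrite e; exact: L2B.
(* Fatou at almost every time, along the subsequence that converges almost everywhere on the
   slab. *)
have EH : Ebound T M H.
 apply: ae2 (ae_foralln EU) (ae_sec1 cv) _ => t ht hcv.
 apply: (@fatou_bound _ _ R mu (fun n k => Wt s k * U (phi n) t k ^+ 2)).
 - by move=> n; have [] := ht (phi n).
 - by apply: mfunM; [exact: mf_Wt|apply: mfunX; exact: (traj_t t mH)].
 - by move=> n k; apply: mulr_ge0; [exact: Wt_ge0|exact: sqr_ge0].
 - by move=> k; apply: mulr_ge0; [exact: Wt_ge0|exact: sqr_ge0].
 - by apply: ae1 hcv _ => k hk; apply: cvgM; [exact: cvg_cst|exact: cvg_sq hk].
 - by move=> n; have [] := ht (phi n).
exists T, M, C, H; split=> //; split=> //.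
have [Cl Cl0 hl] := FF_low (16 * M).
have aH := Ebound_adm mH EH.
have LFU n : L2 P (fun z => FF (U n z.1) z.2) by apply: FF_slab T0' (proj1 (LU n)) (aU n).
have LFH : L2 P (fun z => FF (H z.1) z.2) by exact: FF_slab T0' mH aH.
(* [FF] is controlled only after this division, so the defect [X] of the limit equation is shown to
   vanish when multiplied by [w], which is positive. *)
pose w (k : K) : R := (jap k ^+ 2)^-1.
have w0 k : 0 <= w k := jap_inv2 k.
have w1 k : w k <= 1.
 by rewrite /w invf_le1 ?exprn_gt0 ?jap_gt0// exprn_ege1// jap_ge1.
have mw : mfun w by mtac.
pose Y n (t : RM) (k : K) := w k * (FF (U n t) k - FF (H t) k).
have LY n : L2 P (fun z => Y n z.1 z.2) /\ \int[P]_z (Y n z.1 z.2 ^+ 2) <= Cl * \int[P]_z ((U n z.1 z.2 - H z.1 z.2) ^+ 2).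
 have [mB iB] := L2B (LFU n) (LFH).
 have mY : mfun (fun z : RM * K => Y n z.1 z.2).
  exact: (mfunM (mfcomp mw mfun_snd) mB).
 have iY : intg P (fun z => Y n z.1 z.2 ^+ 2).
  apply: le_intg (mfunX 2 mY) _ iB => z; rewrite ger0_norm ?sqr_ge0// /Y exprMn.
  by apply: ler_piMl; [exact: sqr_ge0|apply: exprn_ile1].
 split=> //; have [_ iD] := LD n; rewrite -(Rfubini1 iY) -(Rfubini1 iD) -RintZ; last exact: (intg_Rint1 iD).
 apply: ae_le_Rint; [exact: (intg_Rint1 iY)|by apply: intgZ; exact: (intg_Rint1 iD)|].
 by apply: ae2 (aU n) aH _ => t [a1 n1] [a2 n2]; have [] := hl _ _ a1 a2 n1 n2.
pose X (t : RM) (k : K) := H t k - H0 k - cum T (fun t => FF (H t) k) t.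
have [LcF _] := @cum_slab T T0' (fun t k => FF (H t) k) LFH.
have L2lift (V : K -> R) : L2 mu V -> L2 P (fun z => V z.2) /\ \int[P]_z (V z.2 ^+ 2) = T * \int[mu]_k (V k ^+ 2).
 move=> LV; have [m1 i1] := @L2_tensor T T0 (fun=> 1) 1 V (mfun_cst _) (fun=> eq_ler (normr1 _)) LV.
 have e : (fun z : RM * K => 1 * V z.2) = (fun z => V z.2) by apply/funext => z; rewrite mul1r.
 rewrite e in m1; have i2 : intg P (fun z => V z.2 ^+ 2) by apply: eq_intg i1 => z; rewrite mul1r.
 split=> //; rewrite -(Rfubini1 i2) /=; have [_] := tm_cst T0' (\int[mu]_k (V k ^+ 2)); exact.
have LX : L2 P (fun z => X z.1 z.2) by apply: L2B LcF; apply: L2B => //; have [] := L2lift _ LH0.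
have [mX iX] := LX.
have mwX : mfun (fun z : RM * K => w z.2 * X z.1 z.2).
 by mtac.
have iwX : intg P (fun z => (w z.2 * X z.1 z.2) ^+ 2).
 apply: le_intg (mfunX 2 mwX) _ iX => z; rewrite ger0_norm ?sqr_ge0// exprMn.
 by apply: ler_piMl; [exact: sqr_ge0|apply: exprn_ile1].
have bX n : \int[P]_z ((w z.2 * X z.1 z.2) ^+ 2) <= (4 + 4 * Cl) * \int[P]_z ((U n z.1 z.2 - H z.1 z.2) ^+ 2) + 8 * dl n.
 have [_ iD] := LD n; have [[_ iA] eA] := L2lift _ (LAH n).
 have [[_ ir] Ir] := cum_slab T0' (Lr n); have [LYn IYn] := LY n; have [[_ iY] IY] := cum_slab T0' LYn.
 have iq := intgD (intgD (intgD (intgZ 4 iD) (intgZ 4 iA)) (intgZ 4 ir)) (intgZ 4 iY).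
 have bd : {ae P, forall z, (w z.2 * X z.1 z.2) ^+ 2 <= 4 * (U n z.1 z.2 - H z.1 z.2) ^+ 2 + 4 * (A n z.2 - H0 z.2) ^+ 2
   + 4 * cum T (rho n ^~ z.2) z.1 ^+ 2 + 4 * cum T (Y n ^~ z.2) z.1 ^+ 2}.
  apply: ae2 (ae2 (eU n) (seck _ (Lg n)) (fun _ a b => conj a b)) (ae2 (seck (fun t k => FF (U n t) k) (LFU n)) (seck (fun t k => FF (H t) k) LFH) (fun _ a b => conj a b)) _.
  move=> z [e i1] [i2 i3].
  rewrite /Y cumZ; last exact: intgB.
  rewrite cumB// /rho cumB//.
  (* Four errors: distance of the approximation to the limit, the datum, the integrated residual,
     and the difference of the right-hand sides. *)
  have -> : w z.2 * X z.1 z.2 = w z.2 * (- (U n z.1 z.2 - H z.1 z.2)) + w z.2 * (A n z.2 - H0 z.2) +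
    w z.2 * (cum T (g n ^~ z.2) z.1 - cum T (fun a => FF (U n a) z.2) z.1) +
    w z.2 * (cum T (fun a => FF (U n a) z.2) z.1 - cum T (fun a => FF (H a) z.2) z.1).
   by rewrite e /X; clear; ring.
  apply: le_trans (sq4 _ _ _ _) _.
  have ww x : (w z.2 * x) ^+ 2 <= x ^+ 2.
   by rewrite exprMn; apply: ler_piMl; [exact: sqr_ge0|apply: exprn_ile1].
  apply: lerD; [apply: lerD; [apply: lerD|]|exact: lexx]; rewrite ler_pM2l//.
  by rewrite -(sqrrN (U n z.1 z.2 - _)).
 apply: le_trans (ae_le_Rint iwX iq bd) _.
 rewrite RintD; [|by apply: intgD; [apply: intgD|]; exact: intgZ|exact: intgZ].
 rewrite RintD; [|by apply: intgD; exact: intgZ|exact: intgZ].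
 rewrite RintD; [|exact: intgZ|exact: intgZ].
 rewrite (RintZ _ iD) (RintZ _ iA) (RintZ _ ir) (RintZ _ iY) eA.
 have a0 : 0 <= \int[mu]_k ((A n k - H0 k) ^+ 2) by apply: Rint_ge0 => k; exact: sqr_ge0.
 have d0 : 0 <= \int[P]_z ((U n z.1 z.2 - H z.1 z.2) ^+ 2) by apply: Rint_ge0 => k; exact: sqr_ge0.
 have r0 : 0 <= \int[P]_z (rho n z.1 z.2 ^+ 2) by apply: Rint_ge0 => k; exact: sqr_ge0.
 have y0 : 0 <= \int[P]_z (Y n z.1 z.2 ^+ 2) by apply: Rint_ge0 => k; exact: sqr_ge0.
 have h1 : T * \int[mu]_k ((A n k - H0 k) ^+ 2) <= dl n.
  by apply: le_trans (dA n); exact: ler_piMl.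
 have h2 : T ^+ 2 * \int[P]_z (rho n z.1 z.2 ^+ 2) <= dl n.
  by apply: le_trans (dr n); exact: ler_piMl.
 have h3 : T ^+ 2 * \int[P]_z (Y n z.1 z.2 ^+ 2) <= Cl * \int[P]_z ((U n z.1 z.2 - H z.1 z.2) ^+ 2).
  by apply: le_trans IYn; exact: ler_piMl.
 exact: four_terms h1 (le_trans Ir h2) (le_trans IY h3).
have X0 : \int[P]_z ((w z.2 * X z.1 z.2) ^+ 2) = 0.
 apply: (@small_eq0 _ (4 + 4 * Cl + 8)); [by apply: Rint_ge0 => z; exact: sqr_ge0|by rewrite !addr_ge0// mulr_ge0|].
 move=> e e0; have [N1 hN1] := dH e e0; have [N2 hN2] := dl_small e e0.
 apply: le_trans (bX (maxn N1 N2)) _; rewrite [leRHS]mulrDl; apply: lerD.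
  apply: ler_wpM2l; first by rewrite !addr_ge0// mulr_ge0.
  apply: le_trans (hN1 _ (leq_maxl _ _)); apply: eq_ler; apply: eq_Rint => z; by case: z.
 by rewrite ler_pM2l//; exact: hN2 (leq_maxr _ _).
apply: ae1 (Rint_eq0 iwX (fun z => sqr_ge0 _) X0) _ => z /eqP.
rewrite sqrf_eq0 mulf_eq0 invr_eq0 expf_eq0 /= gt_eqF ?jap_gt0//= subr_eq0 subr_eq => /eqP ->.
by rewrite addrC.
Qed.

(** * Reading the frequency equation back as fields on the domain *)

Section Fields.

Implicit Types (F G H : K -> R) (x a b k : K).

Definition LL H := intg mu H /\ L2 mu H.

Lemma LL_le F G c : mfun G -> (forall k, `|G k| <= c * `|F k|) -> LL F -> LL G.
Proof.
move=> mG b [iF [mF iF2]]; split.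
 by apply: le_intg mG b _; apply: intgZ; exact: intg_norm.
split=> //; apply: le_intg (mfunX 2 mG) _ (intgZ (c ^+ 2) iF2) => k.
by rewrite normrX -[F k ^+ 2]real_normK ?num_real// -exprMn; apply: lerXn2r; rewrite ?nnegrE//; exact: le_trans (b k).
Qed.

Lemma LL_neg H : LL H -> LL (fun k => H (negK k)).
Proof. by move=> [h1 h2]; split; [exact: neg_int|exact: neg_L2]. Qed.

Lemma adm_norm H : adm H -> adm (fun k => `|H k|) /\ N8 (fun k => `|H k|) = N8 H.
Proof.
move=> [mH iH]; have e k : jap k ^+ 8 * `|H k| ^+ 2 = jap k ^+ 8 * H k ^+ 2 by rewrite real_normK ?num_real.
split; last by apply: eq_Rint => k; rewrite e.
by split; [exact: mfcomp|apply: eq_intg iH => k; rewrite e].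
Qed.

Lemma adm_LL H : adm H -> LL (fun k => jap k ^+ 2 * H k).
Proof.
move=> hH; have [L _] := @adm_L2 H 2 isT hH.
have [i1 _] := @adm_L1 _ 2 isT (proj1 (adm_norm hH)) (fun k => normr_ge0 _).
split=> //; apply: le_intg (proj1 L) _ i1 => k.
by rewrite normrM (ger0_norm (japX_ge0 k 2)).
Qed.

(** The Hartley transform of a directional derivative. Differentiating [cas] reverses its argument,
    hence the value at the reflected frequency and the sign. *)
Definition dd (e : R * R) H k : R := - (dot e k * H (negK k)).
Definition unitv (e : R * R) := forall k : K, `|dot e k| <= jap k.

Lemma unit_e1 : unitv (@e1 R).
Proof.
move=> k; rewrite /dot /= mul1r mul0r addr0; apply: le_trans (norm2_jap k).
apply: le_sq; first exact: norm2_ge0.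
by rewrite real_normK ?num_real// norm2_sq lerDl sqr_ge0.
Qed.

Lemma unit_e2 : unitv (@e2 R).
Proof.
move=> k; rewrite /dot /= mul1r mul0r add0r; apply: le_trans (norm2_jap k).
apply: le_sq; first exact: norm2_ge0.
by rewrite real_normK ?num_real// norm2_sq lerDr sqr_ge0.
Qed.

Lemma mf_dote (e : R * R) : mfun (fun k : K => dot e k).
Proof.
by rewrite /dot; apply: mfunD; apply: mfunM.
Qed.

Lemma mf_dd e H : mfun H -> mfun (dd e H).
Proof.
move=> mH; apply: mfcomp; first exact: oppr_measurable.
by apply: mfunM; [exact: mf_dote|exact: mf_neg].
Qed.

Lemma jap_sq_ge (k : K) : jap k <= jap k ^+ 2.
Proof. by rewrite expr2 ler_peMl ?jap_ge1//; apply: ltW; exact: jap_gt0. Qed.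
Lemma jap2_ge1 (k : K) : 1 <= jap k ^+ 2.
Proof. by apply: exprn_ege1; exact: jap_ge1. Qed.
Definition LwH H k : R := Lw k * H k.
Lemma mf_LwH H : mfun H -> mfun (LwH H).
Proof. by move=> mH; apply: mfunM => //; exact: mf_Lw. Qed.

Lemma LwH_le H k : `|LwH H k| <= 9 * (jap k * `|H k|).
Proof.
rewrite normrM (ger0_norm (ltW (Lw_gt0 k))) mulrA; apply: ler_wpM2r => //; exact: Lw_le.
Qed.

Lemma dd_le e H k : unitv e -> `|dd e H k| <= jap k * `|H (negK k)|.
Proof. by move=> ue; rewrite normrN normrM; apply: ler_wpM2r. Qed.

Lemma LL_jap H F c : adm H -> mfun F -> 0 <= c -> (forall k, `|F k| <= c * (jap k ^+ 2 * `|H k|)) -> LL F.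
Proof.
move=> hH mF c0 b; apply: LL_le mF _ (adm_LL hH) => k; apply: le_trans (b k) _; apply: ler_wpM2l => //.
by rewrite normrM (ger0_norm (japX_ge0 k 2)).
Qed.

Lemma LL_japn H F c : adm H -> mfun F -> 0 <= c -> (forall k, `|F k| <= c * (jap k ^+ 2 * `|H (negK k)|)) -> LL F.
Proof.
move=> hH mF c0 b; apply: LL_le mF _ (LL_neg (adm_LL hH)) => k; apply: le_trans (b k) _; apply: ler_wpM2l => //.
by rewrite normrM (ger0_norm (japX_ge0 _ 2)) jap_neg.
Qed.

Lemma adm_LL0 H : adm H -> LL H.
Proof.
move=> hH; apply: (@LL_jap H H 1 hH (proj1 hH)) => // k; rewrite mul1r ler_peMl//; exact: jap2_ge1.
Qed.

Lemma adm_LLw H : adm H -> LL (LwH H).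
Proof.
move=> hH; apply: (@LL_jap H _ 9 hH (mf_LwH (proj1 hH))) => // k.
apply: le_trans (LwH_le H k) _; rewrite ler_pM2l//; apply: ler_wpM2r => //; exact: jap_sq_ge.
Qed.

Lemma adm_LLd e H : unitv e -> adm H -> LL (dd e H).
Proof.
move=> ue hH; apply: (@LL_japn H _ 1 hH (mf_dd e (proj1 hH))) => // k.
rewrite mul1r; apply: le_trans (dd_le H k ue) _; apply: ler_wpM2r => //; exact: jap_sq_ge.
Qed.

Lemma adm_LLdw e H : unitv e -> adm H -> LL (dd e (LwH H)).
Proof.
move=> ue hH; apply: (@LL_japn H _ 9 hH (mf_dd e (mf_LwH (proj1 hH)))) => // k.
apply: le_trans (dd_le _ k ue) _; have := LwH_le H (negK k); rewrite jap_neg => h.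
have -> : 9 * (jap k ^+ 2 * `|H (negK k)|) = jap k * (9 * (jap k * `|H (negK k)|)) by ring.
by apply: ler_wpM2l => //; apply: ltW; exact: jap_gt0.
Qed.

Lemma adm_LLm H : adm H -> LL (fun k => mB beta k * H k).
Proof.
move=> hH; apply: (@LL_jap H _ cB hH) => //.
- by apply: mfunM; [exact: mf_mB|exact: (proj1 hH)].
- exact: cB_ge0.
- move=> k; rewrite normrM ger0_norm ?mB_ge0// mulrA; apply: ler_wpM2r => //.
 by apply: le_trans (mB_le b1 k) _; apply: ler_wpM2l; [exact: cB_ge0|exact: jap_sq_ge].
Qed.

Lemma adm_LLN H : adm H -> LL (NN H H).
Proof. by move=> hH; split; [have [] := NN_L1 hH hH|exact: NN_L2]. Qed.
Lemma LL_inv H : LL H -> isH (inv H) H.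
Proof. by move=> [h1 h2]; exact: isH_inv. Qed.

Lemma isH_multiplier (m : R -> R) f h H : isH f H -> isH h (fun k => m (norm2 k) * H k) -> is_multiplier Omega m f h.
Proof.
move=> hf hh; exists (herm H); first exact: isH_fourier.
have := isH_fourier hh; congr (is_fourier _ _ _); apply/funext => k.
by apply/eqP; rewrite /herm norm2_neg eq_complex /=; apply/andP; split; apply/eqP; ring.
Qed.

Lemma sqnorm_herm0 H k : sqnormC (herm H k) = (H k ^+ 2 + H (negK k) ^+ 2) / 2.
Proof. by rewrite /sqnormC /herm /=; field. Qed.

Lemma wnorm_dual g H : mfun (fun k => complex.Re (g k)) -> mfun (fun k => complex.Im (g k)) ->
 mfun H -> {ae mu, forall k, g k = herm H k} ->
 dual_int Omega (fun k => (((1 + norm2 k ^+ 2) `^ s) * sqnormC (g k))%:E) =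
 (\int[mu]_k ((Wt s k * H k ^+ 2 + Wt s (negK k) * H (negK k) ^+ 2) / 2)%:E)%E.
Proof.
move=> mR mI mH ae_.
have e1 : (fun k : K => (((1 + norm2 k ^+ 2) `^ s) * sqnormC (g k))%:E) = (fun k => (Wt s k * sqnormC (g k))%:E).
 by apply/funext => k; rewrite norm2_J.
have mq : mfun (fun k => Wt s k * sqnormC (g k)).
 by apply: mfunM; [exact: mf_Wt|apply: mfunD; exact: mfunX].
rewrite e1 dual_intE; [|exact/EFinP|].
 apply: ae_eq_int => //.
  have mWH : mfun (fun k => Wt s k * H k ^+ 2).
   by mtac.
  by mtac.
 by apply: ae1 ae_ _ => k ->; rewrite sqnorm_herm0 Wt_neg; ring.
by move=> k; rewrite lee_fin mulr_ge0 ?Wt_ge0// addr_ge0 ?sqr_ge0.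
Qed.

Lemma Hs_inv f H : isH f H -> intg mu (fun k => Wt s k * H k ^+ 2) -> Hs_sqnorm_le Omega s f (EW H).
Proof.
move=> hf iH; exists (herm H); first exact: isH_fourier.
have [_ [mH _] _] := hf; have [mR mI] := mf_hermR mH.
rewrite (wnorm_dual mR mI mH (aeW _ (fun=> erefl _))).
by have [i2 e2] := intg_refl2 iH; rewrite /EW -e2 RintE.
Qed.

Lemma Hs_elim f M : Hs_sqnorm_le Omega s f M -> exists H, [/\ isH f H, intg mu (fun k => Wt s k * H k ^+ 2) & EW H <= M].
Proof.
move=> [g hg]; have [h1 h2] := fourier_isH hg; have [_ mR mI _] := hg; have [_ [mH _] _] := h1.
rewrite (wnorm_dual mR mI mH h2) => le; exists (hreal g).
have W0 k : 0 <= Wt s k * hreal g k ^+ 2 by rewrite mulr_ge0 ?Wt_ge0 ?sqr_ge0.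
have mWH : mfun (fun k => Wt s k * hreal g k ^+ 2).
 by apply: mfunM; [exact: mf_Wt|exact: mfunX].
have i2 : intg mu (fun k => (Wt s k * hreal g k ^+ 2 + Wt s (negK k) * hreal g (negK k) ^+ 2) / 2).
 apply: ge0_intg; last by apply: le_lt_trans le _; rewrite ltry.
  by apply: mfunM => //; apply: mfunD => //; exact: (mfcomp mWH (@mf_nK)).
 by move=> k; rewrite divr_ge0// addr_ge0.
have i1 : intg mu (fun k => Wt s k * hreal g k ^+ 2).
 apply: le_intg mWH _ (intgZ 2 i2) => k; rewrite ger0_norm// [leRHS]mulrCA divff ?pnatr_eq0// mulr1 lerDl//.
split=> //; have [_ e2] := intg_refl2 i1.
by rewrite /EW -e2 -lee_fin -RintE.
Qed.

Lemma inv_prod F G x : intg mu F -> intg mu G ->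
 intg M2 (fun z => F z.1 * cas (dot x z.1) * (G z.2 * cas (dot x z.2))) /\
 inv F x * inv G x = @cF ^+ 2 * \int[M2]_z (F z.1 * cas (dot x z.1) * (G z.2 * cas (dot x z.2))).
Proof.
move=> iF iG.
have i1 H : intg mu H -> intg mu (fun k => H k * cas (dot x k)).
 by move=> iH; exact: (intg_bdd (mf_casr x) (fun k => norm_cas _) iH).
have i12 := intgM12 (i1 _ iF) (i1 _ iG); split=> //.
rewrite /inv /TK /hartley -(Rfubini1 i12) /=.
have e H : \int[mu]_k (H k * cas (dot k x)) = \int[mu]_k (H k * cas (dot x k)).
 by apply: eq_Rint => k; rewrite dotC.
rewrite !e; under [in RHS]eq_Rint => a do rewrite (RintZ _ (i1 _ iG)).
have -> : \int[mu]_a (F a * cas (dot x a) * \int[mu]_k (G k * cas (dot x k))) = (\int[mu]_a (F a * cas (dot x a))) * \int[mu]_k (G k * cas (dot x k)).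
 by rewrite mulrC -(RintZ _ (i1 _ iF)); apply: eq_Rint => a; rewrite mulrC.
by rewrite expr2; ring.
Qed.

Lemma dot_neg x k : dot x (negK k) = - dot x k.
Proof. by rewrite /dot /negK /=; ring. Qed.

Lemma casNN (A B : R) : cas (- A) * cas (- B) = cos (A - B) - sin (A + B).
Proof.
rewrite casM (_ : - A - - B = - (A - B)); last by ring.
by rewrite (_ : - A + - B = - (A + B)) ?cosN ?sinN//; ring.
Qed.

Lemma cas4 (M A B : R) : M * (sin (A + B) - cos (A - B)) =
 2^-1 * (M * cas (A + B) - M * cas (- A + B) - M * cas (A - B) - M * cas (- A - B)).
Proof.
rewrite (_ : - A + B = - (A - B)); last by ring.
rewrite (_ : - A - B = - (A + B)); last by ring.
rewrite /cas !cosN !sinN; move: (sin _) (cos _) (sin _) (cos _) => a b c d; by field.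
Qed.

(** A product of two inversion integrals is a double frequency integral. The product formula of
    [cas] gives functions of the sum and of the difference of the phases; sign flips bring them all
    to the sum, and the change [conv2] makes it a convolution. *)
Lemma nonlinear_inv H x : adm H ->
 inv (dd (@e2 R) (LwH H)) x * inv (dd (@e1 R) H) x - inv (dd (@e1 R) (LwH H)) x * inv (dd (@e2 R) H) x = inv (NN H H) x.
Proof.
move=> hH; have [mH _] := hH.
have [iA _] := adm_LLdw unit_e2 hH; have [iB _] := adm_LLd unit_e1 hH.
have [iC _] := adm_LLdw unit_e1 hH; have [iD _] := adm_LLd unit_e2 hH.
have [i1 ->] := inv_prod x iA iB; have [i2 ->] := inv_prod x iC iD.
rewrite -mulrBr -RintB//.
pose m (z : K * K) := Lw z.1 * cr z.1 z.2 * (H z.1 * H z.2).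
have jH : intg mu (fun k => jap k ^+ 2 * H k) by have [] := adm_LL hH.
have mm : mfun m.
 apply: mfunM; last by apply: mfunM; [exact: mf_at1|exact: mf_at2].
 by mtac.
have im : intg M2 m.
 apply: le_intg mm _ (intgZ 9 (intgM12 (intg_norm jH) (intg_norm jH))) => z.
 have nj (a : K) : `|jap a ^+ 2 * H a| = jap a ^+ 2 * `|H a| by rewrite normrM (ger0_norm (japX_ge0 a 2)).
 rewrite !nj /m normrM (normrM (H z.1)).
 have -> : 9 * (jap z.1 ^+ 2 * `|H z.1| * (jap z.2 ^+ 2 * `|H z.2|)) = 9 * (jap z.1 ^+ 2 * jap z.2 ^+ 2) * (`|H z.1| * `|H z.2|) by ring.
 apply: ler_wpM2r; first exact: mulr_ge0.
 apply: le_trans (sym_bd3 z.1 z.2) _.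
 by rewrite ler_pM2l//; apply: ler_wpM2l; [exact: japX_ge0|exact: jap_sq_ge].
have mdot : mfun (fun k : K => dot x k) := mf_dote x.
have md1 : mfun (fun z : K * K => dot x z.1) by mtac.
have md2 : mfun (fun z : K * K => dot x z.2) by mtac.
have icas (u v : R) : intg M2 (fun z => m z * cas (u * dot x z.1 + v * dot x z.2)).
 apply: (intg_bdd _ (fun z => norm_cas _) im).
 exact: (mfcomp (@mf_cas R) (mfunD (mfunM (mfun_cst u) md1) (mfunM (mfun_cst v) md2))).
have -> : \int[M2]_z (dd (@e2 R) (LwH H) z.1 * cas (dot x z.1) * (dd (@e1 R) H z.2 * cas (dot x z.2)) -
  dd (@e1 R) (LwH H) z.1 * cas (dot x z.1) * (dd (@e2 R) H z.2 * cas (dot x z.2))) =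
 \int[M2]_z (m z * (sin (dot x z.1 + dot x z.2) - cos (dot x z.1 - dot x z.2))).
 have mS := intg_mf (intgB i1 i2).
 (* Reversing both frequencies undoes the reflection hidden in [dd]. *)
 rewrite -(pres_Rint (pres_neg2) mS); apply: eq_Rint => z.
 rewrite /neg2 /= /dd /LwH !negKK !dot_neg /m /cr.
 have c1 : cas (- dot x z.1) * cas (- dot x z.2) = cos (dot x z.1 - dot x z.2) - sin (dot x z.1 + dot x z.2).
  exact: casNN.
 transitivity ((Lw z.1 * (z.1.2 * z.2.1 - z.1.1 * z.2.2) * (H z.1 * H z.2)) * (cas (- dot x z.1) * cas (- dot x z.2))).
  by clear; rewrite /dot /=; ring.
 by rewrite c1; clear; ring.
(* The four sign combinations in [Qb] match the four terms of [cas4] after flipping the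
   corresponding frequencies. *)
pose q (z : K * K) := Lw z.1 * cr z.1 z.2 * Qb H H z.1 z.2 * cas (dot x z.1 + dot x z.2).
have mq : mfun q.
 apply: mfunM; last by apply: (mfcomp (@mf_cas R)); exact: mfunD.
 apply: mfunM; first by apply: mfunM; [exact: (mf_at1 (@mf_Lw))|exact: mf_cr].
 have mn := mf_neg mH.
 have a1 := mf_at1 mH; have a2 := mf_at2 mH; have n1 := mf_at1 mn; have n2 := mf_at2 mn.
 apply: mfunM => //; apply: mfunB; last exact: mfunM.
 by mtac.
pose nk1 (z : K * K) : K * K := (negK z.1, z.2).
have pnk1 : pres M2 nk1 := pres_prod (pres_neg) (pres_id mu).
have pnk2 : pres M2 (@nk) := @pres_nk.
have pnn : pres M2 (@neg2) := pres_neg2.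
pose r1 z := m z * cas (1 * dot x z.1 + 1 * dot x z.2).
pose r2 z := m z * cas ((-1) * dot x z.1 + 1 * dot x z.2).
pose r3 z := m z * cas (1 * dot x z.1 + (-1) * dot x z.2).
pose r4 z := m z * cas ((-1) * dot x z.1 + (-1) * dot x z.2).
have j1 : intg M2 r1 := icas _ _. have j2 : intg M2 r2 := icas _ _.
have j3 : intg M2 r3 := icas _ _. have j4 : intg M2 r4 := icas _ _.
have k2 := pres_intg pnk1 j2; have k3 := pres_intg pnk2 j3; have k4 := pres_intg pnn j4.
have qE z : q z = 2^-1 * (r1 z - r2 (nk1 z) - r3 (nk z) - r4 (neg2 z)).
 rewrite /q /r1 /r2 /r3 /r4 /m /nk1 /nk /neg2 /= !dot_neg !mulN1r !mul1r !opprK Lw_neg /Qb /cr /=.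
 by clear; ring.
have ir : intg M2 (fun z => r1 z - r2 (nk1 z) - r3 (nk z) - r4 (neg2 z)).
 by apply: intgB => //; apply: intgB => //; exact: intgB.
have iq : intg M2 q by apply: eq_intg (intgZ 2^-1 ir) => z; rewrite qE.
have -> : \int[M2]_z (m z * (sin (dot x z.1 + dot x z.2) - cos (dot x z.1 - dot x z.2))) = \int[M2]_z q z.
 transitivity (\int[M2]_z (2^-1 * (r1 z - r2 z - r3 z - r4 z))).
  apply: eq_Rint => z; rewrite /r1 /r2 /r3 /r4 !mulN1r !mul1r.
  exact: cas4.
 rewrite (eq_Rint _ qE) (RintZ _ ir) (RintZ _ (intgB (intgB (intgB j1 j2) j3) j4)) (RintB4 j1 j2 j3 j4) (RintB4 j1 k2 k3 k4).
 by rewrite (pres_Rint pnk1 (intg_mf j2)) (pres_Rint pnk2 (intg_mf j3)) (pres_Rint pnn (intg_mf j4)).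
rewrite -(pres_Rint (pres_conv2) mq).
have [iN _] := nf_intg hH hH.
have ic := intg_bdd (mf_at2 (mf_casr x)) (fun z => norm_cas _) iN.
have -> : \int[M2]_z q (conv2 z) = \int[M2]_z (nf H H z.1 z.2 * cas (dot x z.2)).
 apply: eq_Rint => z; rewrite /q /conv2 /nf /=; congr (_ * _ * _ * cas _).
  by clear; rewrite /cr /=; ring.
 by clear; rewrite /dot /=; ring.
rewrite -(Rfubini2 ic) /inv /TK /hartley expr2 -mulrA; congr (_ * _).
have iN2 := intg_Rint2 ic; rewrite -(RintZ _ iN2); apply: ae_Rint.
- exact: intg_mf (intgZ _ iN2).
- by mtac.
apply: ae1 (ae_intg1 (intg_swap iN)) _ => k ik /=.
rewrite /NN dotC -mulrA; congr (_ * _).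
by rewrite mulrC -(RintZ _ ik); apply: eq_Rint => a; rewrite mulrC.
Qed.

Lemma measurable_inv d (X : measurableType d) (G : X -> K -> R) : mfun (fun z : X * K => G z.1 z.2) ->
 mfun (fun z : X * K => inv (G z.1) z.2).
Proof.
move=> mG; apply: mfunM; first exact: mfun_cst.
apply: (mf_Rint2 mu (fun (z : X * K) k => G z.1 k * cas (dot k z.2))).
apply: mfunM.
 have h : mfun (fun y : (X * K) * K => (y.1.1, y.2)) by mtac.
 exact: (mfcomp mG h).
have h : mfun (fun y : (X * K) * K => (y.2, y.1.2)) by mtac.
exact: (mfcomp (@mf_casdot R) h).
Qed.

Lemma inv_le H x : intg mu H -> `|inv H x| <= @cF * (2 * \int[mu]_k `|H k|).
Proof.
move=> iH; rewrite normrM (ger0_norm (ltW (@cF_gt0))); apply: ler_wpM2l; first exact/ltW/cF_gt0.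
exact: hartley_le.
Qed.

End Fields.

(** * Test functions: supports, measurability, integration by parts *)

Lemma derive_supp (V : normedModType R) (f c : V -> R) (A : R) (v x : V) : continuous c ->
 (forall y, f y != 0 -> c y <= A) -> 'D_v f x != 0 -> c x <= A.
Proof.
move=> cc h; apply: contraNT; rewrite -ltNge => Ac; apply/eqP.
(* Where [c] exceeds [A] it does so in a neighbourhood, on which [f] vanishes identically. *)
rewrite (@near_eq_derive R V R f (fun=> 0) x v); last first.
 have n1 : \forall y \near x, A < c y by apply: (@cvgr_gt R V (nbhs x) _ c (c x)); [exact: cc|].
 by apply: filterS n1 => y Ay; apply/eqP; apply: contraTT Ay => /h; rewrite -leNgt.
exact: derive_cst.
Qed.

(** A Caratheodory function: rounding the first variable down to multiples of [1 / (n + 1)] gives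
    countably many measurable pieces, and continuity gives the pointwise limit. *)
Lemma carath d (X : measurableType d) (f : RM -> X -> R) : (forall x, continuous (f ^~ x : R -> R)) ->
 (forall t, mfun (f t)) -> mfun (fun z : RM * X => f z.1 z.2).
Proof.
move=> cf mf.
pose p (n : nat) (t : R) : R := (Num.floor (n.+1%:R * t))%:~R / n.+1%:R.
apply: (@measurable_fun_cvg _ _ R setT (fun n (z : RM * X) => f (p n z.1) z.2)).
 move=> n _ B mB; rewrite setTI.
 have -> : (fun z : RM * X => f (p n z.1) z.2) @^-1` B =
  \bigcup_(j : int) ([set t : RM | Num.floor (n.+1%:R * t : R) = j] `*` (f (j%:~R / n.+1%:R) @^-1` B)).
  apply/seteqP; split=> [z Bz|z [j _ [/= <- h2]]]; last exact: h2.
  by exists (Num.floor (n.+1%:R * z.1 : R)).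
 apply: countable_bigcupT_measurable => // j; apply: measurableX.
  have -> : [set t : RM | Num.floor (n.+1%:R * t : R) = j] = (fun t : RM => n.+1%:R * t : R) @^-1` `[j%:~R, (j + 1)%:~R[%classic.
   apply/seteqP; split=> t /=; rewrite in_itv /=.
    by move=> <-; exact: floor_itv.
   by move=> h; apply: floor_def.
  rewrite -[X in measurable X]setTI; apply: (@mfunM _ _ R setT (fun=> n.+1%:R) (fun t : RM => t)) => //.
 by rewrite -[X in measurable X]setTI; exact: mf.
move=> z _.
have pc : p n z.1 @[n --> \oo] --> (z.1 : R).
 have lim0 : (n.+1%:R^-1 : R) @[n --> \oo] --> 0 by exact: cvg_harmonic.
 apply: (@squeeze_cvgr _ _ _ _ (fun n : nat => z.1 - n.+1%:R^-1) (fun=> z.1)).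
 - apply: nearW => n; have /andP[h1 h2] := floor_itv (n.+1%:R * z.1 : R).
  have n0 : 0 < n.+1%:R :> R by rewrite ltr0n.
  rewrite /p; apply/andP; split; last by rewrite ler_pdivrMr// [leRHS]mulrC.
  rewrite ler_pdivlMr// mulrBl mulVf ?gt_eqF// lerBlDr mulrC.
  by apply: ltW; rewrite -[1 : R]/(1%:~R) -intrD.
 - by rewrite -[X in _ --> X]subr0; apply: cvgB => //; exact: cvg_cst.
 - exact: cvg_cst.
exact: (cvg_comp _ _ pc (cf z.2 z.1)).
Qed.

Lemma cont_fst (U V : topologicalType) (f : U * V -> R) v : continuous f -> continuous (fun u => f (u, v)).
Proof. by move=> cf u; apply: (cvg_comp _ _ (cvg_pair (cvg_id) (cvg_cst v)) (cf (u, v))). Qed.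
Lemma cont_snd (U V : topologicalType) (f : U * V -> R) u : continuous f -> continuous (fun v => f (u, v)).
Proof. by move=> cf v; apply: (cvg_comp _ _ (cvg_pair (cvg_cst u) (cvg_id)) (cf (u, v))). Qed.

Lemma mf_cont2 (f : R * R -> R) : continuous f -> mfun (f : K -> R).
Proof.
move=> cf; have -> : (f : K -> R) = (fun z : RM * RM => f (z.1, z.2)) by apply/funext => -[].
apply: (@carath _ RM (fun a b => f (a, b))) => [x|t]; first exact: cont_fst.
by apply: cont_mfun; exact: cont_snd.
Qed.

Lemma mf_cont3 (f : R * (R * R) -> R) : continuous f -> mfun (f : RM * K -> R).
Proof.
move=> cf; have -> : (f : RM * K -> R) = (fun z : RM * K => f (z.1, z.2)) by apply/funext => -[].
apply: (@carath _ K (fun a b => f (a, b))) => [x|t]; first exact: (@cont_fst R (R * R)%type).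
by apply: mf_cont2; exact: cont_snd.
Qed.

Lemma bounded_on_compact (V : normedModType R) (f : V -> R) (C : set V) : continuous f -> compact C ->
 exists2 B, 0 <= B & forall x, C x -> `|f x| <= B.
Proof.
move=> cf cC; have h : compact (f @` C) by apply: continuous_compact => //; exact: continuous_subspaceT.
have [M [_ hM]] := compact_bounded h; exists (`|M| + 1) => // x Cx.
by apply: (hM (`|M| + 1)); [apply: le_lt_trans (ler_norm M) _; rewrite ltrDl|exists x].
Qed.

Lemma ae_rmeas d (X : measurableType d) (m : sfmeas X R) D (mD : measurable D) :
 {ae rmeas m mD, forall x, D x}.
Proof.
exists (~` D); split => //; first exact: measurableC.
by rewrite /= /rmeas /mrestr setICl measure0.
Qed.

Lemma Rint_rmeas d (X : measurableType d) (m : sfmeas X R) D (mD : measurable D) (f : X -> R) :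
 mfun f -> \int[rmeas m mD]_x f x = \int[m]_(x in D) f x.
Proof.
by move=> mf; rewrite /Rintegral integral_mrestr//; exact/EFinP.
Qed.

(** Periodicity on a circle and bounded support on a line both annihilate the boundary terms, so one
    rule covers every coordinate of every domain. *)
Lemma int_primitive (per : bool) (f F : R -> R) : (forall x, is_derive x (1 : R) F (f x)) -> continuous f ->
 (per -> F (2 * pi) = F 0) -> (~~ per -> exists A, forall x, F x != 0 -> `|x| <= A) ->
 \int[rmeas leb (meas_period per)]_x (f x) = 0.
Proof.
move=> dF cf h1 h2; rewrite Rint_rmeas; last exact: cont_mfun.
case: per h1 h2 => [/(_ isT) h1 _|_ /(_ isT)[A h2]].
 rewrite /period itv01 FTC//; first by rewrite h1 subrr.
 by rewrite mulr_ge0// pi_ge0.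
have fA x : f x != 0 -> `|x| <= A.
 have [_ <-] := dF x; apply: derive_supp => //; exact: norm_continuous.
pose B := `|A| + 1; have AB : A < B by apply: le_lt_trans (ler_norm A) _; rewrite ltrDl.
have B0 : 0 <= B by rewrite addr_ge0.
have Bn : `|- B| = B /\ `|B| = B by rewrite normrN ger0_norm.
have F0 x : `|x| = B -> F x = 0.
 by move=> e; apply/eqP; apply: contraTT AB => /h2; rewrite e -leNgt.
have -> : \int[leb]_(x in period false) f x = \int[leb]_(x in `[- B, B]) f x.
 rewrite [RHS]Rintegral_mkcond; apply: eq_Rintegral => x _; rewrite patchE.
 case: ifPn => // xB; apply/eqP; apply: contraNT xB => /fA hx.
 by rewrite inE /= in_itv /= -ler_norml; exact: le_trans (ltW AB).
by rewrite FTC ?F0 ?subrr//; [case: Bn|case: Bn|lra].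
Qed.

Lemma ae_cell : {ae nu, forall x, cell Omega x}.
Proof. exact: ae_prod (ae_rmeas _ _) (ae_rmeas _ _). Qed.

Lemma cell_box (A : R) (N : nat) (x : R * R) : cell Omega x -> bounded_coords Omega A x -> A <= N%:R -> 2 * pi <= N%:R :> R -> box N x.
Proof.
have aux per (y : R) : period per y -> (~~ per -> `|y| <= A) -> A <= N%:R -> 2 * pi <= N%:R :> R -> `|y| <= N%:R.
 case: per => /= [/andP[y0 yp] _ _ hN|_ /(_ isT) h hA _]; last exact: le_trans hA.
 by rewrite ger0_norm//; exact: le_trans hN.
by move=> [c1 c2] [d1 d2] hA hN; split; [exact: aux c1 d1 hA hN|exact: aux c2 d2 hA hN].
Qed.

Lemma box_nat (A : R) : exists N : nat, A <= N%:R /\ 2 * pi <= N%:R :> R.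
Proof.
exists (Num.truncn (`|A| + 2 * pi)).+1; have h := truncnS_gt (`|A| + 2 * pi : R).
have p0 : 0 <= 2 * pi :> R by rewrite mulr_ge0// pi_ge0.
have a0 := normr_ge0 A; have := ler_norm A; split; lra.
Qed.

Lemma box_compact (N : nat) : compact (box N : set (R * R)).
Proof.
have -> : box N = `[- N%:R, N%:R]%classic `*` `[- N%:R, N%:R]%classic :> set (R * R).
 by apply/seteqP; split=> x [h1 h2]; split; move: h1 h2; rewrite /= !in_itv /= -!ler_norml.
by apply: compact_setX; exact: segment_compact.
Qed.

Lemma cont_intg (f : R * R -> R) A : continuous f -> (forall x, f x != 0 -> bounded_coords Omega A x) -> intg nu (f : K -> R).
Proof.
move=> cf fA; have mf := mf_cont2 cf; have [N [hA hN]] := box_nat A.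
have [B B0 fB] := bounded_on_compact cf (@box_compact N).
have ib := intgZ B (@intg_box N).
apply: (ae_le_intg mf ib); apply: ae1 ae_cell _ => x cx.
have [->|fx] := eqVneq (f x) 0; first by rewrite normr0 mulr_ge0//; have /andP[] := ind01 (box N) x.
have bx := cell_box cx (fA x fx) hA hN.
by rewrite indicE mem_set// mulr1; exact: fB.
Qed.

Lemma test_deriv (psi : R * R -> R) v : test_space Omega psi -> [/\ continuous psi, continuous (fun x => 'D_v psi x),
 forall x w, derivable psi x w & exists A, (forall x, psi x != 0 -> bounded_coords Omega A x) /\
  (forall x, 'D_v psi x != 0 -> bounded_coords Omega A x)].
Proof.
move=> [sm _ [A hA]]; have /smoothP sm' := sm.
have [c0 d0 s0] := sm' 1%N; have c1 : continuous _ := s0 v.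
split=> //; exists A; split=> // x dx; split=> hp.
- apply: (@derive_supp _ psi (fun y => `|y.1|) A v x) => //.
  by move=> y; apply: continuous_comp; [exact: cvg_fst|exact: norm_continuous].
 by move=> y /hA[h _]; exact: h.
- apply: (@derive_supp _ psi (fun y => `|y.2|) A v x) => //.
  by move=> y; apply: continuous_comp; [exact: cvg_snd|exact: norm_continuous].
 by move=> y /hA[_ h]; exact: h.
Qed.

Lemma dline1 (f : R * R -> R) (y b : R) : derivable f (y, b) (e1 : R * R) ->
 is_derive y (1 : R) (fun a => f (a, b)) ('D_(e1 : R * R) f (y, b)).
Proof.
move=> d; have h : is_derive (y, b) (e1 : R * R) f ('D_(e1 : R * R) f (y, b)) by exact: DeriveDef.
apply/(is_derive_line (fun a => f (a, b)) y 1); move/is_derive_line: h; congr is_derive.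
by apply/funext => t; congr f; apply/pair_equal_spec; split; rewrite /= ?scaler0 ?add0r.
Qed.

Lemma dline2 (f : R * R -> R) (y b : R) : derivable f (b, y) (e2 : R * R) ->
 is_derive y (1 : R) (fun a => f (b, a)) ('D_(e2 : R * R) f (b, y)).
Proof.
move=> d; have h : is_derive (b, y) (e2 : R * R) f ('D_(e2 : R * R) f (b, y)) by exact: DeriveDef.
apply/(is_derive_line (fun a => f (b, a)) y 1); move/is_derive_line: h; congr is_derive.
by apply/funext => t; congr f; apply/pair_equal_spec; split; rewrite /= ?scaler0 ?add0r.
Qed.

Lemma dcas (g : R -> R) x b : is_derive x (1 : R) g b -> is_derive x (1 : R) (fun y => cas (g y)) (b * cas (- g x)).
Proof.
move=> h; apply: (dEq (dD (dCos h) (dSin h))).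
by rewrite /cas cosN sinN; ring.
Qed.

Lemma cont_cas : continuous (@cas R).
Proof. by move=> y; apply: cvgD; [exact: continuous_cos|exact: continuous_sin]. Qed.

Lemma cont_dot (k : R * R) : continuous (fun x : R * R => dot x k).
Proof.
move=> x; apply: cvgD; apply: cvgM; try exact: cvg_cst; [exact: cvg_fst|exact: cvg_snd].
Qed.

Lemma cont_casdot (k : R * R) : continuous (fun x : R * R => cas (dot x k)).
Proof.
move=> x; apply: (@continuous_comp (R * R)%type R R (fun y : R * R => dot y k) (@cas R) x); [exact: cont_dot|exact: cont_cas].
Qed.

Lemma dot_e1 (k : R * R) : dot e1 k = k.1.
Proof. by rewrite /dot mul1r mul0r addr0. Qed.
Lemma dot_e2 (k : R * R) : dot e2 k = k.2.
Proof. by rewrite /dot mul1r mul0r add0r. Qed.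

(** The derivative of [psi] times the character integrates to 0 in the direction [e]. On a circle
    the character is periodic only at integer frequencies, hence the [dualpt] hypotheses. *)
Lemma TX_deriv (e : R * R) (psi : R * R -> R) (k : K) : e = e1 \/ e = e2 -> test_space Omega psi ->
 dualpt (per1 Omega) k.1 -> dualpt (per2 Omega) k.2 -> TX (fun x => 'D_e psi x) k = - (dot e k * TX psi (negK k)).
Proof.
move=> he tp d1 d2; have [c0 c1 dp [A [sA sB]]] := test_deriv e tp.
have [_ [hp1 hp2] _] := tp.
have ip := cont_intg c0 sA; have id := cont_intg c1 sB.
have i1 : intg nu (fun x : K => 'D_e psi x * cas (dot x k)) := intg_cas k id.
have i2 : intg nu (fun x : K => psi x * cas (dot x (negK k))) := intg_bdd (mf_casl _) (fun x => norm_cas _) ip.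
apply/eqP; rewrite -subr_eq0 opprK; apply/eqP.
rewrite /TX /hartley -(RintZ _ i2) -RintD//; last exact: intgZ.
pose G (x : K) := 'D_e psi x * cas (dot x k) + dot e k * (psi x * cas (dot x (negK k))).
have iG : intg nu G by apply: intgD => //; exact: intgZ.
have cG : continuous (G : R * R -> R).
 move=> x; apply: cvgD; first by apply: cvgM; [exact: c1|exact: cont_casdot].
 apply: cvgM; first exact: cvg_cst.
 by apply: cvgM; [exact: c0|exact: cont_casdot].
rewrite -[LHS]/(\int[nu]_x G x).
case: he => ee; subst e.
 rewrite -(Rfubini2 iG) -[RHS](@Rint0 _ _ _ n2); apply: eq_Rint => b.
 apply: (@int_primitive (per1 Omega) (fun a => G (a, b)) (fun a => psi (a, b) * cas (dot (a, b) k))).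
 - move=> y; have h1 := dline1 (dp (y, b) e1).
  have h2 : is_derive y (1 : R) (fun a => dot (a, b) k) k.1.
   by apply: (dEq (dD (dZr k.1 (dId y)) (dC (b * k.2) y))); rewrite mul1r addr0.
  apply: (dEq (dM h1 (dcas h2))).
  by rewrite /G dot_neg dot_e1; ring.
 - exact: cont_fst.
 - move=> hp; have := hp1 hp (0, b); rewrite /= add0r => ->; congr (_ * _).
  have [n kn] := d1 hp; rewrite -[RHS](cas_int _ n); congr cas.
  by rewrite /dot /= kn; ring.
 - move=> hp; exists A => a; rewrite mulf_eq0 negb_or => /andP[/sA[h _] _]; exact: h.
rewrite -(Rfubini1 iG) -[RHS](@Rint0 _ _ _ n1); apply: eq_Rint => a.
apply: (@int_primitive (per2 Omega) (fun b => G (a, b)) (fun b => psi (a, b) * cas (dot (a, b) k))).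
- move=> y; have h1 := dline2 (dp (a, y) e2).
 have h2 : is_derive y (1 : R) (fun b => dot (a, b) k) k.2.
  by apply: (dEq (dD (dC (a * k.1) y) (dZr k.2 (dId y)))); rewrite mul1r add0r.
 apply: (dEq (dM h1 (dcas h2))).
 by rewrite /G dot_neg dot_e2; ring.
- exact: cont_snd.
- move=> hp; have := hp2 hp (a, 0); rewrite /= add0r => ->; congr (_ * _).
 have [n kn] := d2 hp; rewrite -[RHS](cas_int _ n); congr cas.
 by rewrite /dot /= kn; ring.
- move=> hp; exists A => b; rewrite mulf_eq0 negb_or => /andP[/sA[_ h] _]; exact: h.
Qed.

Lemma pair_inv (F : K -> R) H : intg nu F -> intg mu H ->
 \int[nu]_x (inv H x * F x) = @cF * \int[mu]_k (TX F k * H k).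
Proof.
move=> iF iH; rewrite hartley_adj// -Rint_scale.
 by apply: eq_Rint => x; rewrite /inv; ring.
apply: intgZ.
have b x : `|TK H x| <= 2 * \int[mu]_k `|H k| := hartley_le x iH.
have mT := mf_TK (intg_mf iH).
exact: (intg_bdd mT b iF).
Qed.

(** Both sides are moved to frequency by adjointness, where the identity is [TX_deriv] after the
    reflection of [k]. *)
Lemma weak_partial_inv (e : R * R) H : e = e1 \/ e = e2 -> LL H -> LL (dd e H) ->
 weak_partial Omega e (inv H) (inv (dd e H)).
Proof.
move=> he [iH _] [iD _] psi tp; have [c0 c1 dp [A [sA sB]]] := test_deriv e tp.
have ip := cont_intg c0 sA; have id := cont_intg c1 sB.
have mi G : intg mu G -> mfun (inv G).
 by move=> iG; apply: mfunM => //; exact: mf_TK (intg_mf iG).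
rewrite !cell_Rint; [|by apply: mfunM; [exact: mi|exact: intg_mf ip]|by apply: mfunM; [exact: mi|exact: intg_mf id]].
rewrite !pair_inv//.
have iP : intg mu (fun k => TX psi k * dd e H k).
 have h x : `|TX psi x| <= 2 * \int[nu]_x `|psi x| := hartley_le x ip.
 have mT : mfun (TX psi) := mf_hartley _ _ (intg_mf ip).
 by apply: eq_intg (intg_bdd mT h iD) => k; rewrite mulrC.
have -> : \int[mu]_k (TX psi k * dd e H k) = \int[mu]_k (TX psi (negK k) * dd e H (negK k)).
 by rewrite (pres_Rint (pres_neg) (intg_mf iP)).
rewrite -mulrN -RintN; last exact: (pres_intg (pres_neg) iP).
congr (_ * _); apply: ae_Rint.
- apply: mfunM; [exact: mf_hartley _ _ (intg_mf id)|exact: intg_mf iH].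
- have := intg_mf (intgN (pres_intg (pres_neg) iP)); exact.
apply: ae1 (ae_prod (@ae_dualpt R (per1 Omega)) (@ae_dualpt R (per2 Omega))) _ => k [d1 d2].
rewrite TX_deriv// /dd negKK.
have -> : dot e (negK k) = - dot e k by rewrite /dot /negK /=; ring.
by ring.
Qed.

(** * Calculus on the time interval *)

Section TimeCalculus.
Variable T : R.
Hypothesis T0 : 0 <= T.

Lemma ae_tm_leb (Q : RM -> Prop) : {ae tm T, forall t, Q t} -> {ae leb, forall t, 0 <= t <= T -> Q t}.
Proof.
move=> [A [mA A0 hA]]; exists (A `&` [set t | 0 <= t <= T]); split=> //.
 by apply: measurableI => //; exact: mT.
move=> t /= h; split; last by apply: contrapT => nt; apply: h => /nt.
by apply: hA => /= q; apply: h.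
Qed.

Lemma ae_leb_tm (Q : RM -> Prop) : {ae leb, forall t, 0 <= t <= T -> Q t} -> {ae tm T, forall t, Q t}.
Proof.
move=> [A [mA A0 hA]]; have h : {ae tm T, forall t, ~ A t}.
 exists A; split=> //; last by move=> t /= /contrapT.
 apply/eqP; rewrite -measure_le0 /= /tm /rmeas /mrestr -A0.
 by apply: le_measure; rewrite ?inE; [apply: measurableI => //; exact: mT|exact: mA|exact: subIsetl].
apply: ae2 h (@ae_tm T) _ => t nA ht; apply: contrapT => nq; apply: nA; apply: hA => /= q.
by apply: nq; exact: q.
Qed.

Lemma tm_cont (f : R -> R) : continuous f -> intg (tm T) (f : RM -> R).
Proof.
move=> cf; have [B B0 fB] := bounded_on_compact cf (@segment_compact R 0 T).
have [ic _] := tm_cst T0 B.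
apply: (ae_le_intg _ ic); first exact: cont_mfun.
by apply: ae1 (@ae_tm T) _ => t ht; apply: fB; rewrite /= in_itv.
Qed.

Lemma tm_FTC (f F : R -> R) a : 0 <= a <= T -> (forall x, is_derive x (1 : R) F (f x)) -> continuous f ->
 \int[tm T]_t (le1 a t * f t) = F T - F a.
Proof.
move=> /andP[a0 aT] dF cf; rewrite -(FTC aT dF cf).
have mf : mfun (fun t : RM => le1 a t * f t).
 by apply: mfunM; [exact: mf_le1|exact: cont_mfun].
rewrite tm_itv// Rintegral_mkcond [RHS]Rintegral_mkcond; apply: eq_Rintegral => t _.
rewrite !patchE le1E; case: ifPn => h1; case: ifPn => h2.
- by move: h2; rewrite inE /= in_itv /= => /andP[-> _]; rewrite mul1r.
- have ta : (a <= t) = false.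
  move: h1 h2; rewrite inE /= => /andP[_ tT]; rewrite notin_setE /= in_itv /= tT andbT.
  by move=> h; apply/negP.
 by rewrite ta mul0r.
- exfalso; move: h1 h2; rewrite notin_setE inE /= in_itv /= => h /andP[at_ tT]; apply: h.
 by rewrite (le_trans a0 at_).
- by [].
Qed.

(** Integration by parts in which one factor is only the integral of an integrable function:
    exchange the integrals and apply the fundamental theorem to the smooth factor. *)
Lemma cum_ibp (c : R) (g f F : R -> R) : intg (tm T) (g : RM -> R) -> (forall x, is_derive x (1 : R) F (f x)) ->
 continuous f -> F T = 0 -> intg (tm T) (fun t : RM => (c + cum T g t) * f t) /\
 \int[tm T]_t ((c + cum T g t) * f t) = - (c * F 0) - \int[tm T]_t (g t * F t).
Proof.
move=> ig dF cf FT; have if_ := tm_cont cf; have mg := intg_mf ig.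
have i1 := intgZ c if_.
have ir : intg (tm T) (fun t => cum T g t * f t).
 by apply: eq_intg (intg_bdd (mf_cum ig) (fun t => cum_le ig t) if_) => t; rewrite mulrC.
split; first by apply: eq_intg (intgD i1 ir) => t; rewrite mulrDl.
have -> : \int[tm T]_t ((c + cum T g t) * f t) = \int[tm T]_t (c * f t + cum T g t * f t).
 by apply: eq_Rint => t; rewrite mulrDl.
rewrite RintD// RintZ//; congr (_ + _).
 have h00 : 0 <= (0 : R) <= T by rewrite lexx.
 have := tm_FTC h00 dF cf; rewrite FT sub0r => e; rewrite -mulrN -e; congr (_ * _).
 apply: ae_Rint; [exact: intg_mf if_| |].
  by apply: mfunM; [exact: mf_le1|exact: intg_mf if_].
 by apply: ae1 (@ae_tm T) _ => t /andP[t0 _]; rewrite le1E t0 mul1r.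
have j0 := intgM12 ig if_.
have ml : mfun (fun z : RM * RM => le1 z.1 z.2) by apply: mf_le1; mtac.
have j1 : intg (pm (tm T) (tm T)) (fun z => g z.1 * f z.2 * le1 z.1 z.2) := intg_bdd ml (fun z => norm_le1 _ _) j0.
transitivity (\int[tm T]_t \int[tm T]_a (g a * f t * le1 a t)).
 apply: eq_Rint => t; rewrite /cum mulrC -RintZ; last exact: cum_intg.
 by apply: eq_Rint => a; ring.
rewrite -(Rfubini j1) -RintN; last first.
 have cF : continuous F by move=> x; exact: d_continuous (dF x).
 have [B B0 fB] := bounded_on_compact cF (@segment_compact R 0 T).
 have iN := intgZ B (intg_norm ig); apply: (ae_le_intg _ iN).
  by apply: mfunM => //; exact: cont_mfun.
 apply: ae1 (@ae_tm T) _ => t ht; rewrite normrM mulrC; apply: ler_wpM2r => //.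
 by apply: fB; rewrite /= in_itv.
apply: ae_Rint.
- exact: intg_mf (intg_Rint1 j1).
- apply: mfcomp; first exact: oppr_measurable.
 apply: mfunM => //; apply: cont_mfun => x; exact: d_continuous (dF x).
apply: ae1 (@ae_tm T) _ => a ha /=.
have := tm_FTC ha dF cf; rewrite FT sub0r => e; rewrite -mulrN -e -RintZ.
 by apply: eq_Rint => t; ring.
have mla : mfun (fun t : RM => le1 a t) by exact: mf_le1.
by apply: eq_intg (intg_bdd mla (norm_le1 a) if_) => t; rewrite mulrC.
Qed.

End TimeCalculus.

Lemma adm_L1n H : adm H -> intg mu H /\ \int[mu]_k `|H k| <= N8 H + cJ.
Proof.
move=> hH; have [i1 e1] := @adm_L1 _ 0 isT (proj1 (adm_norm hH)) (fun k => normr_ge0 _).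
split; first by have [] := adm_LL0 hH.
apply: le_trans (_ : \int[mu]_k (jap k ^+ 0 * `|H k|) <= _); last by rewrite (le_trans e1)// (proj2 (adm_norm hH)).
by apply: eq_ler; apply: eq_Rint => k; rewrite expr0 mul1r.
Qed.

Lemma FF_L1 M : exists2 C, 0 <= C & forall H, adm H -> N8 H <= M -> intg mu (FF H) /\ \int[mu]_k `|FF H k| <= C.
Proof.
pose q := kappa * cB; have q0 : 0 <= q by apply: mulr_ge0; [exact: ltW|exact: cB_ge0].
pose m := `|M| + cJ; have m0 : 0 <= m by apply: addr_ge0 => //; exact: cJ_ge0.
exists (@cF * (18 * (m * m)) + q * m).
 apply: addr_ge0; last exact: mulr_ge0.
 by apply: mulr_ge0; [exact/ltW/cF_gt0|do 2 apply: mulr_ge0 => //].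
move=> H hH nH; have [iN eN] := NN_L1 hH hH; have [mH _] := hH.
have hm : N8 H + cJ <= m by rewrite lerD2r; apply: le_trans nH (ler_norm _).
have hm0 : 0 <= N8 H + cJ by apply: addr_ge0; [exact: N8_ge0|exact: cJ_ge0].
have [i1 e1] := @adm_L1 _ 1 isT (proj1 (adm_norm hH)) (fun k => normr_ge0 _).
have iq := intgD (intg_norm iN) (intgZ q i1).
have bd k : `|FF H k| <= `|NN H H k| + q * (jap k ^+ 1 * `|H k|).
 rewrite FFE; apply: le_trans (ler_normB _ _) _; rewrite normrN lerD2l normrM (gtr0_norm k0) normrM.
 rewrite ger0_norm ?mB_ge0// /q -mulrA ler_pM2l// mulrA expr1; apply: ler_wpM2r => //; exact: mB_le.
have iF : intg mu (FF H) by apply: le_intg bd iq; exact: mf_FF.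
split=> //; apply: le_trans (le_Rint (intg_norm iF) iq bd) _.
rewrite RintD; [|exact: intg_norm|exact: intgZ].
rewrite (RintZ _ i1); apply: lerD.
 apply: le_trans eN _; apply: ler_wpM2l; first exact/ltW/cF_gt0.
 by rewrite ler_pM2l//; apply: ler_pM.
by apply: ler_wpM2l => //; apply: le_trans e1 _; rewrite (proj2 (adm_norm hH)).
Qed.

Lemma inv_comb F G (a b : R) x : intg mu F -> intg mu G ->
 inv (fun k => a * F k + b * G k) x = a * inv F x + b * inv G x.
Proof.
move=> iF iG.
have i1 H : intg mu H -> intg mu (fun k => H k * cas (dot k x)).
 by move=> iH; exact: (intg_bdd (mf_casl x) (fun k => norm_cas _) iH).
have e : \int[mu]_k ((a * F k + b * G k) * cas (dot k x)) = a * \int[mu]_k (F k * cas (dot k x)) + b * \int[mu]_k (G k * cas (dot k x)).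
 rewrite -(RintZ a (i1 _ iF)) -(RintZ b (i1 _ iG)) -RintD; [|by apply: intgZ; exact: i1|by apply: intgZ; exact: i1].
 by apply: eq_Rint => k; ring.
by rewrite /inv /TK /hartley e; ring.
Qed.

Lemma inv_FF H x : adm H -> inv (FF H) x = - inv (NN H H) x - kappa * inv (fun k => mB beta k * H k) x.
Proof.
move=> hH; have [iN _] := adm_LLN hH; have [im _] := adm_LLm hH.
have -> : FF H = (fun k => -1 * NN H H k + - kappa * (mB beta k * H k)) by apply/funext => k; rewrite FFE; ring.
by rewrite inv_comb//; ring.
Qed.

(** * From the integrated equation to a weak solution *)

Section Along.
Variables T M : R.
Hypothesis T0 : 0 < T.

Let T0' : 0 <= T := ltW T0.

Notation P := (pm (tm T) mu).

Lemma traj_comp (U : RM -> K -> R) (q : K -> K) : mfun q -> traj U -> traj (fun t k => U t (q k)).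
Proof.
move=> mq mU; have h : mfun (fun z : RM * K => (z.1, q z.2)).
 by mtac.
exact: (mfcomp mU h).
Qed.

Lemma traj_mul (w : K -> R) (U : RM -> K -> R) : mfun w -> traj U -> traj (fun t k => w k * U t k).
Proof. by move=> mw mU; exact: (mfunM (mfcomp mw mfun_snd) mU). Qed.

Lemma traj_dd e (U : RM -> K -> R) : traj U -> traj (fun t => dd e (U t)).
Proof.
move=> mU; apply: mfcomp; first exact: oppr_measurable.
exact: (traj_mul (mf_dote e) (traj_comp (@mf_nK) mU)).
Qed.

Lemma traj_LwH (U : RM -> K -> R) : traj U -> traj (fun t => LwH (U t)).
Proof. exact: (traj_mul (@mf_Lw)). Qed.
Lemma traj_inv (U : RM -> K -> R) : traj U -> mfun (fun z : RM * K => inv (U z.1) z.2).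
Proof. exact: measurable_inv. Qed.

(** Inversion commutes with the time integral by Fubini, because [FF] is integrable over the slab.
    At fixed [x] the equation becomes an integrated equation in time alone. *)
Lemma mild_inv (H0 : K -> R) (H : RM -> K -> R) x : traj H -> intg mu H0 ->
 {ae tm T, forall t, adm (H t) /\ N8 (H t) <= M} -> mild T H0 H -> intg (tm T) (fun a => inv (FF (H a)) x) /\
 {ae tm T, forall t, inv (H t) x = inv H0 x + cum T (fun a => inv (FF (H a)) x) t}.
Proof.
move=> mH iH0 aH hm; have [C C0 hC] := FF_L1 M.
have mF : traj (fun t => FF (H t)) := mf_FF2 mH.
have inF : intg P (fun z => `|FF (H z.1) z.2|).
 apply: (proj1 (slice_bd (tm_setT T0') C0 (mfcomp (@normr_measurable R setT) mF) _ _)); first by move=> z; exact: normr_ge0.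
 by apply: ae1 aH _ => t [a n]; have [i e] := hC _ a n; split=> //; exact: intg_norm.
have iF : intg P (fun z => FF (H z.1) z.2) by apply: le_intg mF _ inF.
have mc : mfun (fun z : RM * K => cas (dot z.2 x)) := mfcomp (mf_casl x) mfun_snd.
have ic : intg P (fun z => FF (H z.1) z.2 * cas (dot z.2 x)) := intg_bdd mc (fun z => norm_cas _) iF.
have ir : intg (tm T) (fun a => inv (FF (H a)) x) := intgZ _ (intg_Rint1 ic).
split=> //; have seck : {ae mu, forall k, intg (tm T) (fun t => FF (H t) k)} := ae_intg1 (intg_swap iF).
have aeM : {ae mu, forall k, forall t, cum T (fun t => FF (H t) k) t * cas (dot k x) = \int[tm T]_a (le1 a t * (FF (H a) k * cas (dot k x)))}.
 apply: ae1 seck _ => k ik t; rewrite /cum mulrC -RintZ; last exact: cum_intg.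
 by apply: eq_Rint => a; ring.
apply: ae2 aH (ae_sec1 hm) _ => t [at_ nt] et.
have [iHt _] := adm_L1n at_.
have mt : mfun (fun z : RM * K => le1 z.1 t) by apply: mf_le1 => //; exact: mfun_fst.
have ilt : intg P (fun z => le1 z.1 t * (FF (H z.1) z.2 * cas (dot z.2 x))).
 by apply: eq_intg (intg_bdd mt (fun z => norm_le1 _ _) ic) => z; rewrite mulrC.
have iH0c : intg mu (fun k => H0 k * cas (dot k x)) := intg_bdd (mf_casl x) (fun k => norm_cas _) iH0.
have i2 := intg_Rint2 ilt.
rewrite /inv /TK /hartley.
have -> : \int[mu]_k (H t k * cas (dot k x)) = \int[mu]_k (H0 k * cas (dot k x) + \int[tm T]_a (le1 a t * (FF (H a) k * cas (dot k x)))).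
 apply: ae_Rint.
 - by apply: mfunM; [exact: traj_t mH|exact: mf_casl].
 - exact: intg_mf (intgD iH0c i2).
 by apply: ae2 et aeM _ => k /= ek eM; rewrite -eM ek; ring.
rewrite RintD// mulrDr; congr (_ + _); rewrite -(Rfubini ilt) /cum.
rewrite -(RintZ _ (intg_Rint1 ilt)); apply: ae_Rint.
- exact: intg_mf (intgZ _ (intg_Rint1 ilt)).
- by apply: mfunM; [exact: mf_le1|exact: intg_mf ir].
apply: ae1 (ae_intg1 ic) _ => a ia /=.
by rewrite (RintZ _ ia); ring.
Qed.

End Along.

Lemma dline_t (f : R * (R * R) -> R) (t : R) (x : R * R) : derivable f (t, x) (1, (0, 0)) ->
 is_derive t (1 : R) (fun a => f (a, x)) ('D_(1, (0, 0)) f (t, x)).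
Proof.
move=> d; have h : is_derive (t, x) (1, (0, 0)) f ('D_(1, (0, 0)) f (t, x)) by exact: DeriveDef.
apply/(is_derive_line (fun a => f (a, x)) t 1); move/is_derive_line: h; congr is_derive.
apply/funext => u; congr f; apply/pair_equal_spec; split=> //=.
by case: x {d} => a b; apply/pair_equal_spec; split; rewrite /= scaler0 add0r.
Qed.

Lemma test_time (T : R) (phi : R * (R * R) -> R) : 0 < T -> test_spacetime Omega T phi ->
 [/\ continuous phi, continuous (fun z => 'D_(1, (0, 0)) phi z),
  forall t x, is_derive t (1 : R) (fun a => phi (a, x)) ('D_(1, (0, 0)) phi (t, x)), forall x, phi (T, x) = 0 &
  exists N B, 0 <= B /\ forall t x, 0 <= t <= T -> cell Omega x ->
   `|phi (t, x)| <= B * \1_(@box N) x /\ `|'D_(1, (0, 0)) phi (t, x)| <= B * \1_(@box N) x].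
Proof.
move=> T0 [sm _ [A [T' [T'T hA]]]]; have /smoothP sm' := sm.
have [c0 d0 s0] := sm' 1%N; have c1 : continuous _ := s0 (1, (0, 0)).
split=> //.
- by move=> t x; exact: dline_t.
- by move=> x; apply/eqP; apply: contraTT T'T => /hA[h _]; rewrite -leNgt.
have supD z : 'D_(1, (0, 0)) phi z != 0 -> bounded_coords Omega A z.2.
 have cs : continuous (fun y : R * (R * R) => y.2) by move=> y; exact: cvg_snd.
 move=> dz; split=> hp.
 - apply: (@derive_supp _ phi (fun y => `|y.2.1|) A (1, (0, 0)) z) => //.
   move=> y; apply: (@continuous_comp _ _ _ (fun y : R * (R * R) => y.2.1) (fun a : R => `|a|)); last exact: norm_continuous.
   by apply: (@continuous_comp _ _ _ (fun y : R * (R * R) => y.2) fst); [exact: cs|exact: cvg_fst].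
  by move=> [a b] /hA[_ [h _]]; exact: h.
 - apply: (@derive_supp _ phi (fun y => `|y.2.2|) A (1, (0, 0)) z) => //.
   move=> y; apply: (@continuous_comp _ _ _ (fun y : R * (R * R) => y.2.2) (fun a : R => `|a|)); last exact: norm_continuous.
   by apply: (@continuous_comp _ _ _ (fun y : R * (R * R) => y.2) snd); [exact: cs|exact: cvg_snd].
  by move=> [a b] /hA[_ [_ h]]; exact: h.
have [N [hN1 hN2]] := box_nat A; exists N.
have cp : compact ([set t : R | t \in `[0, T]] `*` @box N : set (R * (R * R))).
 by apply: compact_setX; [exact: segment_compact|exact: box_compact].
have [B0 B00 h0] := bounded_on_compact c0 cp; have [B1 B10 h1] := bounded_on_compact c1 cp.
exists (B0 + B1); split; first exact: addr_ge0.
have aux (f : R * (R * R) -> R) B t x : (forall z, f z != 0 -> bounded_coords Omega A z.2) -> B <= B0 + B1 ->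
  (forall z, ([set t : R | t \in `[0, T]] `*` @box N) z -> `|f z| <= B) ->
  0 <= t <= T -> cell Omega x -> `|f (t, x)| <= (B0 + B1) * \1_(@box N) x.
 move=> fA BB fB ht cx; have [->|fz] := eqVneq (f (t, x)) 0.
  have /andP[h _] := @ind01 _ (@box N) x.
  by rewrite normr0; apply: mulr_ge0; [exact: addr_ge0|exact: h].
 have bx := cell_box cx (fA _ fz) hN1 hN2.
 rewrite indicE mem_set// mulr1; apply: le_trans BB; apply: fB.
 by split; [rewrite /= in_itv|exact: bx].
move=> t x ht cx; split.
 by apply: (aux phi B0) => //; [move=> [a b] /hA[]|rewrite lerDl].
by apply: (aux (fun z => 'D_(1, (0, 0)) phi z) B1) => //; rewrite lerDr.
Qed.

(** After Fubini this is integration by parts in time at fixed [x]. The cutoff vanishes at [T], so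
    only the initial datum is left as boundary term. *)
Lemma weak_form (T M : R) (H0 : K -> R) (H : RM -> K -> R) (phi : R * (R * R) -> R) :
 0 < T -> traj H -> intg mu H0 -> {ae tm T, forall t, adm (H t) /\ N8 (H t) <= M} -> mild T H0 H ->
 test_spacetime Omega T phi ->
 \int[tm T]_t \int[nu]_x (inv (H t) x * 'D_(1, (0, 0)) phi (t, x) + inv (FF (H t)) x * phi (t, x)) =
  - \int[nu]_x (inv H0 x * phi (0, x)).
Proof.
move=> T0 mH iH0 aH hm tp; have T0' := ltW T0.
have [c0 c1 dp pT [N [B [B0 hB]]]] := test_time T0 tp.
have mF : traj (fun t => FF (H t)) := mf_FF2 mH.
pose Q (z : RM * K) := inv (H z.1) z.2 * 'D_(1, (0, 0)) phi z + inv (FF (H z.1)) z.2 * phi z.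
have mQ : mfun Q.
 apply: mfunD; apply: mfunM; [exact: traj_inv mH|exact: mf_cont3|exact: traj_inv mF|exact: mf_cont3].
have [C C0 hC] := FF_L1 M.
pose c := @cF * (2 * (`|M| + cJ)) + @cF * (2 * C).
have iB : intg (pm (tm T) nu) (fun z : RM * K => c * (B * \1_(@box N) z.2)).
 have [ic _] := tm_cst T0' (c * B).
 by apply: eq_intg (intgM12 ic (intg_box N)) => z; rewrite mulrA.
have cFp := ltW (@cF_gt0).
have iQ : intg (pm (tm T) nu) Q.
 apply: (ae_le_intg mQ iB); have aeT : {ae tm T, forall t, (adm (H t) /\ N8 (H t) <= M) /\ 0 <= t <= T}.
  by apply: ae2 aH (@ae_tm T) _.
 apply: ae1 (ae_prod aeT (ae_cell)) _ => -[t x] /= [[[a n] ht] cx].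
 have [iFt eFt] := hC _ a n; have [iHt eHt] := adm_L1n a.
 have [h1 h2] := hB t x ht cx.
 apply: le_trans (ler_normD _ _) _; rewrite /c mulrDl /= (normrM (inv (H t) x)) (normrM (inv (FF (H t)) x)); apply: lerD; apply: ler_pM => //.
  apply: le_trans (inv_le _ iHt) _; apply: ler_wpM2l => //; rewrite ler_pM2l//.
  by apply: le_trans eHt _; rewrite lerD2r; apply: le_trans n (ler_norm _).
 by apply: le_trans (inv_le _ iFt) _; apply: ler_wpM2l => //; rewrite ler_pM2l.
rewrite (Rfubini iQ) -RintN; last first.
 have cphi0 : continuous (fun x : R * R => phi (0, x)) by exact: (@cont_snd R (R * R)%type).
 have ib := intgZ (@cF * (2 * \int[mu]_k `|H0 k|)) (intgZ B (intg_box N)).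
 apply: (ae_le_intg _ ib).
  by apply: mfunM; [apply: mfunM => //; exact: mf_TK (intg_mf iH0)|exact: mf_cont2].
 apply: ae1 (ae_cell) _ => x cx; have h00 : 0 <= (0 : R) <= T by rewrite lexx.
 have [h1 _] := hB 0 x h00 cx; rewrite (normrM (inv H0 x)); apply: ler_pM => //; exact: inv_le.
apply: eq_Rint => x; rewrite /Q /=.
have [ir er] := mild_inv T0 x mH iH0 aH hm.
have cf : continuous (fun t => 'D_(1, (0, 0)) phi (t, x)) := @cont_fst R (R * R)%type _ x c1.
have cphi : continuous (fun t => phi (t, x)) := @cont_fst R (R * R)%type phi x c0.
have [i1 e1] := cum_ibp T0' (inv H0 x) ir (fun t => dp t x) cf (pT x).
have irp : intg (tm T) (fun t : RM => inv (FF (H t)) x * phi (t, x)).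
 have [B' _ hB'] := bounded_on_compact cphi (@segment_compact R 0 T).
 apply: (ae_le_intg _ (intgZ B' (intg_norm ir))).
  by apply: mfunM; [exact: intg_mf ir|exact: cont_mfun].
 apply: ae1 (@ae_tm T) _ => t ht; rewrite normrM mulrC; apply: ler_wpM2r => //.
 by apply: hB'; rewrite /= in_itv.
transitivity (\int[tm T]_t ((inv H0 x + cum T (fun a => inv (FF (H a)) x) t) * 'D_(1, (0, 0)) phi (t, x) + inv (FF (H t)) x * phi (t, x))).
 apply: ae_Rint.
 - have h : mfun (fun t : RM => Q (t, x)) by mtac.
  by mtac.
 - exact: intg_mf (intgD i1 irp).
 - by apply: ae1 er _ => t ->.
by rewrite RintD// e1 addrNK.
Qed.

(** Every auxiliary field is the inverse transform of an explicit multiple of [H], which gives joint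
    measurability; the nonlinear term is then identified by [nonlinear_inv]. *)
Lemma solution_exists (T M : R) (H0 : K -> R) (H : RM -> K -> R) (theta0 : R * R -> R) :
 0 < T -> traj H -> Ebound T M H -> mild T H0 H ->
 isH theta0 H0 -> intg mu H0 -> is_solution Omega beta kappa s T theta0 (fun t => inv (H t)).
Proof.
move=> T0 mH EH hm hth iH0; have T0' := ltW T0; have aH := Ebound_adm mH EH.
have mdd (e : R * R) (U : RM -> K -> R) : traj U -> traj (fun t => dd e (U t)) by exact: (@traj_dd).
have mL : traj (fun t => LwH (H t)) := traj_LwH mH.
have mmB : traj (fun t k => mB beta k * H t k) := traj_mul (mf_mB beta) mH.
have m1 := traj_inv mH; have m2 := traj_inv (mdd e1 _ mH); have m3 := traj_inv (mdd e2 _ mH).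
have m4 := traj_inv mL; have m5 := traj_inv (mdd e1 _ mL); have m6 := traj_inv (mdd e2 _ mL).
have m7 := traj_inv mmB.
split.
 split; first exact: measurable_funTS m1.
 exists M; apply: ae_tm_leb; apply: ae2 aH EH _ => t [a n] [i e].
 have [g hg le] := Hs_inv (LL_inv (adm_LL0 a)) i; exists g => //.
 by apply: le_trans le _; rewrite lee_fin.
exists (fun t x => (inv (dd e1 (H t)) x, inv (dd e2 (H t)) x)), (fun t => inv (LwH (H t))),
 (fun t x => (inv (dd e1 (LwH (H t))) x, inv (dd e2 (LwH (H t))) x)), (fun t => inv (fun k => mB beta k * H t k)).
split.
- by split; apply: measurable_funTS; [exact: mfun_pair m2 m3|exact: m4|exact: mfun_pair m5 m6|exact: m7].
- apply: ae_tm_leb; apply: ae1 aH _ => t [a n].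
 have L0 := adm_LL0 a; have L1 := adm_LLw a; have Lm := adm_LLm a.
 have D1 := adm_LLd (@unit_e1) a; have D2 := adm_LLd (@unit_e2) a.
 have D3 := adm_LLdw (@unit_e1) a; have D4 := adm_LLdw (@unit_e2) a.
 have wg F : LL F -> LL (dd e1 F) -> LL (dd e2 F) ->
   weak_grad Omega (inv F) (fun x => (inv (dd e1 F) x, inv (dd e2 F) x)).
  move=> LF LF1 LF2; split.
  - by have [q1 q2] := LF1; exact: inv_in_L2.
  - by have [q1 q2] := LF2; exact: inv_in_L2.
  - by apply: weak_partial_inv => //; left.
  - by apply: weak_partial_inv => //; right.
 split; [exact: wg| |exact: wg|].
 - exact: (isH_multiplier (LL_inv L0) (LL_inv L1)).
 - exact: (@isH_multiplier (fun r => log_symbol r `^ beta) _ _ _ (LL_inv L0) (LL_inv Lm)).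
move=> phi tp u; have [c0 c1 _ _ _] := test_time T0 tp.
pose I (z : RM * K) := inv (H z.1) z.2 * 'D_(1, (0, 0)) phi z -
 (dot (- perp (inv (dd e1 (LwH (H z.1))) z.2, inv (dd e2 (LwH (H z.1))) z.2)) (inv (dd e1 (H z.1)) z.2, inv (dd e2 (H z.1)) z.2) +
 kappa * inv (fun k => mB beta k * H z.1 k) z.2) * phi z.
have mI : mfun I.
 have mphi := mf_cont3 c0; have mdphi := mf_cont3 c1.
 apply: mfunB; first exact: mfunM.
 apply: mfunM => //; apply: mfunD; last exact: mfunM.
 rewrite /dot /perp /=; apply: mfunD; apply: mfunM => //.
 - by mtac.
 - by mtac.
have cphi0 : continuous (fun x : R * R => phi (0, x)) by exact: (@cont_snd R (R * R)%type).
have [in0 _ _] := hth; have [mth0 _] := in_L2P in0.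
rewrite (_ : \int[leb]_(t in [set t | 0 <= t <= T]) _ = \int[leb]_(t in [set t | 0 <= t <= T]) \int[nu]_x I (t, x)); last first.
 apply: eq_Rintegral => t _; rewrite cell_Rint//.
 exact: (mfcomp mI (measurable_pair1 t)).
rewrite cell_Rint; last by apply: mfunM; [|exact: mf_cont2].
rewrite -tm_itv; last exact: mf_Rint.
have -> : \int[nu]_x (theta0 x * phi (0, x)) = \int[nu]_x (inv H0 x * phi (0, x)).
 apply: ae_Rint.
 - by apply: mfunM => //; exact: mf_cont2.
 - apply: mfunM; last exact: mf_cont2.
  by apply: mfunM => //; exact: mf_TK (intg_mf iH0).
 by apply: ae1 (isH_eq hth iH0) _ => x ->.
apply/eqP; rewrite addr_eq0 -(weak_form T0 mH iH0 aH hm tp); apply/eqP.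
have mF : traj (fun t => FF (H t)) := mf_FF2 mH.
apply: ae_Rint.
- exact: mf_Rint.
- apply: (mf_Rint2 nu (fun t x => inv (H t) x * 'D_(1, (0, 0)) phi (t, x) + inv (FF (H t)) x * phi (t, x))).
 have e : (fun z : RM * K => inv (H z.1) z.2 * 'D_(1, (0, 0)) phi (z.1, z.2) + inv (FF (H z.1)) z.2 * phi (z.1, z.2)) =
   (fun z => inv (H z.1) z.2 * 'D_(1, (0, 0)) phi z + inv (FF (H z.1)) z.2 * phi z) by apply/funext => -[].
 rewrite e; apply: mfunD; apply: mfunM; [exact: m1|exact: mf_cont3|exact: traj_inv mF|exact: mf_cont3].
apply: ae1 aH _ => t [a n]; apply: eq_Rint => x.
rewrite (inv_FF x a) -(nonlinear_inv x a) /I /dot /perp /=; ring.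
Qed.

(** * Smooth cutoffs, characters and the fundamental lemma *)

Lemma Sm_fst n : @Sm R (R * R)%type n fst.
Proof. by apply: Sm_linear => // x; exact: cvg_fst. Qed.
Lemma Sm_snd n : @Sm R (R * R)%type n snd.
Proof. by apply: Sm_linear => // x; exact: cvg_snd. Qed.

Lemma Sm_poly2 (V : normedModType R) n (c : R) (b : V -> R) : Sm n b -> Sm n (fun x => c - b x ^+ 2).
Proof.
move=> sb; have := SmD (Sm_cst V n c) (SmM (Sm_cst V n (-1)) (SmM sb sb)).
by congr Sm; apply/funext => x; ring.
Qed.

(** Each derivative of [cas] is a shift of the argument by a quarter turn, so the tower is
    explicit. *)
Definition cas_ (k : nat) (y : R) : R := cas (y + k%:R * (pi / 2)).
Lemma cas_shift (y : R) : cas (y + pi / 2) = cas (- y).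
Proof. by rewrite /cas cosD sinD cos_pihalf sin_pihalf cosN sinN; ring. Qed.

Lemma chain_cas : chain cas_.
Proof.
move=> k y; rewrite /cas_.
have h : is_derive y (1 : R) (fun y : R => y + k%:R * (pi / 2)) 1.
 by apply: (dEq (dD (dId y) (dC (k%:R * (pi / 2)) y))); rewrite addr0.
apply: (dEq (dcas h)); rewrite mul1r -cas_shift; congr cas.
by rewrite -natr1; ring.
Qed.

Lemma Sm_cas (V : normedModType R) n (b : V -> R) : Sm n b -> Sm n (fun x => cas (b x)).
Proof.
move=> sb; have := Sm_comp 0 chain_cas sb; congr Sm; apply/funext => x.
by rewrite /cas_ mul0r addr0.
Qed.

Lemma Sm_dot n (k : R * R) : Sm n (fun x : R * R => dot x k).
Proof.
have := SmD (SmM (Sm_fst n) (Sm_cst (R * R)%type n k.1)) (SmM (Sm_snd n) (Sm_cst (R * R)%type n k.2)).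
by congr Sm.
Qed.

Lemma Sm_snd_comp n (f : R * R -> R) : Sm n f -> Sm n (fun z : R * (R * R) => f z.2).
Proof.
elim: n f => [|n IH] f; first by move=> cf z; apply: (@continuous_comp _ _ _ snd f); [exact: cvg_snd|exact: cf].
move=> [cf df sf].
have D (z v : R * (R * R)) : is_derive z v (fun z : R * (R * R) => f z.2) ('D_(v.2) f z.2).
 have h : is_derive z.2 v.2 f ('D_(v.2) f z.2) by exact: DeriveDef.
 by apply/is_derive_line; move/is_derive_line: h; congr is_derive.
split.
- by move=> z; apply: (@continuous_comp _ _ _ snd f); [exact: cvg_snd|exact: cf].
- by move=> z v; have [] := D z v.
- by move=> v; have := IH _ (sf v.2); congr Sm; apply/funext => z; have [_ ->] := D z v.
Qed.

(** A circle needs no cutoff. On a line the bump is positive exactly on the interval of radius [m],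
    so the bumps exhaust the domain without being equal to 1 anywhere. *)
Definition bump1 (per : bool) (m : nat) (y : R) : R := if per then 1 else sigma (m%:R ^+ 2 - y ^+ 2).
Definition bump (m : nat) (x : R * R) : R := bump1 (per1 Omega) m x.1 * bump1 (per2 Omega) m x.2.

Lemma Sm_bump1 (V : normedModType R) n per m (b : V -> R) : Sm n b -> Sm n (fun x => bump1 per m (b x)).
Proof.
move=> sb; rewrite /bump1; case: per; first exact: Sm_cst.
exact: (Sm_comp 0 (@chain_sigma R) (Sm_poly2 _ sb)).
Qed.

Lemma bump1_supp m y : bump1 false m y != 0 -> `|y| <= m%:R.
Proof.
apply: contraNT; rewrite -ltNge => h; rewrite /bump1 sigma_eq0// subr_le0.
by rewrite -[y ^+ 2]real_normK ?num_real//; apply: lerXn2r; rewrite ?nnegrE//; exact: ltW.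
Qed.

Lemma bump1_01 per m y : 0 <= bump1 per m y <= 1.
Proof. by rewrite /bump1; case: per; rewrite ?ler01 ?lexx// sigma_ge0 sigma_le1. Qed.

Lemma bump1_gt0 per (m : nat) y : `|y| < m%:R -> 0 < bump1 per m y.
Proof.
move=> h; rewrite /bump1; case: per => //.
have d : 0 < m%:R ^+ 2 - y ^+ 2.
 by rewrite subr_gt0 -[y ^+ 2]real_normK ?num_real//; apply: ltrXn2r.
by rewrite sigmaE d expR_gt0.
Qed.

Lemma bump_le1 m x : `|bump m x| <= 1.
Proof.
have /andP[a0 a1] := bump1_01 (per1 Omega) m x.1; have /andP[c0 c1] := bump1_01 (per2 Omega) m x.2.
by rewrite ger0_norm ?mulr_ge0//; exact: mulr_ile1.
Qed.

Lemma Sm_bump n m : Sm n (bump m).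
Proof. by apply: SmM; apply: Sm_bump1; [exact: Sm_fst|exact: Sm_snd]. Qed.

Lemma bump_supp m x : bump m x != 0 -> bounded_coords Omega m%:R x.
Proof.
rewrite mulf_eq0 negb_or => /andP[h1 h2]; split => hp.
 by apply: bump1_supp; move: h1; rewrite (negbTE hp).
by apply: bump1_supp; move: h2; rewrite (negbTE hp).
Qed.

Lemma bump_domain m : on_domain Omega (bump m).
Proof. by split=> hp x; rewrite /bump /bump1 hp. Qed.

Lemma test_bump m (k : R * R) : dualpt (per1 Omega) k.1 -> dualpt (per2 Omega) k.2 ->
 test_space Omega (fun x => bump m x * cas (dot x k)).
Proof.
move=> d1 d2; split.
- by apply/smoothP => n; apply: SmM; [exact: Sm_bump|exact/Sm_cas/Sm_dot].
- have [q1 q2] := bump_domain m; split=> hp x.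
  rewrite (q1 hp); have [n kn] := d1 hp; congr (_ * _); rewrite -[RHS](cas_int _ n); congr cas.
  by rewrite /dot /= kn; ring.
 rewrite (q2 hp); have [n kn] := d2 hp; congr (_ * _); rewrite -[RHS](cas_int _ n); congr cas.
 by rewrite /dot /= kn; ring.
- by exists m%:R => x; rewrite mulf_eq0 negb_or => /andP[/bump_supp h _].
Qed.

Lemma cont_bump m : continuous (bump m).
Proof. exact: Sm_continuous (Sm_bump 0 m). Qed.

(* Testing against a bump times a Hartley character kills the transform of the truncated function. *)
Lemma fundamental (f : K -> R) : L2 nu f -> (forall psi, test_space Omega psi -> \int[nu]_x (f x * psi x) = 0) ->
 {ae nu, forall x, f x = 0}.
Proof.
move=> Lf h; have [mf if_] := Lf.
have ae_m m : {ae nu, forall x, f x * bump m x = 0}.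
 have mb : mfun (bump m : K -> R) := mf_cont2 (@cont_bump m).
 have ib : intg nu (bump m : K -> R) := cont_intg (@cont_bump m) (@bump_supp m).
 have ib2 : intg nu (fun x : K => bump m x ^+ 2).
  by apply: eq_intg (intg_bdd mb (@bump_le1 m) ib) => x; rewrite expr2.
 have i1 : intg nu (fun x => f x * bump m x) := intg_sqM mf mb if_ ib2.
 have i2 : intg nu (fun x => (f x * bump m x) ^+ 2).
  apply: le_intg (mfunX 2 (intg_mf i1)) _ if_ => x.
  rewrite ger0_norm ?sqr_ge0// exprMn; apply: ler_piMr; first exact: sqr_ge0.
  by rewrite -[bump m x ^+ 2]real_normK ?num_real//; apply: exprn_ile1 => //; exact: bump_le1.
 have [j1 e1] := plX i1 i2.
 have T0 : {ae mu, forall k, TX (fun x => f x * bump m x) k = 0}.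
  apply: ae1 (ae_prod (@ae_dualpt R (per1 Omega)) (@ae_dualpt R (per2 Omega))) _ => k [d1 d2].
  have := h _ (test_bump m d1 d2) => <-; rewrite /TX /hartley.
  by apply: eq_Rint => x; rewrite mulrA.
 apply: L2_eq0; first by split=> //; exact: intg_mf i1.
 have z : \int[mu]_k (TX (fun x => f x * bump m x) k ^+ 2) = 0.
  rewrite -[RHS](@Rint0 _ _ _ mu); apply: ae_Rint => //; first exact: intg_mf j1.
  by apply: ae1 T0 _ => k ->; rewrite expr0n.
 move: e1; rewrite z => /esym/eqP; rewrite mulf_eq0 gt_eqF ?pi2_gt0//= => /eqP ->.
 exact: lexx.
apply: ae1 (ae_foralln ae_m) _ => x hx.
pose m := (Num.truncn (`|x.1| + `|x.2|)).+1; have hm := truncnS_gt (`|x.1| + `|x.2| : R).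
have bx : bump m x != 0.
 rewrite mulf_eq0 negb_or; apply/andP; split; apply: lt0r_neq0; apply: bump1_gt0; apply: le_lt_trans hm.
  by rewrite lerDl.
 by rewrite lerDr.
by have /eqP := hx m; rewrite mulf_eq0 (negbTE bx) orbF => /eqP.
Qed.

(** * Vanishing of a function whose integrals vanish *)

Section OneDim.
Variable T : R.
Hypothesis T0 : 0 < T.

Let T0' : 0 <= T := ltW T0.

(** By Lebesgue differentiation the primitive has derivative [g] almost everywhere. A nonzero
    derivative at [x] would keep the primitive away from 0 on an interval just after [x], which has
    positive measure. *)
Lemma cum_eq0 (g : RM -> R) : intg (tm T) g -> {ae tm T, forall t, cum T g t = 0} -> {ae tm T, forall t, g t = 0}.
Proof.
move=> ig hc; have mg := intg_mf ig.
pose D : set RM := [set t | 0 <= t <= T]; have mD : measurable D by exact: mT.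
pose f : R -> R := g \_ D.
have mf : mfun (f : RM -> R) by exact: (proj1 (measurable_restrictT _ mD) (measurable_funTS mg)).
have if_ : intg leb (f : RM -> R).
 have mng : mfun (fun x : RM => (`|g x|)%:E) by mtac.
 have : (\int[leb]_(x in D) (`|g x|)%:E < +oo)%E.
  rewrite -(integral_mrestr leb (@mT T) mng).
  by have /integrableP[_] := ig.
 move=> h; apply/integrableP; split; first exact/EFinP.
 move: h; rewrite integral_mkcond; congr (_ < _)%E; apply: eq_integral => x _.
 by rewrite /= /f !patchE; case: ifPn => //= _; rewrite normr0.
have intf y : integrable leb `]-oo, y] (EFin \o f).
 by apply: integrableS if_ => //.
have locf : locally_integrable [set: R] f.
 split; [exact: mf|exact: openT|move=> C _ cC].
 have /integrableP[_] := if_; apply: le_lt_trans.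
 apply: ge0_subset_integral => //; [exact: compact_measurable|].
 by mtac.
have FE x : \int[leb]_(t in `]-oo, x]) f t = cum T g x.
 have mm : mfun (fun a : RM => le1 a x * g a) by apply: mfunM => //; exact: mf_le1.
 rewrite /cum tm_itv// Rintegral_mkcond [RHS]Rintegral_mkcond; apply: eq_Rintegral => t _.
 rewrite !patchE le1E; case: ifPn => h1; case: ifPn => h2.
 - by move: h1; rewrite inE /= in_itv /= => ->; rewrite mul1r /f patchE h2.
 - by rewrite /f patchE (negbTE h2).
 - by move: h1; rewrite notin_setE /= in_itv /= => /negP/negbTE ->; rewrite mul0r.
 - by [].
have dF : {ae tm T, forall x, derivable (cum T g : R -> R) x 1 /\ derive1 (cum T g : R -> R) x = f x}.
 apply: ae_leb_tm; apply: ae1 (FTC1Ny intf locf) _ => x + _.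
 by have -> : (fun x0 : R => \int[leb]_(t in `]-oo, x0]) f t) = cum T g by apply/funext => y; exact: FE.
apply: ae2 (ae2 dF hc (fun _ a b => conj a b)) (ae2 (@ae_tm T) (ae_neq T T) (fun _ a b => conj a b)) _.
move=> x [[d1 d2] Fx] [/andP[x0 xT] xnT]; have xT' : x < T by rewrite lt_neqAle xnT.
have fx : f x = g x by rewrite /f patchE mem_set//; apply/andP.
rewrite -fx -d2; apply/eqP; apply: contraT => nz.
have lim : (fun h => h^-1 *: (cum T g (h + x) - cum T g x)) @ 0^' --> derive1 (cum T g : R -> R) x.
 have := d1; rewrite /derivable /= => /cvg_ex[l hl].
 rewrite derive1E /derive; have e : (fun h : R => h^-1 *: (cum T g (h + x) - cum T g x)) = (fun h : R => h^-1 *: ((cum T g \o shift x) (h *: (1 : R)) - cum T g x)).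
  by apply/funext => h; rewrite /= /GRing.scale /= mulr1.
 rewrite e; exact: d1.
have ne : \forall h \near 0^', h^-1 *: (cum T g (h + x) - cum T g x) != 0.
 exact: (cvgr_neq0 _ lim nz).
have [e /= e0 he] := ne.
(* The interval from [x] to [x + d] lies in the punctured neighbourhood and still inside the time
   interval. *)
pose d := Num.min (e / 2) (T - x).
have d0 : 0 < d by rewrite lt_min subr_gt0 xT' andbT divr_gt0.
have de : d <= e.
 have e2 : e / 2 <= e by lra.
 by rewrite ge_min e2.
have := hc; move=> [A [mA A0 hA]].
pose I : set RM := `]x, x + d[%classic.
have sub : I `<=` A.
 move=> y; rewrite /I /= in_itv /= => /andP[xy yd]; apply: hA => /= Fy.
 have h1 : `|0 - (y - x)| < e.
  rewrite sub0r normrN ger0_norm ?subr_ge0 1?ltW// ltrBlDl; apply: lt_le_trans yd _.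
  by rewrite lerD2l.
 have h2 : y - x != 0 by rewrite subr_eq0 gt_eqF.
 by have := he (y - x) h1 h2; rewrite subrK Fy Fx subrr scaler0 eqxx.
have : (leb I <= 0)%E.
 rewrite -A0 /tm /rmeas /mrestr /=; apply: le_measure; rewrite ?inE; [exact: measurable_itv|exact: measurableI|].
 move=> y hy; split; first exact: sub.
 move: hy; rewrite /I /= in_itv /= => /andP[xy yd]; rewrite (le_trans x0 (ltW xy)) /=.
 apply: le_trans (ltW yd) _; rewrite -lerBrDl ge_min; apply/orP; right; exact: lexx.
rewrite /I lebesgue_measure_itv /= lte_fin ltrDl d0 -EFinB lee_fin addrAC subrr add0r => dl.
by have := lt_le_trans d0 dl; rewrite ltxx.
Qed.

End OneDim.

Lemma isH_ae (f : R * R -> R) (H H' : K -> R) : isH f H -> mfun H' -> {ae mu, forall k, H k = H' k} -> isH f H'.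
Proof.
move=> [f2 [mH iH] c0] mH' e; split=> //.
 split=> //; apply: (ae_intg (mfunX 2 mH') _ iH).
 by apply: ae1 e _ => k ->.
have eq : (fun N => \int[mu]_k ((H' k - TX (trc f N) k) ^+ 2)) = (fun N => \int[mu]_k ((H k - TX (trc f N) k) ^+ 2)).
 apply/funext => N; have [mT _] := TX_L2 N (in_L2P f2).
 apply: ae_Rint; [by apply: mfunX; exact: mfunB|by apply: mfunX; exact: mfunB|].
 by apply: ae1 e _ => k ->.
by rewrite eq.
Qed.

Lemma multiplier_isH (m : R -> R) f h H : mfun (fun k : K => m (norm2 k)) ->
 is_multiplier Omega m f h -> isH f H -> isH h (fun k => m (norm2 k) * H k).
Proof.
move=> mm [g gf gh] hf; have [hf' _] := fourier_isH gf; have [hh _] := fourier_isH gh.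
have [_ [mH _] _] := hf.
apply: (isH_ae hh); first by mtac.
apply: ae1 (isH_unique hf' hf) _ => k <-.
rewrite /hreal; case: (g k) => a b /=; ring.
Qed.

Lemma test_L2 psi : test_space Omega psi -> intg nu (psi : K -> R) /\ L2 nu (psi : K -> R).
Proof.
move=> tp; have [c0 _ _ [A [sA _]]] := test_deriv e1 tp.
split; first exact: cont_intg sA.
split; first exact: mf_cont2.
apply: (@cont_intg (fun x => psi x ^+ 2) A); first by move=> x; apply: cvgM; exact: c0.
by move=> x; rewrite sqrf_eq0; exact: sA.
Qed.

Lemma testd_L2 e psi : test_space Omega psi -> intg nu (fun x : K => 'D_e psi x) /\ L2 nu (fun x : K => 'D_e psi x).
Proof.
move=> tp; have [_ c1 _ [A [_ sA]]] := test_deriv e tp.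
split; first exact: cont_intg sA.
split; first exact: mf_cont2.
apply: (@cont_intg (fun x => 'D_e psi x ^+ 2) A); first by move=> x; apply: cvgM; exact: c1.
by move=> x; rewrite sqrf_eq0; exact: sA.
Qed.

(** The given derivative and the inverse transform of [dd e H] have the same pairing with every test
    function, so the fundamental lemma identifies them. *)
Lemma grad_eq (e : R * R) (f p : R * R -> R) H : e = e1 \/ e = e2 -> in_L2 Omega p -> weak_partial Omega e f p ->
 isH f H -> LL H -> LL (dd e H) -> {ae nu, forall x, p x = inv (dd e H) x}.
Proof.
move=> he p2 wp hf LH LD; have Lp := in_L2P p2; have [f2 _ _] := hf; have Lf := in_L2P f2.
have [iH _] := LH; have [iD LD2] := LD; have LI := inv_L2 iD LD2.
have [mf _] := Lf; have [mp ip] := Lp; have [mI iI] := LI.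
suff : {ae nu, forall x, p x - inv (dd e H) x = 0} by move/ae1; apply=> x /eqP; rewrite subr_eq0 => /eqP.
apply: (@fundamental (fun x => p x - inv (dd e H) x)); first exact: L2B.
move=> psi tp; have [ips [mps Lps]] := test_L2 tp; have [id [md _]] := testd_L2 e tp.
have i1 := intg_sqM mp mps ip Lps; have i2 := intg_sqM mI mps iI Lps.
transitivity (\int[nu]_x (p x * psi x) - \int[nu]_x (inv (dd e H) x * psi x)).
 by rewrite -RintB//; apply: eq_Rint => x; rewrite mulrBl.
have h1 := wp psi tp; have h2 := weak_partial_inv he LH LD tp.
have mIH : mfun (inv H : K -> R) := mfunM (mfun_cst _) (mf_TK (intg_mf iH)).
rewrite (@cell_Rint _ Omega (fun x => f x * 'D_e psi x) (mfunM mf md)) in h1.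
rewrite (@cell_Rint _ Omega (fun x => p x * psi x) (mfunM mp mps)) in h1.
rewrite (@cell_Rint _ Omega (fun x => inv H x * 'D_e psi x) (mfunM mIH md)) in h2.
rewrite (@cell_Rint _ Omega (fun x => inv (dd e H) x * psi x) (mfunM mI mps)) in h2.
have e3 : \int[nu]_x (f x * 'D_e psi x) = \int[nu]_x (inv H x * 'D_e psi x).
 apply: (ae_Rint (mfunM mf md) (mfunM mIH md)).
 by apply: ae1 (isH_eq hf iH) _ => x /= ->.
by move: h2; rewrite -e3 h1 => /oppr_inj ->; rewrite subrr.
Qed.

Lemma mf_udot d (X : measurableType d) (D : set X) (p q : X -> R * R) :
 measurable_fun D (fst \o q) -> measurable_fun D (snd \o q) -> measurable_fun D (fst \o p) -> measurable_fun D (snd \o p) ->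
 measurable_fun D (fun x => dot (- perp (p x)) (q x)).
Proof.
move=> m1 m2 m3 m4.
have -> : (fun x => dot (- perp (p x)) (q x)) = (fun x => (snd \o p) x * (fst \o q) x - (fst \o p) x * (snd \o q) x).
 by apply/funext => x; rewrite /dot /perp /=; ring.
by mtac.
Qed.

(** A solution comes with its own gradient, velocity and damping fields; here they are forced to be
    those computed from the transform, so the equation can be rewritten with [FF]. *)
Lemma fields_eq (f w d : R * R -> R) (gf gw : R * R -> R * R) H :
 weak_grad Omega f gf -> is_multiplier Omega log_symbol f w -> weak_grad Omega w gw ->
 is_multiplier Omega (fun r => log_symbol r `^ beta) f d -> isH f H -> adm H ->
 {ae nu, forall x, f x = inv H x /\ dot (- perp (gw x)) (gf x) + kappa * d x = - inv (FF H) x} /\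
 [/\ mfun (f : K -> R), mfun (fun x : K => dot (- perp (gw x)) (gf x)) & mfun (d : K -> R)].
Proof.
move=> [g1 g2 p1 p2] hw [q1 q2 r1 r2] hd hf aH.
have hw' : isH w (LwH H) := multiplier_isH (@mf_Lw) hw hf.
have hd' : isH d (fun k => mB beta k * H k) := multiplier_isH (mf_mB beta) hd hf.
have [in1 _ _] := hf; have [in3 _ _] := hd'.
have L0 := adm_LL0 aH; have L1 := adm_LLw aH; have [im _] := adm_LLm aH.
have e_1 : (e1 : R * R) = e1 \/ (e1 : R * R) = e2 by left.
have e_2 : (e2 : R * R) = e1 \/ (e2 : R * R) = e2 by right.
have a1 := grad_eq e_1 g1 p1 hf L0 (adm_LLd (@unit_e1) aH).
have a2 := grad_eq e_2 g2 p2 hf L0 (adm_LLd (@unit_e2) aH).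
have a3 := grad_eq e_1 q1 r1 hw' L1 (adm_LLdw (@unit_e1) aH).
have a4 := grad_eq e_2 q2 r2 hw' L1 (adm_LLdw (@unit_e2) aH).
have [iH _] := L0; split.
 have a12 := ae2 a1 a2 (fun _ a b => conj a b); have a34 := ae2 a3 a4 (fun _ a b => conj a b).
 have a56 := ae2 (isH_eq hf iH) (isH_eq hd' im) (fun _ a b => conj a b).
 apply: ae2 (ae2 a12 a34 (fun _ a b => conj a b)) a56 _ => x /= [[x1 x2] [x3 x4]] [x5 x6]; split=> //.
 rewrite (inv_FF x aH) -(nonlinear_inv x aH) x6 -x1 -x2 -x3 -x4 /dot /perp /=; ring.
split; [by have [] := in_L2P in1| |by have [] := in_L2P in3].
have [m1 _] := in_L2P g1; have [m2 _] := in_L2P g2; have [m3 _] := in_L2P q1; have [m4 _] := in_L2P q2.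
exact: (@mf_udot _ _ setT gw gf m1 m2 m3 m4).
Qed.

(** * A jointly measurable transform of a solution *)

Section JointTransform.
Variables T M : R.
Hypothesis T0 : 0 <= T.
Notation P := (pm (tm T) mu).
Notation PX := (pm (tm T) nu).

Lemma meas_slab : measurable (slab Omega T : set (RM * K)).
Proof. by apply: measurableX; [exact: mT|exact: meas_cell]. Qed.

Lemma TX_sub F G k : intg nu F -> intg nu G -> TX (fun x => F x - G x) k = TX F k - TX G k.
Proof.
move=> iF iG; have i1 H : intg nu H -> intg nu (fun x => H x * cas (dot x k)).
 by move=> iH; exact: (intg_cas k iH).
rewrite /TX /hartley -RintB; [|exact: i1|exact: i1].
by apply: eq_Rint => x; rewrite mulrBl.
Qed.

Lemma EW_L2 (H : K -> R) : mfun H -> intg mu (fun k => Wt s k * H k ^+ 2) -> \int[mu]_k (H k ^+ 2) <= EW H.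
Proof.
move=> mH iH; have [a n] := EW_adm mH iH; have [_ i0] := adm0_L2 a.
apply: le_Rint => // k; apply: ler_peMl; [exact: sqr_ge0|exact: Wt_ge1].
Qed.

Lemma quarters (q e : R) : 0 < q -> q * (2 * (e / (4 * q)) + 2 * (e / (4 * q))) = e.
Proof. by move=> q0; field; rewrite gt_eqF. Qed.

(** Transforms chosen separately at each time need not be measurable in time. The truncated
    transforms are explicit integrals, hence jointly measurable; by Plancherel at fixed time they
    are Cauchy over the slab, and their limit is a transform at almost every time. *)
Lemma joint_transform (th : RM -> K -> R) : measurable_fun (slab Omega T) (fun z : RM * K => th z.1 z.2) ->
 {ae tm T, forall t, Hs_sqnorm_le Omega s (th t) M} ->
 exists H, traj H /\ {ae tm T, forall t, [/\ isH (th t) (H t), intg mu (fun k => Wt s k * H t k ^+ 2) & EW (H t) <= M]}.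
Proof.
(* [th] is known to be measurable only on the slab; extension by 0 makes it measurable
   everywhere. *)
move=> mth hth; pose f (z : RM * K) : R := ((fun z : RM * K => th z.1 z.2) \_ (slab Omega T)) z.
have mf : mfun f := proj1 (measurable_restrictT _ meas_slab) mth.
have fE t x : 0 <= t <= T -> cell Omega x -> f (t, x) = th t x.
 by move=> ht cx; rewrite /f patchE mem_set.
pose c := 2 * `|M| / (2 * pi) ^+ 2.
have pi2 := @pi2_gt0.
have c0 : 0 <= c by apply: divr_ge0; [exact: mulr_ge0|exact: ltW].
have good : {ae tm T, forall t, 0 <= t <= T /\ exists H, [/\ isH (th t) H, intg mu (fun k => Wt s k * H k ^+ 2) & EW H <= M]}.
 by apply: ae2 (@ae_tm T) hth _ => t ht /Hs_elim.
have mft t : mfun (fun x : K => f (t, x)) by mtac.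
have aef t : 0 <= t <= T -> {ae nu, forall x, th t x = f (t, x)}.
 by move=> ht; apply: ae1 (ae_cell) _ => x cx; rewrite fE.
have slc : {ae tm T, forall t, intg nu (fun x => f (t, x) ^+ 2) /\ \int[nu]_x (f (t, x) ^+ 2) <= c}.
 apply: ae1 good _ => t [ht [H [hH iW eW]]]; have [in2 [mH _] _] := hH; have [mt it] := in_L2P in2.
 have i2 : intg nu (fun x => f (t, x) ^+ 2).
  by apply: (ae_intg (mfunX 2 (mft t)) _ it); apply: ae1 (aef t ht) _ => x ->.
 split=> //; have -> : \int[nu]_x (f (t, x) ^+ 2) = \int[nu]_x (th t x ^+ 2).
  apply: ae_Rint; [exact: mfunX|exact: mfunX|].
  by apply: ae1 (aef t ht) _ => x ->.
 rewrite /c ler_pdivlMr// mulrC; apply: le_trans (isH_norm hH) _; rewrite ler_pM2l//.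
 by apply: le_trans (EW_L2 mH iW) _; apply: le_trans eW (ler_norm _).
have [if2 _] := slice_bd (tm_setT T0) c0 (mfunX 2 mf) (fun z => sqr_ge0 _) slc.
have mbox N : mfun (\1_(@box N) : K -> R) by apply: mf_indic; exact: meas_box.
pose fN N (z : RM * K) := f z * \1_(@box N) z.2.
have mfN N : mfun (fN N) by apply: mfunM => //; exact: (mfcomp (mbox N) mfun_snd).
have fN_le N z : fN N z ^+ 2 <= f z ^+ 2.
 rewrite /fN exprMn; apply: ler_piMr; first exact: sqr_ge0.
 by have /andP[h0 h1] := @ind01 _ (@box N) z.2; apply: exprn_ile1.
have LfN N : L2 PX (fN N).
 by split=> //; apply: le_intg (mfunX 2 (mfN N)) _ if2 => z; rewrite ger0_norm ?sqr_ge0.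
have Lf : L2 PX f by [].
have dN e : 0 < e -> exists N0, forall N, (N0 <= N)%N -> \int[PX]_z ((fN N z - f z) ^+ 2) <= e.
 have [_ cv] : intg PX (fun _ : RM * K => 0 : R) /\ (\int[PX]_z ((fN N z - f z) ^+ 2) @[N --> \oo] --> \int[PX]_z (0 : R)).
  apply: (Rint_dct (g := fun z => f z ^+ 2)) => //.
  - by move=> N; apply: mfunX; exact: mfunB.
  - move=> N z; rewrite ger0_norm ?sqr_ge0// /fN indicE; case: (_ \in _); rewrite ?mulr1 ?mulr0 ?subrr ?expr0n ?sqr_ge0//.
   by rewrite sub0r sqrrN.
  - apply: aeW => z; have nr := trc_near (fun x => f (z.1, x)) z.2.
   apply: cvg_near_cst; apply: filterS nr => N; rewrite /trc /fN.
   by case: z => t x /= ->; rewrite subrr expr0n.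
 rewrite Rint0 in cv; move=> e0; have /cvgrPdist_le/(_ e e0)[N0 _ hN] := cv.
 exists N0 => N hNN; have := hN N hNN; rewrite sub0r normrN; exact: le_trans (ler_norm _).
pose F N (t : RM) (k : K) := TX (fun x => fN N (t, x)) k.
have mF N : traj (F N).
 apply: (mf_Rint2 nu (fun (z : RM * K) (x : K) => fN N (z.1, x) * cas (dot x z.2))).
 apply: mfunM.
  have h : mfun (fun y : (RM * K) * K => (y.1.1, y.2)) by mtac.
  by mtac.
 have h : mfun (fun y : (RM * K) * K => (y.2, y.1.2)) by mtac.
 exact: (mfcomp (@mf_casdot R) h).
have sN : {ae tm T, forall t, forall N, intg nu (fun x => fN N (t, x)) /\ intg nu (fun x => fN N (t, x) ^+ 2)}.
 by apply: ae1 slc _ => t [it _] N; exact: (@trc_L (fun x => f (t, x)) N (conj (mft t) it)).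
have pl n m : {ae tm T, forall t, [/\ intg mu (fun k => (F n t k - F m t k) ^+ 2), intg nu (fun x => (fN n (t, x) - fN m (t, x)) ^+ 2) &
  \int[mu]_k ((F n t k - F m t k) ^+ 2) = (2 * pi) ^+ 2 * \int[nu]_x ((fN n (t, x) - fN m (t, x)) ^+ 2)]}.
 apply: ae1 sN _ => t ht; have [i1 j1] := ht n; have [i2 j2] := ht m.
 have [md jd] := L2B (conj (intg_mf i1) j1) (conj (intg_mf i2) j2).
 have [h1 h2] := plX (intgB i1 i2) jd.
 have e k : TX (fun x => fN n (t, x) - fN m (t, x)) k = F n t k - F m t k by rewrite TX_sub.
 split=> //; first by apply: eq_intg h1 => k; rewrite e.
 by rewrite -h2; apply: eq_Rint => k; rewrite e.
have iD n m : intg P (fun z => (F n z.1 z.2 - F m z.1 z.2) ^+ 2).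
 have mD : mfun (fun z : RM * K => F n z.1 z.2 - F m z.1 z.2) by mtac.
 have pc : 0 <= (2 * pi) ^+ 2 * c by apply: mulr_ge0 => //; exact: ltW.
 apply: (proj1 (slice_bd (tm_setT T0) pc (mfunX 2 mD) (fun z => sqr_ge0 _) _)).
 apply: ae2 (pl n m) slc _ => t [h1 h2 h3] [it et]; split=> //; rewrite [leLHS]h3; apply: ler_wpM2l; first exact: ltW.
 apply: le_trans et; apply: le_Rint => // x; rewrite /fN -mulrBr exprMn; apply: ler_piMr; first exact: sqr_ge0.
 rewrite !indicE; case: (_ \in _); case: (_ \in _); rewrite ?subrr ?subr0 ?sub0r ?sqrrN ?expr1n ?expr0n//.
have eD n m : \int[P]_z ((F n z.1 z.2 - F m z.1 z.2) ^+ 2) = (2 * pi) ^+ 2 * \int[PX]_z ((fN n z - fN m z) ^+ 2).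
 have [_ jd] := L2B (LfN n) (LfN m).
 rewrite -(Rfubini1 (iD n m)) -(Rfubini1 jd) -RintZ; last exact: (intg_Rint1 jd).
 apply: ae_Rint; [exact: intg_mf (intg_Rint1 (iD n m))|exact: intg_mf (intgZ _ (intg_Rint1 jd))|].
 by apply: ae1 (pl n m) _ => t [].
have hcauchy e : 0 < e -> exists N0, forall n m, (N0 <= n)%N -> (N0 <= m)%N -> \int[P]_z ((F n z.1 z.2 - F m z.1 z.2) ^+ 2) <= e.
 move=> e0; have e4 : 0 < e / (4 * (2 * pi) ^+ 2) by apply: divr_gt0 => //; exact: mulr_gt0.
 have [N0 hN] := dN _ e4; exists N0 => n m hn hm; rewrite eD.
 have h := L2_dist (L2B (LfN n) Lf) (L2B (LfN m) Lf).
 have h' := le_trans h (lerD (ler_wpM2l (ler0n _ 2) (hN n hn)) (ler_wpM2l (ler0n _ 2) (hN m hm))).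
 apply: le_trans (ler_wpM2l (ltW pi2) h') _; apply: eq_ler; exact: quarters.
have [H' [phi hphi [mH' cv _ _]]] := @L2_complete _ _ R P (fun n z => F n z.1 z.2) (fun n => mF n) iD hcauchy.
pose H (t : RM) (k : K) := H' (t, k).
have mH : traj H.
 by rewrite /traj (_ : (fun z : RM * K => H z.1 z.2) = H')//; apply/funext => -[].
exists H; split=> //.
apply: ae2 (ae2 good sN (fun _ a b => conj a b)) (ae_sec1 cv) _ => t [[ht [Ht [hH iW eW]]] st] cvt.
have [in2 LHt cN] := hH; have [mHt iHt] := LHt; have Lth := in_L2P in2.
have mHs := traj_t t mH.
have FE N k : F N t k = TX (trc (th t) N) k.
 apply: ae_Rint.
 - by apply: mfunM; [exact: intg_mf (proj1 (st N))|exact: mf_casl].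
 - by apply: mfunM; [exact: intg_mf (proj1 (trc_L N Lth))|exact: mf_casl].
 - by apply: ae1 (aef t ht) _ => x e; rewrite /fN /trc -e.
(* At a fixed time the same truncated transforms tend to the chosen transform in [L2] and, along the
   subsequence, to [H t] almost everywhere; Fatou compares the two limits. *)
have ae_eq : {ae mu, forall k, Ht k = H t k}.
 have fat e : 0 < e -> intg mu (fun k => (Ht k - H t k) ^+ 2) /\ \int[mu]_k ((Ht k - H t k) ^+ 2) <= e.
  move=> e0; have /cvgrPdist_le/(_ e e0)[N0 _ hN] := cN.
  apply: (@fatou_bound _ _ R mu (fun n k => (Ht k - F (phi (n + N0)) t k) ^+ 2)).
  - by move=> n; have [_ i2] := L2B LHt (TX_L2 (phi (n + N0)) Lth); apply: eq_intg i2 => k; rewrite FE.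
  - by mtac.
  - by move=> n k; exact: sqr_ge0.
  - by move=> k; exact: sqr_ge0.
  - apply: ae1 cvt _ => k hk; apply: cvg_sq; apply: cvgB; first exact: cvg_cst.
   by have := hk; rewrite -(cvg_shiftn N0).
  - move=> n; have := hN (phi (n + N0)%N); rewrite sub0r normrN => h.
   have : \int[mu]_k ((Ht k - TX (trc (th t) (phi (n + N0))) k) ^+ 2) <= e.
    by apply: le_trans (ler_norm _) (h _); rewrite /= (leq_trans _ (hphi _))// leq_addl.
   by under [in X in _ -> X]eq_Rint => k do rewrite FE.
 have [i1 _] := fat 1 ltr01.
 have z : \int[mu]_k ((Ht k - H t k) ^+ 2) = 0.
  apply: (@small_eq0 _ 1) => //; first by apply: Rint_ge0 => k; exact: sqr_ge0.
  by move=> e e0; rewrite mul1r; have [] := fat e e0.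
 apply: ae1 (Rint_eq0 i1 (fun k => sqr_ge0 _) z) _ => k /eqP; rewrite sqrf_eq0 subr_eq0 => /eqP //.
have mWH : mfun (fun k => Wt s k * H t k ^+ 2).
 by apply: mfunM; [exact: mf_Wt|exact: mfunX].
split.
- exact: isH_ae hH mHs ae_eq.
- by apply: (ae_intg mWH _ iW); apply: ae1 ae_eq _ => k ->.
- apply: le_trans eW; apply: eq_ler; apply: ae_Rint => //; first exact: intg_mf iW.
 by apply: ae1 ae_eq _ => k ->.
Qed.

End JointTransform.

(** * From the weak formulation back to the integrated equation *)

Section WeakToMild.
Variable T : R.
Hypothesis T0 : 0 < T.

Let T0' : 0 <= T := ltW T0.

Notation P := (pm (tm T) mu).

Lemma ae_nu_cell (Q : R * R -> Prop) : {ae nu, forall x, Q x} -> {ae leb2 R, forall x, cell Omega x -> Q x}.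
Proof.
move=> [A [mA A0 hA]]; exists (A `&` cell Omega); split.
- by apply: measurableI => //; exact: meas_cell.
- have mI : mfun (EFin \o (\1_A : K -> R)) by apply/EFinP; exact: mf_indic.
 have := integral_rmeas_prod leb leb (meas_period (per1 Omega)) (meas_period (per2 Omega)) mI.
 rewrite integral_indic//; last exact: meas_cell.
 by rewrite integral_indic// setIT => ->.
- move=> x /= h; split; last by apply: contrapT => nx; apply: h => /nx.
 by apply: hA => /= q; apply: h.
Qed.

Lemma intg_mult (c : R -> R) (U : RM -> K -> R) : continuous c -> intg P (fun z => U z.1 z.2) ->
 intg P (fun z => c z.1 * U z.1 z.2).
Proof.
move=> cc iU; have [B B0 hB] := bounded_on_compact cc (@segment_compact R 0 T).
have mc : mfun (fun z : RM * K => c z.1) := mfcomp (cont_mfun cc) mfun_fst.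
apply: (ae_le_intg (mfunM mc (intg_mf iU)) (intgZ B (intg_norm iU))).
have t0 : {ae mu, forall k : K, True} by exact: aeW.
apply: ae1 (ae_prod (@ae_tm T) t0) _ => z [hz _]; rewrite normrM; apply: ler_wpM2r => //.
by apply: hB; rewrite /= in_itv.
Qed.

Lemma L2_mult (c : R -> R) (U : RM -> K -> R) : continuous c -> L2 P (fun z => U z.1 z.2) ->
 L2 P (fun z => c z.1 * U z.1 z.2).
Proof.
move=> cc [mU iU]; have mc : mfun (fun z : RM * K => c z.1) := mfcomp (cont_mfun cc) mfun_fst.
split; first exact: mfunM mc mU.
have c2 : continuous (fun t => c t ^+ 2) by move=> t; apply: cvgM; exact: cc.
by apply: eq_intg (intg_mult (U := fun t k => U t k ^+ 2) c2 iU) => z; rewrite exprMn.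
Qed.

Lemma L2_timeint (U : RM -> K -> R) : L2 P (fun z => U z.1 z.2) -> L2 mu (fun k => \int[tm T]_t U t k).
Proof.
move=> LU; have [mU iU] := LU.
have mI : mfun (fun k : K => \int[tm T]_t U t k).
 apply: (mf_Rint2 (tm T) (fun k t => U t k)).
 have h : mfun (fun y : K * RM => (y.2, y.1)) by mtac.
 exact: (mfcomp mU h).
split=> //; apply: (ae_le_intg (mfunX 2 mI) (intgZ T (intg_Rint2 iU))).
apply: ae1 (L2_seck LU) _ => k Lk; rewrite ger0_norm ?sqr_ge0//.
have -> : \int[tm T]_t U t k = cum T (U ^~ k) T.
 have [mk _] := Lk; apply: ae_Rint => //; first by apply: mfunM => //; exact: mf_le1.
 by apply: ae1 (@ae_tm T) _ => a /andP[_ aT]; rewrite le1E aT mul1r.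
exact: cum_sq.
Qed.

Section Chi.
Variables (b : R) (n : nat).

(** A smooth approximation of the positive part of [b - t], so that minus its derivative tends to
    the indicator of [t < b]. It vanishes from [b] on and is thus admissible for [b < T]. *)
Definition chi (t : R) : R := (n.+1%:R)^-1 * Sig (n.+1%:R * (b - t)).
Definition dchi (t : R) : R := - sigma (n.+1%:R * (b - t)).

Lemma is_derive_chi t : is_derive t (1 : R) chi (dchi t).
Proof.
have h : is_derive t (1 : R) (fun t : R => n.+1%:R * (b - t)) (- n.+1%:R).
 by apply: (dEq (dZ n.+1%:R (dB (dC b t) (dId t)))); rewrite sub0r mulrN1.
apply: (dEq (dZ n.+1%:R^-1 (dComp (is_derive_Sig _) h))).
by rewrite /dchi mulrN mulrN mulrCA mulVf ?mulr1// pnatr_eq0.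
Qed.

Lemma cont_chi : continuous chi.
Proof. by move=> t; exact: d_continuous (is_derive_chi t). Qed.

Lemma cont_dchi : continuous dchi.
Proof.
move=> t; apply: cvgN; apply: (@continuous_comp R R R (fun t => n.+1%:R * (b - t)) sigma); last exact: continuous_sigma.
by apply: cvgM; [exact: cvg_cst|apply: cvgB; [exact: cvg_cst|exact: cvg_id]].
Qed.

Lemma chi_eq0 t : b <= t -> chi t = 0.
Proof. by move=> bt; rewrite /chi Sig_eq0 ?mulr0// mulr_ge0_le0// subr_le0. Qed.

Lemma test_chi psi : b < T -> test_space Omega psi -> test_spacetime Omega T (fun z => chi z.1 * psi z.2).
Proof.
move=> bT [sm dom [A hA]]; split.
- apply/smoothP => m; apply: SmM; last by apply: Sm_snd_comp; have /smoothP := sm; exact.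
 apply: SmM; first exact: Sm_cst.
 apply: (Sm_comp 0 (@chain_Sig R) (b := fun z : R * (R * R) => n.+1%:R * (b - z.1))).
 have sf : @Sm R (R * (R * R))%type m fst by apply: Sm_linear => // x; exact: cvg_fst.
 apply: SmM; first exact: Sm_cst.
 have := SmD (Sm_cst (R * (R * R))%type m b) (SmM (Sm_cst (R * (R * R))%type m (-1)) sf).
 by congr Sm; apply/funext => z; rewrite mulN1r.
- by move=> t; have [d1 d2] := dom; split=> hp x /=; rewrite ?(d1 hp) ?(d2 hp).
- exists A, b; split=> // t x /=; rewrite mulf_eq0 negb_or => /andP[h1 h2]; split; last exact: hA.
 by apply: contraNT h1; rewrite -ltNge => /ltW h; rewrite chi_eq0.
Qed.

Lemma derive_chi psi t x : b < T -> test_space Omega psi ->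
 'D_(1, (0, 0)) (fun z : R * (R * R) => chi z.1 * psi z.2) (t, x) = dchi t * psi x.
Proof.
move=> bT tp; have [_ _ dp _ _] := test_time T0 (test_chi bT tp).
have [_ <-] := dp t x; have [_ e] := dZr (psi x) (is_derive_chi t); exact: e.
Qed.

End Chi.

Section Recover.
Variables (H0 : K -> R) (H : RM -> K -> R) (M : R).
Hypotheses (mH : traj H) (EH : Ebound T M H) (LH0 : LL H0).
Hypothesis weak : forall phi, test_spacetime Omega T phi ->
 \int[tm T]_t \int[nu]_x (inv (H t) x * 'D_(1, (0, 0)) phi (t, x) + inv (FF (H t)) x * phi (t, x)) =
  - \int[nu]_x (inv H0 x * phi (0, x)).

Let aH : {ae tm T, forall t, adm (H t) /\ N8 (H t) <= 16 * M} := Ebound_adm mH EH.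

Lemma Ebound_L2 : L2 P (fun z => H z.1 z.2).
Proof.
split=> //.
have c0 : 0 <= `|M| by [].
apply: (proj1 (slice_bd (tm_setT T0') c0 (mfunX 2 mH) (fun z => sqr_ge0 _) _)).
apply: ae2 aH EH _ => t [a _] [i e]; have [_ i0] := adm0_L2 a; split=> //.
by apply: le_trans (EW_L2 (traj_t t mH) i) _; apply: le_trans e (ler_norm _).
Qed.

Let LFF : L2 P (fun z => FF (H z.1) z.2) := FF_slab T0' mH aH.
Let mF : traj (fun t => FF (H t)) := mf_FF2 mH.

Let iFF : intg P (fun z => FF (H z.1) z.2).
Proof.
have [C C0 hC] := FF_L1 (16 * M).
have inF : intg P (fun z => `|FF (H z.1) z.2|).
 apply: (proj1 (slice_bd (tm_setT T0') C0 (mfcomp (@normr_measurable R setT) mF) _ _)); first by move=> z; exact: normr_ge0.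
 by apply: ae1 aH _ => t [a n]; have [i e] := hC _ a n; split=> //; exact: intg_norm.
by apply: le_intg mF _ inF.
Qed.

Let iHH : intg P (fun z => H z.1 z.2).
Proof.
have c0 : 0 <= `|16 * M| + @cJ by apply: addr_ge0 => //; exact: cJ_ge0.
have inH : intg P (fun z => `|H z.1 z.2|).
 apply: (proj1 (slice_bd (tm_setT T0') c0 (mfcomp (@normr_measurable R setT) mH) _ _)); first by move=> z; exact: normr_ge0.
 apply: ae1 aH _ => t [a n]; have [i e] := adm_L1n a; split; first exact: intg_norm.
 by apply: le_trans e _; rewrite lerD2r; apply: le_trans n (ler_norm _).
by apply: le_intg mH _ inH.
Qed.

Let X (t : RM) (k : K) := H t k - H0 k - cum T (fun t => FF (H t) k) t.

Let LX : L2 P (fun z => X z.1 z.2).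
Proof.
have [LcF _] := @cum_slab T T0' (fun t k => FF (H t) k) LFF.
have [_ L0] := LH0; apply: L2B LcF; apply: L2B; first exact: Ebound_L2.
have [m1 i1] := @L2_tensor T T0 (fun=> 1) 1 H0 (mfun_cst _) (fun=> eq_ler (normr1 _)) L0.
have e : (fun z : RM * K => 1 * H0 z.2) = (fun z => H0 z.2) by apply/funext => z; rewrite mul1r.
by rewrite e in m1; split=> //; apply: eq_intg i1 => z; rewrite mul1r.
Qed.

Let Yf b n (t : RM) (k : K) := dchi b n t * H t k + chi b n t * FF (H t) k.

Let iY b n : intg P (fun z => Yf b n z.1 z.2).
Proof.
exact: (intgD (intg_mult (U := H) (@cont_dchi b n) iHH) (intg_mult (U := fun t k => FF (H t) k) (@cont_chi b n) iFF)).
Qed.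

(** The weak equation tested with the time factor [chi b n], read at one frequency; its vanishing is
    what the tests in space have to prove. *)
Let Y b n (k : K) := \int[tm T]_t Yf b n t k + chi b n 0 * H0 k.

Let LY b n : LL (Y b n).
Proof.
have [i0 L0] := LH0; split; first by apply: intgD; [exact: (intg_Rint2 (iY b n))|exact: intgZ].
apply: L2D; last exact: L2Z.
apply: (@L2_timeint (Yf b n)); apply: L2D; first exact: (L2_mult (U := H) (@cont_dchi b n) Ebound_L2).
exact: (L2_mult (U := fun t k => FF (H t) k) (@cont_chi b n) LFF).
Qed.

(** Tensor products of [chi] with a spatial test function are admissible. Adjointness moves the
    spatial pairing to frequency, where the time integral can be taken first. *)
Let Y_test b n psi : b < T -> test_space Omega psi -> \int[nu]_x (inv (Y b n) x * psi x) = 0.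
Proof.
move=> bT tp; have [ips [mps _]] := test_L2 tp; have [iYm _] := LY b n; have [i0 _] := LH0.
have bTX (k : K) : `|TX psi k| <= 2 * \int[nu]_x `|psi x| := hartley_le k ips.
have mTX : mfun (TX psi) := mf_hartley _ _ (intg_mf ips).
have mTX2 : mfun (fun z : RM * K => TX psi z.2) by mtac.
have iT G : intg mu G -> intg mu (fun k => TX psi k * G k).
 by move=> iG; apply: eq_intg (intg_bdd mTX bTX iG) => k; rewrite mulrC.
have iTY : intg P (fun z => TX psi z.2 * Yf b n z.1 z.2).
 by apply: eq_intg (intg_bdd mTX2 (fun z => bTX z.2) (iY b n)) => z; rewrite mulrC.
rewrite pair_inv//.
have -> : \int[mu]_k (TX psi k * Y b n k) = \int[tm T]_t \int[mu]_k (TX psi k * Yf b n t k) + chi b n 0 * \int[mu]_k (TX psi k * H0 k).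
 rewrite (Rfubini iTY) -(RintZ _ (iT _ i0)) -RintD; [|exact: (intg_Rint2 iTY)|by apply: intgZ; exact: iT].
 apply: ae_Rint; [exact: intg_mf (iT _ iYm)|exact: intg_mf (intgD (intg_Rint2 iTY) (intgZ _ (iT _ i0)))|].
 apply: ae1 (ae_intg1 (intg_swap (iY b n))) _ => k ik /=.
 by rewrite /Y mulrDr -(RintZ _ ik); ring.
have := weak (test_chi n bT tp); rewrite mulrDr.
have -> : - (\int[nu]_x (inv H0 x * (chi b n 0 * psi x))) = - (@cF * (chi b n 0 * \int[mu]_k (TX psi k * H0 k))).
 rewrite mulrCA -(pair_inv ips i0) -Rint_scale; last first.
  apply: intgZ; have bT' x : `|inv H0 x| <= _ := inv_le x i0.
  have mi : mfun (inv H0) := mfunM (mfun_cst _) (mf_TK (intg_mf i0)).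
  by apply: eq_intg (intg_bdd mi bT' ips) => x; rewrite mulrC.
 by congr (- _); apply: eq_Rint => x; ring.
have -> : \int[tm T]_t \int[nu]_x (inv (H t) x * 'D_(1, (0, 0)) (fun z : R * (R * R) => chi b n z.1 * psi z.2) (t, x) + inv (FF (H t)) x * (chi b n t * psi x)) =
  @cF * \int[tm T]_t \int[mu]_k (TX psi k * Yf b n t k).
 have i1 := intg_Rint1 iTY; rewrite -(RintZ _ i1).
 apply: ae_Rint.
 - apply: (mf_Rint2 nu (fun t x => inv (H t) x * 'D_(1, (0, 0)) (fun z : R * (R * R) => chi b n z.1 * psi z.2) (t, x) + inv (FF (H t)) x * (chi b n t * psi x))).
  have e : (fun z : RM * K => inv (H z.1) z.2 * 'D_(1, (0, 0)) (fun z : R * (R * R) => chi b n z.1 * psi z.2) (z.1, z.2) + inv (FF (H z.1)) z.2 * (chi b n z.1 * psi z.2)) =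
   (fun z : RM * K => inv (H z.1) z.2 * (dchi b n z.1 * psi z.2) + inv (FF (H z.1)) z.2 * (chi b n z.1 * psi z.2)).
   by apply/funext => z; rewrite derive_chi.
  rewrite e.
  have mdc : mfun (fun z : RM * K => dchi b n z.1) := mfcomp (cont_mfun (@cont_dchi b n)) mfun_fst.
  have mc : mfun (fun z : RM * K => chi b n z.1) := mfcomp (cont_mfun (@cont_chi b n)) mfun_fst.
  have mp : mfun (fun z : RM * K => psi z.2) by mtac.
  exact: (mfunD (mfunM (traj_inv mH) (mfunM mdc mp)) (mfunM (traj_inv mF) (mfunM mc mp))).
 - exact: intg_mf (intgZ _ i1).
 have [C _ hC] := FF_L1 (16 * M).
 apply: ae1 aH _ => t [a nn] /=; have [iFt _] := hC _ a nn; have [iHt _] := adm_L1n a.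
 have iYt : intg mu (Yf b n t) := intgD (intgZ _ iHt) (intgZ _ iFt).
 rewrite -(pair_inv ips iYt); apply: eq_Rint => x.
 by rewrite derive_chi// /Yf (inv_comb _ _ x iHt iFt); ring.
by move=> ->; rewrite addNr.
Qed.

(** [inv] of this function vanishes by the fundamental lemma, and Plancherel for [TK] makes [inv]
    injective. *)
Let Y0 b n : b < T -> {ae mu, forall k, Y b n k = 0}.
Proof.
move=> bT; have [iYm LYm] := LY b n; have LI := inv_L2 iYm LYm.
have z := fundamental LI (fun psi => @Y_test b n psi bT).
have [iK eK] := plK iYm (proj2 LYm).
have z0 : \int[nu]_x (TK (Y b n) x ^+ 2) = 0.
 rewrite -[RHS](@Rint0 _ _ _ nu); apply: ae_Rint => //; first exact: intg_mf iK.
 apply: ae1 z _ => x /eqP; rewrite mulf_eq0 gt_eqF ?cF_gt0//= => /eqP ->.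
 by rewrite expr0n.
apply: L2_eq0 => //; move: eK; rewrite z0 => /esym/eqP; rewrite mulf_eq0 gt_eqF ?pi2_gt0//= => /eqP ->.
exact: lexx.
Qed.

Let seck (F : RM -> K -> R) : L2 P (fun z => F z.1 z.2) -> {ae mu, forall k, intg (tm T) (F ^~ k)}.
Proof. by move=> LF; apply: ae1 (L2_seck LF) _ => k; exact: tm_L1. Qed.

(** Integration by parts turns the vanishing of [Y b n] into that of the integral of [X] against a
    smoothed indicator of [t < b]; dominated convergence in [n] sharpens the indicator. *)
Let cumX b : 0 <= b -> b < T -> {ae mu, forall k, cum T (X ^~ k) b = 0}.
Proof.
move=> b0 bT; have hY := ae_foralln (fun n => @Y0 b n bT).
have a1 := @seck X LX; have a2 := @seck (fun t k => FF (H t) k) LFF; have a3 := @seck H Ebound_L2.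
apply: ae2 hY (ae2 a1 (ae2 a2 a3 (fun _ x y => conj x y)) (fun _ x y => conj x y)) _ => k hk [iX [iF iH]].
have int0 n : \int[tm T]_t (X t k * sigma (n.+1%:R * (b - t))) = 0.
 have chiT : chi b n T = 0 by apply: chi_eq0; exact: ltW.
 have [j1 e1] := cum_ibp T0' (H0 k) iF (is_derive_chi b n) (@cont_dchi b n) chiT.
 have bdd (c : R -> R) (U : RM -> R) : continuous c -> intg (tm T) U -> intg (tm T) (fun t => c t * U t).
  move=> cc iU; have [B _ hB] := bounded_on_compact cc (@segment_compact R 0 T).
  apply: (ae_le_intg _ (intgZ B (intg_norm iU))).
   by apply: mfunM; [exact: cont_mfun|exact: intg_mf iU].
  by apply: ae1 (@ae_tm T) _ => t ht; rewrite normrM; apply: ler_wpM2r => //; apply: hB; rewrite /= in_itv.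
 have jH := bdd _ _ (@cont_dchi b n) iH; have jF := bdd _ _ (@cont_chi b n) iF.
 have := hk n; rewrite /Y /Yf RintD// => e.
 have -> : \int[tm T]_t (X t k * sigma (n.+1%:R * (b - t))) = \int[tm T]_t ((H0 k + cum T (fun t => FF (H t) k) t) * dchi b n t - dchi b n t * H t k).
  by apply: eq_Rint => t; rewrite /X /dchi; ring.
 rewrite RintB// e1.
 have -> : \int[tm T]_t (FF (H t) k * chi b n t) = \int[tm T]_t (chi b n t * FF (H t) k) by apply: eq_Rint => t; exact: mulrC.
 move: e; move: (\int[tm T]_t (dchi b n t * H t k)) (\int[tm T]_t (chi b n t * FF (H t) k)) (chi b n 0) (H0 k) => p q r u e.
 by rewrite -[RHS]oppr0 -e; ring.
have msig n : mfun (fun t : RM => sigma (n.+1%:R * (b - t))).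
 have -> : (fun t : RM => sigma (n.+1%:R * (b - t))) = (fun t => - dchi b n t) by apply/funext => t; rewrite /dchi opprK.
 apply: mfcomp; [exact: oppr_measurable|exact: (cont_mfun (@cont_dchi b n))].
have [_ lim] : intg (tm T) (fun t : RM => X t k * (0 < b - t)%R%:R) /\
  (\int[tm T]_t (X t k * sigma (n.+1%:R * (b - t))) @[n --> \oo] --> \int[tm T]_t (X t k * (0 < b - t)%R%:R)).
 apply: (Rint_dct (g := fun t => `|X t k|)).
 - by move=> n; exact: mfunM (intg_mf iX) (msig n).
 - apply: measurable_fun_cvg => [n|t _]; first exact: mfunM (intg_mf iX) (msig n).
  by apply: cvgM; [exact: cvg_cst|have := @cvg_sigma R (b - t); rewrite -(cvg_shiftS)].
 - exact: intg_norm.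
 - by move=> n t; rewrite normrM (ger0_norm (sigma_ge0 _)); apply: ler_piMr => //; exact: sigma_le1.
 - apply: aeW => t; apply: cvgM; first exact: cvg_cst.
  by have := @cvg_sigma R (b - t); rewrite -(cvg_shiftS).
have z : \int[tm T]_t (X t k * (0 < b - t)%R%:R) = 0.
 apply: (cvg_unique _ lim); first exact: Rhausdorff.
 by rewrite (_ : (fun n => _) = (fun=> 0)); [exact: cvg_cst|apply/funext => n; exact: int0].
rewrite -z; apply: ae_Rint.
- by apply: mfunM; [exact: mf_le1|exact: intg_mf iX].
- apply: measurable_fun_cvg => [n|t _]; first exact: mfunM (intg_mf iX) (msig n).
 by apply: cvgM; [exact: cvg_cst|have := @cvg_sigma R (b - t); rewrite -(cvg_shiftS)].
apply: ae1 (ae_neq T b) _ => t tb; rewrite le1E subr_gt0 lt_neqAle tb /= mulrC //.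
Qed.

(** The exceptional frequencies in [cumX] depend on [b]. Integrating squares over the slab exchanges
    the order of the quantifiers, after which [cum_eq0] applies at almost every frequency. *)
Lemma weak_mild : mild T H0 H.
Proof.
have [[mc ic] _] := cum_slab T0' LX.
have i1 : \int[P]_z (cum T (X ^~ z.2) z.1 ^+ 2) = 0.
 rewrite -(Rfubini1 ic) -[RHS](@Rint0 _ _ _ (tm T)); apply: ae_Rint; [exact: intg_mf (intg_Rint1 ic)|exact: mfun_cst|].
 apply: ae2 (@ae_tm T) (ae_neq T T) _ => b /andP[b0 bT] bn /=.
 rewrite -[RHS](@Rint0 _ _ _ mu); apply: ae_Rint => //.
  exact: (mfcomp (mfunX 2 mc) (measurable_pair1 b)).
 have bT' : b < T by rewrite lt_neqAle bn.
 by apply: ae1 (cumX b0 bT') _ => k ->; rewrite expr0n.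
have ae_c : {ae P, forall z, cum T (X ^~ z.2) z.1 = 0}.
 by apply: ae1 (Rint_eq0 ic (fun z => sqr_ge0 _) i1) _ => z /eqP; rewrite sqrf_eq0 => /eqP.
have [mX iX] := LX.
have i2 : \int[P]_z (X z.1 z.2 ^+ 2) = 0.
 rewrite -(Rfubini2 iX) -[RHS](@Rint0 _ _ _ mu); apply: ae_Rint; [exact: intg_mf (intg_Rint2 iX)|exact: mfun_cst|].
 apply: ae2 (ae_sec2 ae_c) (seck LX) _ => k hk iXk /=.
 rewrite -[RHS](@Rint0 _ _ _ (tm T)); apply: ae_Rint => //; first exact: mfunX (intg_mf iXk).
 have hz := cum_eq0 iXk hk.
 by apply: ae1 hz _ => t /= ->; rewrite expr0n.
apply: ae1 (Rint_eq0 iX (fun z => sqr_ge0 _) i2) _ => z /eqP.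
by rewrite sqrf_eq0 subr_eq0 subr_eq => /eqP ->; rewrite addrC.
Qed.

End Recover.

End WeakToMild.

(** * Uniqueness *)

Section Uniqueness.
Variable T : R.
Hypothesis T0 : 0 < T.

Let T0' : 0 <= T := ltW T0.

Notation P := (pm (tm T) mu).

(** An arbitrary competitor is brought to the form in which the stability estimate applies. Its
    bound [M] is its own and unrelated to that of the constructed solution. *)
Lemma solution_mild (theta0 : R * R -> R) (theta : R -> R * R -> R) (H0 : K -> R) :
 isH theta0 H0 -> LL H0 -> is_solution Omega beta kappa s T theta0 theta ->
 exists M H, [/\ traj H, Ebound T M H, mild T H0 H & {ae tm T, forall t, isH (theta t) (H t)}].
Proof.
move=> h0 L0 [[mth [M hM]] [gth [w [gw [d [[m1 _ m3 m4] hf wk]]]]]].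
have [H [mH hH]] := joint_transform T0' mth (ae_leb_tm hM).
have EH : Ebound T M H by apply: ae1 hH _ => t [].
have aH := Ebound_adm mH EH; have [i0 _] := L0.
exists M, H; split=> //; last by apply: ae1 hH _ => t [].
apply: (weak_mild T0 mH EH L0) => phi tp.
have [c0 c1 _ _ _] := test_time T0 tp.
have mphi := mf_cont3 c0; have mdphi := mf_cont3 c1.
pose I (z : RM * K) : R := theta z.1 z.2 * 'D_(1, (0, 0)) phi z -
 (dot (- perp (gw z.1 z.2)) (gth z.1 z.2) + kappa * d z.1 z.2) * phi z.
have mS := @meas_slab T.
have mI : measurable_fun (slab Omega T : set (RM * K)) I.
 have mu_ : measurable_fun (slab Omega T : set (RM * K)) (fun z => dot (- perp (gw z.1 z.2)) (gth z.1 z.2)).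
  by apply: (@mf_udot _ (RM * K)%type _ (fun z => gw z.1 z.2) (fun z => gth z.1 z.2)); apply: mfcomp.
 have mk : measurable_fun (slab Omega T : set (RM * K)) (fun z => kappa * d z.1 z.2) := mfunM (mfun_cst _) m4.
 exact: (mfunB (mfunM mth (measurable_funTS mdphi)) (mfunM (mfunD mu_ mk) (measurable_funTS mphi))).
(* The fields of the competitor are measurable only on the slab, so the integrand is extended by 0
   before Fubini-type lemmas are used. *)
pose I2 := I \_ (slab Omega T : set (RM * K)).
have mI2 : mfun I2 := proj1 (measurable_restrictT _ mS) mI.
have I2E t x : 0 <= t <= T -> cell Omega x -> I2 (t, x) = I (t, x).
 by move=> ht cx; rewrite /I2 patchE mem_set.
have mI2t t : mfun (fun x : K => I2 (t, x)) by mtac.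
have := wk phi tp => /=.
have [in0 _ _] := h0; have [mth0 _] := in_L2P in0.
have cphi0 : continuous (fun x : R * R => phi (0, x)) by exact: (@cont_snd R (R * R)%type).
have mp0 := mf_cont2 cphi0.
rewrite (@cell_Rint _ Omega (fun x => theta0 x * phi (0, x)) (mfunM mth0 mp0)).
rewrite (_ : \int[leb]_(t in [set t | 0 <= t <= T]) _ = \int[leb]_(t in [set t | 0 <= t <= T]) \int[nu]_x I2 (t, x)); last first.
 apply: eq_Rintegral => t; rewrite inE /= => ht; rewrite -(@cell_Rint _ Omega (fun x => I2 (t, x)) (mI2t t)).
 by apply: eq_Rintegral => x; rewrite inE => cx; rewrite I2E.
rewrite -tm_itv; last exact: mf_Rint.
have -> : \int[nu]_x (theta0 x * phi (0, x)) = \int[nu]_x (inv H0 x * phi (0, x)).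
 have mi : mfun (inv H0) := mfunM (mfun_cst _) (mf_TK (intg_mf i0)).
 apply: (ae_Rint (mfunM mth0 mp0) (mfunM mi mp0)).
 by apply: ae1 (isH_eq h0 i0) _ => x /= ->.
move/eqP; rewrite addr_eq0 => /eqP <-; apply: ae_Rint.
- apply: (mf_Rint2 nu (fun t x => inv (H t) x * 'D_(1, (0, 0)) phi (t, x) + inv (FF (H t)) x * phi (t, x))).
 have e : (fun z : RM * K => inv (H z.1) z.2 * 'D_(1, (0, 0)) phi (z.1, z.2) + inv (FF (H z.1)) z.2 * phi (z.1, z.2)) =
   (fun z => inv (H z.1) z.2 * 'D_(1, (0, 0)) phi z + inv (FF (H z.1)) z.2 * phi z) by apply/funext => -[].
 have mF : traj (fun t => FF (H t)) := mf_FF2 mH.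
 rewrite e; exact: (mfunD (mfunM (traj_inv mH) mdphi) (mfunM (traj_inv mF) mphi)).
- exact: mf_Rint.
have hft := ae_leb_tm hf.
apply: ae2 (ae2 hH aH (fun _ a b => conj a b)) (ae2 hft (@ae_tm T) (fun _ a b => conj a b)) _ => t [[hHt _ _] [a n]] [[f1 f2 f3 f4] ht].
have [ef [mt mu_ md]] := fields_eq f1 f2 f3 f4 hHt a.
have [_ _ hFt _] : [/\ True, True, LL (FF (H t)) & True].
 split=> //; have [C _ hC] := FF_L1 (16 * M); have [iF _] := hC _ a n.
 by split=> //; have [] := FF_L2 a.
have [iFt _] := hFt; have [iHt _] := adm_L1n a.
have mphit : mfun (fun x : K => phi (t, x)) by mtac.
have mdphit : mfun (fun x : K => 'D_(1, (0, 0)) phi (t, x)) := mfcomp mdphi (measurable_pair1 t).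
apply: ae_Rint => /=.
- have mi1 : mfun (inv (H t)) := mfunM (mfun_cst _) (mf_TK (intg_mf iHt)).
 have mi2 : mfun (inv (FF (H t))) := mfunM (mfun_cst _) (mf_TK (intg_mf iFt)).
 by mtac.
- by mtac.
apply: ae2 ef (ae_cell) _ => x [x1 x2] cx.
by rewrite (I2E t x ht cx) /I /= x2 x1; ring.
Qed.

(** [stab_time] with zero residuals and zero initial difference. The bound [M'] serves only to place
    the second solution in the right spaces; the constant [C] depends on [M] alone. *)
Lemma mild_unique (H0 : K -> R) (M M' C : R) (H H' : RM -> K -> R) :
 0 <= C -> 2 * T * (C + 1 / 2) <= 1 / 2 -> (forall F G, adm F -> adm G -> N8 F <= 16 * M ->
  intg mu (fun k => (F k - G k) * (FF F k - FF G k)) /\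
  \int[mu]_k ((F k - G k) * (FF F k - FF G k)) <= C * \int[mu]_k ((F k - G k) ^+ 2)) ->
 traj H -> Ebound T M H -> mild T H0 H -> traj H' -> Ebound T M' H' -> mild T H0 H' ->
 {ae P, forall z, H z.1 z.2 = H' z.1 z.2}.
Proof.
move=> C0 hT hC mH EH hm mH' EH' hm'.
have aH := Ebound_adm mH EH; have aH' := Ebound_adm mH' EH'.
have LH := Ebound_L2 T0 mH EH; have LH' := Ebound_L2 T0 mH' EH'.
have LF := FF_slab T0' mH aH; have LF' := FF_slab T0' mH' aH'.
have Lz d (X : measurableType d) (m : sfmeas X R) : L2 m (fun _ : X => 0 : R).
 by split=> //; apply: eq_intg (@intg0 _ _ _ m) => x; rewrite expr0n.
have t0 : {ae tm T, forall t : RM, True} by exact: aeW.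
have seck (F : RM -> K -> R) : L2 P (fun z => F z.1 z.2) -> {ae P, forall z, intg (tm T) (F ^~ z.2)}.
 by move=> L; apply: ae1 (ae_prod t0 (L2_seck L)) _ => z [_ hz]; exact: tm_L1.
have eD : {ae P, forall z, H z.1 z.2 - H' z.1 z.2 = 0 + cum T (fun t => FF (H t) z.2 - FF (H' t) z.2) z.1}.
 apply: ae2 (ae2 hm hm' (fun _ a b => conj a b)) (ae2 (seck (fun t k => FF (H t) k) LF) (seck (fun t k => FF (H' t) k) LF') (fun _ a b => conj a b)) _.
 by move=> z [-> ->] [i1 i2]; rewrite cumB//; ring.
have r0 : (fun z : RM * K => FF (H z.1) z.2 - FF (H z.1) z.2 - (FF (H' z.1) z.2 - FF (H' z.1) z.2)) = (fun=> 0).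
 by apply/funext => z; rewrite !subrr.
have Lr : L2 P (fun z : RM * K => FF (H z.1) z.2 - FF (H z.1) z.2 - (FF (H' z.1) z.2 - FF (H' z.1) z.2)).
 by rewrite r0; exact: Lz.
have aa : {ae tm T, forall t, [/\ adm (H t), adm (H' t) & N8 (H t) <= 16 * M]}.
 by apply: ae2 aH aH' _ => t [a1 a2] [a3 _].
have := @stab_time T T0' (16 * M) C H H' (fun t k => FF (H t) k) (fun t k => FF (H' t) k) (fun=> 0)
 hC C0 hT LH LH' LF LF' (Lz _ _ mu) Lr aa eD.
have -> : \int[mu]_k ((0 : R) ^+ 2) = 0 by rewrite -[RHS](@Rint0 _ _ _ mu); apply: eq_Rint => k; rewrite expr0n.
have -> : \int[P]_z ((FF (H z.1) z.2 - FF (H z.1) z.2 - (FF (H' z.1) z.2 - FF (H' z.1) z.2)) ^+ 2) = 0.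
 by rewrite -[RHS](@Rint0 _ _ _ P); apply: eq_Rint => z; rewrite !subrr expr0n.
rewrite addr0 mulr0 => le0.
by apply: ae1 (L2_eq0 (L2B LH LH') le0) _ => z /eqP; rewrite subr_eq0 => /eqP.
Qed.

End Uniqueness.

End Main.

Theorem theorem4 (R : realType) (Omega : domain) (beta : R) (hbeta : 1 < beta)
    (s : R) (hs : 4 < s) (theta0 : R * R -> R) (htheta0 : in_Hs Omega s theta0)
    (kappa : R) (hkappa : 0 < kappa) :
  exists2 T : R, 0 < T &
    exists2 theta : R -> R * R -> R,
      is_solution Omega beta kappa s T theta0 theta &
      forall theta' : R -> R * R -> R,
        is_solution Omega beta kappa s T theta0 theta' ->
        {ae leb1 R, forall t, 0 <= t <= T ->
          {ae leb2 R, forall x, cell Omega x -> theta' t x = theta t x}}.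
Proof.
have [M0 hM0] := htheta0; have [H0 [h0 i0 _]] := Hs_elim hM0.
have [_ [mH0 _] _] := h0; have [a0 _] := EW_adm hs mH0 i0; have L0 := adm_LL0 a0.
have [T [M [C [H [T0 C0 hT hC [mH EH hm]]]]]] := local_existence hbeta hkappa hs mH0 i0.
exists T => //; exists (fun t => inv Omega (H t)).
 exact: (solution_exists hbeta hkappa hs T0 mH EH hm h0 (proj1 L0)).
move=> theta' sol.
have [M' [H' [mH' EH' hm' hH']]] := solution_mild hbeta hkappa hs T0 h0 L0 sol.
have e := mild_unique hbeta hs T0 C0 hT hC mH EH hm mH' EH' hm'.
apply: ae_tm_leb; have aH' := Ebound_adm hs mH' EH'.
(* At almost every time the two transforms agree almost everywhere, so their inverse transforms
   agree at every point of the domain. *)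
apply: ae2 (ae2 hH' aH' (fun _ a b => conj a b)) (ae_sec1 e) _ => t [hHt [a' _]] et.
have [iH' _] := adm_LL0 a'.
apply: ae_nu_cell; apply: ae1 (isH_eq hHt iH') _ => x ->.
rewrite /inv /TK /hartley; congr (_ * _); apply: ae_Rint.
- by apply: mfunM; [exact: traj_t mH'|exact: mf_casl].
- by apply: mfunM; [exact: traj_t mH|exact: mf_casl].
- by apply: ae1 et _ => k /= ->.
Qed.
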